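(* Let $n\ge3$. If $q\in[2,\infty]$ and $a,s\in\mathbb R$ satisfy $|s|\le1$ and $|a|+|s|<\frac n2$, then there is a constant $C$ such that for all $f$ $$\|f\|_{\ell^{q,a}_x\dot H^s}\le C\,\|f\|_{\ell^{2,0}_D\ell^{q,a}_x\dot H^s}.$$
   Context: $\dot H^s=\dot H^s(\mathbb R^n)$ with norm $\|g\|_{\dot H^s}=\||D|^sg\|_{L^2}$, $|D|^s$ the Fourier multiplier $|\xi|^s$. Let $\varphi\in C_0^\infty((1/2,2))$ be nonnegative with $\sum_{k\in\mathbb Z}\varphi(r/2^k)=1$ for $r>0$; $Q_k(x)=\varphi(|x|/2^k)$ is the Paley-Littlewood partition in $x$ (acting by multiplication) and $P_k(\xi)=\varphi(|\xi|/2^k)$ is the Paley-Littlewood partition in frequency, $P_k(D)$ being the Fourier multiplier with symbol $P_k$. The norms are $$\|f\|_{\ell^{q,a}_x\dot H^s}=\Big(\sum_{k\in\mathbb Z}2^{kqa}\|Q_kf\|_{\dot H^s}^q\Big)^{1/q},\qquad \|f\|_{\ell^{2,0}_D\ell^{q,a}_x\dot H^s}=\Big(\sum_{k_2\in\mathbb Z}\Big(\sum_{k_1\in\mathbb Z}2^{k_1qa}\||D|^sQ_{k_1}P_{k_2}(D)f\|_{L^2}^q\Big)^{2/q}\Big)^{1/2},$$ with the $\ell^q$ sums replaced by suprema when $q=\infty$. The space $\ell^{q,a}_x\dot H^s$ is the closure of $C_0^\infty(\mathbb R^n\setminus\{0\})$ in its norm. *)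

(* Defs.v *)
From HB Require Import structures.
From mathcomp Require Import all_boot all_order all_algebra.
From mathcomp Require Import all_classical all_reals all_analysis.
From mathcomp Require Import complex.

Set Implicit Arguments.
Unset Strict Implicit.
Unset Printing Implicit Defensive.

Import Order.TTheory GRing.Theory Num.Theory.
Import numFieldNormedType.Exports.

Local Open Scope classical_set_scope.
Local Open Scope ring_scope.

Section lebesgue_tuple.
Context (R : realType).

Definition cons_tuple n (p : measurableTypeR R * n.-tuple (measurableTypeR R)) :
  n.+1.-tuple (measurableTypeR R) := [tuple of p.1 :: p.2].

Lemma measurable_cons_tuple n : measurable_fun [set: _] (@cons_tuple n).
Proof. exact: measurable_cons. Qed.

Definition uncons_tuple n (t : n.+1.-tuple (measurableTypeR R)) :
  measurableTypeR R * n.-tuple (measurableTypeR R) :=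
  (thead t, [tuple of behead t]).

Lemma measurable_uncons_tuple n : measurable_fun [set: _] (@uncons_tuple n).
Proof.
apply: measurable_fun_pair; first exact: measurable_tnth.
exact: measurable_behead.
Qed.

Lemma cons_tupleK n : cancel (@cons_tuple n) (@uncons_tuple n).
Proof.
by case=> x t; rewrite /uncons_tuple theadE; congr pair; apply/val_inj.
Qed.

Section step.
Context (n : nat).
Variable mu :
  {sigma_finite_measure set (n.-tuple (measurableTypeR R)) -> \bar R}.

Definition lebesgue_cons : set (n.+1.-tuple (measurableTypeR R)) -> \bar R :=
  pushforward (@lebesgue_measure R \x mu)%E (@cons_tuple n).

Let lebesgue_cons0 : lebesgue_cons set0 = 0%E.
Proof. by rewrite /lebesgue_cons /pushforward preimage_set0 measure0. Qed.

Let lebesgue_cons_ge0 A : (0 <= lebesgue_cons A)%E.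
Proof. by rewrite /lebesgue_cons /pushforward measure_ge0. Qed.

Let lebesgue_cons_sigma_additive : semi_sigma_additive lebesgue_cons.
Proof.
have mcons A : measurable A -> measurable (@cons_tuple n @^-1` A).
  by move=> mA; rewrite -[X in measurable X]setTI; exact: measurable_cons_tuple.
move=> F mF tF mUF; rewrite /lebesgue_cons /pushforward preimage_bigcup.
apply: measure_semi_sigma_additive; first by move=> i; exact: mcons.
- apply/trivIsetP => /= i j _ _ ij; rewrite -preimage_setI.
  by move/trivIsetP : tF => /(_ _ _ _ _ ij) ->//; rewrite preimage_set0.
- by rewrite -preimage_bigcup; exact: mcons.
Qed.

HB.instance Definition _ := isMeasure.Build _ _ _ lebesgue_cons
  lebesgue_cons0 lebesgue_cons_ge0 lebesgue_cons_sigma_additive.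

Let lebesgue_cons_sigma_finite : sigma_finite setT lebesgue_cons.
Proof.
have /sigma_finiteP[F [TF ndF Foo]] := sigma_finiteT (@lebesgue_measure R).
have /sigma_finiteP[G [TG ndG Goo]] := sigma_finiteT mu.
exists (fun i => @uncons_tuple n @^-1` (F i `*` G i)).
  rewrite -preimage_bigcup (_ : \bigcup_i _ = setT) ?preimage_setT//.
  apply/seteqP; split=> // -[x y] _.
  have [i _ Fx] : (\bigcup_i F i) x by rewrite -TF.
  have [j _ Gy] : (\bigcup_i G i) y by rewrite -TG.
  exists (maxn i j) => //; split.
  - by move: x Fx; exact/subsetPset/ndF/leq_maxl.
  - by move: y Gy; exact/subsetPset/ndG/leq_maxr.
move=> i; have [mF Fioo] := Foo i; have [mG Gioo] := Goo i; split.
  by rewrite -[X in measurable X]setTI; apply: measurable_uncons_tuple => //;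
     exact: measurableX.
rewrite /lebesgue_cons /pushforward -comp_preimage.
rewrite (_ : _ \o _ = id); last exact/funext/cons_tupleK.
by rewrite preimage_id product_measure1E// lte_mul_pinfty// ge0_fin_numE.
Qed.

HB.instance Definition _ := Measure_isSigmaFinite.Build _ _ _ lebesgue_cons
  lebesgue_cons_sigma_finite.

End step.

Fixpoint lebesgue_tuple (n : nat) :
    {sigma_finite_measure set (n.-tuple (measurableTypeR R)) -> \bar R} :=
  if n is m.+1 then lebesgue_cons (lebesgue_tuple m) else \d_[tuple].

End lebesgue_tuple.

Section functions.
Context (R : realType) (n : nat).
Local Notation E := 'rV[R]_n.
Local Notation C := R[i].
Implicit Types (x xi : E) (g h w psi : E -> C).

Definition enorm x : R := Num.sqrt (\sum_i x ord0 i ^+ 2).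

Definition dotp x xi : R := \sum_i x ord0 i * xi ord0 i.

Definition cis (t : R) : C := (cos t +i* sin t)%C.

Definition cabs (z : C) : R := ComplexField.Normc.normc z.

(* Tuples carry the measurable structure, row vectors the normed one. *)
Definition point (t : n.-tuple (measurableTypeR R)) : E := \row_i tnth t i.

Definition cintegrable g : Prop :=
  (lebesgue_tuple R n).-integrable setT (fun t => (complex.Re (g (point t)))%:E) /\
  (lebesgue_tuple R n).-integrable setT (fun t => (complex.Im (g (point t)))%:E).

Definition cintegral g : C :=
  ((\int[lebesgue_tuple R n]_t complex.Re (g (point t))) +i*
   (\int[lebesgue_tuple R n]_t complex.Im (g (point t))))%C.

Definition L2norm g : \bar R :=
  Lnorm (lebesgue_tuple R n) 2%:E (fun t => (cabs (g (point t)))%:E).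

Definition partials (l : seq 'I_n) (u : E -> R) : E -> R :=
  foldr (fun i v => 'D_(delta_mx ord0 i) v) u l.

Definition cpartials (l : seq 'I_n) g : E -> C :=
  fun x => (partials l (@complex.Re R \o g) x +i* partials l (@complex.Im R \o g) x)%C.

Definition smooth g : Prop := forall (l : seq 'I_n) x,
  differentiable (partials l (@complex.Re R \o g)) x /\
  differentiable (partials l (@complex.Im R \o g)) x.

Definition test_function g : Prop := smooth g /\
  exists r1 r2 : R, 0 < r1 /\ forall x, g x != 0 -> r1 <= enorm x <= r2.

Definition schwartz_bound (N : nat) (M : R) psi : Prop :=
  forall (l : seq 'I_n) x, (size l <= N)%N ->
    (1 + enorm x) ^+ N * cabs (cpartials l psi x) <= M.

Definition schwartz psi : Prop :=
  smooth psi /\ forall N, exists M, schwartz_bound N M psi.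

Definition fourier psi : E -> C :=
  fun xi => cintegral (fun x => cis (- dotp x xi) * psi x).

Definition inv_fourier psi : E -> C :=
  fun x => (((2 * pi) ^- n)%:C)%C *
    cintegral (fun xi => cis (dotp x xi) * psi xi).

End functions.

Section distributions.
Context (R : realType) (n : nat).
Local Notation E := 'rV[R]_n.
Local Notation C := R[i].

(* A tempered distribution is a functional of which only the values at Schwartz
   functions are meaningful. *)
Definition functional := (E -> C) -> C.

Implicit Types (u v f : functional) (h w m : E -> C).

Definition tempered u : Prop :=
  (forall (c : C) psi1 psi2, schwartz psi1 -> schwartz psi2 ->
     u (fun x => c * psi1 x + psi2 x) = c * u psi1 + u psi2) /\
  (exists N K, forall psi M, schwartz psi -> schwartz_bound N M psi ->
     cabs (u psi) <= K * M).

Definition dist_of h : functional :=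
  fun psi => cintegral (fun x => h x * psi x).

Definition represents u h : Prop := forall psi, schwartz psi ->
  cintegrable (fun x => h x * psi x) /\ u psi = dist_of h psi.

Definition dist_mul m u : functional := fun psi => u (fun x => m x * psi x).

Definition dist_fourier u : functional := fun psi => u (fourier psi).

Definition dist_inv_fourier u : functional := fun psi => u (inv_fourier psi).

Definition multiplier m u : functional :=
  dist_inv_fourier (dist_mul m (dist_fourier u)).

(* The symbol |xi|^s is not smooth at the origin: |D|^s v is defined for those v
   whose Fourier transform is a function h such that |xi|^s h still defines a
   distribution.  The predicate says that |D|^s v is the function w. *)
Definition absD (s : R) v w : Prop := exists h : E -> C,
  let hs := fun xi => ((enorm xi `^ s)%:C)%C * h xi in
  [/\ represents (dist_fourier v) h,
      forall psi, schwartz psi -> cintegrable (fun xi => hs xi * psi xi) &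
      represents (dist_inv_fourier (dist_of hs)) w].

(* w is unique up to a null set; the infimum is +oo when |D|^s v is not a
   function. *)
Definition Hdot_norm (s : R) v : \bar R := ereal_inf [set L2norm w | w in absD s v].

Definition ell (q : \bar R) (u : int -> \bar R) : \bar R :=
  match q with
  | r%:E => ((\esum_(k in [set: int]) u k `^ r) `^ r^-1)%E
  | _ => ereal_sup (range u)
  end.

Definition dyadic_profile (phi : R -> R) : Prop :=
  [/\ forall (k : nat) (r : R), derivable (derive1n k phi) r 1,
      exists c d : R, [/\ 2^-1 < c, d < 2 & forall r, phi r != 0 -> c <= r <= d],
      forall r, 0 <= phi r &
      forall r, 0 < r -> \esum_(k in [set: int]) (phi (r / 2 ^ k))%:E = 1%E].

Definition dyadic_cutoff (phi : R -> R) (k : int) : E -> C :=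
  fun x => ((phi (enorm x / 2 ^ k))%:C)%C.

Definition Qk phi k f : functional := dist_mul (dyadic_cutoff phi k) f.

Definition Pk phi k f : functional := multiplier (dyadic_cutoff phi k) f.

Definition norm_x phi (q : \bar R) (a s : R) f : \bar R :=
  ell q (fun k => ((2 `^ (k%:~R * a))%:E * Hdot_norm s (Qk phi k f))%E).

(* The l^2 sum over frequencies carries the weight 2^(k * 0) = 1. *)
Definition norm_Dx phi (q : \bar R) (a s : R) f : \bar R :=
  ell 2%:E (fun k => norm_x phi q a s (Pk phi k f)).

Definition space_x phi (q : \bar R) (a s : R) f : Prop := tempered f /\
  forall e : R, 0 < e -> exists g, test_function g /\
    (norm_x phi q a s (fun psi => (f psi - dist_of g psi)%R) <= e%:E)%E.

End distributions.

(* Main.v *)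
(* The estimate is proved by duality. For a Schwartz function th with
   |xi|^(-s) th in L^2, the pairing of Q_k f with the transform of th is expanded over
   the frequency pieces P_j f and the spatial pieces Q_m, which gives pairings of
   Q_m P_j f with Q_m P_j Q_k acting on th. When m and k are far apart, the kernel of P_j
   only matters at distance 2^max(m,k); truncated there, it has a symbol bounded by
   min(t, 1/t) (1 + 2^max(m,k) |xi|)^(-2(n+2)) with t = 2^(j + max(m,k)). Together with
   the boundedness of convolution with approximate identities on L^2(|xi|^(-2s) d xi)
   (valid for |s| <= 1 < n/2), this size bound alone yields
     sum_j || |D|^(-s) Q_m P_j Q_k th ||^2 <= C 2^(-(n - 2|s|) |m - k|) || |D|^(-s) th ||^2.
   Cauchy-Schwarz then bounds (2^(ka) ||Q_k f||)^2 by
   sum_(j,m) 2^(-(n/2 - |s| - |a|) |m - k|) (2^(ma) ||Q_m P_j f||)^2, and since the first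
   factor is summable in m - k, Jensen's inequality in l^(q/2) with weights given by
   the square of the norm of P_j f finishes the proof. Membership in the closure of the
   test functions is what makes the expansion over frequencies converge: it rules out a
   contribution of f at frequency 0. *)
From HB Require Import structures.
Require Import Defs.
From mathcomp Require Import all_boot all_order all_algebra.
From mathcomp Require Import all_classical all_reals all_analysis.
From mathcomp Require Import measurable_realfun complex ring lra zify.
Set Implicit Arguments.
Unset Strict Implicit.
Unset Printing Implicit Defensive.
Import Order.TTheory GRing.Theory Num.Theory.
Import numFieldNormedType.Exports.
Local Open Scope classical_set_scope.
Local Open Scope ring_scope.

(** * Lebesgue measure on tuples *)

(** Test functions live on the frequency side: there multiplication by Q_m becomes convolution with
    a kernel of width 2^-m, and P_j becomes plain multiplication. For |s| <= 1 and n >= 3 every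
    weight |xi|^p that occurs has |p| <= 2 < n, hence is locally integrable. The gain 2^(-(n - 2|s|)
    |m - k|) counts volume. With sig = -s, averaging at width 1/lam bounds the square of a value
    near 0 by lam^(n + 2 sig) times the squared norm, while a symbol concentrated on |xi| <= 1/mu
    only sees the weighted volume mu^(-(n + 2 sig)). For |m - k| < 4 there is no gain and none is
    needed; there the sum over j is controlled by the bounded overlap of the frequency cutoffs. The
    closure matters: every P_j kills the constant 1, while its pieces Q_k do not vanish. Its use is
    that f differs from a test function by something of finite norm, so that Q_m f is controlled for
    large m; the off-diagonal estimate for a low-pass cutoff, uniform in that cutoff, then leaves
    nothing at frequency 0 in the limit. *)

Section tuple_integral.
Context (R : realType).
Local Notation Rm := (measurableTypeR R).

Lemma ge0_integral_lebesgue_tupleS n (f : n.+1.-tuple Rm -> \bar R) :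
  measurable_fun setT f -> (forall t, 0 <= f t)%E ->
  (\int[lebesgue_tuple R n.+1]_t f t =
   \int[@lebesgue_measure R]_x \int[lebesgue_tuple R n]_t f (Defs.cons_tuple (x, t)))%E.
Proof.
move=> mf f0.
have mc := @measurable_cons_tuple R n.
transitivity (\int[(@lebesgue_measure R \x lebesgue_tuple R n)%E]_z f (Defs.cons_tuple z))%E.
  transitivity (\int[pushforward (@lebesgue_measure R \x lebesgue_tuple R n)%E
     (@Defs.cons_tuple R n)]_t f t)%E.
    exact: eq_measure_integral.
  rewrite ge0_integral_pushforward//=.
by rewrite fubini_tonelli1//=; exact: measurableT_comp.
Qed.

Definition affine (c b : R) : Rm -> Rm := fun x => c * x + b.

Lemma measurable_affine c b : measurable_fun setT (affine c b).
Proof. by apply: measurable_funD => //; exact: measurable_funM. Qed.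

(** Uniqueness of Lebesgue measure reduces the identity to half-open intervals, whose preimages are
    again such intervals. The factor c sits on the pushforward so that the candidate is a scaled
    measure. *)
Lemma lebesgue_measure_affine (c b : R) (A : set R) : 0 < c -> measurable A ->
  (c%:E * pushforward (@lebesgue_measure R) (affine c b) A = lebesgue_measure A)%E.
Proof.
move=> c0 mA; apply/esym.
pose nu : {measure set Rm -> \bar R} :=
  mscale (NngNum (ltW c0)) (pushforward (@lebesgue_measure R) (affine c b)).
rewrite -[RHS]/(nu (measurable_affine c b) A).
apply: lebesgue_measure_unique => //= _ [[x y]] _ <-.
rewrite /nu/= /mscale/= /pushforward.
rewrite [X in (_ * lebesgue_measure X)%E](_ : _ = `](x - b) / c, (y - b) / c]%classic); last first.
  apply/seteqP; split=> t /=; rewrite /affine/= !in_itv/=;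
    by rewrite ltr_pdivrMr// ler_pdivlMr// ltrBlDr lerBrDr mulrC.
rewrite !lebesgue_measure_itv/= !lte_fin ltr_pM2r ?invr_gt0// ltrD2r.
case: ifPn => _; last by rewrite mule0.
by rewrite -EFinB -EFinM -mulrBl mulrC divfK ?gt_eqF// opprB addrA subrK.
Qed.

Lemma ge0_integral_affine (c b : R) (f : Rm -> \bar R) : 0 < c ->
  measurable_fun setT f -> (forall t, 0 <= f t)%E ->
  (\int[@lebesgue_measure R]_x f (affine c b x) =
   (c^-1)%:E * \int[@lebesgue_measure R]_x f x)%E.
Proof.
move=> c0 mf f0.
have -> : (\int[@lebesgue_measure R]_x f (affine c b x) =
   \int[pushforward (@lebesgue_measure R) (affine c b)]_x f x)%E.
  by rewrite (ge0_integral_pushforward (measurable_affine c b)).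
have c0' : 0 <= c^-1 by rewrite invr_ge0 ltW.
transitivity (\int[mscale (NngNum c0') (@lebesgue_measure R)]_x f x)%E.
  apply: eq_measure_integral; first exact: measurable_affine.
  move=> ? A mA _.
  transitivity ((c^-1)%:E * (c%:E * pushforward (@lebesgue_measure R) (affine c b) A))%E.
    by rewrite muleA -EFinM mulVf ?gt_eqF// mul1e.
  by rewrite lebesgue_measure_affine.
by rewrite ge0_integral_mscale.
Qed.

Definition affine_tuple n (c : R) (b : 'I_n -> R) (t : n.-tuple Rm) : n.-tuple Rm :=
  [tuple c * tnth t i + b i | i < n].

Lemma measurable_affine_tuple n c (b : 'I_n -> R) :
  measurable_fun setT (affine_tuple c b).
Proof.
apply/measurable_fun_tnthP => i.
rewrite (_ : _ \o _ = fun t => c * tnth t i + b i); last first.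
  by apply/funext => t /=; rewrite tnth_mktuple.
apply: measurable_funD => //; apply: measurable_funM => //.
exact: measurable_tnth.
Qed.

(** Induction on the dimension by Tonelli: the head coordinate contributes one factor 1/c, and the
    tail is translated by the remaining entries of b. *)
Lemma ge0_integral_affine_tuple n (c : R) (b : 'I_n -> R) (f : n.-tuple Rm -> \bar R) :
  0 < c -> measurable_fun setT f -> (forall t, 0 <= f t)%E ->
  (\int[lebesgue_tuple R n]_t f (affine_tuple c b t) =
   (c^-1 ^+ n)%:E * \int[lebesgue_tuple R n]_t f t)%E.
Proof.
move=> c0; elim: n b f => [|n IH] b f mf f0.
  rewrite expr0 mul1e; apply: eq_integral => t _; congr f.
  by apply: eq_from_tnth => -[].
have mcomp := measurableT_comp mf (measurable_affine_tuple c b).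
have mfc x : measurable_fun setT (fun t => f (Defs.cons_tuple (x, t))).
  apply: measurableT_comp => //.
  apply: (@measurableT_comp _ _ _ _ _ _ (@Defs.cons_tuple R n)).
    exact: measurable_cons_tuple.
  exact: measurable_fun_pair.
rewrite (ge0_integral_lebesgue_tupleS mcomp (fun t => f0 _)).
rewrite (ge0_integral_lebesgue_tupleS mf f0).
pose h (x : Rm) := (\int[lebesgue_tuple R n]_t f (Defs.cons_tuple (x, t)))%E.
have mh : measurable_fun setT h.
  apply: (@measurable_fun_fubini_tonelli_F _ _ _ _ _ _ (f \o @Defs.cons_tuple R n)) => [|z]; last exact: f0.
  by apply: measurableT_comp => //; exact: measurable_cons_tuple.
transitivity (\int[@lebesgue_measure R]_x ((c^-1 ^+ n)%:E * h (affine c (b ord0) x)))%E.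
  apply: eq_integral => x _.
  rewrite -(IH (fun i => b (lift ord0 i)))//.
  apply: eq_integral => t _; congr f; apply: eq_from_tnth => i.
  rewrite tnth_mktuple; case: (unliftP ord0 i) => [j|] ->.
    by rewrite !tnthS tnth_mktuple.
  by rewrite !tnth0.
have i0 : (0 <= (c^-1) ^+ n)%R by rewrite exprn_ge0// invr_ge0 ltW.
have h0 x : (0 <= h x)%E by apply: integral_ge0.
have mha : measurable_fun setT (h \o affine c (b ord0)) := measurableT_comp mh (measurable_affine _ _).
rewrite (ge0_integralZl_EFin _ measurableT (fun x _ => h0 _) mha i0).
by rewrite ge0_integral_affine// muleA -EFinM exprSr.
Qed.

End tuple_integral.

#[export] Instance rV_nbhs_filter (R : realType) n (x : 'rV[R]_n) :
  Filter (nbhs x) := nbhs_filter x.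
#[export] Instance rV_nbhs_pfilter (R : realType) n (x : 'rV[R]_n) :
  ProperFilter (nbhs x) := nbhs_pfilter x.

(** * The Euclidean norm and its comparison with the sup norm of row vectors *)

Section euclid.
Context (R : realType) (n : nat).
Local Notation E := 'rV[R]_n.
Implicit Types x y : E.

Lemma enorm_ge0 x : 0 <= enorm x.
Proof. exact: sqrtr_ge0. Qed.

Lemma sqr_enorm x : enorm x ^+ 2 = \sum_i x ord0 i ^+ 2.
Proof. by rewrite sqr_sqrtr// sumr_ge0// => i _; exact: sqr_ge0. Qed.

Lemma coord_le_enorm x i : `|x ord0 i| <= enorm x.
Proof.
rewrite -(@ler_pXn2r _ 2) ?nnegrE ?enorm_ge0//.
rewrite sqr_enorm real_normK ?num_real// (bigD1 i)//= lerDl.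
by rewrite sumr_ge0// => j _; exact: sqr_ge0.
Qed.

Lemma enorm0 : enorm (0 : E) = 0.
Proof. by rewrite /enorm big1 ?sqrtr0// => i _; rewrite mxE expr0n. Qed.

Lemma enorm_eq0 x : (enorm x == 0) = (x == 0).
Proof.
apply/eqP/eqP => [x0|->]; last exact: enorm0.
apply/rowP => i; rewrite mxE; apply/eqP; rewrite -normr_le0 -x0.
exact: coord_le_enorm.
Qed.

Lemma enorm_gt0 x : (0 < enorm x) = (x != 0).
Proof. by rewrite lt_neqAle enorm_ge0 andbT eq_sym enorm_eq0. Qed.

Lemma enormZ c x : enorm (c *: x) = `|c| * enorm x.
Proof.
apply/eqP; rewrite -(@eqrXn2 _ 2) ?mulr_ge0 ?enorm_ge0//.
rewrite exprMn !sqr_enorm real_normK ?num_real// mulr_sumr; apply/eqP.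
by apply: eq_bigr => i _; rewrite mxE exprMn.
Qed.

Lemma enormN x : enorm (- x) = enorm x.
Proof. by rewrite -scaleN1r enormZ normrN1 mul1r. Qed.

(** The sum of the squares (x_i |y| - y_i |x|)^2 expands to 2 |x| |y| (|x| |y| - x.y). Dividing by
    |x| |y| is why zero vectors are treated first. *)
Lemma dotp_le x y : dotp x y <= enorm x * enorm y.
Proof.
have [->|x0] := eqVneq x 0.
  by rewrite enorm0 mul0r /dotp big1// => i _; rewrite mxE mul0r.
have [->|y0] := eqVneq y 0.
  by rewrite enorm0 mulr0 /dotp big1// => i _; rewrite mxE mulr0.
have a0 : 0 < enorm x by rewrite enorm_gt0.
have b0 : 0 < enorm y by rewrite enorm_gt0.
have : 0 <= \sum_i (x ord0 i * enorm y - y ord0 i * enorm x) ^+ 2.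
  by rewrite sumr_ge0// => i _; exact: sqr_ge0.
rewrite (eq_bigr (fun i => x ord0 i ^+ 2 * enorm y ^+ 2 +
   y ord0 i ^+ 2 * enorm x ^+ 2 - x ord0 i * y ord0 i * (2 * enorm x * enorm y))); last first.
  by move=> i _; ring.
rewrite sumrB big_split/= -!mulr_suml -!sqr_enorm -/(dotp x y) => h.
rewrite -(ler_pM2r (mulr_gt0 a0 b0)).
move: h; rewrite subr_ge0.
rewrite [leRHS](_ : _ = (enorm x * enorm y * (enorm x * enorm y)) *+ 2); last by ring.
rewrite [leLHS](_ : _ = (dotp x y * (enorm x * enorm y)) *+ 2); last by ring.
by rewrite ler_pMn2r.
Qed.

Lemma ler_enormD x y : enorm (x + y) <= enorm x + enorm y.
Proof.
rewrite -(@ler_pXn2r _ 2) ?nnegrE ?addr_ge0 ?enorm_ge0//.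
rewrite sqr_enorm (eq_bigr (fun i => x ord0 i ^+ 2 + y ord0 i ^+ 2 +
   (x ord0 i * y ord0 i) * 2)); last by move=> i _; rewrite mxE; ring.
rewrite !big_split/= -mulr_suml -!sqr_enorm -/(dotp x y).
have := dotp_le x y; nra.
Qed.

Lemma enormB x y : enorm (x - y) = enorm (y - x).
Proof. by rewrite -enormN opprB. Qed.

Lemma enorm_le_sum x : enorm x <= \sum_i `|x ord0 i|.
Proof.
have s0 (P : pred 'I_n) : 0 <= \sum_(i | P i) `|x ord0 i| by rewrite sumr_ge0.
rewrite -(@ler_pXn2r _ 2) ?nnegrE ?enorm_ge0// sqr_enorm expr2 mulr_suml.
apply: ler_sum => i _; rewrite -real_normK ?num_real// expr2 ler_wpM2l//.
by rewrite (bigD1 i)//= lerDl.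
Qed.

Lemma mx_norm_le x e : 0 <= e -> (forall i, `|x ord0 i| <= e) -> `|x| <= e.
Proof.
move=> e0 xe; rewrite -[`|x|]/(mx_norm x) mx_normrE.
by apply: bigmax_le => // -[j i] _; rewrite ord1.
Qed.

Lemma coord_le_mx_norm x i : `|x ord0 i| <= `|x|.
Proof.
rewrite -[`|x|]/(mx_norm x) mx_normrE.
exact: (le_trans _ (le_bigmax _ _ (ord0, i))).
Qed.

Lemma mx_norm_le_enorm x : `|x| <= enorm x.
Proof.
by apply: mx_norm_le => [|i]; [exact: enorm_ge0|exact: coord_le_enorm].
Qed.

Lemma enorm_le_mx_norm x : enorm x <= n%:R * `|x|.
Proof.
apply: le_trans (enorm_le_sum x) _.
rewrite -[n in n%:R]card_ord mulr_natl -sumr_const; by apply: ler_sum => i _; exact: coord_le_mx_norm.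
Qed.

Lemma continuous_enorm : continuous (@enorm R n).
Proof.
move=> x; apply/cvgrPdist_le => e e0.
have e1 : 0 < e / (n%:R + 1) by rewrite divr_gt0// ltr_wpDl.
have /cvgrPdist_le/(_ _ e1) := @cvg_id _ (nbhs x).
apply: filterS => y.
rewrite ler_pdivlMr ?ltr_wpDl// => h.
have hxy : enorm (x - y) <= e.
  by apply: le_trans (enorm_le_mx_norm _) _; have := normr_ge0 (x - y); nra.
rewrite ler_distlC.
have h1 := ler_enormD (x - y) y; have h2 := ler_enormD (y - x) x.
rewrite subrK in h1; rewrite subrK enormB in h2.
by apply/andP; split; lra.
Qed.

End euclid.

(** * Measurability of continuous functions of a tuple *)

Section measurability.
Context (R : realType) (n : nat).
Local Notation E := 'rV[R]_n.
Local Notation Rm := (measurableTypeR R).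
Local Notation mu := (lebesgue_tuple R n).

(** Nothing is asked of [g]: each preimage is a countable union of fibres of [z]. *)
Lemma measurable_preimage_countable d (T : measurableType d) (I : countType)
    d' (U : measurableType d') (z : T -> I) (g : I -> U) :
  (forall v, measurable (z @^-1` [set v])) -> measurable_fun setT (g \o z).
Proof.
move=> mz _ B mB; rewrite setTI.
rewrite (_ : _ @^-1` B = \bigcup_v (if g v \in B then z @^-1` [set v] else set0)).
  apply: countable_bigcupT_measurable => // v.
  by case: ifP.
apply/seteqP; split => [t Bt|t [v _]] /=.
  by exists (z t) => //; rewrite mem_set.
by case: ifPn => //; rewrite inE => Bv /= ->.
Qed.

(** Rounding every coordinate down to a multiple of 1/(k+1) makes the function factor through
    integer vectors, a countable type. Continuity of [u] gives pointwise convergence of these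
    approximations. *)
Lemma measurable_continuous_point (u : E -> R) : continuous u ->
  measurable_fun setT (u \o @Defs.point R n).
Proof.
move=> cu.
pose z k (t : n.-tuple Rm) : 'rV[int]_n := \row_i Num.floor (k.+1%:R * tnth t i).
pose g k (v : 'rV[int]_n) : E := \row_i ((v ord0 i)%:~R / k.+1%:R).
apply: (@measurable_fun_cvg _ _ _ _ (fun k => u \o g k \o z k)) => [k|t _].
  apply: (@measurable_preimage_countable _ _ _ _ _ (z k) (u \o g k)) => v.
  rewrite (_ : _ @^-1` _ = \big[setI/setT]_(i < n)
     ((fun t : n.-tuple Rm => tnth t i) @^-1`
       [set y | (v ord0 i)%:~R <= k.+1%:R * y < ((v ord0 i) + 1)%:~R])); last first.
    rewrite -bigcap_seq; apply/seteqP; split=> [t /= zt i _ /=|t /= h].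
      by rewrite -zt mxE floor_itv.
    apply/rowP => i; rewrite mxE; apply: floor_def; apply: h.
    by rewrite /= mem_index_enum.
  apply: bigsetI_measurable => i _.
  rewrite -[X in measurable X]setTI; apply: measurable_tnth => //.
  rewrite (_ : mkset _ = `[(v ord0 i)%:~R / k.+1%:R, ((v ord0 i) + 1)%:~R / k.+1%:R[%classic).
    exact: measurable_itv.
  apply/seteqP; split=> y /=; rewrite in_itv/=;
    by rewrite ler_pdivrMr// ltr_pdivlMr// mulrC.
apply: (cvg_comp (fun k => g k (z k t)) u); last exact: cu.
apply/cvgrPdist_le => e e0; near=> k.
apply: mx_norm_le => [|j]; first exact: ltW.
rewrite !mxE.
have k0 : 0 < k.+1%:R :> R by [].
have /andP[h1 h2] : (Num.floor (k.+1%:R * tnth t j))%:~R <= k.+1%:R * tnth t j <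
   (Num.floor (k.+1%:R * tnth t j))%:~R + 1.
  by have := floor_itv (k.+1%:R * tnth t j); rewrite intrD.
have he : k.+1%:R^-1 <= e.
  near: k; apply: filterS (near_infty_natSinv_lt (PosNum e0)) => i; exact: ltW.
rewrite (_ : tnth t j - _ = k.+1%:R^-1 *
  (k.+1%:R * tnth t j - (Num.floor (k.+1%:R * tnth t j))%:~R)); last first.
  by rewrite mulrBr mulKf ?gt_eqF// [in RHS]mulrC.
rewrite normrM.
rewrite gtr0_norm ?invr_gt0//.
apply: le_trans he; rewrite ler_piMr ?invr_ge0 ?ler0n//.
by rewrite ger0_norm; lra.
Unshelve. all: by end_near. Qed.

End measurability.

Section space_integral.
Context (R : realType) (n : nat).
Local Notation E := 'rV[R]_n.
Local Notation Rm := (measurableTypeR R).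
Local Notation mu := (lebesgue_tuple R n).
Local Notation pt := (@Defs.point R n).

Lemma point_affine (c : R) (b : E) (t : n.-tuple Rm) :
  pt (affine_tuple c (fun i => b ord0 i) t) = c *: pt t + b.
Proof. by apply/rowP => i; rewrite !mxE tnth_mktuple. Qed.

Lemma ge0_integral_scale_point (c : R) (b : E) (f : E -> \bar R) : 0 < c ->
  measurable_fun setT (f \o pt) -> (forall x, 0 <= f x)%E ->
  (\int[mu]_t f (c *: pt t + b)%R = (c^-1 ^+ n)%:E * \int[mu]_t f (pt t))%E.
Proof.
move=> c0 mf f0.
rewrite -(ge0_integral_affine_tuple (fun i => b ord0 i) c0 mf (fun t => f0 _)).
by apply: eq_integral => t _; rewrite -point_affine.
Qed.

Lemma measurable_scale_point (c : R) (b : E) d (U : measurableType d) (f : E -> U) :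
  measurable_fun setT (f \o pt) -> measurable_fun setT (fun t => f (c *: pt t + b)).
Proof.
move=> mf; rewrite (_ : (fun _ => _) = (f \o pt) \o affine_tuple c (fun i => b ord0 i)).
  by apply: measurableT_comp => //; exact: measurable_affine_tuple.
by apply/funext => t /=; rewrite point_affine.
Qed.

Lemma measurable_enorm_point : measurable_fun setT (fun t => enorm (pt t)).
Proof. exact: (measurable_continuous_point (@continuous_enorm R n)). Qed.

End space_integral.

(** * Volumes of cubes and balls, integration over shells *)

Section volume.
Context (R : realType).
Local Notation Rm := (measurableTypeR R).

Let cube n (r : R) : set (n.-tuple Rm) := [set t | forall i, tnth t i \in `[- r, r]].

Let cubeS n r : @Defs.cons_tuple R n @^-1` @cube n.+1 r = `[- r, r]%classic `*` @cube n r.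
Proof.
apply/seteqP; split => [[x t]|[x t]] /=.
  move=> h; split; first by have := h ord0; rewrite tnth0.
  by move=> i; have := h (lift ord0 i); rewrite tnthS.
move=> [xr tr] i; case: (unliftP ord0 i) => [j|] ->; rewrite ?tnthS//.
Qed.

Let measurable_cube n r : measurable (@cube n r).
Proof.
rewrite (_ : @cube n r = \big[setI/setT]_(i < n) ((fun t : n.-tuple Rm => tnth t i) @^-1` `[- r, r]%classic)).
  apply: bigsetI_measurable => i _; rewrite -[X in measurable X]setTI.
  by apply: measurable_tnth => //; exact: measurable_itv.
rewrite -bigcap_seq; apply/seteqP; split=> t /= h i; first by move=> _; exact: h.
by apply: h; rewrite /= mem_index_enum.
Qed.

Lemma lebesgue_tuple_cube n (r : R) : 0 <= r ->
  lebesgue_tuple R n (@cube n r) = ((2 * r) ^+ n)%:E.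
Proof.
move=> r0; elim: n => [|n IH].
  by rewrite expr0 /= /dirac indicE mem_set// => -[].
transitivity ((@lebesgue_measure R \x lebesgue_tuple R n)%E (@Defs.cons_tuple R n @^-1` @cube n.+1 r)).
  by [].
rewrite cubeS product_measure1E; [|exact: measurable_itv|exact: measurable_cube].
have hl : lebesgue_measure (`[- r, r]%classic : set R) = (2 * r)%:E.
  rewrite lebesgue_measure_itv/= lte_fin; case: ltP => [_|h].
    by rewrite -EFinB; congr EFin; ring.
  congr EFin; move: (h : r <= - r) => h'; lra.
by rewrite exprS EFinM; congr (_ * _)%E.
Qed.

Local Notation mu := (lebesgue_tuple R).

(** The volume of the enclosing cube suffices, since only the order r^n matters. *)
Lemma lebesgue_tuple_ball n (r : R) : 0 <= r ->
  (\int[mu n]_t (if enorm (Defs.point t) <= r then 1 else 0)%:E <= ((2 * r) ^+ n)%:E)%E.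
Proof.
move=> r0.
rewrite -lebesgue_tuple_cube// -[X in (_ <= _ X)%E]setIT -integral_indic//; last exact: measurable_cube.
apply: ge0_le_integral => //=.
- by move=> t _; rewrite lee_fin; case: ifP.
- apply/measurable_EFinP; apply: (measurable_fun_ifT (f := fun t => enorm (Defs.point t) <= r)) => //.
  by apply: measurable_fun_ler => //; exact: measurable_enorm_point.
- by apply/measurable_EFinP; apply: measurable_indic; exact: measurable_cube.
move=> t _; rewrite lee_fin; case: ifPn => [h|_]; last by rewrite indicE.
rewrite indicE mem_set// => i; rewrite in_itv/= -ler_norml.
by apply: le_trans h; have := coord_le_enorm (Defs.point t) i; rewrite mxE.
Qed.

(* The shells [enorm x <= rho i] need not be disjoint nor cover the support. *)
Lemma integral_shells_le n (f : 'rV[R]_n -> R) (u rho : nat -> R) (A r : R) :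
  0 <= r < 1 -> 0 <= A ->
  measurable_fun setT (fun t => f (Defs.point t)) -> (forall x, 0 <= f x) ->
  (forall i, 0 <= u i) -> (forall i, 0 <= rho i) ->
  (forall i, u i * (2 * rho i) ^+ n <= A * r ^+ i) ->
  (forall x, f x = 0 \/ exists i, f x <= u i /\ enorm x <= rho i) ->
  (\int[mu n]_t (f (Defs.point t))%:E <= (A / (1 - r))%:E)%E.
Proof.
move=> /andP[r0 r1] A0 mf f0 u0 rho0 Ar fu.
pose g i (t : n.-tuple Rm) : \bar R := (u i * (if enorm (Defs.point t) <= rho i then 1 else 0))%:E.
have mg i : measurable_fun setT (g i).
  apply/measurable_EFinP; apply: measurable_funM => //.
  apply: (measurable_fun_ifT (f := fun t => enorm (Defs.point t) <= rho i)) => //.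
  by apply: measurable_fun_ler => //; exact: measurable_enorm_point.
have g0 i t : (0 <= g i t)%E by rewrite lee_fin mulr_ge0//; case: ifP.
apply: (@le_trans _ _ (\int[mu n]_t \sum_(0 <= i <oo) g i t)%E).
  apply: ge0_le_integral => //=.
  - by move=> t _; rewrite lee_fin.
  - exact/measurable_EFinP.
  - by apply: ge0_emeasurable_sum.
  move=> t _; have [->|[i [fi ti]]] := fu (Defs.point t).
    by apply: nneseries_ge0.
  apply: (@le_trans _ _ (g i t)); first by rewrite lee_fin ti mulr1.
  rewrite (@nneseriesD1 _ (fun i => g i t) i)//.
  by rewrite leeDl// nneseries_ge0.
rewrite integral_nneseries//.
apply: lime_le; first by apply: is_cvg_nneseries => i _ _; exact: integral_ge0.
apply: nearW => k.
apply: (@le_trans _ _ (\sum_(0 <= i < k) (A * r ^+ i)%:E)%E).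
  apply: lee_sum => i _.
  rewrite /g; under eq_integral do rewrite EFinM.
  rewrite ge0_integralZl_EFin//.
  - apply: le_trans (lee_wpmul2l _ (lebesgue_tuple_ball n (rho0 i))) _.
      by rewrite lee_fin.
    by rewrite -EFinM lee_fin.
  - by move=> t _; rewrite lee_fin; case: ifP.
  - apply/measurable_EFinP.
    apply: (measurable_fun_ifT (f := fun t => enorm (Defs.point t) <= rho i)) => //.
    by apply: measurable_fun_ler => //; exact: measurable_enorm_point.
rewrite sumEFin lee_fin -mulr_sumr ler_wpM2l// big_mkord.
have r1' : 0 < 1 - r by rewrite subr_gt0.
rewrite -[leRHS]mul1r ler_pdivlMr//.
have -> : (\sum_(i < k) r ^+ i) * (1 - r) = 1 - r ^+ k.
  by rewrite mulrC -(opprB r 1) mulNr -subrX1 opprB.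
by rewrite gerBl exprn_ge0.
Qed.

End volume.

(** * Integrals of powers of the norm *)

Section power_integrals.
Context (R : realType).
Local Notation mu := (lebesgue_tuple R).

Lemma pow2_ge (x : R) : exists i : nat, x <= 2 ^+ i.
Proof.
exists (Num.bound x); have [x0|/ltW x0] := leP 0 x.
  apply: (@le_trans _ _ (Num.bound x)%:R).
    by apply/ltW; have := archi_boundP x0.
  by rewrite -natrX ler_nat; exact/ltnW/ltn_expl.
by apply: le_trans x0 _; exact: exprn_ge0.
Qed.

Lemma dyadic_above (x : R) : exists i : nat, x <= 2 ^+ i /\ 2 ^+ i <= 2 * (1 + `|x|).
Proof.
have [k xk] := pow2_ge x.
have ex : exists i, x <= 2 ^+ i by exists k.
have := ex_minnP ex; case=> m xm mmin; exists m; split=> //.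
case: m xm mmin => [|m] xm mmin; first by rewrite expr0; have := normr_ge0 x; lra.
have : ~~ (x <= 2 ^+ m) by apply/negP => /mmin; rewrite ltnn.
rewrite -ltNge exprS => h; rewrite ler_pM2l//.
by apply: le_trans (ltW h) _; have := ler_norm x; lra.
Qed.

Lemma dyadic_below (x : R) : 0 < x <= 1 ->
  exists i : nat, x <= 2 ^- i /\ 2 ^- i.+1 < x.
Proof.
move=> /andP[x0 x1]; have [k xk] := pow2_ge (2 * x^-1).
have ex : exists i, 2 ^- i < x.
  exists k; rewrite -[ltRHS]invrK ltf_pV2 ?posrE ?exprn_gt0 ?invr_gt0//.
  apply: lt_le_trans xk; have : 0 < x^-1 by rewrite invr_gt0. lra.
have := ex_minnP ex; case=> m xm mmin.
case: m xm mmin => [|m] xm mmin.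
  by move: xm; rewrite expr0 invr1 ltNge x1.
exists m; split=> //; rewrite leNgt; apply/negP => /mmin.
by rewrite ltnn.
Qed.

Lemma measurable_powR_enorm n (p : R) :
  measurable_fun setT (fun t => enorm (@Defs.point R n t) `^ p).
Proof. exact: measurableT_comp (measurable_powR p) (@measurable_enorm_point R n). Qed.

Lemma integral_powR_unit_ball n (p : R) : - n%:R < p -> exists C : R, 0 <= C /\
  (\int[mu n]_t (if enorm (Defs.point t) <= 1 then enorm (Defs.point t) `^ p else 0)%:E <= C%:E)%E.
Proof.
move=> pn; pose r := (2 : R) `^ (- (p + n%:R)).
have r01 : 0 <= r < 1.
  rewrite powR_ge0/= /r -[ltRHS](powRr0 2) /powR pnatr_eq0/= mul0r.
  by rewrite ltr_expR pmulr_llt0 ?ln_gt0 ?ltr1n//; lra.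
exists (2 `^ `|p| * 2 ^+ n / (1 - r)); split.
  by rewrite divr_ge0 ?mulr_ge0 ?powR_ge0 ?exprn_ge0//; case/andP: r01; lra.
pose u i : R := 2 `^ `|p| * (2 `^ (- p)) ^+ i.
apply: (@integral_shells_le _ _ (fun x => if enorm x <= 1 then enorm x `^ p else 0) u (fun i => 2 ^- i)) => //.
- apply: (measurable_fun_ifT (f := fun t => enorm (Defs.point t) <= 1)) => //.
    by apply: measurable_fun_ler => //; exact: measurable_enorm_point.
  exact: measurable_powR_enorm.
- by move=> x; case: ifP => // _; exact: powR_ge0.
- by move=> i; rewrite /u mulr_ge0 ?exprn_ge0 ?powR_ge0.
- move=> i; rewrite /u exprMn -!mulrA ler_wpM2l ?powR_ge0//.
  rewrite mulrCA ler_wpM2l ?exprn_ge0//.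
  rewrite /r opprD powRD ?pnatr_eq0 ?implybT// exprMn powR_invn//.
  by rewrite -!exprVn -!exprM mulnC.
move=> x; case: ifPn => [x1|_]; last by left.
have [->|x0] := eqVneq x 0.
  right; exists 0%N; rewrite enorm0 expr0 invr1 ler01; split=> //.
  (* At the origin the power takes the value 1 if p = 0 and 0 otherwise, also for negative p. *)
  have [p0|p0] := eqVneq p 0; first by rewrite /u p0 normr0 !powRr0 mul1r.
  by rewrite powR0// /u mulr_ge0 ?exprn_ge0 ?powR_ge0.
have e0 : 0 < enorm x by rewrite enorm_gt0.
have [|i [xi ix]] := @dyadic_below (enorm x); first by rewrite e0.
right; exists i; split=> //; rewrite /u.
have [p0|p0] := leP 0 p.
  apply: (@le_trans _ _ ((2 ^- i) `^ p)).
    by rewrite ge0_ler_powR ?nnegrE ?enorm_ge0 ?invr_ge0 ?exprn_ge0.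
  rewrite -powR_invn// -powRrM mulNr -mulrN mulrC powRrM powR_mulrn ?powR_ge0//.
  by rewrite ler_peMl ?exprn_ge0 ?powR_ge0// -[leLHS](powRr0 2) ler_powR// ler1n.
rewrite ltr0_norm// -exprS -powR_mulrn ?powR_ge0// -powRrM mulNr -mulrN mulrC powRrM.
rewrite powR_invn//.
have h2 : 0 < 2 ^- i.+1 :> R by rewrite invr_gt0 exprn_gt0.
have pE (y : R) : y `^ p = (y `^ (- p))^-1 by rewrite powRN invrK.
rewrite !pE lef_pV2 ?posrE ?powR_gt0//.
by rewrite ge0_ler_powR ?nnegrE ?enorm_ge0 ?(ltW h2)// ?(ltW ix)//; lra.
Qed.

Lemma powR_natD (r p : R) n : 0 < r -> r `^ (n%:R + p) = r `^ p * r ^+ n.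
Proof.
by move=> r0; rewrite -(@powR_mulrn _ r n (ltW r0)) addrC; apply: powRD; rewrite (gt_eqF r0) implybT.
Qed.

Lemma integral_powR_ball n (p : R) : - n%:R < p -> exists C : R, 0 <= C /\ forall r : R, 0 < r ->
  (\int[mu n]_t (if enorm (Defs.point t) <= r then enorm (Defs.point t) `^ p else 0)%:E
   <= (C * r `^ (n%:R + p))%:E)%E.
Proof.
move=> /integral_powR_unit_ball[C [C0 hC]]; exists C; split=> // r r0.
pose f (x : 'rV[R]_n) := (if enorm x <= 1 then enorm x `^ p else 0)%:E.
have mf : measurable_fun setT (f \o @Defs.point R n).
  apply/measurable_EFinP.
  apply: (measurable_fun_ifT (f := fun t => enorm (Defs.point t) <= 1)) => //.
    by apply: measurable_fun_ler => //; exact: measurable_enorm_point.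
  exact: measurable_powR_enorm.
have f0 x : (0 <= f x)%E by rewrite lee_fin; case: ifP => // _; exact: powR_ge0.
have ri : 0 < r^-1 by rewrite invr_gt0.
have := @ge0_integral_scale_point R n r^-1 0 f ri mf f0.
rewrite invrK => h.
rewrite (_ : (fun t => _) = fun t => ((r `^ p)%:E * f (r^-1 *: (@Defs.point R n t) + 0)%R)%E); last first.
  apply/funext => t; rewrite addr0 /f enormZ gtr0_norm// ler_pdivrMl// mulr1.
  rewrite -EFinM; case: ifP => _; last by rewrite mulr0.
  by rewrite -powRM ?invr_ge0 ?mulr_ge0 ?enorm_ge0 ?invr_ge0 ?(ltW r0)// mulrA mulfV ?gt_eqF// mul1r.
have mr : measurable_fun setT (fun t => f (r^-1 *: (@Defs.point R n t) + 0)).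
  exact: (@measurable_scale_point _ _ r^-1 0 _ _ f).
rewrite (ge0_integralZl_EFin _ measurableT (fun t _ => f0 _) mr (powR_ge0 r p)).
rewrite h muleA -EFinM (_ : r `^ (n%:R + p) = r `^ p * r ^+ n); last exact: powR_natD.
rewrite (mulrC C) [leRHS]EFinM.
by apply: lee_wpmul2l => //; rewrite lee_fin mulr_ge0 ?powR_ge0 ?exprn_ge0 ?(ltW r0).
Qed.

(** For 2^i comparable with 1 + |x| the integrand is at most (2 2^-i)^(n+1), one power of 2^-i
    better than the volume of the ball of radius 2^i requires. Hence the ratio 1/2. *)
Lemma integral_jap n : exists C : R, 0 <= C /\ (\int[mu n]_t ((1 + enorm (Defs.point t)) ^- n.+1)%:E <= C%:E)%E.
Proof.
exists (2 ^+ n.+1 * 2 ^+ n / (1 - 2^-1)); split.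
  by rewrite divr_ge0 ?mulr_ge0 ?exprn_ge0//; lra.
pose u i : R := (2 * 2 ^- i) ^+ n.+1.
apply: (@integral_shells_le _ _ (fun x => (1 + enorm x) ^- n.+1) u (fun i => 2 ^+ i)) => //.
- by rewrite invr_ge0 ler0n/= invf_lt1// ltr1n.
- rewrite (_ : (fun _ => _) = fun t => ((1 + enorm (@Defs.point R n t))^-1) ^+ n.+1); last first.
    by apply/funext => t; rewrite exprVn.
  apply: measurable_funX; apply: (measurable_continuous_point (u := fun x => (1 + enorm x)^-1)).
  move=> x; apply: cvgV; first by rewrite gt_eqF// ltr_wpDr ?enorm_ge0.
  by apply: cvgD; [exact: cvg_cst|exact: continuous_enorm].
- by move=> x; rewrite invr_ge0 exprn_ge0 ?addr_ge0 ?enorm_ge0.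
- by move=> i; rewrite /u exprn_ge0 ?mulr_ge0 ?invr_ge0 ?exprn_ge0.
- move=> i; rewrite /u exprVn; set y : R := 2 ^+ i.
  have y0 : y != 0 by rewrite expf_neq0.
  have -> : (2 * y^-1) ^+ n.+1 * (2 * y) ^+ n = 2 ^+ n.+1 * 2 ^+ n * (y^-1 * (y^-1 * y) ^+ n).
    by rewrite !exprMn [y^-1 ^+ n.+1]exprS; ring.
  by rewrite mulVf// expr1n mulr1.
move=> x; right; have [i [xi ix]] := dyadic_above (enorm x); exists i; split=> //.
rewrite /u -(exprVn (1 + enorm x)) lerXn2r ?nnegrE ?invr_ge0 ?mulr_ge0 ?addr_ge0 ?enorm_ge0 ?invr_ge0 ?exprn_ge0//.
move: ix; rewrite (ger0_norm (enorm_ge0 x)) => ix.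
have i0 : 0 < 2 ^+ i :> R by rewrite exprn_gt0.
rewrite -(invf_div (2 ^+ i) 2) lef_pV2 ?posrE ?divr_gt0 ?ltr_wpDr ?enorm_ge0//.
lra.
Qed.

End power_integrals.

Arguments cintegral : simpl never.
Arguments cabs : simpl never.
Arguments cis : simpl never.

(** * Complex integrals *)

Section cabs_theory.
Context (R : realType).
Local Notation C := R[i].
Implicit Types z w : C.
Local Notation Re := (@complex.Re R).
Local Notation Im := (@complex.Im R).

Lemma cabsE z : cabs z = Num.sqrt (Re z ^+ 2 + Im z ^+ 2).
Proof. by case: z. Qed.

Lemma cabs_ge0 z : 0 <= cabs z.
Proof. by rewrite cabsE sqrtr_ge0. Qed.

Lemma sqr_cabs z : cabs z ^+ 2 = Re z ^+ 2 + Im z ^+ 2.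
Proof. by rewrite cabsE sqr_sqrtr// addr_ge0 ?sqr_ge0. Qed.

Lemma cabs0 : cabs (0 : C) = 0.
Proof. by rewrite cabsE /= expr0n addr0 sqrtr0. Qed.

Lemma cabs0_eq0 z : cabs z = 0 -> z = 0.
Proof. exact: ComplexField.Normc.eq0_normc. Qed.

Lemma cabsM z w : cabs (z * w) = cabs z * cabs w.
Proof. exact: ComplexField.Normc.normcM. Qed.

Lemma ler_cabsD z w : cabs (z + w) <= cabs z + cabs w.
Proof. exact: le_normcD. Qed.

Lemma cabsN z : cabs (- z) = cabs z.
Proof. exact: normcN. Qed.

Lemma cabs_sum I (r : seq I) (P : pred I) (F : I -> C) :
  cabs (\sum_(i <- r | P i) F i) <= \sum_(i <- r | P i) cabs (F i).
Proof.
elim/big_ind2 : _ => //; first by rewrite cabs0.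
by move=> z a w b za wb; apply: le_trans (ler_cabsD _ _) _; exact: lerD.
Qed.

Lemma normr_Re_le z : `|Re z| <= cabs z.
Proof.
rewrite -(@ler_pXn2r _ 2) ?nnegrE ?cabs_ge0// sqr_cabs real_normK ?num_real//.
by rewrite lerDl sqr_ge0.
Qed.

Lemma normr_Im_le z : `|Im z| <= cabs z.
Proof.
rewrite -(@ler_pXn2r _ 2) ?nnegrE ?cabs_ge0// sqr_cabs real_normK ?num_real//.
by rewrite lerDr sqr_ge0.
Qed.

Lemma cabs_le_ReIm z : cabs z <= `|Re z| + `|Im z|.
Proof.
rewrite -(@ler_pXn2r _ 2) ?nnegrE ?cabs_ge0 ?addr_ge0// sqr_cabs.
rewrite -[Re z ^+ 2]real_normK ?num_real// -[Im z ^+ 2]real_normK ?num_real//.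
by have := normr_ge0 (Re z); have := normr_ge0 (Im z); nra.
Qed.

Lemma ReE z w : Re (z * w) = Re z * Re w - Im z * Im w.
Proof. by case: z w => a b [c d]. Qed.
Lemma ImE z w : Im (z * w) = Re z * Im w + Im z * Re w.
Proof. by case: z w => a b [c d]. Qed.
Lemma ReD z w : Re (z + w) = Re z + Re w.
Proof. by case: z w => a b [c d]. Qed.
Lemma ImD z w : Im (z + w) = Im z + Im w.
Proof. by case: z w => a b [c d]. Qed.
Lemma ReN z : Re (- z) = - Re z.
Proof. by case: z. Qed.
Lemma ImN z : Im (- z) = - Im z.
Proof. by case: z. Qed.
Lemma eqReIm z w : Re z = Re w -> Im z = Im w -> z = w.
Proof. by case: z w => a b [c d] /= -> ->. Qed.

Lemma cabs_real (x : R) : cabs (x%:C)%C = `|x|.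
Proof. by rewrite cabsE /= expr0n addr0 sqrtr_sqr. Qed.

Lemma cabs1 : cabs (1 : C) = 1.
Proof. by rewrite -[1 : C]/((1 : R)%:C)%C cabs_real normr1. Qed.

Lemma cabs_conj z : cabs (z^*)%C = cabs z.
Proof. by case: z => a b; rewrite !cabsE /= sqrrN. Qed.

Lemma cabs_cis (t : R) : cabs (cis t) = 1.
Proof. by rewrite cabsE /cis/= cos2Dsin2 sqrtr1. Qed.

Lemma cisD (s t : R) : cis (s + t) = cis s * cis t.
Proof. by apply: eqReIm; rewrite ?ReE ?ImE /cis/= ?cosD ?sinD//; ring. Qed.

Lemma cis0 : cis (0 : R) = 1.
Proof. by rewrite /cis cos0 sin0. Qed.

Lemma conj_cis (t : R) : (cis t)^*%C = cis (- t).
Proof. by rewrite /cis /= cosN sinN. Qed.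

End cabs_theory.

(** * Complex integrals: triangle inequality, dominated convergence, Fubini *)

Section complex_integral.
Context (R : realType) (n : nat).
Local Notation E := 'rV[R]_n.
Local Notation C := R[i].
Local Notation mu := (lebesgue_tuple R n).
Local Notation pt := (@Defs.point R n).
Local Notation Re := (@complex.Re R).
Local Notation Im := (@complex.Im R).
Implicit Types (f g h : E -> C) (u v : E -> R).

Definition cmeasurable g := measurable_fun setT (fun t => Re (g (pt t))) /\
  measurable_fun setT (fun t => Im (g (pt t))).

Lemma eq_cintegral g h : g =1 h -> cintegral g = cintegral h.
Proof. by move=> gh; congr cintegral; exact/funext. Qed.

Lemma cmeasurableD g h : cmeasurable g -> cmeasurable h -> cmeasurable (fun x => g x + h x).
Proof.
move=> [a b] [c d]; split; under eq_fun do rewrite ?ReD ?ImD; exact: measurable_funD.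
Qed.

Lemma cmeasurableM g h : cmeasurable g -> cmeasurable h -> cmeasurable (fun x => g x * h x).
Proof.
move=> [a b] [c d]; split; under eq_fun do rewrite ?ReE ?ImE.
  by apply: measurable_funB; exact: measurable_funM.
by apply: measurable_funD; exact: measurable_funM.
Qed.

Lemma cmeasurable_cst (c : C) : cmeasurable (fun=> c).
Proof. by split. Qed.

Lemma cmeasurableN g : cmeasurable g -> cmeasurable (fun x => - g x).
Proof.
by move=> mg; under eq_fun do rewrite -mulN1r; apply: cmeasurableM => //; exact: cmeasurable_cst.
Qed.

Lemma cmeasurable_continuous g : continuous (Re \o g) -> continuous (Im \o g) -> cmeasurable g.
Proof. by move=> a b; split; [have := measurable_continuous_point a|have := measurable_continuous_point b]. Qed.

Lemma measurable_cabs g : cmeasurable g -> measurable_fun setT (fun t => cabs (g (pt t))).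
Proof.
move=> [a b]; under eq_fun do rewrite cabsE.
apply: (@measurableT_comp _ _ _ _ _ _ (@Num.sqrt R) _ (fun t => Re (g (pt t)) ^+ 2 + Im (g (pt t)) ^+ 2)).
  by apply: continuous_measurable_fun => x; exact: sqrt_continuous.
by apply: measurable_funD; exact: measurable_funX.
Qed.

Lemma continuous_dotp (y : E) : continuous (fun x : E => dotp x y).
Proof.
rewrite /dotp => x; elim: (index_enum _) => [|i s IH].
  by rewrite (_ : (fun _ => _) = cst 0); [exact: cvg_cst|apply/funext => z; rewrite big_nil].
rewrite (_ : (fun _ => _) = fun z : E => z ord0 i * y ord0 i + \sum_(j <- s) z ord0 j * y ord0 j).
  by apply: cvgD => //; apply: cvgM; [exact: coord_continuous|exact: cvg_cst].
by apply/funext => z; rewrite big_cons.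
Qed.

Lemma dotpC (x y : E) : dotp x y = dotp y x.
Proof. by apply: eq_bigr => i _; rewrite mulrC. Qed.

Lemma measurable_dotp2 :
  measurable_fun setT (fun z : n.-tuple (measurableTypeR R) * n.-tuple (measurableTypeR R) =>
    dotp (pt z.1) (pt z.2)).
Proof.
under eq_fun do (rewrite /dotp; under eq_bigr do rewrite !mxE).
apply: measurable_sum => i; apply: measurable_funM.
  by apply: (measurableT_comp (f := fun t : n.-tuple (measurableTypeR R) => tnth t i)) => //; exact: measurable_tnth.
by apply: (measurableT_comp (f := fun t : n.-tuple (measurableTypeR R) => tnth t i)) => //; exact: measurable_tnth.
Qed.

Lemma cintegrableP g : cintegrable g <->
  cmeasurable g /\ (\int[mu]_t (cabs (g (pt t)))%:E < +oo)%E.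
Proof.
split=> [[/integrableP[/measurable_EFinP a ia] /integrableP[/measurable_EFinP b ib]]|[mg ig]].
  have mg : cmeasurable g by split.
  split=> //; apply: le_lt_trans (lte_add_pinfty ia ib).
  rewrite -ge0_integralD//=; last 2 first.
  - by apply/measurable_EFinP; apply: measurableT_comp a.
  - by apply/measurable_EFinP; apply: measurableT_comp b.
  apply: ge0_le_integral => //=.
  - by move=> t _; rewrite lee_fin cabs_ge0.
  - by apply/measurable_EFinP; exact: measurable_cabs.
  - by apply: emeasurable_funD; apply/measurable_EFinP; [apply: measurableT_comp a|apply: measurableT_comp b].
  - by move=> t _; rewrite lee_fin cabs_le_ReIm.
have ic : mu.-integrable setT (fun t => (cabs (g (pt t)))%:E).
  apply/integrableP; split; first by apply/measurable_EFinP; exact: measurable_cabs.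
  by under eq_integral do rewrite /= ger0_norm ?cabs_ge0//.
by case: mg => a b; split; apply: (le_integrable _ _ _ ic) => //=;
  do ?[exact/measurable_EFinP]; move=> t _; rewrite lee_fin [leRHS]ger0_norm ?cabs_ge0 ?normr_Re_le ?normr_Im_le.
Qed.

Lemma eq_cintegrable g h : g =1 h -> cintegrable g -> cintegrable h.
Proof. by move=> /funext ->. Qed.

Lemma le_cintegrable g u : cmeasurable g -> measurable_fun setT (u \o pt) ->
  (forall x, cabs (g x) <= u x) -> (\int[mu]_t (u (pt t))%:E < +oo)%E -> cintegrable g.
Proof.
move=> mg mu' gu iu; apply/cintegrableP; split=> //; apply: le_lt_trans iu.
apply: ge0_le_integral => //=; do ?[exact/measurable_EFinP].
- by move=> t _; rewrite lee_fin cabs_ge0.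
- by apply/measurable_EFinP; exact: measurable_cabs.
by move=> t _; rewrite lee_fin.
Qed.

Lemma cintegrableZ c g : cintegrable g -> cintegrable (fun x => c * g x).
Proof.
move=> /cintegrableP[mg ig]; apply/cintegrableP; split.
  by apply: cmeasurableM => //; exact: cmeasurable_cst.
under eq_integral do rewrite cabsM EFinM.
rewrite ge0_integralZl_EFin ?cabs_ge0//.
- by rewrite lte_mul_pinfty// lee_fin cabs_ge0.
- by move=> t _; rewrite lee_fin cabs_ge0.
by apply/measurable_EFinP; exact: measurable_cabs.
Qed.

Lemma cintegrableD g h : cintegrable g -> cintegrable h -> cintegrable (fun x => g x + h x).
Proof.
move=> [a b] [c d]; split.
  by under eq_fun do rewrite ReD EFinD; exact: integrableD.
by under eq_fun do rewrite ImD EFinD; exact: integrableD.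
Qed.

Lemma cintegralD g h : cintegrable g -> cintegrable h ->
  cintegral (fun x => g x + h x) = cintegral g + cintegral h.
Proof.
move=> [a b] [c d]; apply: eqReIm; rewrite ?ReD ?ImD /cintegral/=.
  by rewrite -RintegralD//; apply: eq_Rintegral => t _; rewrite ReD.
by rewrite -RintegralD//; apply: eq_Rintegral => t _; rewrite ImD.
Qed.

Lemma cintegralZ c g : cintegrable g -> cintegral (fun x => c * g x) = c * cintegral g.
Proof.
move=> [a b].
have ka k := @integrableZl _ _ _ mu setT measurableT k _ a.
have kb k := @integrableZl _ _ _ mu setT measurableT k _ b.
apply: eqReIm; rewrite ?ReE ?ImE /cintegral/=.
  rewrite -!RintegralZl// -RintegralB//; [|exact: ka|exact: kb].
  by apply: eq_Rintegral => t _; rewrite ReE.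
rewrite -!RintegralZl// -RintegralD//; [|exact: kb|exact: ka].
by apply: eq_Rintegral => t _; rewrite ImE.
Qed.

(** Multiplying by the unit number w that rotates the integral onto the positive axis turns its
    modulus into the integral of a real part, which is at most the modulus of the integrand. *)
Lemma cabs_cintegral_le g : cintegrable g ->
  ((cabs (cintegral g))%:E <= \int[mu]_t (cabs (g (pt t)))%:E)%E.
Proof.
move=> ig; have [mg fin] := (cintegrableP g).1 ig.
set z := cintegral g.
have [z0|z0] := eqVneq (cabs z) 0.
  by rewrite z0; apply: integral_ge0 => t _; rewrite lee_fin cabs_ge0.
have zp : 0 < cabs z by rewrite lt_neqAle eq_sym z0 cabs_ge0.
pose w := ((cabs z)^-1%:C * z^*)%C.
have w1 : cabs w = 1.
  by rewrite /w cabsM cabs_conj cabs_real gtr0_norm ?invr_gt0// mulVf.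
have wz : Re (w * z) = cabs z.
  rewrite /w -mulrA [X in Re X](_ : _ = ((cabs z)^-1 * (cabs z ^+ 2))%:C%C).
    by rewrite /= expr2 mulKf.
  by rewrite sqr_cabs; case: (z) => p q; apply: eqReIm; rewrite !(ReE, ImE)/=; ring.
have iw := cintegrableZ w ig.
rewrite -wz -cintegralZ// /cintegral/=.
rewrite /Rintegral fineK; last by apply: integrable_fin_num => //; case: iw.
apply: le_integral => //=; first by case: iw.
  apply/integrableP; split; first by apply/measurable_EFinP; exact: measurable_cabs.
  by under eq_integral do rewrite /= ger0_norm ?cabs_ge0//.
move=> t _; rewrite lee_fin; apply: le_trans (ler_norm _) _.
by apply: le_trans (normr_Re_le _) _; rewrite cabsM w1 mul1r.
Qed.

(** Convergence is expressed through [cabs], so only real limits occur. The real theorem is applied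
    to |g_k - g|, dominated by u + u. *)
Lemma dominated_cintegral (g_ : nat -> E -> C) g u :
  (forall k, cmeasurable (g_ k)) -> measurable_fun setT (u \o pt) ->
  (forall k x, cabs (g_ k x) <= u x) -> (\int[mu]_t (u (pt t))%:E < +oo)%E ->
  (forall x, cabs (g_ k x - g x) @[k --> \oo] --> 0) ->
  [/\ forall k, cintegrable (g_ k), cintegrable g &
    cabs (cintegral (g_ k) - cintegral g) @[k --> \oo] --> 0].
Proof.
move=> mg mu' gu iu gg.
have cR x : Re (g_ k x) @[k --> \oo] --> Re (g x).
  apply/cvgrPdistC_le => e e0; have /cvgr0Pnorm_le/(_ _ e0) := gg x; apply: filterS => k.
  rewrite ger0_norm ?cabs_ge0//; apply: le_trans.
  by rewrite -ReN -ReD normr_Re_le.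
have cI x : Im (g_ k x) @[k --> \oo] --> Im (g x).
  apply/cvgrPdistC_le => e e0; have /cvgr0Pnorm_le/(_ _ e0) := gg x; apply: filterS => k.
  rewrite ger0_norm ?cabs_ge0//; apply: le_trans.
  by rewrite -ImN -ImD normr_Im_le.
have mgg : cmeasurable g.
  split; [apply: (@measurable_fun_cvg _ _ _ _ (fun k t => Re (g_ k (pt t))))|
          apply: (@measurable_fun_cvg _ _ _ _ (fun k t => Im (g_ k (pt t))))] => //.
  - by move=> k; case: (mg k).
  - by move=> k; case: (mg k).
have gu0 x : cabs (g x) <= u x.
  apply/ler_addgt0Pr => e e0; have /cvgr0Pnorm_le/(_ _ e0)[k _ /(_ _ (leqnn k))] := gg x.
  rewrite /= ger0_norm ?cabs_ge0// => h.
  rewrite -[g x](subKr (g_ k x)); apply: le_trans (ler_cabsD _ _) _.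
  by rewrite cabsN; exact: lerD.
have ig_ k : cintegrable (g_ k) by apply: le_cintegrable (mg k) mu' (gu k) iu.
have ig : cintegrable g by apply: le_cintegrable mgg mu' gu0 iu.
split=> //.
have mgB k : cmeasurable (fun x => g_ k x - g x).
  by apply: cmeasurableD => //; exact: cmeasurableN.
have iu1 : mu.-integrable setT (fun t => (u (pt t))%:E).
  apply/integrableP; split; first exact/measurable_EFinP.
  under eq_integral do rewrite /= ger0_norm ?(le_trans (cabs_ge0 _) (gu0 _))//.
  by [].
have [|||||_ _] := @dominated_convergence _ _ _ mu setT measurableT
  (fun k t => (cabs (g_ k (pt t) - g (pt t)))%:E) (cst 0%E) (fun t => (u (pt t))%:E + (u (pt t))%:E)%E.
- by move=> k; apply/measurable_EFinP; exact: (measurable_cabs (mgB k)).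
- exact: measurable_cst.
- by apply: nearW => t _; apply/fine_cvgP; split; [apply: nearW|exact: gg].
- exact: integrableD.
- apply: nearW => t k _; rewrite /= ger0_norm ?cabs_ge0// -EFinD lee_fin.
  by apply: le_trans (ler_cabsD _ _) _; rewrite cabsN lerD.
rewrite integral0 => /fine_cvgP[[K _ fin] h].
apply: (squeeze_cvgr _ (cvg_cst _) h).
near=> k; apply/andP; split; first exact: cabs_ge0.
rewrite (_ : cintegral (g_ k) - cintegral g = cintegral (fun x => g_ k x - g x)); last first.
  rewrite -mulN1r -cintegralZ// -cintegralD//; last exact: cintegrableZ.
  by apply: eq_cintegral => x; rewrite mulN1r.
rewrite -lee_fin fineK; last by apply: fin => /=; near: k; exact: nbhs_infty_ge.
apply: cabs_cintegral_le; under eq_fun do rewrite -[- g _]mulN1r.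
by apply: cintegrableD => //; exact: cintegrableZ.
Unshelve. all: by end_near. Qed.

(** The product bound u x * v y stands for integrability on the product space: it makes every slice
    integrable, not only almost every one. *)
Lemma cfubini (K : E -> E -> C) u v :
  measurable_fun setT (fun z => Re (K (pt z.1) (pt z.2))) ->
  measurable_fun setT (fun z => Im (K (pt z.1) (pt z.2))) ->
  measurable_fun setT (u \o pt) -> measurable_fun setT (v \o pt) ->
  (forall x y, cabs (K x y) <= u x * v y) ->
  (forall x, 0 <= u x) -> (forall x, 0 <= v x) ->
  (\int[mu]_t (u (pt t))%:E < +oo)%E -> (\int[mu]_t (v (pt t))%:E < +oo)%E ->
  cintegrable (fun x => cintegral (K x)) /\
  cintegral (fun x => cintegral (K x)) = cintegral (fun y => cintegral (fun x => K x y)).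
Proof.
move=> mR mI mu' mv Kuv u0 v0 iu iv.
have uv0 z : (0 <= (u (pt z.1) * v (pt z.2))%:E)%E by rewrite lee_fin mulr_ge0.
have muv : measurable_fun setT (fun z : n.-tuple (measurableTypeR R) * n.-tuple (measurableTypeR R) => (u (pt z.1) * v (pt z.2))%:E).
  apply/measurable_EFinP; apply: measurable_funM.
    by apply: (measurableT_comp (f := u \o pt)).
  by apply: (measurableT_comp (f := v \o pt)).
have fin r : (fun z => (r z)%:E) = EFin \o r by [].
have int2 (r : n.-tuple (measurableTypeR R) * n.-tuple (measurableTypeR R) -> R) :
    measurable_fun setT r -> (forall z, `|r z| <= u (pt z.1) * v (pt z.2)) ->
    (mu \x mu)%E.-integrable setT (EFin \o r).
  move=> mr rb; apply/integrable12ltyP; first exact/measurable_EFinP.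
  apply: (@le_lt_trans _ _ (\int[mu]_x \int[mu]_y (u (pt x) * v (pt y))%:E)%E).
    apply: ge0_le_integral => //=.
    - by move=> x _; apply: integral_ge0.
    - apply: (@measurable_fun_fubini_tonelli_F _ _ _ _ _ mu (fun z => `|(EFin \o r) z|%E)) => //.
      by apply: measurableT_comp => //; exact/measurable_EFinP.
    - exact: (@measurable_fun_fubini_tonelli_F _ _ _ _ _ mu _ muv).
    move=> x _; apply: ge0_le_integral => //=.
    - by apply/measurable_EFinP; apply: measurableT_comp => //; apply: measurableT_comp mr _; exact: measurable_fun_pair.
    - by apply/measurable_EFinP; apply: measurable_funM.
    by move=> y _; rewrite lee_fin; exact: (rb (x, y)).
  rewrite (_ : (fun x => _) = fun x => ((\int[mu]_y (v (pt y))%:E) * (u (pt x))%:E)%E); last first.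
    apply/funext => x; under eq_integral do rewrite EFinM.
    rewrite ge0_integralZl_EFin//; first by rewrite muleC.
    - by move=> y _; rewrite lee_fin.
    - exact/measurable_EFinP.
  rewrite ge0_integralZl//.
  - by rewrite lte_mul_pinfty// ?integral_ge0// ?ge0_fin_numE ?integral_ge0// => *; rewrite lee_fin.
  - exact/measurable_EFinP.
  - by move=> *; rewrite lee_fin.
  - by apply: integral_ge0 => *; rewrite lee_fin.
have iR := int2 _ mR (fun z => le_trans (normr_Re_le _) (Kuv _ _)).
have iI := int2 _ mI (fun z => le_trans (normr_Im_le _) (Kuv _ _)).
(* The inner integral passes through [fine]. Finiteness on every slice ensures that nothing is lost
   there, so the real Fubini theorem applies to the parts. *)
have slice1 (r : n.-tuple (measurableTypeR R) * n.-tuple (measurableTypeR R) -> R) :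
    measurable_fun setT r -> (forall z, `|r z| <= u (pt z.1) * v (pt z.2)) ->
    forall x, (fine (\int[mu]_y (r (x, y))%:E)%E)%:E = (\int[mu]_y (r (x, y))%:E)%E.
  move=> mr rb x; rewrite fineK//; apply: integrable_fin_num => //.
  have iv' : mu.-integrable setT (fun y => ((u (pt x))%:E * (v (pt y))%:E)%E).
    apply: integrableZl => //; apply/integrableP; split; first exact/measurable_EFinP.
    by under eq_integral do rewrite /= ger0_norm//.
  apply: (le_integrable _ _ _ iv') => //=.
    by apply/measurable_EFinP; apply: measurableT_comp mr _; exact: measurable_fun_pair.
  by move=> y _; rewrite lee_fin [leRHS]ger0_norm ?mulr_ge0//; exact: (rb (x, y)).
have slice2 (r : n.-tuple (measurableTypeR R) * n.-tuple (measurableTypeR R) -> R) :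
    measurable_fun setT r -> (forall z, `|r z| <= u (pt z.1) * v (pt z.2)) ->
    forall y, (fine (\int[mu]_x (r (x, y))%:E)%E)%:E = (\int[mu]_x (r (x, y))%:E)%E.
  move=> mr rb y; rewrite fineK//; apply: integrable_fin_num => //.
  have iv' : mu.-integrable setT (fun x => ((v (pt y))%:E * (u (pt x))%:E)%E).
    apply: integrableZl => //; apply/integrableP; split; first exact/measurable_EFinP.
    by under eq_integral do rewrite /= ger0_norm//.
  apply: (le_integrable _ _ _ iv') => //=.
    by apply/measurable_EFinP; apply: measurableT_comp mr _; exact: measurable_fun_pair.
  by move=> x _; rewrite lee_fin [leRHS]ger0_norm ?mulr_ge0// mulrC; exact: (rb (x, y)).
have sR1 := slice1 _ mR (fun z => le_trans (normr_Re_le _) (Kuv _ _)).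
have sI1 := slice1 _ mI (fun z => le_trans (normr_Im_le _) (Kuv _ _)).
have sR2 := slice2 _ mR (fun z => le_trans (normr_Re_le _) (Kuv _ _)).
have sI2 := slice2 _ mI (fun z => le_trans (normr_Im_le _) (Kuv _ _)).
split.
  split; rewrite /cintegral/=.
    rewrite (_ : (fun t => _) = fun x => \int[mu]_y (Re (K (pt x) (pt y)))%:E)%E.
      exact: (integrable_fubini_F iR).
    by apply/funext => x; rewrite -sR1.
  rewrite (_ : (fun t => _) = fun x => \int[mu]_y (Im (K (pt x) (pt y)))%:E)%E.
    exact: (integrable_fubini_F iI).
  by apply/funext => x; rewrite -sI1.
apply: eqReIm; rewrite /cintegral/= /Rintegral; congr fine.
  under eq_integral do rewrite sR1; under [RHS]eq_integral do rewrite sR2.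
  exact: (@Fubini _ _ _ _ _ mu mu _ iR).
under eq_integral do rewrite sI1; under [RHS]eq_integral do rewrite sI2.
exact: (@Fubini _ _ _ _ _ mu mu _ iI).
Qed.

End complex_integral.

(** * Smooth functions *)

Section differentiability.
Context (R : realType) (n : nat).
Local Notation E := 'rV[R]_n.
Local Notation e_ i := (delta_mx ord0 i : E).
Implicit Types (u v w : E -> R) (U : set E).

Lemma differentiable_littleo u (df : {linear E -> R}) x : continuous df ->
  u \o shift x = cst (u x) + df +o_ (0 : E) id -> differentiable u x.
Proof.
move=> cdf h; have E := diff_unique cdf h.
by apply/diff_locallyP; rewrite E.
Qed.

Lemma near_eq_differentiable u v x :
  (\forall y \near x, u y = v y) -> differentiable u x -> differentiable v x.
Proof.
move=> uv /diff_locallyP[c /eqaddoP h]; apply: (differentiable_littleo c).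
apply/eqaddoP => e e0; have {}h := h e e0.
have uvx := nbhs_singleton uv.
have uv' : \forall y \near (0 : E), u (y + x) = v (y + x).
  have h0 : (y + x) @[y --> (0 : E)] --> x.
    by rewrite -[X in _ --> X]add0r; apply: cvgD; [exact: cvg_id|exact: cvg_cst].
  exact: h0 _ uv.
apply: filterS2 uv' h => y uvy hy.
change (`|v (y + x) - (v x + 'd u x y)| <= e * `|y|).
by rewrite -uvx -uvy; exact: hy.
Qed.

Lemma differentiable_expansion u (a : 'I_n -> R) x :
  (forall e, 0 < e -> \forall h \near (0 : E),
     `|u (h + x) - (u x + \sum_i h ord0 i * a i)| <= e * `|h|) ->
  differentiable u x /\ forall i, 'D_(e_ i) u x = a i.
Proof.
move=> H.
pose f (h : E) := dotp h (\row_i a i).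
have fE h : f h = \sum_i h ord0 i * a i by apply: eq_bigr => i _; rewrite mxE.
have flin : linear f.
  move=> k y z; rewrite !fE scaler_sumr -big_split/=.
  by apply: eq_bigr => i _; rewrite !mxE mulrDl -mulrA.
pose fm := GRing.isLinear.Build _ _ _ _ f flin.
pose df : {linear E -> R} := HB.pack f fm.
have cdf : continuous df by exact: continuous_dotp.
have hu : u \o shift x = cst (u x) + df +o_ (0 : E) id.
  apply/eqaddoP => e e0; apply: filterS (H e e0) => h.
  by rewrite -fE.
split; first exact: differentiable_littleo hu.
move=> i; rewrite deriveE; last exact: differentiable_littleo hu.
rewrite (diff_unique cdf hu) /= fE (bigD1 i)//= big1 ?addr0 ?mxE ?eqxx ?mul1r//.
by move=> j /negbTE ji; rewrite mxE eqxx ji mul0r.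
Qed.

Definition smooth_on U u := forall l x, U x -> differentiable (partials l u) x.

Lemma partials_rcons l i u : partials (rcons l i) u = partials l ('D_(e_ i) u).
Proof. exact: foldr_rcons. Qed.

Lemma partials_eq_on U u v : open U -> (forall x, U x -> u x = v x) ->
  forall l x, U x -> partials l u x = partials l v x.
Proof.
move=> oU uv; elim=> [|i l IH] x Ux //=; first exact: uv.
apply: near_eq_derive; apply: filterS (open_nbhs_nbhs (conj oU Ux)) => y Uy.
exact: IH.
Qed.

Lemma smooth_on_eq U u v : open U -> (forall x, U x -> u x = v x) ->
  smooth_on U u -> smooth_on U v.
Proof.
move=> oU uv su l x Ux; apply: near_eq_differentiable (su l x Ux).
apply: filterS (open_nbhs_nbhs (conj oU Ux)) => y Uy.
exact: (partials_eq_on oU uv).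
Qed.

Lemma smooth_onS U V u : V `<=` U -> smooth_on U u -> smooth_on V u.
Proof. by move=> VU su l x /VU; exact: su. Qed.

Lemma smooth_onU U V u : smooth_on U u -> smooth_on V u -> smooth_on (U `|` V) u.
Proof. by move=> su sv l x [/su|/sv]. Qed.

Lemma smooth_on_derive U u i : smooth_on U u -> smooth_on U ('D_(e_ i) u).
Proof. by move=> su l x Ux; rewrite -partials_rcons; exact: su. Qed.

Lemma smooth_on_diff U u x : smooth_on U u -> U x -> differentiable u x.
Proof. by move=> /(_ [::]); apply. Qed.

(** The algebra of functions generated by B. If the first partials of the generators agree on U with
    members of the algebra, all its members are smooth on U, so infinitely many derivatives are
    settled by one closure check. *)
Inductive falg (B : set (E -> R)) : (E -> R) -> Prop :=
| falg_base u : B u -> falg B u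
| falg_cst c : falg B (cst c)
| falg_add u v : falg B u -> falg B v -> falg B (fun x => u x + v x)
| falg_mul u v : falg B u -> falg B v -> falg B (fun x => u x * v x).

Lemma falg_smooth U (B : set (E -> R)) : open U ->
  (forall u, B u -> (forall x, U x -> differentiable u x) /\
     forall i, exists2 v, falg B v & forall x, U x -> 'D_(e_ i) u x = v x) ->
  forall u, falg B u -> smooth_on U u.
Proof.
move=> oU hB.
have step u : falg B u -> (forall x, U x -> differentiable u x) /\
     forall i, exists2 v, falg B v & forall x, U x -> 'D_(e_ i) u x = v x.
  elim=> {u} [u /hB//|c|u v fu [du Du] fv [dv Dv]|u v fu [du Du] fv [dv Dv]].
  - split=> [x _|i]; first exact: differentiable_cst.
    by exists (cst 0) => [|x _]; [exact: falg_cst|rewrite derive_cst].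
  - split=> [x Ux|i]; first by apply: differentiableD; [exact: du|exact: dv].
    have [u' fu' uu'] := Du i; have [v' fv' vv'] := Dv i.
    exists (fun x => u' x + v' x) => [|x Ux]; first exact: falg_add.
    rewrite [LHS]deriveD; [by rewrite uu'// vv'|
      exact/diff_derivable/du|exact/diff_derivable/dv].
  - split=> [x Ux|i]; first by apply: differentiableM; [exact: du|exact: dv].
    have [u' fu' uu'] := Du i; have [v' fv' vv'] := Dv i.
    exists (fun x => u x * v' x + v x * u' x) => [|x Ux].
      by apply: falg_add; exact: falg_mul.
    rewrite [LHS]deriveM; [by rewrite uu'// vv'|
      exact/diff_derivable/du|exact/diff_derivable/dv].
(* Peeling off the partial that is applied first replaces [u] by another member of the algebra,
   equal to that derivative on U only. *)
move=> u fu l; elim/last_ind: l u fu => [|l i IH] u fu x Ux.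
  by have [+ _] := step _ fu; apply.
rewrite partials_rcons; have [_ /(_ i)[v fv uv]] := step _ fu.
apply: near_eq_differentiable (IH _ fv x Ux).
apply: filterS (open_nbhs_nbhs (conj oU Ux)) => y Uy.
by apply/esym; exact: (partials_eq_on oU uv).
Qed.

Lemma smooth_on_falg U u : open U -> falg (smooth_on U) u -> smooth_on U u.
Proof.
move=> oU; apply: (falg_smooth oU) => v sv; split=> [x|i]; first exact: smooth_on_diff.
by exists ('D_(e_ i) v) => //; apply/falg_base/smooth_on_derive.
Qed.

Lemma smooth_onD U u v : open U -> smooth_on U u -> smooth_on U v ->
  smooth_on U (fun x => u x + v x).
Proof. by move=> oU su sv; apply: smooth_on_falg => //; apply: falg_add; exact: falg_base. Qed.

Lemma smooth_onM U u v : open U -> smooth_on U u -> smooth_on U v ->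
  smooth_on U (fun x => u x * v x).
Proof. by move=> oU su sv; apply: smooth_on_falg => //; apply: falg_mul; exact: falg_base. Qed.

Lemma smooth_on_cst U c : open U -> smooth_on U (cst c).
Proof. by move=> oU; apply: smooth_on_falg => //; exact: falg_cst. Qed.

Lemma derive_coord x i j : 'D_(e_ i) (fun y : E => y ord0 j) x = (i == j)%:R.
Proof.
have /= [|d ->//] := @differentiable_expansion (fun y : E => y ord0 j) (fun i => (i == j)%:R) x.
move=> e e0; near=> h; rewrite mxE addrC (bigD1 j)//= big1.
  by rewrite eqxx mulr1 addr0 subrr normr0 mulr_ge0// ltW.
by move=> k /negbTE ->; rewrite mulr0.
Unshelve. all: by end_near. Qed.

Lemma smooth_on_coord U j : open U -> smooth_on U (fun y : E => y ord0 j).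
Proof.
move=> oU; apply: (@falg_smooth _ [set fun y : E => y ord0 j]) => //; last exact: falg_base.
move=> u ->; split => [x _|i]; first exact: differentiable_coord.
by exists (cst (i == j)%:R) => [|x _]; [exact: falg_cst|rewrite derive_coord].
Qed.

End differentiability.

(** * Smoothness of radial functions away from the origin *)

Section radial.
Context (R : realType) (n : nat).
Local Notation E := 'rV[R]_n.
Local Notation e_ i := (delta_mx ord0 i : E).

Definition smooth1 (p : R -> R) := forall (k : nat) (r : R), derivable (derive1n k p) r 1.

Lemma smooth1_derive p : smooth1 p -> smooth1 (p^`())%classic.
Proof. by move=> sp k r; rewrite -derive1Sn; exact: sp. Qed.

Lemma derive_comp1 (h : R -> R) (g : E -> R) x i : derivable h (g x) 1 ->
  differentiable g x ->
  differentiable (h \o g) x /\ 'D_(e_ i) (h \o g) x = 'D_1 h (g x) * 'D_(e_ i) g x.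
Proof.
move=> dh dg; have dh' : differentiable h (g x) by exact/derivable1_diffP.
split; first exact: differentiable_comp.
rewrite deriveE; last exact: differentiable_comp.
rewrite diff_comp//= -[in RHS]derive1E (deriveE _ dg) deriv1E//= mulrC//.
Qed.

Lemma open_enorm_gt (r : R) : open [set x : E | r < enorm x].
Proof.
rewrite (_ : mkset _ = @enorm R n @^-1` [set y | r < y]) //.
by apply: open_comp; [move=> x _; exact: continuous_enorm|exact: open_gt].
Qed.

Lemma open_enorm_lt (r : R) : open [set x : E | enorm x < r].
Proof.
rewrite (_ : mkset _ = @enorm R n @^-1` [set y | y < r]) //.
by apply: open_comp; [move=> x _; exact: continuous_enorm|exact: open_lt].
Qed.

Lemma open_punctured : open [set x : E | x != 0].
Proof.
rewrite (_ : mkset _ = [set x : E | 0 < enorm x]); first exact: open_enorm_gt.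
by apply/seteqP; split=> x /=; rewrite enorm_gt0.
Qed.

Let sq (x : E) : R := \sum_i x ord0 i ^+ 2.

Let sq_diff x : differentiable sq x /\ forall i, 'D_(e_ i) sq x = 2 * x ord0 i.
Proof.
apply: differentiable_expansion => e e0.
have d0 : 0 < e / (n%:R ^+ 2 + 1) by rewrite divr_gt0// ltr_wpDl// sqr_ge0.
have /cvgrPdist_le/(_ _ d0) := @cvg_id _ (nbhs (0 : E)).
apply: filterS => h; rewrite sub0r normrN ler_pdivlMr ?ltr_wpDl ?sqr_ge0// => he.
rewrite (_ : _ - _ = enorm h ^+ 2); last first.
  rewrite sqr_enorm /sq -big_split/= -sumrB; apply: eq_bigr => i _.
  by rewrite !mxE; ring.
rewrite ger0_norm ?sqr_ge0//.
apply: (@le_trans _ _ ((n%:R * `|h|) ^+ 2)).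
  by rewrite lerXn2r ?nnegrE ?mulr_ge0 ?enorm_ge0 ?enorm_le_mx_norm.
rewrite exprMn [`|h| ^+ 2]expr2 mulrA ler_wpM2r//.
by have := normr_ge0 h; nra.
Qed.

(** This is p(l |x|) |x|^(2a) written through |x|^2, whose partials are 2 x_i. Together with the
    coordinates the family generates an algebra closed under partials: differentiation produces p'
    with exponent a - 1/2 and p with exponent a - 1, each times coordinates. *)
Let rad (p : R -> R) (l a : R) (x : E) := p (l * sq x `^ 2^-1) * sq x `^ a.

Let sq_gt0 x : x != 0 -> 0 < sq x.
Proof. by move=> x0; rewrite -[sq x]/(\sum_i _) -sqr_enorm exprn_gt0// enorm_gt0. Qed.

Let radial_sq_smooth p l a : smooth1 p -> smooth_on [set x | x != 0] (rad p l a).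
Proof.
move=> sp.
pose B : set (E -> R) := [set u | (exists p a, smooth1 p /\ u = rad p l a) \/ exists i, u = fun y => y ord0 i].
have oU := open_punctured.
apply: (@falg_smooth _ _ _ B) => //; last by apply: falg_base; left; exists p, a.
move=> u [[{}p [{}a [{}sp ->]]]|[j ->]]; last first.
  split=> [x _|i]; first exact: differentiable_coord.
  by exists (cst (i == j)%:R) => [|x _]; [exact: falg_cst|rewrite derive_coord].
pose h (t : R) : R := p (l * t `^ 2^-1) * t `^ a.
have hE (t : R) : 0 < t -> is_derive t 1 h
    (p^`()%classic (l * t `^ 2^-1) * (l * 2^-1 * t `^ (2^-1 - 1)) * t `^ a +
     p (l * t `^ 2^-1) * (a * t `^ (a - 1))).
  move=> t0.
  have d1 := is_derive1_powR a t0; have d2 := is_derive1_powR 2^-1 t0.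
  have d3 : is_derive (l * t `^ 2^-1) 1 p (p^`()%classic (l * t `^ 2^-1)).
    by rewrite derive1E; apply/derivableP; exact: (sp 0%N).
  have d4 : is_derive t 1 (fun t => l * t `^ 2^-1) (l * (2^-1 * t `^ (2^-1 - 1))).
    by have := @is_deriveZ _ _ _ (fun t : R => t `^ 2^-1 : R) l t 1 _ d2.
  have d5 := @is_derive1_comp _ p (fun t => l * t `^ 2^-1) t _ _ d3 d4.
  have d6 := is_deriveM d5 d1.
  apply: is_derive_eq; rewrite /= /GRing.scale/=; ring.
have rE : rad p l a = h \o sq by [].
have key x i : x != 0 -> differentiable (rad p l a) x /\
    'D_(e_ i) (rad p l a) x = 'D_1 h (sq x) * (2 * x ord0 i).
  move=> x0; have [ds Ds] := sq_diff x; rewrite -Ds rE.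
  by apply: derive_comp1 => //; exact: (@ex_derive _ _ _ _ _ _ _ (hE _ (sq_gt0 x0))).
split=> [x Ux|i].
  by have /rV0Pn[i0 _] : x != 0 by []; exact: (key x i0 Ux).1.
exists (fun x => (((cst (l * 2^-1) x) * (rad p^`()%classic l (a - 2^-1) x)) +
     ((cst a x) * (rad p l (a - 1) x))) * (cst 2 x * x ord0 i)) => [|x Ux].
  apply: falg_mul; [apply: falg_add; apply: falg_mul|apply: falg_mul];
    do ?[exact: falg_cst]; apply: falg_base.
  - by left; exists p^`()%classic, (a - 2^-1); split=> //; exact: smooth1_derive.
  - by left; exists p, (a - 1).
  - by right; exists i.
have [_ ->] := key x i Ux; congr (_ * _).
have t0 := sq_gt0 Ux.
rewrite (@derive_val _ _ _ _ _ _ _ (hE _ t0)) /rad.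
have -> : sq x `^ (a - 2^-1) = sq x `^ (2^-1 - 1) * sq x `^ a.
  by rewrite -powRD; [congr (_ `^ _); lra|rewrite (gt_eqF t0) implybT].
by rewrite /=; ring.
Qed.

Lemma radial_smooth p l a : smooth1 p ->
  smooth_on [set x : E | x != 0] (fun x => p (l * enorm x) * enorm x `^ a).
Proof.
move=> sp; have := @radial_sq_smooth p l (2^-1 * a) sp.
apply: smooth_on_eq; first exact: open_punctured.
by move=> x _; rewrite /rad powRrM powR12_sqrt// sumr_ge0// => i _; exact: sqr_ge0.
Qed.

End radial.

(** * Complex-valued smooth functions, Leibniz bounds, compactly supported functions *)

Section complex_calculus.
Context (R : realType) (n : nat).
Local Notation E := 'rV[R]_n.
Local Notation C := R[i].
Local Notation e_ i := (delta_mx ord0 i : E).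
Local Notation Re := (@complex.Re R).
Local Notation Im := (@complex.Im R).
Implicit Types (g h b psi : E -> C) (U : set E).

Definition csmooth_on U g := smooth_on U (Re \o g) /\ smooth_on U (Im \o g).

Lemma smoothP g : smooth g <-> csmooth_on setT g.
Proof.
split=> [sg|[a b] l x]; last by split; [exact: a|exact: b].
by split=> l x _; have [] := sg l x.
Qed.

Definition cderive i g : E -> C :=
  fun x => ('D_(e_ i) (Re \o g) x +i* 'D_(e_ i) (Im \o g) x)%C.

Lemma cpartials_rcons l i g : cpartials (rcons l i) g = cpartials l (cderive i g).
Proof. by apply/funext => x; rewrite /cpartials !partials_rcons. Qed.

Lemma cpartials_nil g : cpartials [::] g = g.
Proof. by apply/funext => x; rewrite /cpartials /=; case: (g x). Qed.

Lemma csmooth_on_eq U g h : open U -> (forall x, U x -> g x = h x) ->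
  csmooth_on U g -> csmooth_on U h.
Proof.
move=> oU gh [a b]; split; [apply: smooth_on_eq oU _ a|apply: smooth_on_eq oU _ b];
  by move=> x Ux /=; rewrite gh.
Qed.

Lemma cpartials_eq_on U g h : open U -> (forall x, U x -> g x = h x) ->
  forall l x, U x -> cpartials l g x = cpartials l h x.
Proof.
move=> oU gh l x Ux; rewrite /cpartials; congr (_ +i* _)%C;
  by apply: (partials_eq_on oU) => // y Uy /=; rewrite gh.
Qed.

Lemma csmooth_onS U V g : V `<=` U -> csmooth_on U g -> csmooth_on V g.
Proof. by move=> VU [a b]; split; exact: (smooth_onS VU). Qed.

Lemma csmooth_onU U V g : csmooth_on U g -> csmooth_on V g -> csmooth_on (U `|` V) g.
Proof. by move=> [a b] [c d]; split; exact: smooth_onU. Qed.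

Lemma csmooth_onD U g h : open U -> csmooth_on U g -> csmooth_on U h ->
  csmooth_on U (fun x => g x + h x).
Proof.
move=> oU [a b] [c d]; split.
  by rewrite (_ : _ \o _ = fun x => Re (g x) + Re (h x)); [exact: smooth_onD|apply/funext => x /=; rewrite ReD].
by rewrite (_ : _ \o _ = fun x => Im (g x) + Im (h x)); [exact: smooth_onD|apply/funext => x /=; rewrite ImD].
Qed.

Lemma csmooth_onM U g h : open U -> csmooth_on U g -> csmooth_on U h ->
  csmooth_on U (fun x => g x * h x).
Proof.
move=> oU [a b] [c d]; split.
  rewrite (_ : _ \o _ = fun x => Re (g x) * Re (h x) + (cst (-1) x * (Im (g x) * Im (h x)))).
    by apply: smooth_onD => //; do ?apply: smooth_onM => //; exact: smooth_on_cst.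
  by apply/funext => x /=; rewrite ReE mulN1r.
rewrite (_ : _ \o _ = fun x => Re (g x) * Im (h x) + (Im (g x) * Re (h x))).
  by apply: smooth_onD => //; exact: smooth_onM.
by apply/funext => x /=; rewrite ImE.
Qed.

Lemma csmooth_on_cst U c : open U -> csmooth_on U (fun=> c).
Proof. by move=> oU; split; exact: smooth_on_cst. Qed.

Lemma csmooth_on_real U (u : E -> R) : open U -> smooth_on U u -> csmooth_on U (fun x => (u x)%:C%C).
Proof. by move=> oU su; split => //; exact: smooth_on_cst. Qed.

Lemma smooth_diff g x : smooth g -> differentiable (Re \o g) x /\ differentiable (Im \o g) x.
Proof. by move=> /(_ [::] x). Qed.

Lemma smoothD g h : smooth g -> smooth h -> smooth (fun x => g x + h x).
Proof. by move=> /smoothP a /smoothP b; apply/smoothP; apply: csmooth_onD => //; exact: openT. Qed.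

Lemma smoothM g h : smooth g -> smooth h -> smooth (fun x => g x * h x).
Proof. by move=> /smoothP a /smoothP b; apply/smoothP; apply: csmooth_onM => //; exact: openT. Qed.

Lemma smooth_cst (c : C) : smooth ((fun=> c) : E -> C).
Proof. by apply/smoothP; apply: csmooth_on_cst; exact: openT. Qed.

Lemma smooth_coord (i : 'I_n) : smooth (fun x : E => (x ord0 i)%:C%C).
Proof. by apply/smoothP; apply: csmooth_on_real; [exact: openT|apply: smooth_on_coord; exact: openT]. Qed.

Lemma smooth_cderive i g : smooth g -> smooth (cderive i g).
Proof. by move=> /smoothP[a b]; apply/smoothP; split; exact: smooth_on_derive. Qed.

Lemma smooth_conj g : smooth g -> smooth (fun x => (g x)^*%C).
Proof.
move=> /smoothP[a b]; apply/smoothP; split.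
  by rewrite (_ : _ \o _ = Re \o g)//; apply/funext => x /=; case: (g x).
rewrite (_ : _ \o _ = fun x => cst (-1) x * Im (g x)).
  by apply: smooth_onM => //; [exact: openT|apply: smooth_on_cst; exact: openT].
by apply/funext => x /=; case: (g x) => p q; rewrite mulN1r.
Qed.

Lemma cderiveD i g h : smooth g -> smooth h ->
  cderive i (fun x => g x + h x) = fun x => cderive i g x + cderive i h x.
Proof.
move=> sg sh; apply/funext => x.
have [[a b] [c d]] := (smooth_diff x sg, smooth_diff x sh).
apply: eqReIm; rewrite ?ReD ?ImD /=.
  rewrite (_ : Re \o _ = (Re \o g) + (Re \o h)); last by apply/funext => y /=; rewrite ReD.
  by rewrite deriveD//; exact: diff_derivable.
rewrite (_ : Im \o _ = (Im \o g) + (Im \o h)); last by apply/funext => y /=; rewrite ImD.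
by rewrite deriveD//; exact: diff_derivable.
Qed.

Lemma cderiveM i g h : smooth g -> smooth h ->
  cderive i (fun x => g x * h x) = fun x => cderive i g x * h x + g x * cderive i h x.
Proof.
move=> sg sh; apply/funext => x.
have [[a b] [c d]] := (smooth_diff x sg, smooth_diff x sh).
have [[a' b'] [c' d']] := ((@diff_derivable _ _ _ _ _ (e_ i) a, @diff_derivable _ _ _ _ _ (e_ i) b),
  (@diff_derivable _ _ _ _ _ (e_ i) c, @diff_derivable _ _ _ _ _ (e_ i) d)).
apply: eqReIm; rewrite ?ReD ?ImD ?ReE ?ImE /=.
  rewrite (_ : Re \o _ = (Re \o g) * (Re \o h) - (Im \o g) * (Im \o h)); last by apply/funext => y /=; rewrite ReE.
  rewrite (deriveB (derivableM a' c') (derivableM b' d')) (deriveM a' c') (deriveM b' d').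
  rewrite /GRing.scale /=.
  move: ('D_(e_ i) (Re \o g) x) ('D_(e_ i) (Im \o g) x) ('D_(e_ i) (Re \o h) x) ('D_(e_ i) (Im \o h) x) => A B A' B'.
  by ring.
rewrite (_ : Im \o _ = (Re \o g) * (Im \o h) + (Im \o g) * (Re \o h)); last by apply/funext => y /=; rewrite ImE.
rewrite (deriveD (derivableM a' d') (derivableM b' c')) (deriveM a' d') (deriveM b' c').
rewrite /GRing.scale /=.
move: ('D_(e_ i) (Re \o g) x) ('D_(e_ i) (Im \o g) x) ('D_(e_ i) (Re \o h) x) ('D_(e_ i) (Im \o h) x) => A B A' B'.
by ring.
Qed.

Lemma cderive_cst i c : cderive i (fun=> c) = fun=> 0.
Proof. by apply/funext => x; apply: eqReIm; rewrite /= derive_cst. Qed.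

Lemma cderiveZ i c g : smooth g -> cderive i (fun x => c * g x) = fun x => c * cderive i g x.
Proof.
by move=> sg; rewrite cderiveM//; [rewrite cderive_cst; apply/funext => x; rewrite mul0r add0r|exact: smooth_cst].
Qed.

Lemma cderive_coord i (j : 'I_n) : cderive i (fun x : E => (x ord0 j)%:C%C) = fun=> (i == j)%:R.
Proof.
apply/funext => x; apply: eqReIm => /=.
  by rewrite -[RHS]/(Re ((i == j)%:R : C)) derive_coord; case: eqP.
by rewrite (_ : _ \o _ = cst 0)// derive_cst; case: eqP.
Qed.

Lemma cpartials_cst0 l : cpartials l (fun=> 0 : C) = (fun=> 0) :> (E -> C).
Proof.
elim/last_ind: l => [|l i IH]; first exact: cpartials_nil.
by rewrite cpartials_rcons cderive_cst.
Qed.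

Lemma cpartialsD l g h : smooth g -> smooth h ->
  cpartials l (fun x => g x + h x) = fun x => cpartials l g x + cpartials l h x.
Proof.
elim/last_ind: l g h => [|l i IH] g h sg sh; first by rewrite !cpartials_nil.
by rewrite !cpartials_rcons cderiveD// IH//; exact: smooth_cderive.
Qed.

Lemma cpartialsZ l c g : smooth g ->
  cpartials l (fun x => c * g x) = fun x => c * cpartials l g x.
Proof.
elim/last_ind: l g => [|l i IH] g sg; first by rewrite !cpartials_nil.
by rewrite !cpartials_rcons cderiveZ// IH//; exact: smooth_cderive.
Qed.

(** Each use of the product rule doubles the number of products, hence the factor 2^N. *)
Lemma leibniz_bound N b g x (K1 K2 : R) : smooth b -> smooth g ->
  (forall l, (size l <= N)%N -> cabs (cpartials l b x) <= K1) ->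
  (forall l, (size l <= N)%N -> cabs (cpartials l g x) <= K2) ->
  forall l, (size l <= N)%N ->
  cabs (cpartials l (fun y => b y * g y) x) <= 2 ^+ N * (K1 * K2).
Proof.
move=> + + + + l; elim/last_ind: l N b g => [|l i IH] N b g sb sg Kb Kg lN.
  rewrite cpartials_nil cabsM.
  have K10 := Kb [::] isT; have K20 := Kg [::] isT.
  rewrite cpartials_nil in K10; rewrite cpartials_nil in K20.
  apply: (@le_trans _ _ (K1 * K2)); first by rewrite ler_pM ?cabs_ge0.
  by rewrite ler_peMl ?exprn_ege1 ?ler1n// mulr_ge0// (le_trans _ K10, le_trans _ K20) ?cabs_ge0.
case: N Kb Kg lN => [|N] Kb Kg; first by rewrite size_rcons.
rewrite size_rcons ltnS => lN.
rewrite cpartials_rcons cderiveM// cpartialsD; do ?[exact: smoothM|apply: smoothM => //; exact: smooth_cderive].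
apply: le_trans (ler_cabsD _ _) _.
have W (f : E -> C) (K : R) : (forall l, (size l <= N.+1)%N -> cabs (cpartials l f x) <= K) ->
  forall l, (size l <= N)%N -> cabs (cpartials l f x) <= K.
  by move=> H l' l'N; apply: H; exact: leqW.
have W' (f : E -> C) (K : R) : (forall l, (size l <= N.+1)%N -> cabs (cpartials l f x) <= K) ->
  forall l, (size l <= N)%N -> cabs (cpartials l (cderive i f) x) <= K.
  by move=> H l' l'N; rewrite -cpartials_rcons; apply: H; rewrite size_rcons.
rewrite exprS -mulrA mulr2n mulrDl mul1r; apply: lerD; apply: IH => //;
  do ?[exact: smooth_cderive|exact: W|exact: W'].
Qed.

Lemma continuous_cpartials l g : smooth g ->
  continuous (fun x => cabs (cpartials l g x)).
Proof.
move=> sg x; have [a b] := sg l x.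
rewrite (_ : (fun _ => _) = fun y => Num.sqrt (partials l (Re \o g) y ^+ 2 + partials l (Im \o g) y ^+ 2)); last first.
  by apply/funext => y; rewrite cabsE.
apply: (@cvg_comp _ _ _ (fun y => partials l (Re \o g) y ^+ 2 + partials l (Im \o g) y ^+ 2) (@Num.sqrt R)); last exact: sqrt_continuous.
by apply: cvgD; apply: cvgM; apply: differentiable_continuous.
Qed.

Lemma smooth_cmeasurable g : smooth g -> cmeasurable g.
Proof.
move=> sg; apply: cmeasurable_continuous => x; have [a b] := smooth_diff x sg;
  exact: differentiable_continuous.
Qed.

Definition bump g := smooth g /\ exists r, forall x, g x != 0 -> enorm x <= r.

Lemma test_bump g : test_function g -> bump g.
Proof. by move=> [sg [r1 [r2 [r0 H]]]]; split=> //; exists r2 => x /H/andP[]. Qed.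

Lemma cpartials_support (V : set E) g : open V -> (forall x, V x -> g x = 0) ->
  forall l x, V x -> cpartials l g x = 0.
Proof. by move=> oV g0 l x Vx; rewrite (cpartials_eq_on oV g0)// cpartials_cst0. Qed.

Lemma bump_cderive i g : bump g -> bump (cderive i g).
Proof.
move=> [sg [r gr]]; split; first exact: smooth_cderive.
exists r => x; apply: contraR; rewrite -ltNge => rx.
apply/eqP; rewrite -[cderive i g]cpartials_nil -cpartials_rcons.
apply: (@cpartials_support [set x | r < enorm x]) => // [|y /= ry]; first exact: open_enorm_gt.
by apply/eqP; apply: contraTT ry => /gr; rewrite -leNgt.
Qed.

(** Compactness bounds the function itself; higher orders follow by applying the induction
    hypothesis to the n first partials, which are bumps again. *)
Lemma bump_bounded g : bump g -> forall N, exists K, 0 <= K /\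
  forall l x, (size l <= N)%N -> cabs (cpartials l g x) <= K.
Proof.
move=> + N; elim: N g => [|N IH] g bg.
  have [sg [r gr]] := bg.
  pose A : set E := [set x | `|x| <= `|r|].
  have A0 : A 0 by rewrite /A/= normr0.
  have cA : compact A.
    apply: bounded_closed_compact; first by exists `|r|; split=> // M rM x /= /le_trans; apply; exact: ltW.
    rewrite (_ : A = (fun x : E => `|x|) @^-1` [set y | y <= `|r|])//.
    by apply: closed_comp => [x _|]; [exact: norm_continuous|exact: closed_le].
  have [|c _ Hc] := @EVT_max_rV R n (fun x => cabs (cpartials [::] g x)) A (ex_intro _ _ A0) cA.
    by apply: continuous_subspaceT; exact: continuous_cpartials.
  exists (cabs (cpartials [::] g c)); split=> [|[]// x _]; first exact: cabs_ge0.
  have [xA|xA] := pselect (A x); first by apply: Hc; rewrite inE.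
  rewrite cpartials_nil; have [->|gx] := eqVneq (g x) 0; first by rewrite cabs0 cabs_ge0.
  exfalso; apply: xA; apply: le_trans (mx_norm_le_enorm _) _.
  by apply: le_trans (gr _ gx) _; exact: ler_norm.
have [K0 [K00 HK0]] := IH _ bg.
have /choice[K HK] : forall i : 'I_n, exists K, 0 <= K /\
    forall l x, (size l <= N)%N -> cabs (cpartials l (cderive i g) x) <= K.
  by move=> i; apply: IH; exact: bump_cderive.
have sK (P : pred 'I_n) : 0 <= \sum_(i | P i) K i by apply: sumr_ge0 => i _; have [] := HK i.
exists (K0 + \sum_i K i); split=> [|l x]; first exact: addr_ge0.
case/lastP: l => [_|l i]; first by apply: le_trans (HK0 [::] x isT) _; rewrite lerDl.
rewrite size_rcons ltnS cpartials_rcons => lN; have [_ /(_ l x lN)] := HK i.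
move=> /le_trans; apply; rewrite (bigD1 i)//= addrA -[leLHS]addr0.
by apply: lerD => //; rewrite lerDr.
Qed.

End complex_calculus.

(** * Schwartz functions *)

Section schwartz_space.
Context (R : realType) (n : nat).
Local Notation E := 'rV[R]_n.
Local Notation C := R[i].
Local Notation mu := (lebesgue_tuple R n).
Local Notation pt := (@Defs.point R n).
Local Notation Re := (@complex.Re R).
Local Notation Im := (@complex.Im R).
Local Notation sb := (@schwartz_bound R n).
Implicit Types (g h b psi : E -> C).

Lemma jap_ge1 (x : E) : 1 <= 1 + enorm x.
Proof. by rewrite lerDl enorm_ge0. Qed.

Lemma jap_gt0 (x : E) : 0 < 1 + enorm x.
Proof. exact: lt_le_trans (jap_ge1 x). Qed.

Lemma jap_pow_gt0 (x : E) N : 0 < (1 + enorm x) ^+ N.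
Proof. by rewrite exprn_gt0 ?jap_gt0. Qed.

Lemma schwartz_boundP N M psi l x : sb N M psi -> (size l <= N)%N ->
  cabs (cpartials l psi x) <= M / (1 + enorm x) ^+ N.
Proof. by move=> h lN; rewrite ler_pdivlMr ?jap_pow_gt0// mulrC; exact: h. Qed.

Lemma schwartz_bound_ge0 N M psi : sb N M psi -> 0 <= M.
Proof.
move=> /(_ [::] 0 isT); apply: le_trans.
by rewrite mulr_ge0 ?cabs_ge0// ltW ?jap_pow_gt0.
Qed.

Lemma schwartz_boundW N N' M M' psi : (N' <= N)%N -> M <= M' -> sb N M psi -> sb N' M' psi.
Proof.
move=> N'N MM h l x lN; apply: le_trans MM; apply: le_trans (h l x (leq_trans lN N'N)).
by rewrite ler_wpM2r ?cabs_ge0// ler_weXn2l ?jap_ge1.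
Qed.

Lemma schwartz_boundD N M1 M2 g h : smooth g -> smooth h ->
  sb N M1 g -> sb N M2 h -> sb N (M1 + M2) (fun x => g x + h x).
Proof.
move=> sg sh bg bh l x lN; rewrite cpartialsD//.
apply: (@le_trans _ _ ((1 + enorm x) ^+ N * (cabs (cpartials l g x) + cabs (cpartials l h x)))).
  by rewrite ler_wpM2l ?ler_cabsD// ltW ?jap_pow_gt0.
by rewrite mulrDr lerD ?bg ?bh.
Qed.

Lemma schwartz_boundZ N M c g : smooth g -> sb N M g -> sb N (cabs c * M) (fun x => c * g x).
Proof.
move=> sg bg l x lN; rewrite cpartialsZ// cabsM mulrCA.
by rewrite ler_wpM2l ?cabs_ge0 ?bg.
Qed.

Lemma schwartz_bound_cderive N M i g : sb N.+1 M g -> sb N M (cderive i g).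
Proof.
move=> bg l x lN; rewrite -cpartials_rcons.
apply: le_trans (bg (rcons l i) x _); last by rewrite size_rcons.
by rewrite ler_wpM2r ?cabs_ge0// ler_weXn2l ?jap_ge1.
Qed.

(** A factor of growth (1 + |x|)^p consumes p of the N + p decay powers of [g]. *)
Lemma schwartz_boundM N p (K M : R) b g : smooth b -> smooth g ->
  (forall l x, (size l <= N)%N -> cabs (cpartials l b x) <= K * (1 + enorm x) ^+ p) ->
  sb (N + p)%N M g -> sb N (2 ^+ N * (K * M)) (fun x => b x * g x).
Proof.
move=> sm_b sg bK bg l x lN.
have := @leibniz_bound R n N b g x _ _ sm_b sg (fun l' => @bK l' x)
   (fun l' l'N => schwartz_boundP x bg (leq_trans l'N (leq_addr p N))) l lN.
move=> H; rewrite mulrC -ler_pdivlMr ?jap_pow_gt0//; apply: le_trans H _.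
have /lt0r_neq0 := jap_pow_gt0 x N; have /lt0r_neq0 := jap_pow_gt0 x p.
rewrite exprD; move: (_ ^+ p) (_ ^+ N) => y z y0 z0.
by rewrite le_eqVlt; apply/orP; left; apply/eqP; field; rewrite ?y0 ?z0.
Qed.

Lemma schwartzD g h : schwartz g -> schwartz h -> schwartz (fun x => g x + h x).
Proof.
move=> [sg bg] [sh bh]; split; first exact: smoothD.
move=> N; have [M1 h1] := bg N; have [M2 h2] := bh N.
by exists (M1 + M2); exact: schwartz_boundD.
Qed.

Lemma schwartzZ c g : schwartz g -> schwartz (fun x => c * g x).
Proof.
move=> [sg bg]; split; first by apply: smoothM => //; exact: smooth_cst.
by move=> N; have [M h1] := bg N; exists (cabs c * M); exact: schwartz_boundZ.
Qed.

Lemma schwartzB g h : schwartz g -> schwartz h -> schwartz (fun x => g x - h x).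
Proof.
move=> sg sh; under eq_fun do rewrite -[- h _]mulN1r.
by apply: schwartzD => //; exact: schwartzZ.
Qed.

Lemma schwartz_cderive i g : schwartz g -> schwartz (cderive i g).
Proof.
move=> [sg bg]; split; first exact: smooth_cderive.
by move=> N; have [M h1] := bg N.+1; exists M; exact: schwartz_bound_cderive.
Qed.

Lemma coord_bound (j : 'I_n) N l (x : E) : (size l <= N)%N ->
  cabs (cpartials l (fun x : E => (x ord0 j)%:C%C) x) <= 1 * (1 + enorm x) ^+ 1.
Proof.
move=> _; rewrite mul1r expr1; case/lastP: l => [|l i].
  rewrite cpartials_nil cabs_real; apply: le_trans (coord_le_enorm _ _) _.
  by rewrite lerDr.
rewrite cpartials_rcons cderive_coord; case/lastP: l => [|l k].
  rewrite cpartials_nil; case: (_ == _); rewrite ?cabs1 ?cabs0 ?jap_ge1//.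
  by rewrite ltW ?jap_gt0.
by rewrite cpartials_rcons cderive_cst cpartials_cst0 cabs0 ltW ?jap_gt0.
Qed.

Lemma schwartz_bound_coord N M j g : smooth g -> sb N.+1 M g ->
  sb N (2 ^+ N * M) (fun x => (x ord0 j)%:C%C * g x).
Proof.
move=> sg bg; rewrite -[M]mul1r; apply: (@schwartz_boundM N 1) => //.
- exact: smooth_coord.
- by move=> l x; exact: coord_bound.
- by rewrite addn1.
Qed.

Lemma schwartz_coord j g : schwartz g -> schwartz (fun x => (x ord0 j)%:C%C * g x).
Proof.
move=> [sg bg]; split; first by apply: smoothM => //; exact: smooth_coord.
by move=> N; have [M h] := bg N.+1; exists (2 ^+ N * M); exact: schwartz_bound_coord.
Qed.

Lemma schwartz_bumpM b g : bump b -> schwartz g -> schwartz (fun x => b x * g x).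
Proof.
move=> bb [sg bg]; split; first by apply: smoothM => //; case: bb.
move=> N; have [M h] := bg N; have [K [K0 hK]] := bump_bounded bb N.
exists (2 ^+ N * (K * M)); apply: (@schwartz_boundM N 0) => //; first by case: bb.
  by move=> l x lN; rewrite expr0 mulr1; exact: hK.
by rewrite addn0.
Qed.

Lemma bump_schwartz b : bump b -> schwartz b.
Proof.
move=> bb; have [sm_b [r br]] := bb; split=> // N; have [K [K0 hK]] := bump_bounded bb N.
exists ((1 + `|r|) ^+ N * K) => l x lN.
have [xr|xr] := leP (enorm x) `|r|.
  by rewrite ler_pM ?cabs_ge0 ?hK ?exprn_ge0 ?(ltW (jap_gt0 _))// lerXn2r ?nnegrE ?lerD2l ?(ltW (jap_gt0 _))// addr_ge0.
rewrite (@cpartials_support _ _ [set x | `|r| < enorm x] b)//.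
- by rewrite cabs0 mulr0 mulr_ge0// exprn_ge0// addr_ge0.
- exact: open_enorm_gt.
- move=> y /= ry; apply/eqP; apply: contraTT ry => /br h; rewrite -leNgt.
  by apply: le_trans h _; exact: ler_norm.
Qed.

Lemma smooth_bumpM b g : bump b -> smooth g -> bump (fun x => b x * g x).
Proof.
move=> [sm_b [r br]] sg; split; first exact: smoothM.
by exists r => x; rewrite mulf_eq0 negb_or => /andP[/br].
Qed.

Lemma cderive_conj i g : smooth g ->
  cderive i (fun x => (g x)^*%C) = fun x => (cderive i g x)^*%C.
Proof.
move=> sg; apply/funext => x; have [a b] := smooth_diff x sg.
apply: eqReIm => /=; first by congr ('D_ _ _ _); apply/funext => y /=; case: (g y).
rewrite (_ : Im \o _ = - (Im \o g)); last first.
  by apply/funext => y; rewrite -[RHS]/(- Im (g y)) /=; case: (g y).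
by rewrite deriveN//; exact: diff_derivable.
Qed.

Lemma schwartz_conj g : schwartz g -> schwartz (fun x => (g x)^*%C).
Proof.
move=> [sg bg]; split; first exact: smooth_conj.
move=> N; have [M h] := bg N; exists M => l x lN.
suff -> : cpartials l (fun x => (g x)^*%C) x = (cpartials l g x)^*%C.
  by rewrite cabs_conj; exact: h.
elim/last_ind: l g sg {bg lN h} x => [|l i IH] g sg x; first by rewrite !cpartials_nil.
by rewrite !cpartials_rcons cderive_conj// IH//; exact: smooth_cderive.
Qed.

(** The constant does not depend on the function. This uniformity is what later makes the Fourier
    transform continuous in the Schwartz seminorms. *)
Lemma schwartz_integrable_bound : exists K : R, 0 <= K /\ forall psi M,
  smooth psi -> sb n.+1 M psi ->
  cintegrable psi /\ (\int[mu]_t (cabs (psi (pt t)))%:E <= (K * M)%:E)%E.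
Proof.
have [K [K0 hK]] := @integral_jap R n; exists K; split=> // psi M spsi bpsi.
have M0 := schwartz_bound_ge0 bpsi.
have mj : measurable_fun setT (fun t => (1 + enorm (pt t)) ^- n.+1).
  rewrite (_ : (fun _ => _) = fun t => ((1 + enorm (pt t))^-1) ^+ n.+1); last first.
    by apply/funext => t; rewrite exprVn.
  apply: measurable_funX; apply: (measurable_continuous_point (u := fun x => (1 + enorm x)^-1)).
  move=> x; apply: cvgV; first by rewrite gt_eqF// jap_gt0.
  by apply: cvgD; [exact: cvg_cst|exact: continuous_enorm].
have le1 : (\int[mu]_t (M * (1 + enorm (pt t)) ^- n.+1)%:E <= (K * M)%:E)%E.
  under eq_integral do rewrite EFinM.
  rewrite ge0_integralZl_EFin//; last 2 first.
  - by move=> t _; rewrite lee_fin invr_ge0 ltW ?jap_pow_gt0.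
  - exact/measurable_EFinP.
  by rewrite mulrC EFinM; apply: lee_wpmul2l.
have le2 x : cabs (psi x) <= M * (1 + enorm x) ^- n.+1.
  by have := schwartz_boundP x bpsi (isT : (size [::] <= n.+1)%N); rewrite cpartials_nil.
have mM : measurable_fun setT ((fun x => M * (1 + enorm x) ^- n.+1) \o pt).
  by apply: measurable_funM.
split.
  by apply: le_cintegrable le2 (le_lt_trans le1 (ltry _)) => //; exact: smooth_cmeasurable.
apply: le_trans le1; apply: ge0_le_integral => //.
- by move=> t _; rewrite lee_fin cabs_ge0.
- by apply/measurable_EFinP; apply: measurable_cabs; exact: smooth_cmeasurable.
- exact/measurable_EFinP.
- by move=> t _; rewrite lee_fin le2.
Qed.

Lemma schwartz_cintegrable psi : schwartz psi -> cintegrable psi.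
Proof.
move=> [sp bp]; have [K [_ hK]] := schwartz_integrable_bound.
by have [M /hK] := bp n.+1; case.
Qed.

Lemma schwartz_bounded psi : schwartz psi -> exists M, forall x, cabs (psi x) <= M.
Proof.
move=> [_ /(_ 0%N)[M hM]]; exists M => x.
by have := hM [::] x isT; rewrite expr0 mul1r cpartials_nil.
Qed.

Lemma cintegrable_bounded g h (M : R) : cmeasurable g -> (forall x, cabs (g x) <= M) ->
  cintegrable h -> cintegrable (fun x => g x * h x).
Proof.
move=> mg gM /cintegrableP[mh ih].
have M0 : 0 <= M by apply: le_trans (gM 0); exact: cabs_ge0.
apply: (@le_cintegrable _ _ _ (fun x => M * cabs (h x))); first exact: cmeasurableM.
- by apply: measurable_funM => //; exact: measurable_cabs.
- by move=> x; rewrite cabsM ler_wpM2r ?cabs_ge0.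
under eq_integral do rewrite EFinM.
rewrite ge0_integralZl_EFin ?lte_mul_pinfty//.
- by move=> t _; rewrite lee_fin cabs_ge0.
- by apply/measurable_EFinP; exact: measurable_cabs.
Qed.

Lemma cintegrable_schwartzM psi h : schwartz psi -> cintegrable h ->
  cintegrable (fun x => psi x * h x).
Proof.
move=> sp; have [M hM] := schwartz_bounded sp.
by apply: cintegrable_bounded hM; apply: smooth_cmeasurable; case: sp.
Qed.

End schwartz_space.

(** * The Fourier transform *)

Section fourier_transform.
Context (R : realType) (n : nat).
Local Notation E := 'rV[R]_n.
Local Notation C := R[i].
Local Notation e_ i := (delta_mx ord0 i : E).
Local Notation mu := (lebesgue_tuple R n).
Local Notation pt := (@Defs.point R n).
Local Notation Re := (@complex.Re R).
Local Notation Im := (@complex.Im R).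
Local Notation sb := (@schwartz_bound R n).
Implicit Types (g h b psi : E -> C) (s : R).

(* Both Fourier transforms at once: [s = -1] is the transform of Defs, [s = 1] the
   inverse one up to normalisation. *)
Definition FT s psi : E -> C := fun xi => cintegral (fun x => cis (s * dotp x xi) * psi x).

Lemma fourierE psi : fourier psi = FT (-1) psi.
Proof. by apply/funext => xi; apply: eq_cintegral => x; rewrite mulN1r. Qed.

Lemma inv_fourierE psi : inv_fourier psi = fun x => (((2 * pi) ^- n)%:C)%C * FT 1 psi x.
Proof.
by apply/funext => xi; rewrite /inv_fourier; congr (_ * _); apply: eq_cintegral => x; rewrite mul1r dotpC.
Qed.

Lemma dotpDr (x y z : E) : dotp x (y + z) = dotp x y + dotp x z.
Proof. by rewrite -big_split; apply: eq_bigr => i _; rewrite mxE mulrDr. Qed.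

Lemma dotpZr (x y : E) c : dotp x (c *: y) = c * dotp x y.
Proof. by rewrite mulr_sumr; apply: eq_bigr => i _; rewrite mxE mulrCA. Qed.

Lemma dotpDl (x y z : E) : dotp (y + z) x = dotp y x + dotp z x.
Proof. by rewrite -!(dotpC x) dotpDr. Qed.

Lemma dotpZl (x y : E) c : dotp (c *: y) x = c * dotp y x.
Proof. by rewrite -!(dotpC x) dotpZr. Qed.

Lemma dotp_delta (x : E) i : dotp x (e_ i) = x ord0 i.
Proof.
rewrite /dotp (bigD1 i)//= big1 ?addr0 => [|j /negbTE ji]; first by rewrite mxE !eqxx mulr1.
by rewrite mxE eqxx ji mulr0.
Qed.

Lemma normr_dotp_le (x y : E) : `|dotp x y| <= enorm x * enorm y.
Proof.
rewrite ler_norml dotp_le andbT lerNl -mulN1r -dotpZl scaleN1r.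
by apply: le_trans (dotp_le _ _) _; rewrite enormN.
Qed.

Lemma cmeasurable_cis s (xi : E) : cmeasurable (fun x => cis (s * dotp x xi)).
Proof.
have c : continuous (fun x : E => s * dotp x xi).
  by move=> x; apply: cvgM; [exact: cvg_cst|exact: continuous_dotp].
apply: cmeasurable_continuous => x.
  by apply: (@cvg_comp _ _ _ (fun x => s * dotp x xi) (@cos R)); [exact: c|exact: continuous_cos].
by apply: (@cvg_comp _ _ _ (fun x => s * dotp x xi) (@sin R)); [exact: c|exact: continuous_sin].
Qed.

Lemma cintegrable_cis s xi g : cintegrable g -> cintegrable (fun x => cis (s * dotp x xi) * g x).
Proof.
by apply: (@cintegrable_bounded _ _ _ _ 1); [exact: cmeasurable_cis|move=> x; rewrite cabs_cis].
Qed.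

Lemma cabs_FT_le s g xi : cintegrable g ->
  ((cabs (FT s g xi))%:E <= \int[mu]_t (cabs (g (pt t)))%:E)%E.
Proof.
move=> ig; apply: le_trans (cabs_cintegral_le (cintegrable_cis s xi ig)) _.
by under eq_integral do rewrite cabsM cabs_cis mul1r.
Qed.

Lemma FT_D s g h : cintegrable g -> cintegrable h ->
  FT s (fun x => g x + h x) = fun xi => FT s g xi + FT s h xi.
Proof.
move=> ig ih; apply/funext => xi; rewrite /FT -cintegralD; try exact: cintegrable_cis.
by apply: eq_cintegral => x; rewrite mulrDr.
Qed.

Lemma FT_Z s c g : cintegrable g -> FT s (fun x => c * g x) = fun xi => c * FT s g xi.
Proof.
move=> ig; apply/funext => xi; rewrite /FT -cintegralZ; last exact: cintegrable_cis.
by apply: eq_cintegral => x; rewrite mulrCA.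
Qed.

(** Transposition by Fubini: there is no conjugation, and integrability of both functions is
    enough. *)
Lemma parseval s g h : cintegrable g -> cintegrable h ->
  cintegrable (fun x => g x * FT s h x) /\
  cintegral (fun x => g x * FT s h x) = cintegral (fun y => FT s g y * h y).
Proof.
move=> ig ih; have [[mg fg] [mh fh]] := ((cintegrableP g).1 ig, (cintegrableP h).1 ih).
pose K (x y : E) := g x * (cis (s * dotp x y) * h y).
have mp (f : E -> C) : cmeasurable f ->
    [/\ measurable_fun setT (fun z : n.-tuple (measurableTypeR R) * n.-tuple (measurableTypeR R) => Re (f (pt z.1))),
        measurable_fun setT (fun z : n.-tuple (measurableTypeR R) * n.-tuple (measurableTypeR R) => Im (f (pt z.1))),
        measurable_fun setT (fun z : n.-tuple (measurableTypeR R) * n.-tuple (measurableTypeR R) => Re (f (pt z.2))) &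
        measurable_fun setT (fun z : n.-tuple (measurableTypeR R) * n.-tuple (measurableTypeR R) => Im (f (pt z.2)))].
  move=> [a b]; split.
  - by apply: (measurableT_comp (f := fun t => Re (f (pt t)))).
  - by apply: (measurableT_comp (f := fun t => Im (f (pt t)))).
  - by apply: (measurableT_comp (f := fun t => Re (f (pt t)))).
  - by apply: (measurableT_comp (f := fun t => Im (f (pt t)))).
have md : measurable_fun setT (fun z : n.-tuple (measurableTypeR R) * n.-tuple (measurableTypeR R) => s * dotp (pt z.1) (pt z.2)).
  by apply: measurable_funM => //; exact: measurable_dotp2.
have mc : measurable_fun setT (fun z : n.-tuple (measurableTypeR R) * n.-tuple (measurableTypeR R) => cos (s * dotp (pt z.1) (pt z.2))).
  by apply: (measurableT_comp (f := @cos R)) => //; apply: continuous_measurable_fun; exact: continuous_cos.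
have ms : measurable_fun setT (fun z : n.-tuple (measurableTypeR R) * n.-tuple (measurableTypeR R) => sin (s * dotp (pt z.1) (pt z.2))).
  by apply: (measurableT_comp (f := @sin R)) => //; apply: continuous_measurable_fun; exact: continuous_sin.
have [gR gI _ _] := mp g mg; have [_ _ hR hI] := mp h mh.
have mKR : measurable_fun setT (fun z : n.-tuple (measurableTypeR R) * n.-tuple (measurableTypeR R) => Re (K (pt z.1) (pt z.2))).
  rewrite /K; under eq_fun do rewrite !(ReE, ImE) /cis /=.
  by do ?[apply: measurable_funB|apply: measurable_funM|apply: measurable_funD].
have mKI : measurable_fun setT (fun z : n.-tuple (measurableTypeR R) * n.-tuple (measurableTypeR R) => Im (K (pt z.1) (pt z.2))).
  rewrite /K; under eq_fun do rewrite !(ReE, ImE) /cis /=.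
  by do ?[apply: measurable_funB|apply: measurable_funM|apply: measurable_funD].
have Kb x y : cabs (K x y) <= cabs (g x) * cabs (h y) by rewrite /K !cabsM cabs_cis mul1r.
have [ic Ec] := cfubini mKR mKI (measurable_cabs mg) (measurable_cabs mh) Kb
  (fun x => cabs_ge0 _) (fun x => cabs_ge0 _) fg fh.
have E1 x : cintegral (K x) = g x * FT s h x.
  rewrite -cintegralZ; last exact: cintegrable_cis.
  by apply: eq_cintegral => y; rewrite /K dotpC.
have E2 y : cintegral (fun x => K x y) = FT s g y * h y.
  rewrite mulrC -cintegralZ; last exact: cintegrable_cis.
  by apply: eq_cintegral => x; rewrite /K; ring.
by rewrite (eq_cintegral E1) (eq_cintegral E2) in Ec; split=> //; apply: eq_cintegrable E1 ic.
Qed.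

Lemma sin_le_abs (t : R) : `|sin t| <= `|t|.
Proof.
wlog t0 : t / 0 <= t => [H|].
  have [/H//|t0] := leP 0 t; rewrite -normrN -sinN -[leRHS]normrN; apply: H; lra.
have [c _] : exists2 c, c \in `[0, t]%R & sin t - sin 0 = cos c * (t - 0).
  by apply: MVT_segment => //; apply: continuous_subspaceT; exact: continuous_sin.
rewrite sin0 !subr0 => ->; rewrite normrM ler_piMl//.
by rewrite ler_norml cos_le1 cos_geN1.
Qed.

Lemma cos_sub1_le (t : R) : `|cos t - 1| <= t ^+ 2.
Proof.
wlog t0 : t / 0 <= t => [H|].
  have [/H//|t0] := leP 0 t; rewrite -cosN -sqrrN; apply: H; lra.
have [c ct] : exists2 c, c \in `[0, t]%R & cos t - cos 0 = - sin c * (t - 0).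
  by apply: MVT_segment => //; apply: continuous_subspaceT; exact: continuous_cos.
rewrite cos0 !subr0 => ->; rewrite normrM normrN expr2 (ger0_norm t0) ler_wpM2r//.
move: ct; rewrite in_itv/= => /andP[c0 ct]; apply: le_trans (sin_le_abs c) _.
by rewrite ger0_norm.
Qed.

Lemma sin_sub_le (t : R) : `|sin t - t| <= `|t| ^+ 3.
Proof.
wlog t0 : t / 0 <= t => [H|].
  have [/H//|t0] := leP 0 t; rewrite (_ : sin t - t = - (sin (- t) - (- t))); last by rewrite sinN; ring.
  by rewrite normrN -[`|t|]normrN; apply: H; lra.
have [c ct] : exists2 c, c \in `[0, t]%R & (sin t - t) - (sin 0 - 0) = (cos c - 1) * (t - 0).
  apply: (@MVT_segment _ (fun x => sin x - x) (fun x => cos x - 1)) => //.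
  by apply: continuous_subspaceT => x; apply: cvgB; [exact: continuous_sin|exact: cvg_id].
rewrite sin0 !subr0 => ->; rewrite normrM exprSr (ger0_norm t0) ler_wpM2r//.
move: ct; rewrite in_itv/= => /andP[c0 ct]; apply: le_trans (cos_sub1_le c) _.
by rewrite lerXn2r ?nnegrE.
Qed.

(** The quadratic bound on sin t - t interpolates between |t|^3, used for |t| <= 1, and 2 |t|, used
    beyond. *)
Lemma cis_taylor (t : R) : cabs (cis t - 1 - (0 +i* t)%C) <= 4 * t ^+ 2.
Proof.
apply: le_trans (cabs_le_ReIm _) _; rewrite !(ReD, ImD, ReN, ImN) /cis /= !subr0.
have h1 := cos_sub1_le t; have h2 := sin_sub_le t; have h3 := sin_le_abs t.
have h4 : `|sin t - t| <= 2 * `|t| by apply: le_trans (ler_normB _ _) _; lra.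
have h5 : `|sin t - t| <= 2 * t ^+ 2.
  rewrite -real_normK ?num_real//; move: h2 h4; have := normr_ge0 t.
  move: (`|t|) (`|_ - t|) => a d a0 da d2; have [a1|a1] := leP a 1; last by nra.
  by apply: le_trans da _; nra.
by have := sqr_ge0 t; lra.
Qed.

End fourier_transform.

(** * Smoothness of the transform and changes of variable *)

Section fourier_schwartz.
Context (R : realType) (n : nat).
Local Notation E := 'rV[R]_n.
Local Notation C := R[i].
Local Notation e_ i := (delta_mx ord0 i : E).
Local Notation mu := (lebesgue_tuple R n).
Local Notation pt := (@Defs.point R n).
Local Notation Re := (@complex.Re R).
Local Notation Im := (@complex.Im R).
Local Notation sb := (@schwartz_bound R n).
Implicit Types (g h b psi : E -> C) (s : R).

Lemma Re_sum (I : Type) (r : seq I) (P : pred I) (F : I -> C) :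
  Re (\sum_(i <- r | P i) F i) = \sum_(i <- r | P i) Re (F i).
Proof. exact: (big_morph Re (@ReD R) erefl). Qed.

Lemma Im_sum (I : Type) (r : seq I) (P : pred I) (F : I -> C) :
  Im (\sum_(i <- r | P i) F i) = \sum_(i <- r | P i) Im (F i).
Proof. exact: (big_morph Im (@ImD R) erefl). Qed.

Lemma cintegral_sum (I : Type) (r : seq I) (F : I -> E -> C) :
  (forall i, cintegrable (F i)) ->
  cintegrable (fun x => \sum_(i <- r) F i x) /\
  cintegral (fun x => \sum_(i <- r) F i x) = \sum_(i <- r) cintegral (F i).
Proof.
move=> iF; elim: r => [|i r [IH1 IH2]].
  have E0 : (fun x : E => \sum_(i <- [::]) F i x) =1 (fun=> 0) by move=> x; rewrite big_nil.
  have i0 : cintegrable (cst 0 : E -> C) by split; exact: integrable0.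
  split; first by apply: eq_cintegrable i0 => x; rewrite E0.
  rewrite (eq_cintegral E0) big_nil -[RHS](mul0r (cintegral (cst 0 : E -> C))) -cintegralZ//.
  by apply: eq_cintegral => x; rewrite mul0r.
have E1 : (fun x : E => \sum_(j <- i :: r) F j x) =1 (fun x => F i x + \sum_(j <- r) F j x).
  by move=> x; rewrite big_cons.
split; first by apply: eq_cintegrable (cintegrableD (iF i) IH1) => x; rewrite E1.
by rewrite (eq_cintegral E1) cintegralD// IH2 big_cons.
Qed.

(** Differentiation under the integral sign: the remainder is the second order Taylor remainder of
    [cis], at most 4 s^2 |x|^2 |h|^2 times |psi|, and |x|^2 |psi| is integrable with integral B. *)
Lemma FT_differentiable s psi xi : schwartz psi ->
  [/\ differentiable (Re \o FT s psi) xi, differentiable (Im \o FT s psi) xi &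
   forall i, cderive i (FT s psi) xi = FT s (fun x => (0 +i* s)%C * ((x ord0 i)%:C%C * psi x)) xi].
Proof.
move=> sp.
pose G i := FT s (fun x => (0 +i* s)%C * ((x ord0 i)%:C%C * psi x)) xi.
have sc i : schwartz (fun x => (x ord0 i)%:C%C * psi x) by exact: schwartz_coord.
have scc i : schwartz (fun x => (x ord0 i)%:C%C * ((x ord0 i)%:C%C * psi x)) by exact: schwartz_coord.
pose u (x : E) : R := \sum_i cabs ((x ord0 i)%:C%C * ((x ord0 i)%:C%C * psi x)).
have mcc i : measurable_fun setT (fun t => cabs ((pt t ord0 i)%:C%C * ((pt t ord0 i)%:C%C * psi (pt t)))).
  by apply: (@measurable_cabs _ _ (fun x => (x ord0 i)%:C%C * ((x ord0 i)%:C%C * psi x))); apply: smooth_cmeasurable; case: (scc i).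
have mu' : measurable_fun setT (u \o pt) by apply: measurable_sum.
have iu : (\int[mu]_t (u (pt t))%:E < +oo)%E.
  rewrite /u; under eq_integral do rewrite -sumEFin.
  rewrite ge0_integral_sum//.
  - apply: lte_sum_pinfty => i _.
    by have /schwartz_cintegrable/cintegrableP[] := scc i.
  - by move=> i; exact/measurable_EFinP.
  - by move=> i t _; rewrite lee_fin cabs_ge0.
have u0 x : 0 <= u x by apply: sumr_ge0 => i _; exact: cabs_ge0.
have uE x : u x = enorm x ^+ 2 * cabs (psi x).
  rewrite sqr_enorm mulr_suml; apply: eq_bigr => i _.
  by rewrite !cabsM !cabs_real mulrA -expr2 real_normK// num_real.
pose B := fine (\int[mu]_t (u (pt t))%:E).
have BE : (\int[mu]_t (u (pt t))%:E)%E = B%:E.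
  by rewrite fineK// ge0_fin_numE// integral_ge0// => t _; rewrite lee_fin.
have B0 : 0 <= B by rewrite -lee_fin -BE integral_ge0// => t _; rewrite lee_fin.
have key (h : E) : cabs (FT s psi (h + xi) - (FT s psi xi + \sum_i (h ord0 i)%:C%C * G i)) <=
   4 * s ^+ 2 * B * enorm h ^+ 2.
  have ip := schwartz_cintegrable sp.
  pose F i (x : E) := (h ord0 i)%:C%C * (cis (s * dotp x xi) * ((0 +i* s)%C * ((x ord0 i)%:C%C * psi x))).
  have iF i : cintegrable (F i).
    by apply/cintegrableZ/cintegrable_cis/cintegrableZ/schwartz_cintegrable.
  have [iS ES] := cintegral_sum (index_enum 'I_n) iF.
  pose L (x : E) := cis (s * dotp x (h + xi)) * psi x + (-1) * (cis (s * dotp x xi) * psi x + \sum_i F i x).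
  have iA : cintegrable (fun x => cis (s * dotp x xi) * psi x + \sum_i F i x).
    by apply: cintegrableD => //; exact: cintegrable_cis.
  have iL : cintegrable L.
    by apply: cintegrableD; [exact: cintegrable_cis|exact: cintegrableZ].
  have EL : cintegral L = FT s psi (h + xi) - (FT s psi xi + \sum_i (h ord0 i)%:C%C * G i).
    rewrite cintegralD; [|exact: cintegrable_cis|exact: cintegrableZ].
    rewrite cintegralZ// mulN1r cintegralD//; last exact: cintegrable_cis.
    rewrite ES; congr (_ - (_ + _)); apply: eq_bigr => i _.
    by rewrite cintegralZ//; apply/cintegrable_cis/cintegrableZ/schwartz_cintegrable.
  rewrite -EL -lee_fin; apply: le_trans (cabs_cintegral_le iL) _.
  apply: (@le_trans _ _ (\int[mu]_t ((4 * s ^+ 2 * enorm h ^+ 2)%:E * (u (pt t))%:E))%E).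
    apply: ge0_le_integral => //.
    - by move=> t _; rewrite lee_fin cabs_ge0.
    - by apply/measurable_EFinP; apply: measurable_cabs; case/cintegrableP: iL.
    - by apply: measurable_funeM; exact/measurable_EFinP.
    move=> t _; rewrite -EFinM lee_fin uE; move: (pt t) => x.
    have -> : L x = (cis (s * dotp x xi) * psi x) * (cis (s * dotp x h) - 1 - (0 +i* (s * dotp x h))%C).
      rewrite /L /F dotpDr mulrDr cisD.
      have -> : \sum_i (h ord0 i)%:C%C * (cis (s * dotp x xi) * ((0 +i* s)%C * ((x ord0 i)%:C%C * psi x))) =
          (cis (s * dotp x xi) * psi x) * (0 +i* (s * dotp x h))%C.
        rewrite (_ : (0 +i* (s * dotp x h))%C = \sum_i (h ord0 i)%:C%C * ((0 +i* s)%C * (x ord0 i)%:C%C)).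
          by rewrite mulr_sumr; apply: eq_bigr => i _; ring.
        rewrite /dotp mulr_sumr; apply: eqReIm.
          by rewrite Re_sum [RHS]big1//= => i _; ring.
        by rewrite Im_sum /=; apply: eq_bigr => i _; ring.
      by ring.
    rewrite !cabsM cabs_cis mul1r.
    apply: (@le_trans _ _ (cabs (psi x) * (4 * (s * dotp x h) ^+ 2))).
      by rewrite ler_wpM2l ?cabs_ge0 ?cis_taylor.
    have : dotp x h ^+ 2 <= enorm x ^+ 2 * enorm h ^+ 2.
      rewrite -exprMn -real_normK ?num_real// lerXn2r ?nnegrE ?mulr_ge0 ?enorm_ge0//.
      exact: normr_dotp_le.
    move=> hd; rewrite [leRHS](_ : _ = cabs (psi x) * (4 * (s ^+ 2 * (enorm x ^+ 2 * enorm h ^+ 2)))); last by ring.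
    rewrite exprMn ler_wpM2l ?cabs_ge0// ler_wpM2l// ler_wpM2l// sqr_ge0//.
  rewrite ge0_integralZl_EFin//; last 3 first.
  - by move=> t _; rewrite lee_fin.
  - exact/measurable_EFinP.
  - by apply: mulr_ge0; [apply: mulr_ge0 => //; exact: sqr_ge0|exact: sqr_ge0].
  by rewrite BE -EFinM lee_fin [leRHS]mulrAC.
have small (e : R) : 0 < e -> \forall h \near (0 : E), 4 * s ^+ 2 * B * enorm h ^+ 2 <= e * `|h|.
  move=> e0; pose D := 4 * s ^+ 2 * B * n%:R ^+ 2 + 1.
  have D0 : 0 < D by apply: ltr_wpDl => //; do ![apply: sqr_ge0|apply: mulr_ge0|by []].
  have d0 : 0 < e / D by rewrite divr_gt0.
  have /cvgrPdist_le/(_ _ d0) := @cvg_id _ (nbhs (0 : E)).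
  apply: filterS => h; rewrite sub0r normrN ler_pdivlMr// => he.
  apply: (@le_trans _ _ (4 * s ^+ 2 * B * (n%:R * `|h|) ^+ 2)).
    apply: ler_wpM2l; first by do ![apply: sqr_ge0|apply: mulr_ge0|by []].
    rewrite lerXn2r ?nnegrE ?mulr_ge0 ?enorm_ge0//.
    exact: enorm_le_mx_norm.
  rewrite [leLHS](_ : _ = (`|h| * (D - 1)) * `|h|); last by rewrite /D; ring.
  by rewrite ler_wpM2r//; have := normr_ge0 h; nra.
have Rsum (h : E) : Re (\sum_i (h ord0 i)%:C%C * G i) = \sum_i h ord0 i * Re (G i).
  by rewrite Re_sum; apply: eq_bigr => i _; rewrite ReE/= mul0r subr0.
have Isum (h : E) : Im (\sum_i (h ord0 i)%:C%C * G i) = \sum_i h ord0 i * Im (G i).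
  by rewrite Im_sum; apply: eq_bigr => i _; rewrite ImE/= mul0r addr0.
have [|dR DR] := @differentiable_expansion R n (Re \o FT s psi) (fun i => Re (G i)) xi.
  move=> e e0; apply: filterS (small e e0) => h; apply: le_trans; apply: le_trans (key h).
  have := normr_Re_le (FT s psi (h + xi) - (FT s psi xi + \sum_i (h ord0 i)%:C%C * G i)).
  by rewrite ReD ReN ReD Rsum.
have [|dI DI] := @differentiable_expansion R n (Im \o FT s psi) (fun i => Im (G i)) xi.
  move=> e e0; apply: filterS (small e e0) => h; apply: le_trans; apply: le_trans (key h).
  have := normr_Im_le (FT s psi (h + xi) - (FT s psi xi + \sum_i (h ord0 i)%:C%C * G i)).
  by rewrite ImD ImN ImD Isum.
by split=> // i; apply: eqReIm; [exact: DR|exact: DI].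
Qed.

Lemma FT_cderive_out s psi i : schwartz psi ->
  cderive i (FT s psi) = FT s (fun x => (0 +i* s)%C * ((x ord0 i)%:C%C * psi x)).
Proof. by move=> sp; apply/funext => xi; have [_ _] := FT_differentiable s xi sp. Qed.

Lemma smooth_FT s psi : schwartz psi -> smooth (FT s psi).
Proof.
move=> sp l x; elim/last_ind: l psi sp => [|l i IH] psi sp.
  by have [a b _] := FT_differentiable s x sp.
rewrite !partials_rcons.
rewrite -[X in partials l X]/(Re \o cderive i (FT s psi)) -[X in _ /\ differentiable (partials l X) _]/(Im \o cderive i (FT s psi)).
by rewrite FT_cderive_out//; apply: IH; apply/schwartzZ/schwartz_coord.
Qed.

Lemma integral_scale_point (c : R) (b : E) (u : E -> R) : 0 < c ->
  mu.-integrable setT (fun t => (u (pt t))%:E) ->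
  mu.-integrable setT (fun t => (u (c *: pt t + b))%:E) /\
  \int[mu]_t (u (c *: pt t + b)) = (c^-1 ^+ n) * \int[mu]_t (u (pt t)).
Proof.
move=> c0 iu.
have mu1 : measurable_fun setT (fun t => u (pt t)) by case/integrableP: iu => /measurable_EFinP.
pose p (x : E) : \bar R := maxe (u x)%:E 0%E.
pose m (x : E) : \bar R := (maxe (- (u x)%:E) 0)%E.
have pE c' (b' : E) : (fun t => (u (c' *: pt t + b'))%:E)^\+%E = fun t => p (c' *: pt t + b')%R.
  by apply/funext => t; rewrite funeposE.
have mE c' (b' : E) : (fun t => (u (c' *: pt t + b'))%:E)^\-%E = fun t => m (c' *: pt t + b')%R.
  by apply/funext => t; rewrite funenegE.
have pE1 : (fun t => (u (pt t))%:E)^\+%E = fun t => p (pt t) by apply/funext => t; rewrite funeposE.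
have mE1 : (fun t => (u (pt t))%:E)^\-%E = fun t => m (pt t) by apply/funext => t; rewrite funenegE.
have mp : measurable_fun setT (p \o pt).
  by apply: measurable_maxe => //; exact/measurable_EFinP.
have mm : measurable_fun setT (m \o pt).
  by apply: measurable_maxe => //; apply: measurableT_comp => //; exact/measurable_EFinP.
have p0 x : (0 <= p x)%E by rewrite /p le_max lexx orbT.
have m0 x : (0 <= m x)%E by rewrite /m le_max lexx orbT.
have Ep := ge0_integral_scale_point b c0 mp p0.
have Em := ge0_integral_scale_point b c0 mm m0.
have c1 : (0 <= c^-1 ^+ n) by rewrite exprn_ge0// invr_ge0 ltW.
have ipf : (\int[mu]_t p (pt t) < +oo)%E .
  by have := @integral_funepos_lt_pinfty _ _ _ mu setT measurableT _ iu; rewrite pE1.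
have imf : (\int[mu]_t m (pt t) < +oo)%E .
  by have := @integral_funeneg_lt_pinfty _ _ _ mu setT measurableT _ iu; rewrite mE1.
have mu2 : measurable_fun setT (fun t => (u (c *: pt t + b))%:E).
  by apply/measurable_EFinP; exact: (@measurable_scale_point _ _ c b _ _ u mu1).
split.
  apply/integrableP; split=> //.
  pose au (x : E) : \bar R := `|u x|%:E.
  rewrite (_ : (fun x => _) = fun t => au (c *: pt t + b)%R)//.
  rewrite (ge0_integral_scale_point b c0 (f := au)) => [||x]; last by rewrite lee_fin.
    by rewrite lte_mul_pinfty// ?lee_fin//; case/integrableP: iu.
  by apply/measurable_EFinP; exact: measurableT_comp mu1.
rewrite /Rintegral integralE [in RHS]integralE.
rewrite pE mE pE1 mE1.
change (fine (\int[mu]_t p (c *: pt t + b)%R - \int[mu]_t m (c *: pt t + b)%R)%E =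
  c^-1 ^+ n * fine (\int[mu]_t p (pt t) - \int[mu]_t m (pt t))%E).
rewrite Ep Em.
have ip0 : (0 <= \int[mu]_t p (pt t))%E by exact: integral_ge0.
have im0 : (0 <= \int[mu]_t m (pt t))%E by exact: integral_ge0.
move: ip0 im0 ipf imf; case: (integral _ _ _) => [x| |]//; case: (integral _ _ _) => [y| |]// *.
by rewrite -!EFinM -!EFinB /= mulrBr.
Qed.

Lemma cintegral_scale_point (c : R) (b : E) g : 0 < c -> cintegrable g ->
  cintegrable (fun x => g (c *: x + b)) /\
  cintegral (fun x => g (c *: x + b)) = ((c^-1 ^+ n)%:C)%C * cintegral g.
Proof.
move=> c0 [iR iI].
have [jR ER] := @integral_scale_point c b (Re \o g) c0 iR.
have [jI EI] := @integral_scale_point c b (Im \o g) c0 iI.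
split; first by split.
by apply: eqReIm; rewrite ?ReE ?ImE /cintegral/= ?ER ?EI mul0r ?subr0 ?addr0.
Qed.

End fourier_schwartz.

Lemma eq_cvgn (T : topologicalType) (u v : nat -> T) (l : T) :
  u =1 v -> u @ \oo --> l -> v @ \oo --> l.
Proof. by move=> /funext ->. Qed.

(** * The transform of a derivative *)

Section fourier_bounds.
Context (R : realType) (n : nat).
Local Notation E := 'rV[R]_n.
Local Notation C := R[i].
Local Notation e_ i := (delta_mx ord0 i : E).
Local Notation mu := (lebesgue_tuple R n).
Local Notation pt := (@Defs.point R n).
Local Notation Re := (@complex.Re R).
Local Notation Im := (@complex.Im R).
Local Notation sb := (@schwartz_bound R n).
Implicit Types (g h psi : E -> C) (s : R).

Lemma mvt_line (u : E -> R) (x : E) i (h M : R) : 0 < h ->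
  (forall y, differentiable u y) ->
  (forall t, 0 <= t <= h -> `|'D_(e_ i) u (x + t *: e_ i)| <= M) ->
  `|u (x + h *: e_ i) - u x| <= M * h.
Proof.
move=> h0 du bM.
pose g (t : R) := u (x + t *: e_ i).
have dg (t : R) : is_derive t 1 g ('D_(e_ i) u (x + t *: e_ i)).
  have E0 : (fun k : R => k^-1 *: ((g \o shift t) (k *: 1) - g t)) =
      (fun k : R => k^-1 *: ((u \o shift (x + t *: e_ i)) (k *: e_ i) - u (x + t *: e_ i))).
    apply/funext => k; congr (_ *: (_ - _)); rewrite /= /g; congr u.
    by rewrite scaler1 scalerDl addrCA.
  apply: DeriveDef; last by rewrite /derive E0.
  by rewrite /derivable E0; exact: diff_derivable.
have cg : {within `[0, h], continuous g}.
  apply: derivable_within_continuous => t _; exact: (@ex_derive _ _ _ _ _ _ _ (dg t)).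
have [c] := @MVT_segment R g (fun t => 'D_(e_ i) u (x + t *: e_ i)) 0 h (ltW h0) (fun t _ => dg t) cg.
rewrite in_itv/= => ct; rewrite /g scale0r addr0 subr0 => ->.
by rewrite normrM (gtr0_norm h0) ler_wpM2r ?(ltW h0)// bM.
Qed.

Lemma cvg_cabs0 (z_ : nat -> C) z : Re (z_ k) @[k --> \oo] --> Re z ->
  Im (z_ k) @[k --> \oo] --> Im z -> cabs (z_ k - z) @[k --> \oo] --> 0.
Proof.
move=> cR cI; apply/cvgr0Pnorm_le => e e0.
have e2 : 0 < e / 2 by rewrite divr_gt0.
have /cvgrPdistC_le/(_ _ e2) hR := cR; have /cvgrPdistC_le/(_ _ e2) hI := cI.
apply: filterS2 hR hI => k hR hI; rewrite ger0_norm ?cabs_ge0//.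
by apply: le_trans (cabs_le_ReIm _) _; rewrite ReD ImD ReN ImN; lra.
Qed.

Lemma ccvg_unique (z_ : nat -> C) (z w : C) : cabs (z_ k - z) @[k --> \oo] --> 0 ->
  cabs (z_ k - w) @[k --> \oo] --> 0 -> z = w.
Proof.
move=> cz cw; apply/eqP; rewrite -subr_eq0; apply/eqP/cabs0_eq0/eqP.
rewrite eq_le cabs_ge0 andbT; apply/ler_addgt0Pr => e e0; rewrite add0r.
have e2 : 0 < e / 2 by rewrite divr_gt0.
have /cvgr0Pnorm_le/(_ _ e2) hz := cz; have /cvgr0Pnorm_le/(_ _ e2) hw := cw.
have [k _ /(_ k (leqnn k))] := filterI hz hw; rewrite /= !ger0_norm ?cabs_ge0// => -[h1 h2].
have -> : z - w = (z_ k - w) - (z_ k - z) by ring.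
by apply: le_trans (ler_cabsD _ _) _; rewrite cabsN; lra.
Qed.

Lemma enorm_delta i : enorm (e_ i) = 1.
Proof.
rewrite /enorm (bigD1 i)//= big1 ?addr0; last first.
  by move=> j /negbTE ji; rewrite mxE eqxx ji expr0n.
by rewrite mxE !eqxx expr1n sqrtr1.
Qed.

Lemma FT_translate s g (b xi : E) : cintegrable g ->
  FT s (fun x => g (x + b)) xi = cis (- (s * dotp b xi)) * FT s g xi.
Proof.
move=> ig.
have [_] := cintegral_scale_point b ltr01 (cintegrable_cis s xi ig).
rewrite invr1 expr1n mul1r => E0; rewrite {2}/FT -E0 -cintegralZ.
  apply: eq_cintegral => x; rewrite scale1r mulrA; congr (_ * _).
  by rewrite -cisD dotpDl; congr cis; ring.
by have [] := cintegral_scale_point b ltr01 (cintegrable_cis s xi ig).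
Qed.

(** Integration by parts is replaced by difference quotients of step 1/(k+1). Translation multiplies
    the transform by a phase, whose quotient has the limit -i s xi_i; on the other side dominated
    convergence produces the derivative. *)
Lemma FT_cderive_in s psi i : schwartz psi ->
  FT s (cderive i psi) = fun xi => (0 +i* (- (s * xi ord0 i)))%C * FT s psi xi.
Proof.
move=> sp; have [sm bp] := sp; apply/funext => xi.
have ip := schwartz_cintegrable sp.
pose t (k : nat) : R := k.+1%:R^-1.
have t0 k : 0 < t k by rewrite invr_gt0.
have t1 k : t k <= 1 by rewrite invf_le1// ler1n.
pose D k (x : E) : C := ((t k)^-1)%:C%C * (psi (x + t k *: e_ i) - psi x).
have ipt k : cintegrable (fun x => psi (x + t k *: e_ i)).
  have [+ _] := cintegral_scale_point (t k *: e_ i) ltr01 ip.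
  by apply: eq_cintegrable => x; rewrite scale1r.
have iD0 k : cintegrable (fun x => psi (x + t k *: e_ i) - psi x).
  apply: eq_cintegrable (cintegrableD (ipt k) (cintegrableZ (-1) ip)) => x.
  by rewrite mulN1r.
have iD k : cintegrable (D k) by exact: cintegrableZ.
have [M0 bM] := bp n.+2.
have bM1 := schwartz_bound_cderive i bM.
have M00 := schwartz_bound_ge0 bM.
(* The factor 2^(n+1) comes from 1 + |x| <= 2 (1 + |x + r e_i|) for 0 <= r <= 1, and the outer 2
   from adding real and imaginary parts. *)
pose M := 2 * (M0 * 2 ^+ n.+1).
have Db k x : cabs (D k x) <= M * (1 + enorm x) ^- n.+1.
  have near_bd r : 0 <= r <= t k -> cabs (cderive i psi (x + r *: e_ i)) <= M0 * 2 ^+ n.+1 * (1 + enorm x) ^- n.+1.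
    move=> /andP[r0 rt].
    have := schwartz_boundP (x + r *: e_ i) bM1 (isT : (size [::] <= n.+1)%N).
    rewrite cpartials_nil => /le_trans; apply.
    rewrite -mulrA ler_wpM2l// ler_pdivlMr ?jap_pow_gt0// ler_pdivrMl ?jap_pow_gt0//.
    rewrite mulrC -exprMn lerXn2r ?nnegrE ?mulr_ge0 ?(ltW (jap_gt0 _))//.
    have : enorm x <= enorm (x + r *: e_ i) + 1.
      rewrite -{1}(addrK (r *: e_ i) x); apply: le_trans (ler_enormD _ _) _.
      by rewrite enormN enormZ enorm_delta mulr1 ger0_norm// lerD2l (le_trans rt).
    by have := enorm_ge0 (x + r *: e_ i); lra.
  rewrite /D cabsM cabs_real gtr0_norm ?invr_gt0// ler_pdivrMl//.
  apply: le_trans (cabs_le_ReIm _) _; rewrite ReD ImD ReN ImN.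
  have h1 := @mvt_line (Re \o psi) x i (t k) _ (t0 k) (fun y => (smooth_diff y sm).1)
     (fun r hr => le_trans (normr_Re_le (cderive i psi (x + r *: e_ i))) (near_bd r hr)).
  have h2 := @mvt_line (Im \o psi) x i (t k) _ (t0 k) (fun y => (smooth_diff y sm).2)
     (fun r hr => le_trans (normr_Im_le (cderive i psi (x + r *: e_ i))) (near_bd r hr)).
  apply: le_trans (lerD h1 h2) _; rewrite /M le_eqVlt; apply/orP; left; apply/eqP; ring.
have tcvg : t k @[k --> \oo] --> (0 : R) by exact: cvg_harmonic.
have Dcvg x : cabs (D k x - cderive i psi x) @[k --> \oo] --> 0.
  have cv (u : E -> R) : differentiable u x ->
      (t k)^-1 * (u (x + t k *: e_ i) - u x) @[k --> \oo] --> 'D_(e_ i) u x.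
    move=> du; have d := @diff_derivable _ _ _ _ _ (e_ i) du.
    have H : h^-1 *: ((u \o shift x) (h *: e_ i) - u x) @[h --> 0^'] --> 'D_(e_ i) u x by exact: d.
    have /cvg_at_rightP/(_ t) := cvg_dnbhs_at_right H.
    move=> /(_ (conj (fun k => t0 k) tcvg)).
    move=> cc; suff -> : (fun k => (t k)^-1 * (u (x + t k *: e_ i) - u x)) =
      (fun k => (t k)^-1 *: ((u \o shift x) (t k *: e_ i) - u x)) by exact: cc.
    by apply/funext => k /=; rewrite [x + _]addrC.
  have [dR dI] := smooth_diff x sm.
  apply: cvg_cabs0; rewrite /D.
    under eq_fun do rewrite ReE /= mul0r subr0 ReD ReN.
    exact: (cv _ dR).
  under eq_fun do rewrite ImE /= mul0r addr0 ImD ImN.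
  exact: (cv _ dI).
have mj : measurable_fun setT (fun tt => M * (1 + enorm (pt tt)) ^- n.+1).
  apply: measurable_funM => //.
  rewrite (_ : (fun _ => _) = fun tt => ((1 + enorm (pt tt))^-1) ^+ n.+1); last first.
    by apply/funext => tt; rewrite exprVn.
  apply: measurable_funX; apply: (measurable_continuous_point (u := fun x => (1 + enorm x)^-1)).
  move=> x; apply: cvgV; first by rewrite gt_eqF// jap_gt0.
  by apply: cvgD; [exact: cvg_cst|exact: continuous_enorm].
have M0' : 0 <= M by rewrite /M !mulr_ge0// exprn_ge0.
have ij : (\int[mu]_tt (M * (1 + enorm (pt tt)) ^- n.+1)%:E < +oo)%E.
  have [K [K0 hK]] := @integral_jap R n.
  apply: (@le_lt_trans _ _ (M%:E * K%:E)%E); last by rewrite -EFinM ltry.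
  under eq_integral do rewrite EFinM.
  have mj1 : measurable_fun setT (fun tt => (1 + enorm (pt tt)) ^- n.+1).
    rewrite (_ : (fun _ => _) = fun tt => ((1 + enorm (pt tt))^-1) ^+ n.+1); last first.
      by apply/funext => tt; rewrite exprVn.
    apply: measurable_funX; apply: (measurable_continuous_point (u := fun x => (1 + enorm x)^-1)).
    move=> x; apply: cvgV; first by rewrite gt_eqF// jap_gt0.
    by apply: cvgD; [exact: cvg_cst|exact: continuous_enorm].
  rewrite ge0_integralZl_EFin//; last 2 first.
  - by move=> tt _; rewrite lee_fin invr_ge0 ltW ?jap_pow_gt0.
  - exact/measurable_EFinP.
  by apply: lee_wpmul2l.
have [_ _ lim1] : [/\ forall k, cintegrable (fun x => cis (s * dotp x xi) * D k x),
    cintegrable (fun x => cis (s * dotp x xi) * cderive i psi x) &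
    cabs (cintegral (fun x => cis (s * dotp x xi) * D k x) - FT s (cderive i psi) xi) @[k --> \oo] --> 0].
  apply: (@dominated_cintegral _ _ _ _ (fun x => M * (1 + enorm x) ^- n.+1)) => //.
  - by move=> k; have /cintegrableP[] := cintegrable_cis s xi (iD k).
  - by move=> k x; rewrite cabsM cabs_cis mul1r.
  move=> x; apply: eq_cvgn (Dcvg x) => k.
  by rewrite -mulrBr cabsM cabs_cis mul1r.
apply: (ccvg_unique lim1).
have E1 k : cintegral (fun x => cis (s * dotp x xi) * D k x) =
    ((t k)^-1)%:C%C * (cis (- (s * (t k * xi ord0 i))) - 1) * FT s psi xi.
  transitivity (((t k)^-1)%:C%C * (FT s (fun x => psi (x + t k *: e_ i)) xi - FT s psi xi)).
    rewrite -mulN1r -cintegralZ; last exact: cintegrable_cis.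
    rewrite -cintegralD; [|exact: cintegrable_cis|apply: cintegrableZ; exact: cintegrable_cis].
    rewrite -cintegralZ.
      by apply: eq_cintegral => x; rewrite /D; ring.
    by apply: cintegrableD; [exact: cintegrable_cis|apply: cintegrableZ; exact: cintegrable_cis].
  by rewrite FT_translate// dotpZl dotpC dotp_delta; ring.
apply/cvgr0Pnorm_le => e e0.
pose B := 4 * (s * xi ord0 i) ^+ 2 * cabs (FT s psi xi) + 1.
have B0 : 0 < B by apply: ltr_wpDl => //; do ![apply: sqr_ge0|apply: cabs_ge0|apply: mulr_ge0|by []].
have eB : 0 < e / B by rewrite divr_gt0.
have /cvgr0Pnorm_le/(_ _ eB) := tcvg; apply: filterS => k.
rewrite (gtr0_norm (t0 k)) => te; rewrite ger0_norm ?cabs_ge0// E1.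
set tau := - (s * (t k * xi ord0 i)).
have -> : ((t k)^-1)%:C%C * (cis tau - 1) * FT s psi xi - (0 +i* - (s * xi ord0 i))%C * FT s psi xi =
   ((t k)^-1)%:C%C * (cis tau - 1 - (0 +i* tau)%C) * FT s psi xi.
  have -> : (0 +i* - (s * xi ord0 i))%C = ((t k)^-1)%:C%C * (0 +i* tau)%C.
    apply: eqReIm; rewrite ?ReE ?ImE /=; first by ring.
    by rewrite /tau; field; rewrite gt_eqF.
  by ring.
rewrite !cabsM cabs_real gtr0_norm ?invr_gt0//.
apply: (@le_trans _ _ ((t k)^-1 * (4 * tau ^+ 2) * cabs (FT s psi xi))).
  by rewrite ler_wpM2r ?cabs_ge0// ler_wpM2l ?invr_ge0 ?(ltW (t0 k))// cis_taylor.
have -> : (t k)^-1 * (4 * tau ^+ 2) * cabs (FT s psi xi) = t k * (B - 1).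
  by rewrite /tau /B; field; rewrite gt_eqF.
apply: (@le_trans _ _ (t k * B)); first by rewrite ler_wpM2l ?(ltW (t0 k))//; lra.
by rewrite -ler_pdivlMr.
Qed.

End fourier_bounds.

(** * Continuity on Schwartz functions and Fourier inversion *)

Section fourier_inversion.
Context (R : realType) (n : nat).
Local Notation E := 'rV[R]_n.
Local Notation C := R[i].
Local Notation e_ i := (delta_mx ord0 i : E).
Local Notation mu := (lebesgue_tuple R n).
Local Notation pt := (@Defs.point R n).
Local Notation Re := (@complex.Re R).
Local Notation Im := (@complex.Im R).
Local Notation sb := (@schwartz_bound R n).
Implicit Types (g h psi : E -> C) (s : R).

(** Each additional power of |xi| is bounded by the sum of the |xi_i|, and each xi_i is traded for a
    derivative of psi at the price of 1/|s| and one more order N'. *)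
Lemma FT_decay s N : s != 0 -> exists N' K, 0 <= K /\ forall psi M, schwartz psi ->
  sb N' M psi -> forall xi, (1 + enorm xi) ^+ N * cabs (FT s psi xi) <= K * M.
Proof.
move=> s0; elim: N => [|N [N' [K [K0 IH]]]].
  have [K [K0 hK]] := schwartz_integrable_bound R n.
  exists n.+1, K; split=> // psi M [sp _] bp xi; rewrite expr0 mul1r.
  have [ip le] := hK _ _ sp bp.
  by have := le_trans (cabs_FT_le s xi ip) le; rewrite lee_fin.
exists N'.+1, (K * (1 + n%:R / `|s|)); split.
  by rewrite mulr_ge0// addr_ge0// divr_ge0.
move=> psi M sp bp xi.
have h0 := IH _ _ sp (schwartz_boundW (leqnSn _) (lexx _) bp) xi.
have hi i := IH _ _ (schwartz_cderive i sp) (schwartz_bound_cderive i bp) xi.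
have s1 : 0 < `|s| by rewrite normr_gt0.
set A := (1 + enorm xi) ^+ N in h0 *.
have A0 : 0 <= A by rewrite ltW ?jap_pow_gt0.
have hi' i : A * (`|xi ord0 i| * cabs (FT s psi xi)) <= K * M / `|s|.
  rewrite ler_pdivlMr//; have := hi i; rewrite FT_cderive_in// cabsM.
  rewrite (_ : cabs (0 +i* - (s * xi ord0 i))%C = `|s| * `|xi ord0 i|); last first.
    by rewrite cabsE /= expr0n add0r sqrtr_sqr normrN normrM.
  by apply: le_trans; rewrite -/A le_eqVlt; apply/orP; left; apply/eqP; ring.
rewrite exprSr -/A -mulrA mulrDl mul1r mulrDr.
apply: (@le_trans _ _ (K * M + \sum_(i < n) (K * M / `|s|))).
  apply: lerD => //.
  apply: (@le_trans _ _ (A * ((\sum_i `|xi ord0 i|) * cabs (FT s psi xi)))).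
    by rewrite ler_wpM2l// ler_wpM2r ?cabs_ge0// enorm_le_sum.
  by rewrite mulr_suml mulr_sumr; apply: ler_sum => i _; exact: hi'.
rewrite sumr_const card_ord -mulr_natl le_eqVlt; apply/orP; left; apply/eqP; ring.
Qed.

(** The number L of derivatives runs through an induction of its own, with the weight N fixed: a
    derivative of the transform is the transform of a coordinate times psi. *)
Lemma FT_bound s N : s != 0 -> exists N' K, 0 <= K /\ forall psi M, schwartz psi ->
  sb N' M psi -> sb N (K * M) (FT s psi).
Proof.
move=> s0; suff H : forall L, exists N' K, 0 <= K /\ forall psi M, schwartz psi ->
    sb N' M psi -> forall l xi, (size l <= L)%N ->
    (1 + enorm xi) ^+ N * cabs (cpartials l (FT s psi) xi) <= K * M.
  by have [N' [K [K0 h]]] := H N; exists N', K; split=> // psi M sp bp l xi lN; exact: (h _ _ sp bp).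
elim=> [|L [N' [K [K0 IH]]]].
  have [N' [K [K0 h]]] := FT_decay N s0; exists N', K; split=> // psi M sp bp [] // xi _.
  by rewrite cpartials_nil; exact: h.
pose c := `|s| * 2 ^+ N'.
have c0 : 0 <= c by rewrite mulr_ge0// exprn_ge0.
exists N'.+1, (K * (1 + c)); split; first by rewrite mulr_ge0// addr_ge0.
move=> psi M sp bp l xi; have M0 := schwartz_bound_ge0 bp.
case/lastP: l => [_|l i].
  apply: le_trans (IH _ M sp (schwartz_boundW (leqnSn _) (lexx _) bp) [::] xi isT) _.
  by rewrite -mulrA ler_wpM2l// mulrDl mul1r lerDl mulr_ge0.
rewrite size_rcons ltnS cpartials_rcons FT_cderive_out// => lL.
have [sm _] := sp.
have sm2 : smooth (fun x => (x ord0 i)%:C%C * psi x) by apply: smoothM => //; exact: smooth_coord.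
have := IH _ _ (schwartzZ (0 +i* s)%C (schwartz_coord i sp))
  (schwartz_boundZ (0 +i* s)%C sm2 (schwartz_bound_coord i sm bp)) l xi lL.
move=> /le_trans; apply; rewrite -mulrA ler_wpM2l//.
rewrite (_ : cabs (0 +i* s)%C = `|s|); last by rewrite cabsE /= expr0n add0r sqrtr_sqr.
by rewrite mulrA -/c mulrDl mul1r lerDr.
Qed.

Lemma schwartz_FT s psi : s != 0 -> schwartz psi -> schwartz (FT s psi).
Proof.
move=> s0 sp; split; first exact: smooth_FT.
move=> N; have [N' [K [K0 h]]] := FT_bound N s0.
by have [_ /(_ N')[M bM]] := sp; exists (K * M); exact: h.
Qed.

Lemma conj_cintegral g : cintegrable g -> (cintegral g)^*%C = cintegral (fun x => (g x)^*%C).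
Proof.
move=> [iR iI]; apply: eqReIm; rewrite /cintegral/=.
  by apply: eq_Rintegral => t _; case: (g _).
rewrite -mulN1r -RintegralZl//; apply: eq_Rintegral => t _.
by rewrite mulN1r; case: (g _).
Qed.

Lemma conj_FT s g : cintegrable g -> (fun xi => (FT s g xi)^*%C) = FT (- s) (fun x => (g x)^*%C).
Proof.
move=> ig; apply/funext => xi; rewrite /FT conj_cintegral; last exact: cintegrable_cis.
apply: eq_cintegral => x; rewrite mulNr -conj_cis.
by case: (cis _) => a b; case: (g x) => c d; apply: eqReIm => /=; ring.
Qed.

Lemma integral_gt0_continuous (u : E -> R) : continuous u -> (forall x, 0 <= u x) -> 0 < u 0 ->
  (0 < \int[mu]_t (u (pt t))%:E)%E.
Proof.
move=> cu u0 u00.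
have a0 : 0 < u 0 / 2 by rewrite divr_gt0.
have [d d0 hd] : exists2 d : R, 0 < d & forall x, `|x| <= d -> u 0 / 2 <= u x.
  have /cvgrPdist_le/(_ _ a0) := cu 0; rewrite near_simpl => /nbhs_normP[d /= d0 hd].
  exists (d / 2) => [|x xd]; first by rewrite divr_gt0.
  have : `|u 0 - u x| <= u 0 / 2.
    by apply: hd; rewrite /= sub0r normrN; apply: le_lt_trans xd _; rewrite ltr_pdivrMr// mulr_natr mulr2n ltrDl.
  by rewrite ler_norml => /andP[_]; lra.
pose cube : set (n.-tuple (measurableTypeR R)) := [set t | forall i, tnth t i \in `[- d, d]%R].
have mc : measurable cube.
  rewrite (_ : cube = \big[setI/setT]_(i < n) ((fun t : n.-tuple (measurableTypeR R) => tnth t i) @^-1` `[- d, d]%classic)).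
    apply: bigsetI_measurable => i _; rewrite -[X in measurable X]setTI.
    by apply: measurable_tnth => //; exact: measurable_itv.
  rewrite -bigcap_seq; apply/seteqP; split=> t /= h i; first by move=> _; exact: h.
  by apply: h; rewrite /= mem_index_enum.
have mcube : mu cube = ((2 * d) ^+ n)%:E by apply: lebesgue_tuple_cube; exact: ltW.
apply: (@lt_le_trans _ _ (\int[mu]_t ((u 0 / 2)%:E * (\1_cube t)%:E))%E).
  rewrite ge0_integralZl_EFin ?(ltW a0)//; last first.
    by apply/measurable_EFinP; exact: measurable_indic.
  rewrite integral_indic//= setIT [lebesgue_tuple R n cube]mcube -EFinM lte_fin mulr_gt0//.
  by rewrite exprn_gt0// mulr_gt0.
apply: ge0_le_integral => //.
- by move=> t _; rewrite -EFinM lee_fin mulr_ge0 ?(ltW a0)// indicE; case: (_ \in _).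
- by apply: measurable_funeM; apply/measurable_EFinP; exact: measurable_indic.
- by apply/measurable_EFinP; exact: measurable_continuous_point.
move=> t _; rewrite -EFinM lee_fin indicE; case: (boolP (t \in cube)) => [|_]; last by rewrite mulr0.
rewrite inE => ct; rewrite mulr1 hd//; apply: mx_norm_le => [|i]; first exact: ltW.
by rewrite mxE ler_norml; have := ct i; rewrite in_itv.
Qed.

Lemma continuous_schwartz_seq g (x z : E) : smooth g ->
  cabs (g (x + k.+1%:R^-1 *: z) - g x) @[k --> \oo] --> 0.
Proof.
move=> sg; have xz : x + k.+1%:R^-1 *: z @[k --> \oo] --> x.
  rewrite -[X in _ --> X]addr0; apply: cvgD; first exact: cvg_cst.
  rewrite -[X in _ --> X](scale0r z); apply: cvgZr_tmp; exact: cvg_harmonic.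
have [dR dI] := smooth_diff x sg.
apply: cvg_cabs0.
  exact: (@cvg_comp _ _ _ (fun k : nat => x + k.+1%:R^-1 *: z) (Re \o g) _ _ _ xz (differentiable_continuous dR)).
exact: (@cvg_comp _ _ _ (fun k : nat => x + k.+1%:R^-1 *: z) (Im \o g) _ _ _ xz (differentiable_continuous dI)).
Qed.

(** Any Schwartz [gam] with value 1 at 0 can regularise. With gam(t xi) inserted, the double
    transform at x becomes the average of psi(x + t z) against the transform of [gam]; letting t
    tend to 0 on both sides gives the identity. *)
Lemma FT_inversion s (gam : E -> C) : s != 0 -> schwartz gam -> gam 0 = 1 ->
  forall psi x, schwartz psi ->
  FT (- s) (FT s psi) x = cintegral (FT s gam) * psi x.
Proof.
move=> s0 sg g0 psi x sp.
have [ip ig] := (schwartz_cintegrable sp, schwartz_cintegrable sg).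
have sF := schwartz_FT s0 sp; have iF := schwartz_cintegrable sF.
have sG := schwartz_FT s0 sg; have iG := schwartz_cintegrable sG.
pose t (k : nat) : R := k.+1%:R^-1.
have t0 k : 0 < t k by rewrite invr_gt0.
have scal k : cintegrable (fun xi => gam (t k *: xi)).
  have [+ _] := cintegral_scale_point 0 (t0 k) ig.
  by apply: eq_cintegrable => y; rewrite addr0.
pose H k (xi : E) := cis (- s * dotp xi x) * gam (t k *: xi).
have iH k : cintegrable (H k) by exact: cintegrable_cis.
have FH k y : FT s (H k) y = ((t k)^-1 ^+ n)%:C%C * FT s gam ((t k)^-1 *: (y - x)).
  have [_ /esym E0] := cintegral_scale_point 0 (t0 k) (cintegrable_cis s ((t k)^-1 *: (y - x)) ig).
  rewrite [RHS]E0; apply: eq_cintegral => xi.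
  rewrite addr0 dotpZl dotpZr mulVKf ?gt_eqF// /H mulrA; congr (_ * _).
  by rewrite -cisD; congr cis; rewrite dotpDr -(scaleN1r x) dotpZr; ring.
(* Transposition, followed by the substitution y = x + t z; the Jacobian t^n cancels the dilation
   factor of the transform. *)
have L1 k : cintegral (fun xi => FT s psi xi * H k xi) =
    cintegral (fun z => psi (x + t k *: z) * FT s gam z).
  have [_ <-] := parseval s ip (iH k).
  have i1 : cintegrable (fun z => psi (x + t k *: z) * FT s gam z).
    have [M hM] := schwartz_bounded sp.
    apply: (cintegrable_bounded (M := M)) => //.
    have [m1 m2] : cmeasurable psi by apply: smooth_cmeasurable; case: sp.
    by split; under eq_fun do rewrite addrC; [exact: (@measurable_scale_point _ _ _ _ _ _ (Re \o psi))|exact: (@measurable_scale_point _ _ _ _ _ _ (Im \o psi))].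
  have ti : 0 < (t k)^-1 by rewrite invr_gt0.
  have [_] := cintegral_scale_point (- ((t k)^-1 *: x)) ti i1.
  rewrite invrK => E0.
  transitivity (((t k)^-1 ^+ n)%:C%C * (((t k) ^+ n)%:C%C * cintegral (fun z => psi (x + t k *: z) * FT s gam z))).
    rewrite -E0 -cintegralZ.
      apply: eq_cintegral => y; rewrite FH mulrCA; congr (_ * (_ * FT s gam _)); last by rewrite scalerBr.
      by congr psi; rewrite scalerDr scalerN !scalerA mulfV ?gt_eqF// !scale1r addrC subrK.
    by have [] := cintegral_scale_point (- ((t k)^-1 *: x)) ti i1.
  rewrite mulrA -rmorphM/= -exprMn mulVf ?gt_eqF// expr1n mul1r//.
have [_ _ lim1] : [/\ forall k, cintegrable (fun xi => FT s psi xi * H k xi),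
   cintegrable (fun xi => FT s psi xi * cis (- s * dotp xi x)) &
   cabs (cintegral (fun xi => FT s psi xi * H k xi) - cintegral (fun xi => FT s psi xi * cis (- s * dotp xi x))) @[k --> \oo] --> 0].
  have [M hM] := schwartz_bounded sg.
  have [mF fF] := (cintegrableP _).1 iF.
  apply: (@dominated_cintegral _ _ _ _ (fun xi => M * cabs (FT s psi xi))).
  - by move=> k; apply: cmeasurableM => //; have /cintegrableP[] := iH k.
  - by apply: measurable_funM => //; exact: measurable_cabs.
  - by move=> k xi; rewrite !cabsM cabs_cis mul1r mulrC ler_wpM2r ?cabs_ge0.
  - under eq_integral do rewrite EFinM.
    have M0 : 0 <= M by apply: le_trans (hM 0); exact: cabs_ge0.
    rewrite ge0_integralZl_EFin ?lte_mul_pinfty//.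
    + by move=> tt _; rewrite lee_fin cabs_ge0.
    + by apply/measurable_EFinP; exact: measurable_cabs.
  move=> xi.
  have : cabs (FT s psi xi) * cabs (gam (0 + t k *: xi) - gam 0) @[k --> \oo] --> 0.
    rewrite -[X in _ --> X](mulr0 (cabs (FT s psi xi))).
    by apply: cvgMr; apply: continuous_schwartz_seq; case: sg.
  apply: eq_cvgn => k.
  by rewrite -[in RHS](mulr1 (cis (- s * dotp xi x))) -g0 -mulrBr -mulrBr !cabsM cabs_cis mul1r add0r.
have [_ _ lim2] : [/\ forall k, cintegrable (fun z => psi (x + t k *: z) * FT s gam z),
   cintegrable (fun z => psi x * FT s gam z) &
   cabs (cintegral (fun z => psi (x + t k *: z) * FT s gam z) - cintegral (fun z => psi x * FT s gam z)) @[k --> \oo] --> 0].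
  have [M hM] := schwartz_bounded sp.
  have [mG fG] := (cintegrableP _).1 iG.
  apply: (@dominated_cintegral _ _ _ _ (fun xi => M * cabs (FT s gam xi))).
  - move=> k; apply: cmeasurableM => //.
    have [m1 m2] : cmeasurable psi by apply: smooth_cmeasurable; case: sp.
    by split; under eq_fun do rewrite addrC; [exact: (@measurable_scale_point _ _ _ _ _ _ (Re \o psi))|exact: (@measurable_scale_point _ _ _ _ _ _ (Im \o psi))].
  - by apply: measurable_funM => //; exact: measurable_cabs.
  - by move=> k xi; rewrite !cabsM ler_wpM2r ?cabs_ge0.
  - under eq_integral do rewrite EFinM.
    have M0 : 0 <= M by apply: le_trans (hM 0); exact: cabs_ge0.
    rewrite ge0_integralZl_EFin ?lte_mul_pinfty//.
    + by move=> tt _; rewrite lee_fin cabs_ge0.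
    + by apply/measurable_EFinP; exact: measurable_cabs.
  move=> z.
  have : cabs (FT s gam z) * cabs (psi (x + t k *: z) - psi x) @[k --> \oo] --> 0.
    rewrite -[X in _ --> X](mulr0 (cabs (FT s gam z))).
    by apply: cvgMr; apply: continuous_schwartz_seq; case: sp.
  apply: eq_cvgn => k.
  by rewrite -mulrBl cabsM mulrC.
have lim3 : cabs (cintegral (fun xi => FT s psi xi * H k xi) - psi x * cintegral (FT s gam)) @[k --> \oo] --> 0.
  by apply: eq_cvgn lim2 => k; rewrite L1 cintegralZ.
rewrite mulrC -(ccvg_unique lim1 lim3).
by apply: eq_cintegral => xi; rewrite mulrC.
Qed.

End fourier_inversion.

(** * The inversion constant, Plancherel and the convolution theorem *)

Section plancherel.
Context (R : realType) (n : nat).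
Local Notation E := 'rV[R]_n.
Local Notation C := R[i].
Local Notation mu := (lebesgue_tuple R n).
Local Notation pt := (@Defs.point R n).
Local Notation Re := (@complex.Re R).
Local Notation Im := (@complex.Im R).
Implicit Types (g h psi : E -> C) (s : R).

(* The value (2 pi)^n of the constant is never needed; its existence follows by testing
   with one bump function. *)
Definition inversion_constant (kap : R) := 0 < kap /\ forall psi, schwartz psi ->
  [/\ FT 1 (FT (-1) psi) = (fun x => kap%:C%C * psi x),
      FT (-1) (FT 1 psi) = (fun x => kap%:C%C * psi x),
      (\int[mu]_t (cabs (FT 1 psi (pt t)) ^+ 2)%:E =
        kap%:E * \int[mu]_t (cabs (psi (pt t)) ^+ 2)%:E)%E &
      (\int[mu]_t (cabs (FT (-1) psi (pt t)) ^+ 2)%:E =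
        kap%:E * \int[mu]_t (cabs (psi (pt t)) ^+ 2)%:E)%E].

Lemma mul_conj (z : C) : z * z^*%C = (cabs z ^+ 2)%:C%C.
Proof. by case: z => a b; rewrite sqr_cabs; apply: eqReIm => /=; ring. Qed.

Lemma schwartz_sqr_integrable psi : schwartz psi ->
  cintegrable (fun x => (cabs (psi x) ^+ 2)%:C%C).
Proof.
move=> sp; apply: eq_cintegrable (cintegrable_schwartzM sp (schwartz_cintegrable (schwartz_conj sp))) => x.
exact: mul_conj.
Qed.

Lemma integral_Re_cintegral (u : E -> R) : cintegrable (fun x => (u x)%:C%C) ->
  (\int[mu]_t (u (pt t))%:E = (Re (cintegral (fun x => (u x)%:C%C)))%:E)%E.
Proof.
move=> [iu _]; rewrite /cintegral/= /Rintegral fineK//.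
exact: integrable_fin_num.
Qed.

Lemma cintegral_real (u : E -> R) : cintegrable (fun x => (u x)%:C%C) ->
  cintegral (fun x => (u x)%:C%C) = (fine (\int[mu]_t (u (pt t))%:E))%:C%C.
Proof.
move=> iu; rewrite integral_Re_cintegral//=; apply: eqReIm => //.
by rewrite /cintegral/= /Rintegral; under eq_integral do rewrite /=; rewrite integral0.
Qed.

(** The conjugate of a transform is the opposite transform of the conjugate, so transposition and
    inversion give the identity. At this stage the constant is a complex number of unknown sign. *)
Lemma plancherel_pre s (gam : E -> C) : s != 0 -> schwartz gam -> gam 0 = 1 ->
  forall psi, schwartz psi ->
  cintegral (fun x => (cabs (FT s psi x) ^+ 2)%:C%C) =
  cintegral (FT s gam) * cintegral (fun x => (cabs (psi x) ^+ 2)%:C%C).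
Proof.
move=> s0 sg g0 psi sp; have sF := schwartz_FT s0 sp.
transitivity (cintegral (fun x => FT s psi x * FT (- s) (fun y => (psi y)^*%C) x)).
  apply: eq_cintegral => x; rewrite -mul_conj; congr (_ * _).
  by rewrite -(conj_FT s (schwartz_cintegrable sp)).
have [_ ->] := parseval (- s) (schwartz_cintegrable sF) (schwartz_cintegrable (schwartz_conj sp)).
rewrite -cintegralZ; last exact: schwartz_sqr_integrable.
apply: eq_cintegral => x; rewrite (FT_inversion s0 sg g0)// -mulrA; congr (_ * _).
exact: mul_conj.
Qed.

(** For either sign the constant is the quotient of two squared norms, hence real and positive once
    some function has both norms nonzero. The two signs are then shown to share the constant. *)
Lemma exists_inversion_constant (gam : E -> C) : bump gam -> gam 0 = 1 ->
  exists kap, inversion_constant kap.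
Proof.
move=> bg g0; have sg := bump_schwartz bg.
have sqr_gt0 (u : E -> C) : schwartz u -> u 0 != 0 ->
    0 < fine (\int[mu]_t (cabs (u (pt t)) ^+ 2)%:E)%E.
  move=> su u0; have iu := schwartz_sqr_integrable su.
  apply: fine_gt0; rewrite (@integral_gt0_continuous _ _ (fun x => cabs (u x) ^+ 2)) /=.
  - by rewrite (integral_Re_cintegral (u := fun x => cabs (u x) ^+ 2))// ltry.
  - have [sm _] := su; move=> x; under eq_fun do rewrite expr2.
    by apply: cvgM; have := @continuous_cpartials _ _ [::] u sm x; rewrite cpartials_nil.
  - by move=> x; rewrite sqr_ge0.
  by rewrite exprn_gt0// lt_neqAle cabs_ge0 eq_sym andbT; apply: contraNN u0 => /eqP/cabs0_eq0 ->.
have pos s : s != 0 -> exists2 k : R, 0 < k & cintegral (FT s gam) = k%:C%C.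
  move=> s0.
  have H (u : E -> C) : schwartz u -> u 0 != 0 -> cintegral (FT s gam) =
      (fine (\int[mu]_t (cabs (FT s u (pt t)) ^+ 2)%:E)%E / fine (\int[mu]_t (cabs (u (pt t)) ^+ 2)%:E)%E)%:C%C.
    move=> su u0; have := plancherel_pre s0 sg g0 su.
    rewrite !cintegral_real; try by apply: schwartz_sqr_integrable => //; exact: schwartz_FT.
    have := sqr_gt0 _ su u0; set a := fine _; set b := fine _ => a0 ab.
    rewrite rmorphM/= ab -mulrA -rmorphM/= mulfV ?gt_eqF// mulr1//.
  (* The transform of |gam|^2 at 0 is the integral of |gam|^2, which is positive; so both norms in
     the quotient are nonzero. *)
  pose u := fun x => gam x * (gam x)^*%C.
  have bu : bump u by apply: smooth_bumpM => //; apply: smooth_conj; case: bg.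
  have su := bump_schwartz bu.
  have u0 : u 0 != 0 by rewrite /u g0 mul1r conjc1 oner_neq0.
  have Fu0 : FT s u 0 != 0.
    have := sqr_gt0 _ sg; rewrite g0 oner_neq0 => /(_ isT) h.
    rewrite /FT (_ : (fun x => _) = fun x => (cabs (gam x) ^+ 2)%:C%C); last first.
      apply/funext => x; rewrite /u mul_conj (_ : dotp x 0 = 0) ?mulr0 ?cis0 ?mul1r//.
      by rewrite /dotp big1// => i _; rewrite mxE mulr0.
    rewrite cintegral_real; last exact: schwartz_sqr_integrable.
    by apply/negP => /eqP[] /eqP; rewrite gt_eqF.
  exists (fine (\int[mu]_t (cabs (FT s u (pt t)) ^+ 2)%:E)%E / fine (\int[mu]_t (cabs (u (pt t)) ^+ 2)%:E)%E); last exact: H.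
  by rewrite divr_gt0 ?sqr_gt0//; exact: schwartz_FT.
have one_neq0 : (1 : R) != 0 by exact: oner_neq0.
have neg1_neq0 : (-1 : R) != 0 by rewrite oppr_eq0.
have [k1 k10 E1] := pos _ one_neq0; have [k2 k20 E2] := pos _ neg1_neq0.
have I1 psi : schwartz psi -> FT (-1) (FT 1 psi) = fun x => k1%:C%C * psi x.
  by move=> sp; apply/funext => x; rewrite (FT_inversion one_neq0 sg g0)// E1.
have I2 psi : schwartz psi -> FT 1 (FT (-1) psi) = fun x => k2%:C%C * psi x.
  by move=> sp; apply/funext => x; rewrite -{1}(opprK 1) (FT_inversion neg1_neq0 sg g0)// E2.
(* Four alternating transforms of [gam] are evaluated at 0 by two groupings: the outer and inner
   pairs give k2 k2, the middle pair first gives k1 k2. *)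
have k12 : k1 = k2.
  have sm1 := schwartz_FT neg1_neq0 sg; have s1 := schwartz_FT one_neq0 sm1.
  have e1 : FT 1 (FT (-1) (FT 1 (FT (-1) gam))) 0 = k2%:C%C * k2%:C%C.
    by rewrite (I2 _ s1) (I2 _ sg) g0 mulr1.
  have e2 : FT 1 (FT (-1) (FT 1 (FT (-1) gam))) 0 = k1%:C%C * k2%:C%C.
    by rewrite (I1 _ sm1) (FT_Z _ _ (schwartz_cintegrable sm1)) (I2 _ sg) g0 mulr1.
  by move: e1; rewrite e2 -!rmorphM/= => -[] /(mulIf (lt0r_neq0 k20)).
have P s k psi : s != 0 -> cintegral (FT s gam) = k%:C%C -> schwartz psi ->
    (\int[mu]_t (cabs (FT s psi (pt t)) ^+ 2)%:E =
      k%:E * \int[mu]_t (cabs (psi (pt t)) ^+ 2)%:E)%E.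
  move=> s0 Ek sp; have sF := schwartz_FT s0 sp.
  have i1 := schwartz_sqr_integrable sF; have i2 := schwartz_sqr_integrable sp.
  rewrite (integral_Re_cintegral i1) (integral_Re_cintegral i2) (plancherel_pre s0 sg g0 sp) Ek.
  by rewrite ReE/= mul0r subr0 EFinM.
have E2' : cintegral (FT (-1) gam) = k1%:C%C by rewrite E2 k12.
exists k1; split; first exact: k10.
move=> psi sp; split; last exact: (P _ _ _ neg1_neq0 E2' sp).
- by rewrite (I2 _ sp) k12.
- exact: (I1 _ sp).
- exact: (P _ _ _ one_neq0 E1 sp).
Qed.

Lemma FT_scale s g (c : R) : 0 < c -> cintegrable g ->
  FT s (fun x => g (c *: x)) = fun xi => ((c^-1) ^+ n)%:C%C * FT s g (c^-1 *: xi).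
Proof.
move=> c0 ig; apply/funext => xi.
have [_ E0] := cintegral_scale_point 0 c0 (cintegrable_cis s (c^-1 *: xi) ig).
rewrite -[RHS]E0; apply: eq_cintegral => x.
by rewrite addr0 dotpZl dotpZr mulVKf ?gt_eqF.
Qed.

(** The convolution theorem: transposition applied to the modulated [p], whose opposite transform is
    a translated reflection of the transform of [p]. *)
Lemma FT_mul_FT s p h x : schwartz p -> schwartz h ->
  cintegrable (fun y => FT s p (x - y) * h y) /\
  FT s (fun xi => p xi * FT (- s) h xi) x = cintegral (fun y => FT s p (x - y) * h y).
Proof.
move=> sp sh.
have ie := cintegrable_cis s x (schwartz_cintegrable sp).
have ip : FT (- s) (fun xi => cis (s * dotp xi x) * p xi) = fun y => FT s p (x - y).
  apply/funext => y; apply: eq_cintegral => xi; rewrite mulrA -cisD; congr (cis _ * _).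
  by rewrite dotpDr -(scaleN1r y) dotpZr; ring.
have ih := schwartz_cintegrable sh.
have [_ E1] := parseval (- s) ie ih; have [i2 _] := parseval (- s) ih ie.
rewrite ip in i2, E1; split; first by apply: eq_cintegrable i2 => y; rewrite mulrC.
by rewrite -[RHS]E1; apply: eq_cintegral => xi; rewrite mulrA.
Qed.

End plancherel.

(** * Dyadic cutoffs *)

Section cutoffs.
Context (R : realType) (n : nat) (phi : R -> R) (hphi : dyadic_profile phi).
Local Notation E := 'rV[R]_n.
Local Notation C := R[i].
Local Notation e_ i := (delta_mx ord0 i : E).
Local Notation Re := (@complex.Re R).
Local Notation Im := (@complex.Im R).
Implicit Types (g h b : E -> C).

Lemma profile_ge0 r : 0 <= phi r. Proof. by case: hphi. Qed.

Lemma profile_small r : r <= 2^-1 -> phi r = 0.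
Proof.
move=> r2; have [_ [c [d [c2 _ h]]] _ _] := hphi; apply/eqP; apply: contraLR r2 => /h/andP[cr _].
by rewrite -ltNge (lt_le_trans c2).
Qed.

Lemma profile_large r : 2 <= r -> phi r = 0.
Proof.
move=> r2; have [_ [c [d [_ d2 h]]] _ _] := hphi; apply/eqP; apply: contraLR r2 => /h/andP[_ rd].
by rewrite -ltNge (le_lt_trans rd).
Qed.

(** On [1, 2) the support condition leaves only the terms k = 0 and k = 1 of the partition of
    unity. *)
Lemma profile_sum r : 1 <= r < 2 -> phi r + phi (r / 2) = 1.
Proof.
move=> /andP[r1 r2]; have r0 : 0 < r by lra.
have [_ _ _ /(_ r r0)] := hphi.
have f0 (A : set int) k : A k -> (0 <= (phi (r / 2 ^ k))%:E)%E by move=> _; rewrite lee_fin profile_ge0.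
rewrite (esumID [set (0 : int)])//; last by move=> k _; exact: (f0 setT).
rewrite setTI esum_set1; last exact: (f0 setT).
rewrite setTI (esumID [set (1 : int)]); last by move=> k hk; exact: (f0 _ _ hk).
rewrite (_ : _ `&` _ = [set (1 : int)]); last by apply/seteqP; split=> [k []|k ->].
rewrite esum_set1; last exact: (f0 setT).
rewrite esum1 ?adde0 -?EFinD => [[]|]; first by rewrite expr0z divr1 expr1z.
move=> k [/= k0 k1]; congr (_%:E); case: k k0 k1 => [[|[|k]]|k] // _ _.
  apply: profile_small; rewrite -exprnP ler_pdivrMr ?exprn_gt0//.
  rewrite exprS mulKf//.
  by apply: (le_trans (ltW r2)); rewrite exprS ler_peMr// exprn_ege1//; lra.
apply: profile_large; rewrite NegzE -exprnN invrK exprS.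
by rewrite mulrCA ler_peMr// mulr_ege1// exprn_ege1//; lra.
Qed.

Lemma profile_le1 r : phi r <= 1.
Proof.
have [r2|r2] := leP r (2^-1); first by rewrite profile_small.
have [r1|r1] := ltP r 1.
  have : 1 <= 2 * r < 2 by lra.
  move/profile_sum; rewrite mulrAC divff// mul1r => <-.
  by rewrite lerDr profile_ge0.
have [rr|rr] := leP 2 r; first by rewrite profile_large.
have : 1 <= r < 2 by rewrite r1 rr.
by move/profile_sum => <-; rewrite lerDl profile_ge0.
Qed.

(* The low-frequency sum of phi(r/2^j) over j <= 0, which equals phi on [1, 2]. *)
Definition Psi (r : R) : R := if r < 1 then 1 else phi r.

Lemma Psi_ge0 r : 0 <= Psi r.
Proof. by rewrite /Psi; case: ifP => // _; exact: profile_ge0. Qed.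

Lemma Psi_le1 r : Psi r <= 1.
Proof. by rewrite /Psi; case: ifP => // _; exact: profile_le1. Qed.

Lemma Psi1 r : r <= 1 -> Psi r = 1.
Proof.
rewrite le_eqVlt /Psi => /orP[/eqP ->|->]//; rewrite ltxx.
have := @profile_sum 1; rewrite [phi (1 / 2)]profile_small ?mul1r// addr0; apply.
by rewrite lexx/=; lra.
Qed.

Lemma Psi0 r : 2 <= r -> Psi r = 0.
Proof. by move=> r2; rewrite /Psi ltNge (_ : 1 <= r) ?profile_large//=; lra. Qed.

Lemma PsiB r : Psi r - Psi (2 * r) = phi r.
Proof.
have [r2|r2] := leP r (2^-1); first by rewrite !Psi1 ?profile_small ?subrr//; lra.
have [r1|r1] := ltP r 1.
  rewrite Psi1; last lra.
  have : 1 <= 2 * r < 2 by lra.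
  move/profile_sum; rewrite mulrAC divff// mul1r => h.
  rewrite /Psi ltNge (_ : 1 <= 2 * r) /=; last lra.
  by lra.
by rewrite [Psi (2 * r)]Psi0 ?subr0 /Psi ?ltNge ?r1//; lra.
Qed.

Lemma Psi_eqD r : 2^-1 < r -> Psi r = phi r + phi (2 * r).
Proof.
move=> r2; have [r1|r1] := ltP r 1.
  rewrite Psi1; last lra.
  have : 1 <= 2 * r < 2 by lra.
  by move/profile_sum; rewrite mulrAC divff// mul1r addrC.
by rewrite [phi (2 * r)]profile_large ?addr0 /Psi ?ltNge ?r1//; lra.
Qed.

Definition cutoff (t : R) : E -> C := fun x => (Psi (enorm x / t))%:C%C.

Lemma cutE k x : dyadic_cutoff phi k x = cutoff (2 ^ k) x - cutoff (2 ^ (k - 1)) x.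
Proof.
rewrite /dyadic_cutoff /cutoff -PsiB rmorphB/=; congr (_ - (Psi _)%:C%C).
by rewrite expfzDr// invfM exprN1 invrK; ring.
Qed.

Lemma cut_eq1 t x : 0 < t -> enorm x <= t -> cutoff t x = 1.
Proof. by move=> t0 xt; rewrite /cutoff Psi1// ler_pdivrMr// mul1r. Qed.

Lemma cut_eq0 t x : 0 < t -> 2 * t <= enorm x -> cutoff t x = 0.
Proof. by move=> t0 xt; rewrite /cutoff Psi0// ler_pdivlMr. Qed.

Lemma cabs_cut_le1 t x : cabs (cutoff t x) <= 1.
Proof. by rewrite /cutoff cabs_real ger0_norm ?Psi_ge0 ?Psi_le1. Qed.

(** [Psi] is defined by cases, but the open sets |x| < t and |x| > t/2 overlap: on the first the
    cutoff is 1, on the second it is a sum of two smooth profiles. So no matching at |x| = t has to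
    be checked. *)
Lemma bump_cut t : 0 < t -> bump (cutoff t).
Proof.
move=> t0; split; last first.
  exists (2 * t) => x; apply: contraR; rewrite -ltNge => h.
  by rewrite cut_eq0// ltW.
have [sp _ _ _] := hphi.
have ol := @open_enorm_lt R n t; have og := @open_enorm_gt R n (t / 2).
apply/smoothP; apply: (@csmooth_onS _ _ ([set x | enorm x < t] `|` [set x | t / 2 < enorm x])).
  by move=> x _ /=; have [h|h] := ltP (enorm x) t; [left|right; lra].
apply: csmooth_onU.
  apply: (csmooth_on_eq ol) (csmooth_on_cst 1 ol) => x /= xt.
  by rewrite cut_eq1// ltW.
apply: (csmooth_on_eq og (g := fun x => (phi (t^-1 * enorm x) * enorm x `^ 0 + phi (2 * t^-1 * enorm x) * enorm x `^ 0)%:C%C)) => [x /= xt|].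
  rewrite /cutoff Psi_eqD; last by rewrite ltr_pdivlMr// mulrC.
  by rewrite powRr0 !mulr1; congr ((phi _ + phi _)%:C%C); ring.
apply: csmooth_on_real => //; apply: smooth_onD => //.
  by apply: smooth_onS (radial_smooth (n := n) t^-1 0 sp) => x /= xt; rewrite -enorm_gt0; lra.
by apply: smooth_onS (radial_smooth (n := n) (2 * t^-1) 0 sp) => x /= xt; rewrite -enorm_gt0; lra.
Qed.

Lemma bumpD g h : bump g -> bump h -> bump (fun x => g x + h x).
Proof.
move=> [sg [r gr]] [sh [r' hr]]; split; first exact: smoothD.
exists (Num.max r r') => x; rewrite le_max; apply: contraR; rewrite negb_or -!ltNge => /andP[a b].
have -> : g x = 0 by apply/eqP; apply: contraTT a => /gr; rewrite leNgt.
have -> : h x = 0 by apply/eqP; apply: contraTT b => /hr; rewrite leNgt.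
by rewrite addr0.
Qed.

Lemma bumpZ c g : bump g -> bump (fun x => c * g x).
Proof.
move=> bg; have := smooth_bumpM bg (smooth_cst c); by under eq_fun do rewrite mulrC.
Qed.

Lemma bumpB g h : bump g -> bump h -> bump (fun x => g x - h x).
Proof.
move=> bg bh; have := bumpD bg (bumpZ (-1) bh).
by under eq_fun do rewrite mulN1r.
Qed.

Lemma bump_dyadic k : bump (@dyadic_cutoff R n phi k).
Proof.
rewrite (_ : dyadic_cutoff phi k = fun x => cutoff (2 ^ k) x - cutoff (2 ^ (k - 1)) x); last exact/funext/cutE.
by apply: bumpB; apply: bump_cut; rewrite exprz_gt0.
Qed.

Lemma bump_powR (a r : R) b : bump b -> 0 < r -> (forall x, enorm x < r -> b x = 0) ->
  bump (fun x => (enorm x `^ a)%:C%C * b x).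
Proof.
move=> [sb [r1 br]] r0 hb; split; last first.
  by exists r1 => x; rewrite mulf_eq0 negb_or => /andP[_ /br].
have ol := @open_enorm_lt R n r; have op := @open_punctured R n.
apply/smoothP; apply: (@csmooth_onS _ _ ([set x | enorm x < r] `|` [set x | x != 0])).
  move=> x _ /=; have [->|x0] := eqVneq x 0; last by right.
  by left; rewrite enorm0.
apply: csmooth_onU.
  apply: (csmooth_on_eq ol) (csmooth_on_cst 0 ol) => x /= xr.
  by rewrite hb// mulr0.
apply: csmooth_onM => //; last exact: (csmooth_onS _ ((smoothP _).1 sb)).
apply: csmooth_on_real => //.
(* A bare power of |x| is the radial family with constant profile. *)
have s1 : smooth1 (fun=> 1 : R).
  move=> k x; case: k => [|k]; first by rewrite /derive1n/=; exact: derivable_cst.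
  rewrite (_ : derive1n _ _ = cst 0); first exact: derivable_cst.
  elim: k => [|k IH]; apply/funext => y; first by rewrite /derive1n/= derive1_cst.
  by rewrite derive1nS IH derive1_cst.
apply: smooth_on_eq op _ (radial_smooth (n := n) 1 a s1) => x _.
by rewrite mul1r.
Qed.

Lemma dyadic_sum (J : nat) x : \sum_(i < (2 * J).+1) dyadic_cutoff phi (i%:Z - J%:Z) x =
  cutoff (2 ^+ J) x - cutoff (2 ^- J.+1) x.
Proof.
under eq_bigr do rewrite cutE.
have H m : \sum_(i < m) (cutoff (2 ^ (i%:Z - J%:Z)) x - cutoff (2 ^ (i%:Z - J%:Z - 1)) x) =
   cutoff (2 ^ (m%:Z - J%:Z - 1)) x - cutoff (2 ^ (- J%:Z - 1)) x.
  elim: m => [|m IH]; first by rewrite big_ord0 sub0r subrr.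
  rewrite big_ord_recr/= IH intS [1 + _]addrC -[m%:Z + 1 - _]addrAC addrK.
  by ring.
rewrite H; congr (cutoff _ x - cutoff _ x).
  by rewrite exprnP; congr (_ ^ _); lia.
by rewrite (_ : - J%:Z - 1 = - J.+1%:Z)//; lia.
Qed.

Lemma derive_scale (u : E -> R) (c : R) x : differentiable u (c *: x) ->
  differentiable (fun x => u (c *: x)) x /\
  forall i, 'D_(e_ i) (fun x => u (c *: x)) x = c * 'D_(e_ i) u (c *: x).
Proof.
move=> du; have cs : continuous ( *:%R c : E -> E) by exact: scaler_continuous.
have ds : differentiable ( *:%R c : E -> E) x by exact: linear_differentiable.
have dc : differentiable (u \o ( *:%R c)) x by exact: differentiable_comp.
split=> // i; rewrite -[X in 'D_ _ X x]/(u \o ( *:%R c)) deriveE//.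
by rewrite diff_comp//= deriveE// (diff_lin x cs) linearZ.
Qed.

Lemma partials_scale l (u : E -> R) (c : R) : smooth_on setT u ->
  partials l (fun x => u (c *: x)) = (fun x => c ^+ size l * partials l u (c *: x)) /\
  forall x, differentiable (partials l (fun x => u (c *: x))) x.
Proof.
move=> su.
have E0 k : partials k (fun x => u (c *: x)) = (fun x => c ^+ size k * partials k u (c *: x)).
  elim: k => [|i k IH]; first by apply/funext => x; rewrite /= mul1r.
  apply/funext => x; rewrite /= -/(partials k _) IH.
  have [d1 d2] := derive_scale (su k (c *: x) I).
  by rewrite deriveZ ?d2 ?exprS; [rewrite /= /GRing.scale/=; ring|exact: diff_derivable].
split=> // x; rewrite E0.
have [d1 _] := derive_scale (u := partials l u) (x := x) (c := c) (su l (c *: x) I).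
exact: differentiableZ.
Qed.

Lemma cpartials_scale g (c : R) : smooth g -> smooth (fun x => g (c *: x)) /\
  forall l x, cpartials l (fun x => g (c *: x)) x = (c ^+ size l)%:C%C * cpartials l g (c *: x).
Proof.
move=> /smoothP[a b].
have A l := partials_scale l c a; have B l := partials_scale l c b.
split=> [l x|l x]; first by split; [exact: (A l).2|exact: (B l).2].
rewrite /cpartials; apply: eqReIm; rewrite ?ReE ?ImE /= mul0r ?subr0 ?addr0.
  exact: (congr1 (fun f => f x) (A l).1).
exact: (congr1 (fun f => f x) (B l).1).
Qed.

End cutoffs.

(** * Weighted estimates for convolutions *)

Section weighted_estimates.
Context (R : realType) (n : nat) (n3 : (3 <= n)%N).
Local Notation E := 'rV[R]_n.
Local Notation mu := (lebesgue_tuple R n).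
Local Notation pt := (@Defs.point R n).
Local Notation T := (n.-tuple (measurableTypeR R)).
Implicit Types (u v : E -> R).

Definition integ (u : E -> R) : \bar R := (\int[mu]_t (u (pt t))%:E)%E.

Definition mfun u := measurable_fun setT (u \o pt).

Lemma integ_ge0 u : (forall x, 0 <= u x) -> (0 <= integ u)%E.
Proof. by move=> u0; apply: integral_ge0 => t _; rewrite lee_fin. Qed.

Lemma le_integ u v : mfun u -> mfun v -> (forall x, 0 <= u x) -> (forall x, u x <= v x) ->
  (integ u <= integ v)%E.
Proof.
move=> mu' mv u0 uv; apply: ge0_le_integral => //.
- by move=> t _; rewrite lee_fin.
- exact/measurable_EFinP.
- exact/measurable_EFinP.
- by move=> t _; rewrite lee_fin.
Qed.

Lemma integZ c u : mfun u -> (forall x, 0 <= u x) -> 0 <= c ->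
  integ (fun x => c * u x) = (c%:E * integ u)%E.
Proof.
move=> mu' u0 c0; rewrite /integ; under eq_integral do rewrite EFinM.
rewrite ge0_integralZl_EFin//; [by move=> t _; rewrite lee_fin|exact/measurable_EFinP].
Qed.

Lemma integD u v : mfun u -> mfun v -> (forall x, 0 <= u x) -> (forall x, 0 <= v x) ->
  integ (fun x => u x + v x) = (integ u + integ v)%E.
Proof.
move=> mu' mv u0 v0; rewrite /integ; under eq_integral do rewrite EFinD.
rewrite ge0_integralD//; try (by move=> t _; rewrite lee_fin); exact/measurable_EFinP.
Qed.

Lemma mfunM u v : mfun u -> mfun v -> mfun (fun x => u x * v x).
Proof. exact: measurable_funM. Qed.

Lemma mfunZ c u : mfun u -> mfun (fun x => c * u x).
Proof. by move=> mu'; apply: measurable_funM. Qed.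

Lemma mfun_continuous u : continuous u -> mfun u.
Proof. exact: measurable_continuous_point. Qed.

Lemma mfun_powR (p : R) : mfun (fun x => enorm x `^ p).
Proof. exact: measurable_powR_enorm. Qed.

Lemma mfun_comp_scale u c b : mfun u -> mfun (fun x => u (c *: x + b)).
Proof. by move=> ?; exact: measurable_scale_point. Qed.

Lemma expe2_poweR (x : \bar R) : (0 <= x)%E -> (x `^ 2 = x ^+ 2)%E.
Proof.
case: x => [r r0| _|//]; last by rewrite poweRyr ?expe2 ?mulyy// gt_eqF.
by rewrite poweR_EFin powR_mulrn// EFin_expe.
Qed.

Lemma cauchy_schwarz_integ u v : mfun u -> mfun v -> (forall x, 0 <= u x) -> (forall x, 0 <= v x) ->
  ((integ (fun x => u x * v x)%R) ^+ 2 <=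
   integ (fun x => u x ^+ 2)%R * integ (fun x => v x ^+ 2)%R)%E.
Proof.
move=> mu' mv u0 v0.
have h2 : 2^-1 + 2^-1 = 1 :> R by lra.
have := @hoelder _ _ _ mu _ _ 2 2 mu' mv (ltr0Sn _ _) (ltr0Sn _ _) h2.
rewrite Lnorm1 => H.
have N2 w : (forall x, 0 <= w x) -> ('N[mu]_2%:E[EFin \o (w \o pt)] ^+ 2 = integ (fun x => w x ^+ 2)%R)%E.
  move=> w0; rewrite -expe2_poweR ?Lnorm_ge0// powR_Lnorm//; apply: eq_integral => t _ /=.
  by rewrite ger0_norm// powR_mulrn.
rewrite -!N2//; have {}H : (integ (fun x => u x * v x)%R <= 'N[mu]_2%:E[EFin \o (u \o pt)] * 'N[mu]_2%:E[EFin \o (v \o pt)])%E.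
  apply: le_trans H; rewrite le_eqVlt; apply/orP; left; apply/eqP.
  by apply: eq_integral => t _ /=; rewrite ger0_norm// mulr_ge0.
set a := ('N[mu]_2%:E[EFin \o (u \o pt)])%E in H *; set b := ('N[mu]_2%:E[EFin \o (v \o pt)])%E in H *.
have a0 : (0 <= a)%E by exact: Lnorm_ge0.
have b0 : (0 <= b)%E by exact: Lnorm_ge0.
have i0 : (0 <= integ (fun x => u x * v x)%R)%E by apply: integ_ge0 => x; rewrite mulr_ge0.
rewrite !expe2 muleACA.
by apply: lee_pmul.
Qed.

Lemma integ_scale u (c : R) (b : E) : 0 < c -> mfun u -> (forall x, 0 <= u x) ->
  integ (fun x => u (c *: x + b)) = ((c^-1 ^+ n)%:E * integ u)%E.
Proof.
move=> c0 mu' u0; apply: (@ge0_integral_scale_point _ _ c b (EFin \o u)) => //.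
exact/measurable_EFinP.
Qed.

Lemma lebesgue_tuple_origin : mu [set t | pt t == 0] = 0%E.
Proof.
have := @lebesgue_tuple_cube R n 0 (lexx _); rewrite mulr0 expr0n (_ : (n == 0)%N = false); last by case: n n3.
move=> E0; rewrite -[RHS]E0; congr (mu _); apply/seteqP; split=> t /=.
  move=> /eqP/rowP h i; rewrite in_itv/=; have := h i; rewrite !mxE => ->.
  by rewrite oppr0 lexx.
move=> h; apply/eqP/rowP => i; rewrite !mxE; have := h i.
by rewrite in_itv/= oppr0 => /le_anti.
Qed.

Lemma measurable_origin : measurable [set t : T | pt t == 0].
Proof.
rewrite (_ : mkset _ = (fun t => enorm (pt t)) @^-1` [set 0]).
  by rewrite -[X in measurable X]setTI; apply: measurable_enorm_point => //; exact: measurable_set1.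
by apply/seteqP; split=> t /=; [move=> /eqP ->; exact: enorm0|move=> /eqP; rewrite enorm_eq0].
Qed.

(** Identities such as |x|^p |x|^(-p) = 1 fail at the origin, where powers take default values.
    Comparing integrands off this null set avoids the exception. *)
Lemma integral_punctured (f g : T -> \bar R) : measurable_fun setT f -> measurable_fun setT g ->
  (forall t, 0 <= f t)%E -> (forall t, 0 <= g t)%E -> (forall t, pt t != 0%R -> f t <= g t)%E ->
  (\int[mu]_t f t <= \int[mu]_t g t)%E.
Proof.
move=> mf mg f0 g0 fg; apply: ae_ge0_le_integral => //.
exists [set t | pt t == 0]; split; [exact: measurable_origin|exact: lebesgue_tuple_origin|].
by move=> t /= h; apply: contrapT => /negP t0; apply: h => _; exact: fg.
Qed.

(* Up to a factor independent of lam, an approximate identity at scale 1/lam. *)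
Definition kern (lam : R) (x : E) : R := lam ^+ n * (1 + lam * enorm x) ^- n.+2.

Lemma jap_lam_gt0 lam (x : E) N : 0 < lam -> 0 < (1 + lam * enorm x) ^+ N.
Proof. by move=> l0; rewrite exprn_gt0// ltr_pwDl// mulr_ge0 ?enorm_ge0// ltW. Qed.

Lemma kern_ge0 lam x : 0 < lam -> 0 <= kern lam x.
Proof. by move=> l0; rewrite mulr_ge0 ?exprn_ge0 ?(ltW l0)// invr_ge0 ltW ?jap_lam_gt0. Qed.

Lemma kernB lam (x y : E) : kern lam (x - y) = kern lam (y - x).
Proof. by rewrite /kern enormB. Qed.

Lemma continuous_jap_lam lam (x : E) N : 0 < lam -> {for x, continuous (fun y : E => (1 + lam * enorm y) ^- N)}.
Proof.
move=> l0; rewrite (_ : (fun y : E => (1 + lam * enorm y) ^- N) = fun y => ((1 + lam * enorm y)^-1) ^+ N); last first.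
  by apply/funext => y; rewrite exprVn.
have c1 : {for x, continuous (fun y : E => (1 + lam * enorm y)^-1)}.
  apply: cvgV; first by have := jap_lam_gt0 x 1 l0; rewrite expr1 => /lt0r_neq0.
  by apply: cvgD; [exact: cvg_cst|apply: cvgMr; exact: continuous_enorm].
elim: N => [|N IH]; first exact: cvg_cst.
rewrite (_ : (fun y => _) = fun y : E => (1 + lam * enorm y)^-1 * (1 + lam * enorm y)^-1 ^+ N); last first.
  by apply/funext => y; rewrite exprS.
by apply: cvgM.
Qed.

Lemma mfun_jap_lam lam N : 0 < lam -> mfun (fun y => (1 + lam * enorm y) ^- N).
Proof. by move=> l0; apply: mfun_continuous => x; exact: continuous_jap_lam. Qed.

Lemma mfun_kern lam : 0 < lam -> mfun (kern lam).
Proof. by move=> l0; apply: measurable_funM => //; exact: mfun_jap_lam. Qed.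

Lemma mfun_kernB lam x : 0 < lam -> mfun (fun y => kern lam (x - y)).
Proof.
move=> l0; under eq_fun do rewrite kernB.
rewrite (_ : (fun _ => _) = fun y => kern lam (1 *: y + (- x))); last by apply/funext => y; rewrite scale1r.
by apply: mfun_comp_scale; exact: mfun_kern.
Qed.

Lemma integ_kern : exists2 C : R, 0 < C & forall lam x, 0 < lam ->
  (integ (fun y => kern lam (x - y)) <= C%:E)%E.
Proof.
have [K [K0 hK]] := @integral_jap R n; exists (K + 1); first by rewrite ltr_wpDl.
move=> lam x l0.
have E1 (y : E) : kern lam (x - y) = lam ^+ n * (1 + enorm (lam *: y + (- (lam *: x)))) ^- n.+2.
  by rewrite kernB /kern -scalerBr enormZ gtr0_norm.
under eq_fun do rewrite E1.
have m1 : mfun (fun y => (1 + enorm y) ^- n.+2).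
  by have := @mfun_jap_lam 1 n.+2 ltr01; under eq_fun do rewrite mul1r.
have p1 (y : E) N : 0 <= (1 + enorm y) ^- N by rewrite invr_ge0 ltW ?jap_pow_gt0.
rewrite integZ ?exprn_ge0 ?(ltW l0)//; last by apply: (mfun_comp_scale (u := fun y => (1 + enorm y) ^- n.+2)).
rewrite (integ_scale (u := fun y => (1 + enorm y) ^- n.+2))// muleA -EFinM -exprMn mulfV ?gt_eqF// expr1n mul1e.
apply: (@le_trans _ _ K%:E); last by rewrite lee_fin lerDl.
apply: (@le_trans _ _ (integ (fun y => (1 + enorm y) ^- n.+1))); last exact: hK.
apply: le_integ => // [|x0].
  by have := @mfun_jap_lam 1 n.+1 ltr01; under eq_fun do rewrite mul1r.
by rewrite lef_pV2 ?posrE ?jap_pow_gt0// ler_weXn2l// jap_ge1.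
Qed.

(** Scaling reduces the claim to lam = 1. Near 0 the weight is integrable because 2 |tau| <= 2 < n;
    for |x| > 1 it is at most (1 + |x|)^2, and at least n + 1 of the 2(n+2) powers remain. *)
Lemma integ_jap_powR (tau : R) : `|tau| <= 1 -> exists2 C : R, 0 < C & forall lam, 0 < lam ->
  (integ (fun x => (1 + lam * enorm x) ^- (2 * n.+2) * enorm x `^ (2 * tau))%R <=
   (C * lam `^ (- (n%:R + 2 * tau)))%:E)%E.
Proof.
move=> t1; have n3' : (3 : R) <= n%:R by rewrite ler_nat.
have t2 : 2 * tau <= 2 by move: t1; rewrite ler_norml => /andP[_]; lra.
have tn : - n%:R < 2 * tau by move: t1; rewrite ler_norml => /andP[]; lra.
have [C1 [C10 h1]] := integral_powR_ball tn; have [C2 [C20 h2]] := @integral_jap R n.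
pose F (x : E) := (1 + enorm x) ^- (2 * n.+2) * enorm x `^ (2 * tau).
pose F1 (x : E) := if enorm x <= 1 then enorm x `^ (2 * tau) else 0.
pose F2 (x : E) := (1 + enorm x) ^- n.+1.
have mj N : mfun (fun y => (1 + enorm y) ^- N).
  by have := @mfun_jap_lam 1 N ltr01; under eq_fun do rewrite mul1r.
have mF : mfun F by apply: mfunM => //; exact: mfun_powR.
have F0 x : 0 <= F x by rewrite mulr_ge0 ?powR_ge0// invr_ge0 ltW ?jap_pow_gt0.
have mF1 : mfun F1.
  apply: measurable_fun_ifT; [|exact: mfun_powR|exact: measurable_cst].
  apply: (measurable_fun_bool true); rewrite (_ : _ @^-1` _ = (fun t => enorm (pt t)) @^-1` `]-oo, 1]).
    by apply: measurable_enorm_point => //; exact: measurable_itv.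
  by apply/seteqP; split => t /=; rewrite in_itv.
have F10 x : 0 <= F1 x by rewrite /F1; case: ifP => // _; exact: powR_ge0.
have F20 x : 0 <= F2 x by rewrite /F2 invr_ge0 ltW ?jap_pow_gt0.
have FF x : F x <= F1 x + F2 x.
  rewrite /F/F1/F2; case: ifPn => [x1|]; last rewrite -ltNge => x1.
    apply: (@le_trans _ _ (enorm x `^ (2 * tau))); last by rewrite lerDl; exact: F20.
    rewrite ler_piMl ?powR_ge0// invf_le1 ?jap_pow_gt0//.
    by rewrite exprn_ege1// jap_ge1.
  rewrite add0r ler_pdivrMl ?jap_pow_gt0//.
  apply: (@le_trans _ _ ((1 + enorm x) ^+ 2)).
    apply: (@le_trans _ _ (enorm x `^ 2)).
      by rewrite ler_powR// ltW.
    by rewrite powR_mulrn ?enorm_ge0// lerXn2r ?nnegrE ?addr_ge0 ?enorm_ge0// lerDr.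
  rewrite ler_pdivlMr ?jap_pow_gt0// -exprD ler_weXn2l ?jap_ge1//; lia.
have IF : (integ F <= (C1 + C2 + 1)%:E)%E.
  apply: (@le_trans _ _ (integ (fun x => F1 x + F2 x))).
    by apply: le_integ => //; apply: measurable_funD => //; exact: (mj n.+1).
  rewrite integD//; last exact: (mj n.+1).
  apply: (@le_trans _ _ ((C1)%:E + C2%:E)%E).
    apply: leeD; last exact: h2.
    by apply: le_trans (h1 1 ltr01) _; rewrite powR1 mulr1.
  by rewrite -EFinD lee_fin lerDl.
exists (C1 + C2 + 1); first by rewrite ltr_wpDl// addr_ge0.
move=> lam l0.
rewrite (_ : (fun x => _) = fun x => lam `^ (- (2 * tau)) * F (lam *: x + 0)); last first.
  apply/funext => x; rewrite /F addr0 enormZ gtr0_norm// powRM ?enorm_ge0 ?(ltW l0)//.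
  have h : lam `^ (- (2 * tau)) * lam `^ (2 * tau) = 1.
    by rewrite -powRD ?addNr ?powRr0// (gt_eqF l0) implybT.
  rewrite [RHS](_ : _ = (lam `^ (- (2 * tau)) * lam `^ (2 * tau)) *
    ((1 + lam * enorm x) ^- (2 * n.+2) * enorm x `^ (2 * tau))); first by rewrite h mul1r.
  by ring.
rewrite (integZ (mfun_comp_scale lam 0 mF) (fun x => F0 _) (powR_ge0 _ _)).
rewrite integ_scale// muleA -EFinM.
apply: le_trans (lee_wpmul2l _ IF) _; first by rewrite lee_fin mulr_ge0 ?powR_ge0// exprn_ge0// invr_ge0 ltW.
rewrite -EFinM lee_fin [leRHS]mulrC ler_wpM2r//; first by rewrite !addr_ge0.
rewrite opprD addrC powRD; last by rewrite (gt_eqF l0) implybT.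
by rewrite [lam `^ (- n%:R)]powRN powR_mulrn ?(ltW l0)// exprVn.
Qed.

(** For these exponents |x|^p is a Muckenhoupt A_1 weight: its averages are bounded by its value at
    the centre. The integral is split at |y| = r = |x|/2. Outside, |y|^p <= r^p; inside, |x - y| >=
    r bounds the kernel by r^-n whatever lam is. *)
Lemma integ_kern_powR (p : R) : - n%:R < p <= 0 -> exists2 C : R, 0 < C & forall lam x, 0 < lam ->
  ((enorm x `^ (- p))%:E * integ (fun y => (kern lam (x - y) * enorm y `^ p)%R) <= C%:E)%E.
Proof.
move=> /andP[np p0].
have [C1 [C10 h1]] := integral_powR_ball np; have [C2 C20 h2] := integ_kern.
exists (2 `^ (- p) * (C2 + C1) + C2); first by rewrite ltr_wpDl// mulr_ge0 ?powR_ge0// addr_ge0// ltW.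
move=> lam x l0.
have [->|pn0] := eqVneq p 0.
  rewrite oppr0 !powRr0 mul1e; under eq_fun do rewrite powRr0 mulr1.
  by apply: le_trans (h2 lam x l0) _; rewrite lee_fin mul1r addrAC -addrA lerDl addr_ge0// ltW.
have [->|x0] := eqVneq x 0.
  rewrite enorm0 powR0 ?oppr_eq0// mul0e lee_fin addr_ge0 ?(ltW C20)//.
  by rewrite mulr_ge0 ?powR_ge0// addr_ge0// ltW.
have ex : 0 < enorm x by rewrite enorm_gt0.
pose r := enorm x / 2; have r0 : 0 < r by rewrite divr_gt0.
pose G1 y := r `^ p * kern lam (x - y).
pose B (y : E) := if enorm y <= r then enorm y `^ p else 0.
pose G2 y := r ^- n * B y.
have mB : mfun B.
  apply: measurable_fun_ifT; [|exact: mfun_powR|exact: measurable_cst].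
  apply: (measurable_fun_bool true); rewrite (_ : _ @^-1` _ = (fun t => enorm (pt t)) @^-1` `]-oo, r]).
    by apply: measurable_enorm_point => //; exact: measurable_itv.
  by apply/seteqP; split => t /=; rewrite in_itv.
have B0 y : 0 <= B y by rewrite /B; case: ifP => // _; exact: powR_ge0.
have mk := mfun_kernB x l0.
have k0 y : 0 <= kern lam (x - y) by exact: kern_ge0.
have rn0 : 0 <= r ^- n by rewrite invr_ge0 exprn_ge0// ltW.
have le1 : (integ (fun y => kern lam (x - y) * enorm y `^ p)%R <= integ (fun y => G1 y + G2 y)%R)%E.
  apply: le_integ.
  - by apply: mfunM => //; exact: mfun_powR.
  - by apply: measurable_funD; apply: measurable_funM.
  - by move=> y; rewrite mulr_ge0// powR_ge0.
  move=> y; rewrite /G1 /G2 /B; case: ifPn => [yr|]; last rewrite -ltNge => ry.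
    rewrite -[leLHS]add0r; apply: lerD; first by apply: mulr_ge0 => //; exact: powR_ge0.
    rewrite ler_wpM2r ?powR_ge0// /kern ler_pdivrMr ?jap_lam_gt0//.
    rewrite mulrC ler_pdivlMr ?exprn_gt0//.
    have xy : r <= enorm (x - y).
      have := ler_enormD (x - y) y; rewrite subrK; rewrite /r in yr *; lra.
    apply: (@le_trans _ _ ((1 + lam * enorm (x - y)) ^+ n)).
      rewrite -exprMn lerXn2r ?nnegrE ?mulr_ge0 ?addr_ge0 ?enorm_ge0 ?mulr_ge0 ?(ltW l0) ?(ltW r0)//.
        by rewrite enorm_ge0.
      by rewrite ler_wpDl// ler_wpM2l// ltW.
    by rewrite ler_weXn2l ?lerDl ?mulr_ge0 ?enorm_ge0 ?(ltW l0)// leqW.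
  rewrite mulr0 addr0 mulrC ler_wpM2r//.
  have y0 : 0 < enorm y := lt_trans r0 ry.
  rewrite -[p in enorm y `^ p]opprK -[p in r `^ p]opprK [leLHS]powRN [leRHS]powRN lef_pV2 ?posrE ?powR_gt0//.
  by rewrite ge0_ler_powR ?nnegrE ?oppr_ge0// ltW.
have le2 : (integ (fun y => G1 y + G2 y)%R <= (r `^ p * (C2 + C1))%:E)%E.
  rewrite integD; try (by apply: measurable_funM); last 2 first.
  - by move=> y; rewrite mulr_ge0 ?powR_ge0.
  - by move=> y; rewrite mulr_ge0.
  have -> : integ G1 = ((r `^ p)%:E * integ (fun y => kern lam (x - y)))%E by exact: integZ (powR_ge0 _ _).
  have -> : integ G2 = ((r ^- n)%:E * integ B)%E by exact: integZ.
  rewrite mulrDr EFinD; apply: leeD.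
    by rewrite EFinM lee_wpmul2l ?lee_fin ?powR_ge0// h2.
  apply: (@le_trans _ _ ((r ^- n)%:E * (C1 * r `^ (n%:R + p))%:E)%E).
    by rewrite lee_wpmul2l ?lee_fin// h1.
  rewrite -EFinM lee_fin powR_natD// le_eqVlt; apply/orP; left; apply/eqP; field.
  by rewrite expf_neq0// gt_eqF.
apply: le_trans (lee_wpmul2l _ (le_trans le1 le2)) _; first by rewrite lee_fin powR_ge0.
rewrite -EFinM lee_fin mulrA; apply: (@le_trans _ _ (2 `^ (- p) * (C2 + C1))); last by rewrite lerDl ltW.
rewrite ler_wpM2r ?addr_ge0 ?(ltW C20)//.
rewrite /r powRM ?(ltW ex) ?invr_ge0// mulrA -powRD ?addNr ?powRr0 ?mul1r; last by rewrite (gt_eqF ex) implybT.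
by rewrite powRN -powR_inv1// -powRrM mulN1r powRN.
Qed.

End weighted_estimates.

(** * Weighted L^2 bounds for convolution with approximate identities *)

Section convolution_estimates.
Context (R : realType) (n : nat) (n3 : (3 <= n)%N).
Local Notation E := 'rV[R]_n.
Local Notation mu := (lebesgue_tuple R n).
Local Notation pt := (@Defs.point R n).
Local Notation T := (n.-tuple (measurableTypeR R)).
Implicit Types (u v : E -> R).

Lemma measurable_kern2 lam : 0 < lam ->
  measurable_fun setT (fun z : T * T => kern lam (pt z.1 - pt z.2)).
Proof.
move=> l0; apply: measurable_funM => //.
rewrite (_ : (fun _ => _) = fun z : T * T => (1 + lam * enorm (pt z.1 - pt z.2)) `^ (- n.+2%:R)); last first.
  by apply/funext => z; rewrite powRN powR_mulrn// addr_ge0// mulr_ge0 ?enorm_ge0// ltW.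
apply: (measurableT_comp (measurable_powR _)).
apply: measurable_funD => //; apply: measurable_funM => //.
apply: (measurableT_comp (f := @Num.sqrt R)).
  by apply: continuous_measurable_fun; exact: sqrt_continuous.
apply: measurable_sum => i; apply: measurable_funX; under eq_fun do rewrite !mxE.
apply: measurable_funB.
  by apply: (measurableT_comp (f := fun t : T => tnth t i)) => //; exact: measurable_tnth.
by apply: (measurableT_comp (f := fun t : T => tnth t i)) => //; exact: measurable_tnth.
Qed.

Lemma kern_tonelli lam (a b : E -> R) : 0 < lam -> mfun a -> mfun b ->
  (forall x, 0 <= a x) -> (forall x, 0 <= b x) ->
  (\int[mu]_t ((a (pt t))%:E * integ (fun y => kern lam (pt t - y) * b y)%R) =
   \int[mu]_t ((b (pt t))%:E * integ (fun x => kern lam (pt t - x) * a x)%R))%E.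
Proof.
move=> l0 ma mb a0 b0.
have H (c d : E -> R) : mfun c -> mfun d -> (forall x, 0 <= c x) -> (forall x, 0 <= d x) ->
   (\int[mu]_t ((c (pt t))%:E * integ (fun y => kern lam (pt t - y) * d y)%R) =
    \int[mu]_t \int[mu]_t' (kern lam (pt t - pt t') * (c (pt t) * d (pt t')))%:E)%E.
  move=> mc md c0 d0; apply: eq_integral => t _; rewrite -integZ//.
  - by apply: eq_integral => t' _; rewrite mulrCA.
  - by apply: mfunM => //; exact: mfun_kernB.
  - by move=> y; rewrite mulr_ge0 ?kern_ge0.
rewrite (H a b ma mb a0 b0) (H b a mb ma b0 a0).
rewrite (@fubini_tonelli _ _ _ _ _ mu mu (fun z : T * T => (kern lam (pt z.1 - pt z.2) * (a (pt z.1) * b (pt z.2)))%:E)) /=.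
- by apply: eq_integral => t _; apply: eq_integral => t' _; rewrite kernB [a _ * _]mulrC.
- apply/measurable_EFinP; apply: measurable_funM; first exact: measurable_kern2.
  apply: measurable_funM.
    by apply: (measurableT_comp (f := a \o pt)).
  by apply: (measurableT_comp (f := b \o pt)).
by move=> z; rewrite lee_fin mulr_ge0 ?kern_ge0// mulr_ge0.
Qed.

(** A squared norm: the constants below bound squares of operator norms, and off-diagonal exponents
    are twice those of the final estimate. *)
Definition wnorm (sig : R) u : \bar R := integ (fun x => enorm x `^ (2 * sig) * u x ^+ 2)%R.

Lemma mfun_wnorm sig u : mfun u -> mfun (fun x => enorm x `^ (2 * sig) * u x ^+ 2).
Proof. by move=> mu'; apply: mfunM; [exact: mfun_powR|exact: measurable_funX]. Qed.

Lemma wnorm_ge0 sig u : (0 <= wnorm sig u)%E.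
Proof. by apply: integ_ge0 => x; rewrite mulr_ge0 ?powR_ge0 ?sqr_ge0. Qed.

Lemma sqr_le_cauchy_schwarz (c a b : R) (u v : E -> R) : mfun u -> mfun v ->
  (forall x, 0 <= u x) -> (forall x, 0 <= v x) -> 0 <= c ->
  (c%:E <= integ (fun x => u x * v x)%R)%E ->
  (integ (fun x => u x ^+ 2)%R <= a%:E)%E -> (integ (fun x => v x ^+ 2)%R <= b%:E)%E ->
  c ^+ 2 <= a * b.
Proof.
move=> mu' mv u0 v0 c0 cuv ha hb; rewrite -lee_fin EFin_expe [(a * b)%:E]EFinM.
have i0 (w : E -> R) : (0 <= integ (fun x => w x ^+ 2)%R)%E by apply: integ_ge0 => x; exact: sqr_ge0.
apply: (@le_trans _ _ ((integ (fun x => u x * v x)%R) ^+ 2)%E).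
  by rewrite !expe2; apply: lee_pmul => //; rewrite lee_fin.
by apply: le_trans (cauchy_schwarz_integ mu' mv u0 v0) _; apply: lee_pmul.
Qed.

Lemma integ_punctured_le u v : mfun u -> mfun v -> (forall x, 0 <= u x) -> (forall x, 0 <= v x) ->
  (forall x, x != 0 -> u x <= v x) -> (integ u <= integ v)%E.
Proof.
move=> mu' mv u0 v0 uv; apply: integral_punctured => //.
- exact/measurable_EFinP.
- exact/measurable_EFinP.
- by move=> t; rewrite lee_fin.
- by move=> t; rewrite lee_fin.
- by move=> t t0; rewrite lee_fin uv.
Qed.

Lemma powR_enormD (x : E) (p q : R) : x != 0 -> enorm x `^ (p + q) = enorm x `^ p * enorm x `^ q.
Proof. by move=> x0; rewrite powRD// enorm_eq0 (negbTE x0) implybT. Qed.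

Lemma wnorm_conv_le (sig : R) : `|sig| <= 1 -> exists2 C : R, 0 < C & forall lam u v M, 0 < lam ->
  mfun u -> mfun v -> (forall x, 0 <= u x) -> (forall x, 0 <= v x) ->
  (forall x, (v x)%:E <= integ (fun y => kern lam (x - y) * u y)%R)%E ->
  (wnorm sig u <= M%:E)%E -> (wnorm sig v <= (C * M)%:E)%E.
Proof.
move=> s1; have n3' : (3 : R) <= n%:R by rewrite ler_nat.
(* With this choice both -2 al and 2 sig - 2 al lie in (-n, 0], the range of [integ_kern_powR]. *)
pose al := Num.max sig 0; have al0 : 0 <= al by rewrite le_max lexx orbT.
have [sm1 s1'] : -1 <= sig /\ sig <= 1 by move: s1; rewrite ler_norml => /andP[].
have al1 : al <= 1 by rewrite ge_max s1'/=.
have sal : sig <= al by rewrite le_max lexx.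
have als : al - sig <= 1 by rewrite /al /Num.max; case: ifP => _; lra.
have p1 : - n%:R < - (2 * al) <= 0 by apply/andP; split; lra.
have p2 : - n%:R < 2 * sig - 2 * al <= 0 by apply/andP; split; lra.
have [C1 C10 h1] := integ_kern_powR p1; have [C2 C20 h2] := integ_kern_powR p2.
exists (C1 * C2); first exact: mulr_gt0.
move=> lam u v M l0 mu' mv u0 v0 vu uM.
pose b (y : E) := enorm y `^ (2 * al) * u y ^+ 2.
have mb : mfun b by exact: mfun_wnorm.
have b0 y : 0 <= b y by rewrite mulr_ge0 ?powR_ge0 ?sqr_ge0.
have mk (x : E) : mfun (fun y => kern lam (x - y)) by exact: mfun_kernB.
have k0 (x y : E) : 0 <= kern lam (x - y) by exact: kern_ge0.
have step1 x : (((v x) ^+ 2)%:E <= integ (fun y => kern lam (x - y) * enorm y `^ (- (2 * al)))%R *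
    integ (fun y => kern lam (x - y) * b y)%R)%E.
  pose A y := Num.sqrt (kern lam (x - y) * enorm y `^ (- (2 * al))).
  pose B y := Num.sqrt (kern lam (x - y) * b y).
  have msq (w : E -> R) : mfun w -> mfun (fun y => Num.sqrt (w y)).
    by move=> mw; apply: (measurableT_comp (f := @Num.sqrt R)) => //; apply: continuous_measurable_fun; exact: sqrt_continuous.
  have mA : mfun A by apply: msq; apply: mfunM => //; exact: mfun_powR.
  have mB : mfun B by apply: msq; apply: mfunM.
  have eA y : A y ^+ 2 = kern lam (x - y) * enorm y `^ (- (2 * al)) by rewrite sqr_sqrtr// mulr_ge0 ?powR_ge0.
  have eB y : B y ^+ 2 = kern lam (x - y) * b y by rewrite sqr_sqrtr// mulr_ge0.
  have le1 : (integ (fun y => kern lam (x - y) * u y)%R <= integ (fun y => A y * B y)%R)%E.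
    apply: integ_punctured_le.
    - exact: mfunM.
    - exact: mfunM.
    - by move=> y; rewrite mulr_ge0.
    - by move=> y; rewrite mulr_ge0 ?sqrtr_ge0.
    move=> y y0; rewrite -sqrtrM; last by rewrite mulr_ge0 ?powR_ge0.
    rewrite [X in Num.sqrt X](_ : _ = (kern lam (x - y) * u y) ^+ 2 * (enorm y `^ (- (2 * al)) * enorm y `^ (2 * al))); last by rewrite /b; ring.
    by rewrite -powR_enormD// addNr powRr0 mulr1 sqrtr_sqr ger0_norm// mulr_ge0.
  have := cauchy_schwarz_integ mA mB (fun y => sqrtr_ge0 _) (fun y => sqrtr_ge0 _).
  under [X in (_ <= X * _)%E]eq_integral do rewrite eA.
  under [X in (_ <= _ * X)%E]eq_integral do rewrite eB.
  apply: le_trans; rewrite EFin_expe !expe2.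
  have vAB : ((v x)%:E <= integ (fun y => A y * B y)%R)%E by exact: le_trans (vu x) le1.
  by apply: lee_pmul => //; rewrite lee_fin.
have mI (w : E -> R) : mfun w -> (forall y, 0 <= w y) ->
    measurable_fun setT (fun t => integ (fun y => kern lam (pt t - y) * w y)%R).
  move=> mw w0.
  apply: (@measurable_fun_fubini_tonelli_F _ _ _ _ _ mu (fun z : T * T => (kern lam (pt z.1 - pt z.2) * w (pt z.2))%:E)); last by move=> z; rewrite lee_fin mulr_ge0.
  apply/measurable_EFinP; apply: measurable_funM; first exact: measurable_kern2.
  by apply: (measurableT_comp (f := w \o pt)).
have I0 (x : E) (w : E -> R) : (forall y, 0 <= w y) -> (0 <= integ (fun y => kern lam (x - y) * w y)%R)%E.
  by move=> w0; apply: integ_ge0 => y; rewrite mulr_ge0.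
pose a (y : E) := enorm y `^ (2 * sig - 2 * al).
have ma : mfun a by exact: mfun_powR.
have a0 y : 0 <= a y by exact: powR_ge0.
apply: (@le_trans _ _ (\int[mu]_t (C1%:E * ((a (pt t))%:E * integ (fun y => kern lam (pt t - y) * b y)%R)))%E).
  apply: integral_punctured => //.
  - by apply/measurable_EFinP; exact: mfun_wnorm.
  - by apply: measurable_funeM; apply: emeasurable_funM; [exact/measurable_EFinP|exact: mI].
  - by move=> t; rewrite lee_fin mulr_ge0 ?powR_ge0 ?sqr_ge0.
  - by move=> t; rewrite !mule_ge0 ?lee_fin ?(ltW C10) ?a0 ?I0.
  move=> t t0; rewrite EFinM -[2 * sig](subrK (2 * al)) powR_enormD// EFinM -muleA.
  rewrite [leRHS]muleCA; apply: lee_wpmul2l; first by rewrite lee_fin a0.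
  apply: (le_trans (lee_wpmul2l _ (step1 _))); first by rewrite lee_fin powR_ge0.
  rewrite muleA; apply: lee_wpmul2r; first exact: I0.
  by have := h1 lam (pt t) l0; rewrite opprK.
rewrite ge0_integralZl_EFin ?(ltW C10)//; last 2 first.
- by move=> t _; rewrite mule_ge0 ?lee_fin ?a0 ?I0.
- by apply: emeasurable_funM; [exact/measurable_EFinP|exact: mI].
rewrite kern_tonelli// -mulrA EFinM; apply: lee_wpmul2l; first by rewrite lee_fin ltW.
apply: (@le_trans _ _ (C2%:E * wnorm sig u)%E); last first.
  by rewrite EFinM; apply: lee_wpmul2l => //; rewrite lee_fin ltW.
rewrite -integZ ?(ltW C20)//; last 2 first.
- exact: mfun_wnorm.
- by move=> x; rewrite mulr_ge0 ?powR_ge0 ?sqr_ge0.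
apply: integral_punctured => //.
- by apply: emeasurable_funM; [exact/measurable_EFinP|exact: mI].
- by apply/measurable_EFinP; apply: measurable_funM => //; exact: mfun_wnorm.
- by move=> t; rewrite mule_ge0 ?lee_fin ?b0 ?I0.
- by move=> t; rewrite lee_fin mulr_ge0 ?(ltW C20)// mulr_ge0 ?powR_ge0 ?sqr_ge0.
move=> t t0; have pa : 0 < enorm (pt t) `^ (2 * sig - 2 * al) by rewrite powR_gt0 ?enorm_gt0.
have := h2 lam (pt t) l0; rewrite powRN -/(a (pt t)) => h.
have {}h : (integ (fun x => kern lam (pt t - x) * a x)%R <= (C2 * a (pt t))%:E)%E.
  rewrite -(@lee_pmul2l _ ((a (pt t))^-1)%:E) ?lte_fin ?invr_gt0//.
  apply: (le_trans h); rewrite -EFinM lee_fin mulrCA mulVf ?mulr1 ?gt_eqF//.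
apply: (le_trans (lee_wpmul2l _ h)); first by rewrite lee_fin.
rewrite -EFinM lee_fin /b /a mulrCA ler_wpM2l ?(ltW C20)//.
have -> : enorm (pt t) `^ (2 * sig) = enorm (pt t) `^ (2 * sig - 2 * al) * enorm (pt t) `^ (2 * al).
  by rewrite -powR_enormD// subrK.
by rewrite le_eqVlt; apply/orP; left; apply/eqP; ring.
Qed.

(** A Peetre inequality: it recentres a polynomial weight at the price of polynomial growth in the
    displacement. *)
Lemma jap_submul lam (x y z : E) N : 0 < lam -> enorm z <= enorm x + enorm y ->
  (1 + lam * enorm z) ^+ N <= (1 + lam * enorm x) ^+ N * (1 + lam * enorm y) ^+ N.
Proof.
move=> l0 h; rewrite -exprMn lerXn2r ?nnegrE ?mulr_ge0 ?addr_ge0 ?mulr_ge0 ?enorm_ge0 ?(ltW l0)//.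
apply: (@le_trans _ _ (1 + lam * (enorm x + enorm y))); first by rewrite lerD2l ler_wpM2l ?(ltW l0).
have : 0 <= (lam * enorm x) * (lam * enorm y) by rewrite !mulr_ge0 ?enorm_ge0 ?(ltW l0).
by rewrite mulrDr; lra.
Qed.

Lemma powR_ratio (lam mu' p : R) : 0 < lam -> 0 < mu' ->
  lam `^ p * mu' `^ (- p) = (lam / mu') `^ p.
Proof.
by move=> l0 m0; rewrite powRM ?invr_ge0 ?(ltW l0) ?(ltW m0)// -[mu'^-1]powR_inv1 ?(ltW m0)// -powRrM mulN1r.
Qed.

Lemma powR_ratio_le (lam mu' p q : R) : 0 < lam -> lam <= mu' -> q <= p ->
  (lam / mu') `^ p <= (lam / mu') `^ q.
Proof.
move=> l0 lm qp; have m0 := lt_le_trans l0 lm; apply: ger_powR => //.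
by rewrite divr_gt0//= ler_pdivrMr// mul1r.
Qed.

(** Bounds a single value of a convolution, by Cauchy-Schwarz with the factors |y|^(-sig) and
    |y|^sig u. The power of lam is the weighted volume of the ball of radius 1/lam. *)
Lemma sqr_conv_le (sig : R) : `|sig| <= 1 -> exists2 C : R, 0 < C & forall lam u c M, 0 < lam ->
  mfun u -> (forall x, 0 <= u x) -> 0 <= c ->
  (c%:E <= integ (fun y => (1 + lam * enorm y) ^- n.+2 * u y)%R)%E ->
  (wnorm sig u <= M%:E)%E -> c ^+ 2 <= C * lam `^ (- (n%:R - 2 * sig)) * M.
Proof.
move=> s1; have := @integ_jap_powR _ _ n3 (- sig); rewrite normrN => /(_ s1)[C C0 hC].
exists C => // lam u c M l0 mu' u0 c0 cu uM.
have p0 (x : E) N : 0 <= (1 + lam * enorm x) ^- N by rewrite invr_ge0 ltW// jap_lam_gt0.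
have sp (x : E) p : (enorm x `^ p) ^+ 2 = enorm x `^ (2 * p).
  by rewrite -powR_mulrn ?powR_ge0// -powRrM mulrC.
apply: (@sqr_le_cauchy_schwarz c _ _ (fun x => (1 + lam * enorm x) ^- n.+2 * enorm x `^ (- sig)) (fun x => enorm x `^ sig * u x)) => //.
- by apply: mfunM; [exact: mfun_jap_lam|exact: mfun_powR].
- by apply: mfunM => //; exact: mfun_powR.
- by move=> x; rewrite mulr_ge0 ?powR_ge0.
- by move=> x; rewrite mulr_ge0 ?powR_ge0.
- apply: (le_trans cu); apply: integ_punctured_le.
  + by apply: mfunM => //; exact: mfun_jap_lam.
  + by do !apply: mfunM; [exact: mfun_jap_lam|exact: mfun_powR|exact: mfun_powR|].
  + by move=> x; rewrite mulr_ge0.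
  + by move=> x; rewrite !mulr_ge0 ?powR_ge0.
  move=> x x0.
  have -> : (1 + lam * enorm x) ^- n.+2 * enorm x `^ (- sig) * (enorm x `^ sig * u x) =
     (enorm x `^ sig * enorm x `^ (- sig)) * ((1 + lam * enorm x) ^- n.+2 * u x) by ring.
  by rewrite -powR_enormD// subrr powRr0 mul1r.
- have := hC lam l0; rewrite mulrN; apply: le_trans; rewrite le_eqVlt; apply/orP; left; apply/eqP.
  by apply: eq_integral => t _; rewrite exprMn sp mulrN -exprVn -exprVn -exprM mulnC.
by apply: le_trans uM; rewrite le_eqVlt; apply/orP; left; apply/eqP; apply: eq_integral => t _; rewrite exprMn sp.
Qed.

Lemma jap_kern_le lam (x y : E) : 0 < lam ->
  kern lam (x - y) <= lam ^+ n * (1 + lam * enorm x) ^+ n.+2 * (1 + lam * enorm y) ^- n.+2.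
Proof.
move=> l0; rewrite /kern -mulrA ler_wpM2l ?exprn_ge0 ?(ltW l0)//.
rewrite ler_pdivlMr ?jap_lam_gt0// ler_pdivrMl ?jap_lam_gt0//.
apply: (@jap_submul _ (x - y) x) => //.
rewrite -[X in enorm X](subrK x); apply: le_trans (ler_enormD _ _) _.
by rewrite enormB lerD2l.
Qed.

Lemma kern_jap_le lam (x y : E) : 0 < lam ->
  kern lam (x - y) <= lam ^+ n * (1 + lam * enorm x) ^- n.+2 * (1 + lam * enorm y) ^+ n.+2.
Proof.
move=> l0; rewrite /kern -mulrA ler_wpM2l ?exprn_ge0 ?(ltW l0)//.
rewrite [leRHS]mulrC ler_pdivlMr ?jap_lam_gt0// ler_pdivrMl ?jap_lam_gt0//.
apply: jap_submul => //.
by rewrite -{1}(subrK y x); exact: ler_enormD.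
Qed.

Lemma jap_le_mono lam mu' (x : E) N : 0 < lam -> lam <= mu' ->
  (1 + lam * enorm x) ^+ N <= (1 + mu' * enorm x) ^+ N.
Proof.
move=> l0 lm; have m0 := lt_le_trans l0 lm.
have j0 c : 0 < c -> 0 <= 1 + c * enorm x by move=> c0; rewrite addr_ge0// mulr_ge0 ?enorm_ge0// ltW.
by rewrite lerXn2r ?nnegrE ?j0// lerD2l ler_wpM2r ?enorm_ge0.
Qed.

(** Averaging first, over the larger width 1/lam: v^2 grows no faster than (1 + lam |x|)^(2(n+2))
    and is of size lam^(n + 2 sig) M near 0. The localising factor, squared, absorbs this growth and
    leaves (1 + mu' |x|)^(-2(n+2)), of weighted volume mu'^(-(n + 2 sig)). *)
Lemma conv_localized_le (sig : R) : `|sig| <= 1 -> exists2 C : R, 0 < C & forall lam mu' u v w M,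
  0 < lam -> lam <= mu' -> mfun u -> mfun v -> (forall x, 0 <= u x) -> (forall x, 0 <= v x) ->
  (forall x, (v x)%:E <= integ (fun y => kern lam (x - y) * u y)%R)%E ->
  mfun w -> (forall x, 0 <= w x <= (1 + mu' * enorm x) ^- (2 * n.+2) * v x) ->
  (wnorm sig u <= M%:E)%E ->
  (wnorm sig w <= (C * (lam / mu') `^ (n%:R - 2 * `|sig|) * M)%:E)%E.
Proof.
move=> s1; have [C C0 hC] := sqr_conv_le s1; have [C' C'0 hC'] := @integ_jap_powR _ _ n3 _ s1.
exists (C * C'); first exact: mulr_gt0.
move=> lam m u v w M l0 lm mu' mv u0 v0 vu mw hw uM; have m0 := lt_le_trans l0 lm.
have M0 : 0 <= M by rewrite -lee_fin; apply: le_trans uM; exact: wnorm_ge0.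
have p0 (x : E) N : 0 <= (1 + lam * enorm x) ^- N by rewrite invr_ge0 ltW// jap_lam_gt0.
have p0' (x : E) N : 0 <= (1 + m * enorm x) ^- N by rewrite invr_ge0 ltW// jap_lam_gt0.
have vb x : v x ^+ 2 <= (lam ^+ n * (1 + lam * enorm x) ^+ n.+2) ^+ 2 * (C * lam `^ (- (n%:R - 2 * sig)) * M).
  have : 0 < lam ^+ n * (1 + lam * enorm x) ^+ n.+2 by apply: mulr_gt0; [exact: exprn_gt0|exact: jap_lam_gt0].
  set c := lam ^+ n * _ => c0.
  rewrite -ler_pdivrMl ?exprn_gt0// -exprVn -exprMn.
  apply: (hC lam u) => //; first by rewrite mulr_ge0// invr_ge0 ltW.
  rewrite EFinM lee_pdivrMl//.
  rewrite -integZ ?(ltW c0)//; last 2 first.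
  - by apply: mfunM => //; exact: mfun_jap_lam.
  - by move=> y; rewrite mulr_ge0.
  apply: (le_trans (vu x)); apply: le_integ.
  - by apply: mfunM => //; exact: mfun_kernB.
  - by apply: mfunZ; apply: mfunM => //; exact: mfun_jap_lam.
  - by move=> y; rewrite mulr_ge0 ?kern_ge0.
  by move=> y; rewrite mulrA ler_wpM2r// jap_kern_le.
pose c := lam ^+ n * lam ^+ n * (C * lam `^ (- (n%:R - 2 * sig)) * M).
have c0 : 0 <= c by rewrite !mulr_ge0 ?exprn_ge0 ?powR_ge0 ?(ltW l0) ?(ltW C0).
have wb x : w x ^+ 2 <= c * (1 + m * enorm x) ^- (2 * n.+2).
  have /andP[w0 wv] := hw x.
  apply: (@le_trans _ _ (((1 + m * enorm x) ^- (2 * n.+2) * v x) ^+ 2)).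
    by rewrite lerXn2r ?nnegrE ?mulr_ge0.
  rewrite exprMn; apply: (le_trans (ler_wpM2l (sqr_ge0 _) (vb x))).
  have lx : (1 + lam * enorm x) ^+ n.+2 <= (1 + m * enorm x) ^+ n.+2 by exact: jap_le_mono.
  set Z := C * _ * M; have Z0 : 0 <= Z by rewrite !mulr_ge0 ?powR_ge0 ?(ltW C0).
  rewrite /c -/Z; set a := (1 + lam * enorm x) ^+ n.+2 in lx *.
  have a0 : 0 < a by exact: jap_lam_gt0.
  set b := (1 + m * enorm x) ^+ n.+2 in lx *.
  have -> : (1 + m * enorm x) ^+ (2 * n.+2) = b ^+ 2 by rewrite -exprM mulnC.
  have b0 : 0 < b by exact: jap_lam_gt0.
  have -> : (b ^- 2) ^+ 2 * ((lam ^+ n * a) ^+ 2 * Z) = lam ^+ n * lam ^+ n * Z * b ^- 2 * (a / b) ^+ 2.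
    by field; rewrite gt_eqF.
  rewrite ler_piMr//; first by rewrite mulr_ge0 ?invr_ge0 ?sqr_ge0// mulr_ge0// mulr_ge0// exprn_ge0// ltW.
  by rewrite exprn_ile1 ?divr_ge0 ?(ltW a0) ?(ltW b0)// ler_pdivrMr// mul1r.
apply: (@le_trans _ _ (integ (fun x => c * ((1 + m * enorm x) ^- (2 * n.+2) * enorm x `^ (2 * sig)))%R)).
  apply: le_integ.
  - exact: mfun_wnorm.
  - by apply: mfunZ; apply: mfunM; [exact: mfun_jap_lam|exact: mfun_powR].
  - by move=> x; rewrite mulr_ge0 ?powR_ge0 ?sqr_ge0.
  by move=> x; rewrite [leRHS]mulrA [leLHS]mulrC ler_wpM2r ?powR_ge0.
rewrite integZ//; last 2 first.
- by apply: mfunM; [exact: mfun_jap_lam|exact: mfun_powR].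
- by move=> x; rewrite mulr_ge0 ?powR_ge0.
apply: (le_trans (lee_wpmul2l _ (hC' m m0))); first by rewrite lee_fin.
rewrite -EFinM lee_fin /c.
have -> : lam ^+ n * lam ^+ n * (C * lam `^ (- (n%:R - 2 * sig)) * M) * (C' * m `^ (- (n%:R + 2 * sig))) =
  C * C' * (lam `^ (n%:R + 2 * sig) * m `^ (- (n%:R + 2 * sig))) * M.
  have -> : lam `^ (n%:R + 2 * sig) = lam ^+ n * lam ^+ n * lam `^ (- (n%:R - 2 * sig)).
    rewrite -(powR_mulrn n (ltW l0)) -!powRD ?(gt_eqF l0) ?implybT//; congr (_ `^ _); ring.
  by ring.
rewrite ler_wpM2r// ler_wpM2l ?mulr_ge0 ?(ltW C0) ?(ltW C'0)//.
by rewrite powR_ratio//; apply: powR_ratio_le => //; have := ler_norm (- sig); rewrite normrN; lra.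
Qed.

(** The transposed order: localise at width 1/mu', then average over the larger width 1/lam. The
    localised function lives near 0, so the kernel can be evaluated there, which leaves a profile at
    width 1/lam times one integral of u; the ratio now has exponent n - 2 sig. *)
Lemma conv_localized_dual_le (sig : R) : `|sig| <= 1 -> exists2 C : R, 0 < C & forall lam mu' u v w M,
  0 < lam -> lam <= mu' -> mfun u -> mfun v -> (forall x, 0 <= u x) -> (forall x, 0 <= v x) ->
  mfun w -> (forall x, 0 <= w x <= (1 + mu' * enorm x) ^- (2 * n.+2) * u x) ->
  (forall x, (v x)%:E <= integ (fun y => kern lam (x - y) * w y)%R)%E ->
  (wnorm sig u <= M%:E)%E ->
  (wnorm sig v <= (C * (lam / mu') `^ (n%:R - 2 * `|sig|) * M)%:E)%E.
Proof.
move=> s1; have [C C0 hC] := sqr_conv_le s1; have [C' C'0 hC'] := @integ_jap_powR _ _ n3 _ s1.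
exists (C * C'); first exact: mulr_gt0.
move=> lam m u v w M l0 lm mu' mv u0 v0 mw hw vu uM; have m0 := lt_le_trans l0 lm.
have M0 : 0 <= M by rewrite -lee_fin; apply: le_trans uM; exact: wnorm_ge0.
have p0 (x : E) N : 0 <= (1 + lam * enorm x) ^- N by rewrite invr_ge0 ltW// jap_lam_gt0.
have p0' (x : E) N : 0 <= (1 + m * enorm x) ^- N by rewrite invr_ge0 ltW// jap_lam_gt0.
set Z := C * m `^ (- (n%:R - 2 * sig)) * M; have Z0 : 0 <= Z by rewrite !mulr_ge0 ?powR_ge0 ?(ltW C0).
have vb x : v x ^+ 2 <= (lam ^+ n * (1 + lam * enorm x) ^- n.+2) ^+ 2 * Z.
  have : 0 < lam ^+ n * (1 + lam * enorm x) ^- n.+2.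
    by apply: mulr_gt0; [exact: exprn_gt0|rewrite invr_gt0; exact: jap_lam_gt0].
  set c := lam ^+ n * _ => c0.
  rewrite -ler_pdivrMl ?exprn_gt0// -exprVn -exprMn.
  apply: (hC m u) => //; first by rewrite mulr_ge0// invr_ge0 ltW.
  rewrite EFinM lee_pdivrMl//.
  rewrite -integZ ?(ltW c0)//; last 2 first.
  - by apply: mfunM => //; exact: mfun_jap_lam.
  - by move=> y; rewrite mulr_ge0.
  apply: (le_trans (vu x)); apply: le_integ.
  - by apply: mfunM => //; exact: mfun_kernB.
  - by apply: mfunZ; apply: mfunM => //; exact: mfun_jap_lam.
  - by move=> y; have /andP[w0 _] := hw y; rewrite mulr_ge0 ?kern_ge0.
  move=> y; have /andP[w0 wu] := hw y.
  apply: (le_trans (ler_wpM2l (kern_ge0 _ l0) wu)).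
  rewrite mulrA [leRHS]mulrA ler_wpM2r//.
  apply: (le_trans (ler_wpM2r (p0' _ _) (kern_jap_le x y l0))).
  rewrite -/c -mulrA ler_wpM2l ?(ltW c0)//.
  rewrite ler_pdivrMr ?jap_lam_gt0// mul2n -addnn exprD mulrA mulVf ?lt0r_neq0 ?jap_lam_gt0// mul1r.
  exact: jap_le_mono.
pose c := lam ^+ n * lam ^+ n * Z.
have c0 : 0 <= c by rewrite /c mulr_ge0// mulr_ge0// exprn_ge0// ltW.
have wb x : v x ^+ 2 <= c * (1 + lam * enorm x) ^- (2 * n.+2).
  apply: (le_trans (vb x)); rewrite /c (_ : (1 + lam * enorm x) ^- (2 * n.+2) = ((1 + lam * enorm x) ^- n.+2) ^+ 2).
    by rewrite le_eqVlt; apply/orP; left; apply/eqP; ring.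
  by rewrite -exprVn -exprVn -exprM mulnC.
apply: (@le_trans _ _ (integ (fun x => c * ((1 + lam * enorm x) ^- (2 * n.+2) * enorm x `^ (2 * sig)))%R)).
  apply: le_integ.
  - exact: mfun_wnorm.
  - by apply: mfunZ; apply: mfunM; [exact: mfun_jap_lam|exact: mfun_powR].
  - by move=> x; rewrite mulr_ge0 ?powR_ge0 ?sqr_ge0.
  by move=> x; rewrite [leRHS]mulrA [leLHS]mulrC ler_wpM2r ?powR_ge0.
rewrite integZ//; last 2 first.
- by apply: mfunM; [exact: mfun_jap_lam|exact: mfun_powR].
- by move=> x; rewrite mulr_ge0 ?powR_ge0.
apply: (le_trans (lee_wpmul2l _ (hC' lam l0))); first by rewrite lee_fin.
rewrite -EFinM lee_fin /c /Z.
have -> : lam ^+ n * lam ^+ n * (C * m `^ (- (n%:R - 2 * sig)) * M) * (C' * lam `^ (- (n%:R + 2 * sig))) =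
  C * C' * (lam `^ (n%:R - 2 * sig) * m `^ (- (n%:R - 2 * sig))) * M.
  have -> : lam `^ (n%:R - 2 * sig) = lam ^+ n * lam ^+ n * lam `^ (- (n%:R + 2 * sig)).
    rewrite -(powR_mulrn n (ltW l0)) -!powRD ?(gt_eqF l0) ?implybT//; congr (_ `^ _); ring.
  by ring.
rewrite ler_wpM2r// ler_wpM2l ?mulr_ge0 ?(ltW C0) ?(ltW C'0)//.
by rewrite powR_ratio//; apply: powR_ratio_le => //; have := ler_norm sig; lra.
Qed.

End convolution_estimates.

(** * The off-diagonal estimate *)

Section multipliers.
Context (R : realType) (n : nat) (n3 : (3 <= n)%N).
Context (kap : R) (hkap : @inversion_constant R n kap).
Local Notation E := 'rV[R]_n.
Local Notation C := R[i].
Local Notation mu := (lebesgue_tuple R n).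
Local Notation pt := (@Defs.point R n).
Local Notation sb := (@schwartz_bound R n).
Implicit Types (b p A B th g h : E -> C) (u v : E -> R).

Definition dil (t : R) b : E -> C := fun x => b (t^-1 *: x).

(* The convolution operator whose kernel is a transform of A. *)
Definition convop A th : E -> C := FT 1 (fun x => A x * FT (-1) th x).

Definition snorm (sig : R) th : \bar R := wnorm sig (fun x => cabs (th x)).

Lemma one_neq0 : (1 : R) != 0. Proof. exact: oner_neq0. Qed.
Lemma neg1_neq0 : (-1 : R) != 0. Proof. by rewrite oppr_eq0 oner_neq0. Qed.

Lemma bump_dil t b : 0 < t -> bump b -> bump (dil t b).
Proof.
move=> t0 [sb [r br]]; split; first by have [] := cpartials_scale t^-1 sb.
exists (t * r) => x /br; rewrite enormZ gtr0_norm ?invr_gt0//.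
by rewrite ler_pdivrMl.
Qed.

Lemma schwartz_convop A th : bump A -> schwartz th -> schwartz (convop A th).
Proof.
move=> bA sth; apply: (schwartz_FT one_neq0); apply: schwartz_bumpM => //.
exact: (schwartz_FT neg1_neq0).
Qed.

Lemma FT_dil s t b xi : 0 < t -> cintegrable b ->
  FT s (dil t b) xi = (t ^+ n)%:C%C * FT s b (t *: xi).
Proof.
move=> t0 ib; have ti : 0 < t^-1 by rewrite invr_gt0.
by rewrite /dil (FT_scale s ti ib) invrK.
Qed.

Lemma mfun_cabs th : cmeasurable th -> mfun (fun x => cabs (th x)).
Proof. exact: measurable_cabs. Qed.

Lemma mfun_schwartz th : schwartz th -> mfun (fun x => cabs (th x)).
Proof. by move=> [sm _]; apply: mfun_cabs; exact: smooth_cmeasurable. Qed.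

(** The constant stands on the left because the weighted estimates assume domination by [kern] with
    constant one. *)
Lemma convop_kern_le b : bump b -> exists2 K : R, 0 < K & forall t th x, 0 < t -> schwartz th ->
  ((K^-1 * cabs (convop (dil t b) th x))%:E <= integ (fun y => kern t (x - y) * cabs (th y))%R)%E.
Proof.
move=> bb; have sF := schwartz_FT one_neq0 (bump_schwartz bb).
have [_ /(_ n.+2)[M hM]] := sF; have M0 := schwartz_bound_ge0 hM.
exists (M + 1) => [|t th x t0 sth]; first by rewrite ltr_wpDl.
have sd := bump_schwartz (bump_dil t0 bb).
rewrite EFinM lee_pdivrMl ?ltr_wpDl// /convop.
have [i0 ->] := @FT_mul_FT _ _ 1 (dil t b) th x sd sth.
apply: (le_trans (cabs_cintegral_le i0)).
have mk : mfun (fun y => kern t (x - y) * cabs (th y)).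
  by apply: mfunM; [exact: mfun_kernB|exact: mfun_schwartz].
rewrite -integZ ?addr_ge0//; last by move=> y; rewrite mulr_ge0 ?kern_ge0 ?cabs_ge0.
apply: (le_integ (u := fun y => cabs (FT 1 (dil t b) (x - y) * th y))).
- by apply: mfun_cabs; case/cintegrableP: i0.
- exact: mfunZ.
- by move=> y; exact: cabs_ge0.
move=> y; rewrite cabsM mulrA ler_wpM2r ?cabs_ge0//.
rewrite FT_dil//; last exact/schwartz_cintegrable/bump_schwartz.
rewrite cabsM cabs_real ger0_norm ?exprn_ge0 ?(ltW t0)// /kern mulrCA ler_wpM2l ?exprn_ge0 ?(ltW t0)//.
have := schwartz_boundP (t *: (x - y)) hM (isT : (size [::] <= n.+2)%N).
rewrite cpartials_nil enormZ gtr0_norm// => /le_trans; apply.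
by rewrite ler_wpM2r ?invr_ge0 ?(ltW (jap_lam_gt0 _ _ _))// lerDl.
Qed.

Lemma snormZ sig (c : R) u : mfun u -> wnorm sig (fun x => c * u x) = ((c ^+ 2)%:E * wnorm sig u)%E.
Proof.
move=> mu'; rewrite /wnorm -integZ ?sqr_ge0//.
- by apply: eq_integral => t _; rewrite exprMn mulrCA.
- exact: mfun_wnorm.
by move=> x; rewrite mulr_ge0 ?powR_ge0 ?sqr_ge0.
Qed.

Lemma snormZ_le sig (c M : R) u : 0 < c -> mfun u -> (wnorm sig (fun x => (c^-1 * u x)%R) <= M%:E)%E ->
  (wnorm sig u <= (c ^+ 2 * M)%:E)%E.
Proof.
move=> c0 mu'; rewrite snormZ// exprVn lee_pdivrMl ?exprn_gt0//.
Qed.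

Lemma snorm_convop_le sig b : `|sig| <= 1 -> bump b -> exists2 K : R, 0 < K & forall t th M, 0 < t ->
  schwartz th -> (snorm sig th <= M%:E)%E -> (snorm sig (convop (dil t b) th) <= (K * M)%:E)%E.
Proof.
move=> s1 bb; have [K1 K10 h1] := convop_kern_le bb; have [K2 K20 h2] := wnorm_conv_le n3 s1.
exists (K1 ^+ 2 * K2) => [|t th M t0 sth thM]; first by rewrite mulr_gt0 ?exprn_gt0.
rewrite -mulrA; have sC := schwartz_convop (bump_dil t0 bb) sth.
apply: (snormZ_le K10); first exact: mfun_schwartz.
apply: (h2 t (fun x => cabs (th x))) => //.
- exact: mfun_schwartz.
- by apply: mfunZ; exact: mfun_schwartz.
- by move=> x; exact: cabs_ge0.
- by move=> x; rewrite mulr_ge0 ?cabs_ge0// invr_ge0 ltW.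
- by move=> x; exact: h1.
Qed.

(* The gain in the off-diagonal estimate from a mismatch between the frequency scale of p
   and the spatial scales. *)
Definition omega (lam : R) : R := if lam <= 1 then lam else lam^-1.

Lemma omega_gt0 lam : 0 < lam -> 0 < omega lam.
Proof. by move=> l0; rewrite /omega; case: ifP => // _; rewrite invr_gt0. Qed.

(* The symbol of p(D/t) after its kernel is localised to |x| ~ m; by the uncertainty
   principle it is spread out at scale 1/m, and small when tm is far from 1. *)
Definition locsymb (chi p : E -> C) (m t : R) : E -> C :=
  fun xi => (kap^-1)%:C%C * FT 1 (fun x => dil m chi x * FT (-1) (dil t p) x) xi.

(** After rescaling, the truncated kernel is chi(y) P(lam y) with lam = t m and P the transform of
    [p]. For lam <= 1 boundedness suffices, since 1 <= lam^-n lam. For lam > 1 the vanishing of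
    [chi] near 0 puts lam |y| >= lam c1, and the decay of P gives the gain. *)
Lemma locsymb_le chi p (c1 : R) : bump chi -> 0 < c1 -> (forall x, enorm x < c1 -> chi x = 0) -> bump p ->
  exists2 K : R, 0 < K & forall m t x, 0 < m -> 0 < t ->
  cabs (locsymb chi p m t x) <= K * omega (t * m) * (1 + m * enorm x) ^- (2 * n.+2).
Proof.
move=> bchi c10 chi0 bp; pose P := FT (-1) p.
have sP : schwartz P by apply: (schwartz_FT neg1_neq0); exact: bump_schwartz.
have [k0 _] := hkap.
have [N [K1 [K10 h1]]] := @FT_bound R n 1 (2 * n.+2) one_neq0.
have [r chr] := bchi.2; have [K2 [K20 h2]] := bump_bounded bchi N.
(* N powers of decay pay for derivatives of P(lam y), n for the scaling factor lam^-n, and the last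
   one is the gain 1/lam. *)
pose L := (n + N).+1; have [smP bP] := sP; have [M1 hM1] := bP L; have M10 := schwartz_bound_ge0 hM1.
pose D := (1 + `|r|) ^+ N * (2 ^+ N * (K2 * (M1 * (1 + c1 ^- L)))).
have c1L : 0 <= c1 ^- L by rewrite invr_ge0 exprn_ge0// ltW.
have D0 : 0 <= D by rewrite !mulr_ge0 ?exprn_ge0 ?addr_ge0.
have hb lam : 0 < lam -> sb N (D * (lam ^- n * omega lam)) (fun y => chi y * P (lam *: y)).
  move=> l0 l y lN.
  have o0 := omega_gt0 l0.
  have ln0 : 0 < lam ^- n by rewrite invr_gt0 exprn_gt0.
  have R0 : 0 <= D * (lam ^- n * omega lam) by rewrite mulr_ge0// mulr_ge0 ?ltW.
  have [yc|cy] := ltP (enorm y) c1.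
    rewrite (cpartials_support (@open_enorm_lt R n c1)) ?cabs0 ?mulr0// => x xc.
    by rewrite chi0 ?mul0r.
  have [ry|yr] := ltP `|r| (enorm y).
    rewrite (cpartials_support (@open_enorm_gt R n `|r|)) ?cabs0 ?mulr0// => x /= xc.
    have [->|/chr] := eqVneq (chi x) 0; first by rewrite mul0r.
    by move=> xr; have := le_lt_trans (ler_norm r) xc; rewrite ltNge xr.
  have [smS ES] := cpartials_scale lam smP.
  have le1 : cabs (cpartials l (fun y => chi y * P (lam *: y)) y) <= 2 ^+ N * (K2 * (M1 * (1 + c1 ^- L) * (lam ^- n * omega lam))).
    apply: leibniz_bound => //; first by case: bchi.
      by move=> l' l'N; exact: h2.
    move=> l' l'N; rewrite ES cabsM cabs_real ger0_norm ?exprn_ge0 ?(ltW l0)//.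
    have l'L : (size l' <= L)%N by rewrite (leq_trans l'N)// /L leqW// leq_addl.
    have := schwartz_boundP (lam *: y) hM1 l'L; rewrite enormZ gtr0_norm// => h.
    apply: (le_trans (ler_wpM2l _ h)); first by rewrite exprn_ge0 ?(ltW l0).
    rewrite mulrCA -mulrA ler_wpM2l//.
    have j0 : 0 < 1 + lam * c1 by rewrite ltr_pwDl// mulr_ge0// ltW.
    apply: (@le_trans _ _ (lam ^+ size l' / (1 + lam * c1) ^+ L)).
      rewrite ler_wpM2l ?exprn_ge0 ?(ltW l0)// lef_pV2 ?posrE ?jap_lam_gt0 ?exprn_gt0//.
      rewrite lerXn2r ?nnegrE ?(ltW j0) ?addr_ge0 ?mulr_ge0 ?enorm_ge0 ?(ltW l0)//.
      by rewrite lerD2l ler_wpM2l// ltW.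
    rewrite /omega; case: (leP lam 1) => l1.
      apply: (@le_trans _ _ 1).
        rewrite ler_pdivrMr ?exprn_gt0// mul1r (@le_trans _ _ 1)//.
          by rewrite exprn_ile1// ltW.
        by rewrite exprn_ege1// lerDl mulr_ge0 ?ltW.
      rewrite (@le_trans _ _ (lam ^- n * lam))//; last by rewrite ler_peMl ?lerDl// mulr_ge0 ?ltW.
      rewrite mulrC ler_pdivlMr ?exprn_gt0// mul1r; case: n n3 => // n' _.
      by rewrite exprS ler_piMr ?(ltW l0)// exprn_ile1 ?(ltW l0).
    have l1' := ltW l1.
    apply: (@le_trans _ _ (lam ^+ N / (lam * c1) ^+ L)).
      rewrite ler_pM ?exprn_ge0 ?invr_ge0 ?exprn_ge0 ?(ltW l0) ?(ltW j0)//.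
        by rewrite ler_weXn2l.
      rewrite lef_pV2 ?posrE ?exprn_gt0 ?mulr_gt0//.
      by rewrite lerXn2r ?nnegrE ?mulr_ge0 ?(ltW j0) ?(ltW l0) ?(ltW c10)// lerDr.
    have -> : lam ^+ N / (lam * c1) ^+ L = c1 ^- L * (lam ^- n * lam^-1).
      rewrite /L exprMn exprS exprD; field.
      by rewrite !expf_neq0 ?gt_eqF.
    by rewrite ler_wpM2r ?lerDr// mulr_ge0 ?(ltW ln0)// invr_ge0 ltW.
  apply: (@le_trans _ _ ((1 + `|r|) ^+ N * (2 ^+ N * (K2 * (M1 * (1 + c1 ^- L) * (lam ^- n * omega lam)))))).
    rewrite ler_pM ?exprn_ge0 ?cabs_ge0 ?addr_ge0 ?enorm_ge0//.
    by rewrite lerXn2r ?nnegrE ?addr_ge0 ?enorm_ge0// lerD2l.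
  by rewrite /D le_eqVlt; apply/orP; left; apply/eqP; ring.
exists (kap^-1 * (K1 * D) + 1) => [|m t x m0 t0].
  by rewrite ltr_wpDl// mulr_ge0 ?invr_ge0 ?(ltW k0)// mulr_ge0.
have l0 : 0 < t * m by rewrite mulr_gt0.
pose h y := chi y * P (t * m *: y).
have sh : schwartz h.
  apply: bump_schwartz; apply: smooth_bumpM => //.
  by have [] := cpartials_scale (t * m) smP.
have E1 : (fun x => dil m chi x * FT (-1) (dil t p) x) = fun x => (t ^+ n)%:C%C * dil m h x.
  apply/funext => y; rewrite FT_dil//; last exact/schwartz_cintegrable/bump_schwartz.
  rewrite /dil /h mulrCA -/P; congr (_ * (_ * P _)).
  by rewrite scalerA mulfK ?gt_eqF.
rewrite /locsymb E1 cabsM cabs_real gtr0_norm ?invr_gt0//.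
have ih := schwartz_cintegrable sh.
have idh : cintegrable (dil m h).
  have m0' : 0 < m^-1 by rewrite invr_gt0.
  have [+ _] := cintegral_scale_point 0 m0' ih.
  by apply: eq_cintegrable => y; rewrite addr0.
rewrite FT_Z// FT_dil// !cabsM !cabs_real !ger0_norm ?exprn_ge0 ?(ltW t0) ?(ltW m0)//.
have := schwartz_boundP (m *: x) (h1 _ _ sh (hb _ l0)) (isT : (size [::] <= 2 * n.+2)%N).
rewrite cpartials_nil enormZ gtr0_norm// => hF.
rewrite [t ^+ n * _]mulrA -exprMn.
apply: (@le_trans _ _ (kap^-1 * ((t * m) ^+ n * (K1 * (D * ((t * m) ^- n * omega (t * m))) / (1 + m * enorm x) ^+ (2 * n.+2))))).
  by rewrite ler_wpM2l ?invr_ge0 ?(ltW k0)// ler_wpM2l ?exprn_ge0 ?(ltW l0).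
rewrite [leLHS](_ : _ = kap^-1 * (K1 * D) * omega (t * m) * (1 + m * enorm x) ^- (2 * n.+2)); last first.
  have := jap_lam_gt0 x (2 * n.+2) m0; set J := (1 + _) ^+ _ => J0.
  have : 0 < (t * m) ^+ n by rewrite exprn_gt0.
  set T := (t * m) ^+ n => T0.
  by field; rewrite !gt_eqF.
rewrite ler_wpM2r ?invr_ge0 ?(ltW (jap_lam_gt0 _ _ _))//.
by rewrite ler_wpM2r ?lerDl// ltW// omega_gt0.
Qed.

Lemma schwartz_locsymb chi p m t : bump chi -> bump p -> 0 < m -> 0 < t -> schwartz (locsymb chi p m t).
Proof.
move=> bc bp m0 t0; apply: schwartzZ; apply: (schwartz_FT one_neq0); apply: schwartz_bumpM; first exact: bump_dil.
by apply: (schwartz_FT neg1_neq0); apply: bump_schwartz; exact: bump_dil.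
Qed.

(* The kernel of p(D) matters only at x - y with A(x) and B(y) nonzero, so it may be
   truncated by chi there. *)
Lemma convop_locsymb chi p A B m t th : bump chi -> bump p -> bump B -> 0 < m -> 0 < t ->
  (forall x y, A x != 0 -> B y != 0 -> dil m chi (x - y) = 1) -> schwartz th ->
  convop A (fun x => dil t p x * convop B th x) = convop A (fun x => locsymb chi p m t x * convop B th x).
Proof.
move=> bc bp bB m0 t0 H sth; have [k0 hk] := hkap.
have sp : schwartz (dil t p) by apply: bump_schwartz; exact: bump_dil.
have sr := schwartz_locsymb bc bp m0 t0.
pose h x := B x * FT (-1) th x.
have sh : schwartz h by apply: schwartz_bumpM => //; exact: (schwartz_FT neg1_neq0).
have sc : schwartz (fun x => dil m chi x * FT (-1) (dil t p) x).
  by apply: schwartz_bumpM; [exact: bump_dil|exact: (schwartz_FT neg1_neq0)].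
have Er : FT (-1) (locsymb chi p m t) = fun x => dil m chi x * FT (-1) (dil t p) x.
  rewrite /locsymb FT_Z; last by apply: schwartz_cintegrable; exact: (schwartz_FT one_neq0).
  have [_ -> _ _] := hk _ sc; apply/funext => x.
  by rewrite mulrA -rmorphM/= mulVf ?gt_eqF// mul1r.
congr FT; apply/funext => x.
have [->|Ax] := eqVneq (A x) 0; first by rewrite !mul0r.
congr (_ * _); rewrite /convop -/h.
have [_ E1] := @FT_mul_FT _ _ (-1) _ h x sp sh; have [_ E2] := @FT_mul_FT _ _ (-1) _ h x sr sh.
rewrite opprK in E1 E2; rewrite E1 E2 Er; apply: eq_cintegral => y.
have [By|By] := eqVneq (B y) 0; first by rewrite /h By mul0r !mulr0.
by rewrite (H x y Ax By) mul1r.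
Qed.

Lemma schwartzM g h : schwartz g -> schwartz h -> schwartz (fun x => g x * h x).
Proof.
move=> [sg bg] [sh bh]; split; first exact: smoothM.
move=> N; have [M1 h1] := bg N; have [M2 h2] := bh (N + 0)%N.
exists (2 ^+ N * (M1 * M2)); apply: (schwartz_boundM (p := 0)) => // l x lN.
rewrite expr0 mulr1; apply: le_trans (schwartz_boundP x h1 lN) _.
by rewrite ler_piMr ?(schwartz_bound_ge0 h1)// invf_le1 ?jap_pow_gt0// exprn_ege1// jap_ge1.
Qed.

(** The smaller of a and d gives the wider kernel, and the gain comes from the interaction of that
    kernel with the localised symbol. For d <= a it acts before the symbol and [conv_localized_le]
    applies; for a < d it acts after it and the dual version does. The other convolution is merely
    bounded. *)
Lemma snorm_far_le sig chi p A B (c1 : R) : `|sig| <= 1 -> bump chi -> 0 < c1 ->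
  (forall x, enorm x < c1 -> chi x = 0) -> bump p -> bump A -> bump B ->
  exists2 K : R, 0 < K & forall (a d t : R) th M, 0 < a -> 0 < d -> 0 < t -> schwartz th ->
  (forall x y, dil a A x != 0 -> dil d B y != 0 -> dil (Num.max a d) chi (x - y) = 1) ->
  (snorm sig th <= M%:E)%E ->
  (snorm sig (convop (dil a A) (fun x => dil t p x * convop (dil d B) th x)%R) <=
   (K * omega (t * Num.max a d) ^+ 2 * (Num.min a d / Num.max a d) `^ (n%:R - 2 * `|sig|) * M)%:E)%E.
Proof.
move=> s1 bc c10 hc bp bA bB.
have [K1 K10 h1] := locsymb_le bc c10 hc bp.
have [KA KA0 hA] := snorm_convop_le s1 bA; have [KB KB0 hB] := snorm_convop_le s1 bB.
have [LA LA0 kA] := convop_kern_le bA; have [LB LB0 kB] := convop_kern_le bB.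
have [C1 C10 e1] := conv_localized_le n3 s1; have [C2 C20 e2] := conv_localized_dual_le n3 s1.
exists (K1 ^+ 2 * (KA * (LB ^+ 2 * C1) + LA ^+ 2 * (C2 * KB))) => [|a d t th M a0 d0 t0 sth H thM].
  by rewrite mulr_gt0 ?exprn_gt0// addr_gt0// !mulr_gt0 ?exprn_gt0.
have [ba bb] := (bump_dil a0 bA, bump_dil d0 bB).
have M0 : 0 <= M by rewrite -lee_fin; apply: le_trans thM; exact: wnorm_ge0.
have m0 : 0 < Num.max a d by rewrite lt_max a0.
rewrite (convop_locsymb bc bp bb m0 t0 H sth).
set m := Num.max a d in m0 *; set r := locsymb chi p m t; set v := convop (dil d B) th.
have sr : schwartz r by exact: schwartz_locsymb.
have sv : schwartz v by exact: schwartz_convop.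
have srv : schwartz (fun x => r x * v x) by exact: schwartzM.
have o0 : 0 < omega (t * m) by rewrite omega_gt0// mulr_gt0.
pose c := K1 * omega (t * m); have c0 : 0 < c by rewrite mulr_gt0.
have rle x : c^-1 * cabs (r x) <= (1 + m * enorm x) ^- (2 * n.+2).
  by rewrite ler_pdivrMl//; exact: h1.
set X := (Num.min a d / m) `^ (n%:R - 2 * `|sig|).
have X0 : 0 <= X by exact: powR_ge0.
have Y0 : 0 <= omega (t * m) ^+ 2 * X * M by apply: mulr_ge0 => //; apply: mulr_ge0 => //; exact: sqr_ge0.
have pA : 0 <= KA * (LB ^+ 2 * C1) by rewrite !mulr_ge0 ?exprn_ge0 ?(ltW KA0) ?(ltW LB0) ?(ltW C10).
have pB : 0 <= LA ^+ 2 * (C2 * KB) by rewrite !mulr_ge0 ?exprn_ge0 ?(ltW KB0) ?(ltW LA0) ?(ltW C20).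
have K10' : 0 <= K1 ^+ 2 by exact: sqr_ge0.
have [ad|ad] := leP d a.
  have em : m = a by rewrite /m; apply/max_idPl.
  have en : Num.min a d = d by apply/min_idPr.
  have w1 : (wnorm sig (fun x => (c * LB)^-1 * cabs (r x * v x))%R <= (C1 * X * M)%:E)%E.
    rewrite /X en; apply: (e1 d m (fun x => cabs (th x)) (fun x => LB^-1 * cabs (v x))) => //.
    - by rewrite em.
    - exact: mfun_schwartz.
    - by apply: mfunZ; exact: mfun_schwartz.
    - by move=> x; exact: cabs_ge0.
    - by move=> x; rewrite mulr_ge0 ?cabs_ge0// invr_ge0 ltW.
    - by move=> x; exact: kB.
    - by apply: mfunZ; exact: mfun_schwartz.
    move=> x; apply/andP; split.
      by rewrite mulr_ge0 ?cabs_ge0// invr_ge0 ltW// mulr_gt0.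
    by rewrite cabsM invfM mulrACA ler_wpM2r// mulr_ge0 ?cabs_ge0// invr_ge0 ltW.
  have {}w1 := snormZ_le (mulr_gt0 c0 LB0) (mfun_schwartz srv) w1.
  have := hA a _ _ a0 srv w1; move=> /le_trans; apply; rewrite lee_fin.
  rewrite [leLHS](_ : _ = K1 ^+ 2 * (KA * (LB ^+ 2 * C1)) * (omega (t * m) ^+ 2 * X * M)); last by rewrite /c; ring.
  rewrite [leRHS](_ : _ = K1 ^+ 2 * (KA * (LB ^+ 2 * C1) + LA ^+ 2 * (C2 * KB)) * (omega (t * m) ^+ 2 * X * M)); last by ring.
  by apply: ler_wpM2r => //; apply: ler_wpM2l => //; rewrite lerDl.
have em : m = d by rewrite /m; apply/max_idPr; exact: ltW.
have en : Num.min a d = a by apply/min_idPl; exact: ltW.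
have sA := schwartz_convop ba srv.
have w1 : (wnorm sig (fun x => (c * LA)^-1 * cabs (convop (dil a A) (fun x => r x * v x) x))%R <= (C2 * X * (KB * M))%:E)%E.
  rewrite /X en; apply: (e2 a m (fun x => cabs (v x)) _ (fun x => c^-1 * cabs (r x * v x))) => //.
  - by rewrite em ltW.
  - exact: mfun_schwartz.
  - by apply: mfunZ; exact: mfun_schwartz.
  - by move=> x; exact: cabs_ge0.
  - by move=> x; rewrite mulr_ge0 ?cabs_ge0// invr_ge0 ltW// mulr_gt0.
  - by apply: mfunZ; exact: mfun_schwartz.
  - move=> x; apply/andP; split; first by rewrite mulr_ge0 ?cabs_ge0// invr_ge0 ltW.
    by rewrite cabsM mulrA ler_wpM2r// cabs_ge0.
  - move=> x; rewrite invfM -mulrA EFinM lee_pdivrMl//.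
    apply: (le_trans (kA a _ x a0 srv)); rewrite -integZ ?(ltW c0)//.
    + by rewrite le_eqVlt; apply/orP; left; apply/eqP; apply: eq_integral => y _; rewrite mulrCA mulVKf ?gt_eqF.
    + by apply: mfunM; [exact: mfun_kernB|apply: mfunZ; exact: mfun_schwartz].
    + by move=> y; rewrite mulr_ge0 ?kern_ge0// mulr_ge0 ?cabs_ge0// invr_ge0 ltW.
  - exact: hB.
have {}w1 := snormZ_le (mulr_gt0 c0 LA0) (mfun_schwartz sA) w1.
apply: (le_trans w1); rewrite lee_fin.
rewrite [leLHS](_ : _ = K1 ^+ 2 * (LA ^+ 2 * (C2 * KB)) * (omega (t * m) ^+ 2 * X * M)); last by rewrite /c; ring.
rewrite [leRHS](_ : _ = K1 ^+ 2 * (KA * (LB ^+ 2 * C1) + LA ^+ 2 * (C2 * KB)) * (omega (t * m) ^+ 2 * X * M)); last by ring.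
by apply: ler_wpM2r => //; apply: ler_wpM2l => //; rewrite lerDr.
Qed.

End multipliers.

(** * Geometric sums over the integers and powers of two *)

Section geometric.
Context (R : realType).
Implicit Types (r : R).

Lemma geometric_int_le r (c : int) N : 0 < r < 1 ->
  \sum_(i < N) r ^+ `|i%:Z + c| <= 2 / (1 - r).
Proof.
move=> /andP[r0 r1]; have d0 : 0 < 1 - r by rewrite subr_gt0.
have rb k : 0 < r ^+ k <= 1 by rewrite exprn_gt0// exprn_ile1// ltW.
(* A discrete antiderivative: F(z+1) - F(z) = (1 - r) r^|z|. Its values lie in [-(1+r), 0], so the
   telescoped sum is at most (1 + r)/(1 - r). *)
pose F (z : int) : R := match z with Posz k => - r ^+ k | Negz k => r ^+ k.+2 - (1 + r) end.
have FS z : r ^+ `|z| <= (F (z + 1) - F z) / (1 - r).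
  rewrite ler_pdivlMr//; case: z => [k|[|k]].
  - by rewrite -PoszD addn1 /F absz_nat exprS le_eqVlt; apply/orP; left; apply/eqP; ring.
  - by rewrite /F /= !exprS expr0; lra.
  have -> : Negz k.+1 + 1 = Negz k by rewrite !NegzE; lia.
  rewrite (_ : `|Negz k.+1|%N = k.+2)//; rewrite /F !exprS le_eqVlt; apply/orP; left; apply/eqP; ring.
have H m : \sum_(i < m) r ^+ `|i%:Z + c| <= (F (m%:Z + c) - F c) / (1 - r).
  elim: m => [|m IH]; first by rewrite big_ord0 add0r subrr mul0r.
  rewrite big_ord_recr/=; apply: le_trans (lerD IH (FS _)) _.
  rewrite -mulrDl ler_wpM2r ?invr_ge0 ?(ltW d0)//.
  rewrite (_ : m.+1%:Z + c = m%:Z + c + 1); last by lia.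
  by rewrite addrC addrA subrK.
apply: (le_trans (H N)); rewrite ler_wpM2r ?invr_ge0 ?(ltW d0)//.
have Fb z : - (1 + r) <= F z <= 0.
  by case: z => k; rewrite /F; [have := rb k|have := rb k.+2; have : r ^+ k.+2 <= r * 1 by rewrite exprS ler_wpM2l ?(ltW r0)//; have /andP[_] := rb k.+1]; lra.
by have /andP[_ h1] := Fb (N%:Z + c); have /andP[h2 _] := Fb c; lra.
Qed.

Lemma pow2_gt0 (k : int) : 0 < (2 : R) ^ k. Proof. exact: exprz_gt0. Qed.

Lemma omega_pow2 (z : int) : omega ((2 : R) ^ z) = 2^-1 ^+ `|z|.
Proof.
case: z => [[|k]|k]; rewrite /omega.
- by rewrite expr0z lexx.
- have h : (1 : R) < 2 ^+ k.+1 by rewrite exprn_egt1//; lra.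
  by rewrite -exprnP leNgt h/= exprVn.
by rewrite NegzE -exprnN exprVn invf_le1 ?exprn_gt0// exprn_ege1//; lra.
Qed.

Lemma pow2_le (m k : int) : ((2 : R) ^ m <= 2 ^ k) = (m <= k).
Proof. by rewrite ler_eXz2l//; lra. Qed.

Lemma pow2_max (m k : int) : Num.max ((2 : R) ^ m) (2 ^ k) = 2 ^ (Num.max m k).
Proof.
have [mk|mk] := leP m k; first by apply/max_idPr; rewrite pow2_le.
by apply/max_idPl; rewrite pow2_le ltW.
Qed.

Lemma pow2_ratio (m k : int) : Num.min ((2 : R) ^ m) (2 ^ k) / Num.max ((2 : R) ^ m) (2 ^ k) = 2^-1 ^+ `|m - k|.
Proof.
have H (a b : int) : a <= b -> (2 : R) ^ a / 2 ^ b = 2^-1 ^+ `|a - b|.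
  move=> ab; rewrite invr_expz -expfzDr//.
  have -> : a - b = - (`|a - b|%N)%:Z by lia.
  by rewrite -exprnN abszN exprVn.
have [mk|mk] := leP m k.
  have h : (2 : R) ^ m <= 2 ^ k by rewrite pow2_le.
  by rewrite (min_idPl h) (max_idPr h) H.
have h : (2 : R) ^ k <= 2 ^ m by rewrite pow2_le ltW.
by rewrite (min_idPr h) (max_idPl h) H ?(ltW mk)// -abszN opprB.
Qed.

End geometric.

(** * Dyadic blocks and their sum over frequencies *)

Section key_estimate.
Context (R : realType) (n : nat) (n3 : (3 <= n)%N).
Context (kap : R) (hkap : @inversion_constant R n kap).
Context (phi : R -> R) (hphi : dyadic_profile phi).
Local Notation E := 'rV[R]_n.
Local Notation C := R[i].
Local Notation mu := (lebesgue_tuple R n).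
Local Notation pt := (@Defs.point R n).
Local Notation cut := (@cutoff R n phi).
Implicit Types (b p A B th g h : E -> C) (u v : E -> R).

Lemma dil_cut t c x : 0 < t -> dil t (cut c) x = cut (t * c) x.
Proof.
move=> t0; rewrite /dil /cutoff enormZ gtr0_norm ?invr_gt0//.
congr ((Psi phi _)%:C%C); rewrite invfM; ring.
Qed.

(* [fat] equals 1 on the support of [thin]. *)
Definition fat : E -> C := fun x => cut 2 x - cut 4^-1 x.
Definition thin : E -> C := dyadic_cutoff phi 0.
Definition Qfat (m : int) : E -> C := dil (2 ^ m) fat.

Lemma bump_fat : bump fat.
Proof. by apply: bumpB; apply: bump_cut. Qed.

Lemma bump_thin : bump thin. Proof. exact: bump_dyadic. Qed.

Lemma dyadic_dil k : dyadic_cutoff phi k = dil (2 ^ k) thin.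
Proof.
apply/funext => x; rewrite /dil /thin /dyadic_cutoff expr0z divr1 enormZ gtr0_norm ?invr_gt0 ?pow2_gt0//.
by rewrite mulrC.
Qed.

Lemma fat_thin m x : Qfat m x * dyadic_cutoff phi m x = dyadic_cutoff phi m x.
Proof.
rewrite dyadic_dil /Qfat /dil; set y := _ *: x.
have [h|h] := leP (enorm y) 2^-1.
  by rewrite /thin /dyadic_cutoff expr0z divr1 (profile_small hphi h) mulr0.
have [h'|h'] := leP 2 (enorm y).
  by rewrite /thin /dyadic_cutoff expr0z divr1 (profile_large hphi h') mulr0.
rewrite /fat (cut_eq1 hphi) ?(cut_eq0 hphi) ?subr0 ?mul1r//; last exact: ltW.
by apply: le_trans (ltW h); lra.
Qed.

Lemma fat_support t x : 0 < t -> dil t fat x != 0 -> t / 4 < enorm x < 4 * t.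
Proof.
move=> t0; rewrite /dil /fat; set y := _ *: x => h.
have -> : enorm x = t * enorm y by rewrite enormZ gtr0_norm ?invr_gt0// mulVKf ?gt_eqF.
have : 4^-1 < enorm y < 4.
  apply: contraNT h; rewrite negb_and -!leNgt => /orP[h|h].
    by rewrite !(cut_eq1 hphi) ?subrr//; lra.
  by rewrite !(cut_eq0 hphi) ?subrr//; lra.
by move=> /andP[h1 h2]; rewrite ltr_pM2l// h1/= mulrC ltr_pM2r.
Qed.

Lemma thin_support t x : 0 < t -> dil t thin x != 0 -> t / 2 < enorm x < 2 * t.
Proof.
move=> t0; rewrite /dil /thin /dyadic_cutoff expr0z divr1; set y := _ *: x => h.
have -> : enorm x = t * enorm y by rewrite enormZ gtr0_norm ?invr_gt0// mulVKf ?gt_eqF.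
have : 2^-1 < enorm y < 2.
  apply: contraNT h; rewrite negb_and -!leNgt => /orP[h|h].
    by rewrite (profile_small hphi h).
  by rewrite (profile_large hphi h).
by move=> /andP[h1 h2]; rewrite ltr_pM2l// h1/= mulrC ltr_pM2r.
Qed.

Definition chi : E -> C := fun x => cut 16 x - cut 16^-1 x.

Lemma chi_eq1 t x : 0 < t -> t / 8 <= enorm x <= 16 * t -> dil t chi x = 1.
Proof.
move=> t0; rewrite /dil /chi; set y := _ *: x.
have -> : enorm x = t * enorm y by rewrite enormZ gtr0_norm ?invr_gt0// mulVKf ?gt_eqF.
rewrite ler_pM2l// [16 * t]mulrC ler_pM2l// => /andP[h1 h2].
by rewrite (cut_eq1 hphi)// (cut_eq0 hphi) ?subr0//; lra.
Qed.

(** The ratio 16 keeps |x - y| above max(a, d)/8: if 16 d <= a, then |x| > a/4 and |y| < 2d <= a/8;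
    if 16 a <= d, then |y| > d/2 and |x| < 4a <= d/4. *)
Lemma chi_separated a d x y : 0 < a -> 0 < d -> 16 * d <= a \/ 16 * a <= d ->
  dil a fat x != 0 -> dil d thin y != 0 -> dil (Num.max a d) chi (x - y) = 1.
Proof.
move=> a0 d0 sep /(fat_support a0)/andP[x1 x2] /(thin_support d0)/andP[y1 y2].
have t1 := ler_enormD (x - y) y; rewrite subrK in t1.
have t2 := ler_enormD (y - x) x; rewrite subrK enormB in t2.
have t3 := ler_enormD x (- y); rewrite enormN in t3.
apply: chi_eq1; first by rewrite lt_max a0.
case: sep => h.
  by rewrite (max_idPl _); [apply/andP; split; lra|lra].
by rewrite (max_idPr _); [apply/andP; split; lra|lra].
Qed.

(* Q_m p(D) Q_k seen from the frequency side, with the fattened cutoff at 2^m. *)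
Definition blockop (p : E -> C) (m k : int) th : E -> C :=
  convop (Qfat m) (fun x => p x * convop (dyadic_cutoff phi k) th x).

Lemma snorm_blockop_far sig p : `|sig| <= 1 -> bump p -> exists2 K : R, 0 < K &
  forall (m k j : int) th M, (4 <= `|m - k|)%N -> schwartz th -> (snorm sig th <= M%:E)%E ->
  (snorm sig (blockop (dil (2 ^ j)%R p) m k th) <=
    (K * 2^-1 ^+ `|(j + Num.max m k)%R|%N * (2^-1 ^+ `|(m - k)%R|%N) `^ (n%:R - 2 * `|sig|) * M)%:E)%E.
Proof.
move=> s1 bp.
have bchi : bump chi by apply: bumpB; apply: bump_cut.
have c1 : 0 < 16^-1 :> R by rewrite invr_gt0.
have hchi (x : E) : enorm x < 16^-1 -> chi x = 0.
  by move=> h; rewrite /chi !(cut_eq1 hphi) ?subrr//; lra.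
have [K K0 hK] := snorm_far_le n3 hkap s1 bchi c1 hchi bp bump_fat bump_thin.
exists K => // m k j th M mk sth thM.
have M0 : 0 <= M by rewrite -lee_fin; apply: le_trans thM; exact: wnorm_ge0.
rewrite /blockop dyadic_dil.
have sep : 16 * (2 : R) ^ k <= 2 ^ m \/ 16 * (2 : R) ^ m <= 2 ^ k.
  have e4 : (16 : R) = 2 ^ (4%:Z) by rewrite -exprnP; lra.
  rewrite e4 -!expfzDr// !pow2_le; lia.
have := hK _ _ _ th M (pow2_gt0 R m) (pow2_gt0 R k) (pow2_gt0 R j) sth
  (fun x y => chi_separated (pow2_gt0 R m) (pow2_gt0 R k) sep) thM.
move=> /le_trans; apply; rewrite lee_fin pow2_max -expfzDr// omega_pow2 -pow2_max pow2_ratio.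
do 2 (apply: ler_wpM2r; rewrite ?powR_ge0//).
(* One of the two factors [omega] is dropped; the other still sums over the frequencies. *)
rewrite ler_wpM2l ?(ltW K0)// expr2 ler_piMl ?exprn_ge0// ?invr_ge0//.
by rewrite exprn_ile1// ?invr_ge0//; lra.
Qed.

Lemma snorm_convop_leE sig b : `|sig| <= 1 -> bump b -> exists2 K : R, 0 < K & forall t th, 0 < t ->
  schwartz th -> (snorm sig (convop (dil t b) th) <= K%:E * snorm sig th)%E.
Proof.
move=> s1 bb; have [K K0 hK] := snorm_convop_le n3 s1 bb; exists K => // t th t0 sth.
have := wnorm_ge0 sig (fun x => cabs (th x)); rewrite -/(snorm sig th).
case E0 : (snorm sig th) => [M| |]//= _; last by rewrite gt0_muley ?lte_fin// leey.
by rewrite -EFinM; apply: hK => //; rewrite E0.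
Qed.

(** Bounded overlap replaces orthogonality: the factors a_i multiply on the frequency side, where
    the norm is a weighted integral of pointwise squares. *)
Lemma snorm_sum_le sig N (a : 'I_N -> E -> C) (v : E -> C) (K : R) : 0 <= K -> (forall i, cmeasurable (a i)) ->
  cmeasurable v -> (forall x, \sum_(i < N) cabs (a i x) ^+ 2 <= K) ->
  (\sum_(i < N) snorm sig (fun x => (a i x * v x)%R) <= K%:E * snorm sig v)%E.
Proof.
move=> K0 ma mv aK.
have mm i : mfun (fun x => cabs (a i x * v x)) by apply: mfun_cabs; exact: cmeasurableM.
rewrite /snorm /wnorm /integ -ge0_integral_sum//; last 2 first.
- by move=> i; apply/measurable_EFinP; exact: (mfun_wnorm sig (mm i)).
- by move=> i t _; rewrite lee_fin mulr_ge0 ?powR_ge0 ?sqr_ge0.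
rewrite -ge0_integralZl_EFin//; last 2 first.
- by move=> t _; rewrite lee_fin mulr_ge0 ?powR_ge0 ?sqr_ge0.
- by apply/measurable_EFinP; exact: (mfun_wnorm sig (mfun_cabs mv)).
apply: ge0_le_integral => //.
- by move=> t _; apply: sume_ge0 => i _; rewrite lee_fin mulr_ge0 ?powR_ge0 ?sqr_ge0.
- by apply: emeasurable_sum => i; apply/measurable_EFinP; exact: (mfun_wnorm sig (mm i)).
- by apply: measurable_funeM; apply/measurable_EFinP; exact: (mfun_wnorm sig (mfun_cabs mv)).
move=> t _; rewrite sumEFin -EFinM lee_fin.
under eq_bigr do rewrite cabsM exprMn mulrCA.
by rewrite -mulr_suml ler_wpM2r// mulr_ge0 ?powR_ge0 ?sqr_ge0.
Qed.

(** The fattened cutoff spans three dyadic steps, so it equals f(i+3) - f(i) for a nondecreasing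
    sequence f in [0, 1]. Its square is at most itself, and the sum telescopes to at most 3. *)
Lemma sum_fat_le (J : nat) x : \sum_(i < (2 * J).+1) cabs (Qfat (i%:Z - J%:Z) x) ^+ 2 <= 3.
Proof.
pose f (z : nat) : R := Psi phi (enorm x / (2 ^ (z%:Z - J%:Z - 2))).
have f01 z : 0 <= f z <= 1 by rewrite Psi_ge0 ?Psi_le1.
have E1 (i : nat) : Qfat (i%:Z - J%:Z) x = (f i.+3 - f i)%:C%C.
  rewrite /Qfat rmorphB/=; have p0 := pow2_gt0 R (i%:Z - J%:Z).
  transitivity (cut (2 ^ (i%:Z - J%:Z) * 2) x - cut (2 ^ (i%:Z - J%:Z) * 4^-1) x).
    by rewrite -!dil_cut.
  rewrite /cutoff /f; congr ((Psi phi (_ / _))%:C%C - (Psi phi (_ / _))%:C%C).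
    rewrite -{2}(expr1z 2) -expfzDr//; congr (_ ^ _); lia.
  rewrite (_ : 4 = 2 ^+ 2); last by lra.
  by rewrite exprnN -expfzDr.
have H m : \sum_(i < m) (f i.+3 - f i) = f m + f m.+1 + f m.+2 - (f 0 + f 1 + f 2).
  by elim: m => [|m IH]; [rewrite big_ord0 subrr|rewrite big_ord_recr/= IH; ring].
apply: (@le_trans _ _ (\sum_(i < (2 * J).+1) (f i.+3 - f i))).
  apply: ler_sum => i _; rewrite E1 cabs_real.
  have mono : f i <= f i.+3.
    have H1 z : f z <= f z.+1.
      rewrite -subr_ge0 /f; set r := enorm x / 2 ^ (z.+1%:Z - J%:Z - 2).
      rewrite (_ : enorm x / _ = 2 * r); first by rewrite PsiB// profile_ge0.
      rewrite /r (_ : z.+1%:Z - J%:Z - 2 = (z%:Z - J%:Z - 2) + 1); last by lia.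
      set w := z%:Z - J%:Z - 2; have -> : (2 : R) ^ (w + 1) = 2 ^ w * 2 by rewrite expfzDr.
      have : (2 : R) ^ w != 0 by rewrite gt_eqF// pow2_gt0.
      by move=> w0; field.
    exact: le_trans (H1 _) (le_trans (H1 _) (H1 _)).
  rewrite ger0_norm ?subr_ge0// expr2 ler_piMr ?subr_ge0//.
  by have := f01 i; have := f01 i.+3; lra.
rewrite H; have := f01 (2 * J).+1; have := f01 (2 * J).+2; have := f01 (2 * J).+3.
have := f01 0; have := f01 1; have := f01 2; lra.
Qed.

Lemma schwartz_blockop p m k th : bump p -> schwartz th -> schwartz (blockop p m k th).
Proof.
move=> bp sth; apply: schwartz_convop; first by apply: bump_dil (pow2_gt0 _ _) bump_fat.
by apply: schwartz_bumpM => //; apply: schwartz_convop => //; exact: bump_dyadic.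
Qed.

(** For |m - k| >= 4 the decay in |j + max(m, k)| is summed over j. Close to the diagonal both
    convolutions are merely bounded, and the sum over j comes from the bounded overlap of the
    frequency cutoffs between them. *)
Lemma snorm_blockop_sum sig : `|sig| <= 1 -> exists2 K : R, 0 < K &
  forall (m k : int) J th M, schwartz th -> (snorm sig th <= M%:E)%E ->
  (\sum_(i < (2 * J).+1) snorm sig (blockop (Qfat (i%:Z - J%:Z)%R) m k th) <=
    (K * (2^-1 ^+ `|(m - k)%R|%N) `^ (n%:R - 2 * `|sig|) * M)%:E)%E.
Proof.
move=> s1; have n3' : (3 : R) <= n%:R by rewrite ler_nat.
have [K1 K10 h1] := snorm_blockop_far s1 bump_fat.
have [KA KA0 hA] := snorm_convop_leE s1 bump_fat; have [KB KB0 hB] := snorm_convop_leE s1 bump_thin.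
pose e := n%:R - 2 * `|sig|; have e0 : 0 <= e by rewrite /e; lra.
(* The value of the off-diagonal factor at |m - k| = 3, its least one in the near case; dividing by
   it inserts the factor for free. *)
pose c3 := (2^-1 ^+ 3) `^ e : R; have c30 : 0 < c3 by rewrite powR_gt0// exprn_gt0// invr_gt0.
exists (K1 * 4 + KA * 3 * KB / c3) => [|m k J th M sth thM].
  by rewrite addr_gt0// ?mulr_gt0 ?invr_gt0.
have M0 : 0 <= M by rewrite -lee_fin; apply: le_trans thM; exact: wnorm_ge0.
set X := (2^-1 ^+ _) `^ _; have X0 : 0 <= X by exact: powR_ge0.
have [far|near] := leqP 4 `|m - k|%N.
  apply: (@le_trans _ _ (\sum_(i < (2 * J).+1) (K1 * 2^-1 ^+ `|(i%:Z - J%:Z + Num.max m k)%R|%N * X * M)%:E)%E).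
    by apply: lee_sum => i _; exact: h1.
  rewrite sumEFin lee_fin -!mulr_suml -mulr_sumr.
  apply: ler_wpM2r => //; apply: ler_wpM2r => //.
  apply: (@le_trans _ _ (K1 * 4)); last by rewrite lerDl// !mulr_ge0 ?invr_ge0 ?(ltW KA0) ?(ltW KB0) ?(ltW c30).
  rewrite ler_wpM2l ?(ltW K10)//.
  under eq_bigr do rewrite -addrA.
  apply: (le_trans (geometric_int_le _ _ _)); first by apply/andP; split; lra.
  by rewrite ler_pdivrMr; lra.
have sv : schwartz (convop (dyadic_cutoff phi k) th) by apply: schwartz_convop => //; exact: bump_dyadic.
have sm (v : E -> C) : schwartz v -> cmeasurable v by case=> + _; exact: smooth_cmeasurable.
have bQ j : bump (Qfat j) by apply: bump_dil (pow2_gt0 _ _) bump_fat.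
apply: (@le_trans _ _ (\sum_(i < (2 * J).+1) (KA%:E * snorm sig (fun x => (Qfat (i%:Z - J%:Z) x * convop (dyadic_cutoff phi k) th x)%R)))%E).
  by apply: lee_sum => i _; apply: (hA (2 ^ m)); [exact: pow2_gt0|exact: schwartz_bumpM].
rewrite -ge0_sume_distrr; last by move=> i _; exact: wnorm_ge0.
apply: (@le_trans _ _ (KA%:E * (3%:E * (KB%:E * M%:E)))%E).
  apply: lee_wpmul2l; first by rewrite lee_fin ltW.
  apply: (le_trans (snorm_sum_le sig (K := 3) _ _ _ (fun x => sum_fat_le J x))) => //.
  - by move=> i; apply: sm; exact: bump_schwartz.
  - exact: sm.
  apply: lee_wpmul2l => //.
  rewrite dyadic_dil; apply: (le_trans (hB _ _ (pow2_gt0 _ k) sth)).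
  by apply: lee_wpmul2l => //; rewrite lee_fin ltW.
rewrite -!EFinM lee_fin mulrA mulrA; apply: ler_wpM2r => //.
apply: (@le_trans _ _ (KA * 3 * KB / c3 * X)); last by rewrite ler_wpM2r// lerDr !mulr_ge0 ?(ltW K10).
rewrite -[leRHS]mulrA ler_peMr//; first by rewrite !mulr_ge0 ?(ltW KA0) ?(ltW KB0).
rewrite mulrC ler_pdivlMr// mul1r /c3 /X ge0_ler_powR ?nnegrE ?exprn_ge0//.
by rewrite ler_wiXn2l//; lra.
Qed.

End key_estimate.

(** * Tempered functionals and homogeneous norms *)

Section null_sequences.
Context (R : realType) (n : nat) (n3 : (3 <= n)%N).
Context (phi : R -> R) (hphi : dyadic_profile phi).
Local Notation E := 'rV[R]_n.
Local Notation C := R[i].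
Local Notation mu := (lebesgue_tuple R n).
Local Notation pt := (@Defs.point R n).
Local Notation cut := (@cutoff R n phi).
Local Notation sb := (@schwartz_bound R n).
Implicit Types (b th g h : E -> C) (u : nat -> E -> C) (f : functional R n).

(** Convergence to 0 in the Schwartz topology, the only continuity that a tempered functional
    offers. *)
Definition snull u := (forall i, schwartz (u i)) /\
  forall N (e : R), 0 < e -> exists i0, forall i, (i0 <= i)%N -> sb N e (u i).

Lemma snull_tempered f u : tempered f -> snull u ->
  forall e : R, 0 < e -> exists i0, forall i, (i0 <= i)%N -> cabs (f (u i)) <= e.
Proof.
move=> [_ [N [K fK]]] [su hu] e e0.
have K0 : 0 < `|K| + 1 by rewrite ltr_wpDl.
have [i0 h] := hu N (e / (`|K| + 1)) (divr_gt0 e0 K0).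
exists i0 => i ii; apply: (le_trans (fK _ _ (su i) (h i ii))).
rewrite mulrCA ler_piMr ?(ltW e0)// ler_pdivrMr// mul1r.
by apply: (le_trans (ler_norm K)); rewrite lerDl.
Qed.

Lemma snull_le u v : (forall i, schwartz (v i)) ->
  (forall N, exists N' K, 0 <= K /\ forall i M, sb N' M (u i) -> sb N (K * M) (v i)) ->
  snull u -> snull v.
Proof.
move=> sv H [su hu]; split=> // N e e0; have [N' [K [K0 hK]]] := H N.
have K1 : 0 < K + 1 by rewrite ltr_wpDl.
have [i0 h] := hu N' (e / (K + 1)) (divr_gt0 e0 K1).
exists i0 => i ii; apply: schwartz_boundW (hK i _ (h i ii)) => //.
by rewrite mulrCA ler_piMr ?(ltW e0)// ler_pdivrMr// mul1r lerDl.
Qed.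

Lemma snull_FT s u : s != 0 -> snull u -> snull (fun i => FT s (u i)).
Proof.
move=> s0 nu; have [su _] := nu; apply: snull_le nu => [i|N]; first exact: schwartz_FT.
by have [N' [K [K0 hK]]] := @FT_bound R n s N s0; exists N', K; split=> // i M; exact: hK.
Qed.

Lemma snull_bumpM b u : bump b -> snull u -> snull (fun i x => b x * u i x).
Proof.
move=> bb nu; have [su _] := nu; apply: snull_le nu => [i|N]; first exact: schwartz_bumpM.
have [K [K0 hK]] := bump_bounded bb N.
exists (N + 0)%N, (2 ^+ N * K); split; first by rewrite mulr_ge0// exprn_ge0.
move=> i M hM; rewrite -mulrA; apply: (schwartz_boundM bb.1 (su i).1 _ hM).
by move=> l x lN; rewrite expr0 mulr1; exact: hK.
Qed.

Lemma snullZ c u : snull u -> snull (fun i x => c * u i x).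
Proof.
move=> nu; have [su _] := nu; apply: snull_le nu => [i|N]; first exact: schwartzZ.
exists N, (cabs c); split; first exact: cabs_ge0.
by move=> i M hM; apply: schwartz_boundZ => //; case: (su i).
Qed.

Lemma exprV_small (K e : R) : 0 <= K -> 0 < e -> exists i0, forall i, (i0 <= i)%N -> K * 2 ^- i <= e.
Proof.
move=> K0 e0; have [i0 h] := pow2_ge (K / e); exists i0 => i ii.
rewrite ler_pdivrMr ?exprn_gt0// mulrC -ler_pdivrMr//.
by apply: (le_trans h); rewrite ler_weXn2l//; lra.
Qed.

Lemma one_sub_cut_bound N : exists K : R, 0 <= K /\ forall J l x, (size l <= N)%N ->
  cabs (cpartials l (fun x => 1 - cut (2 ^+ J) x) x) <= K.
Proof.
have bc : bump (cut 1) by exact: bump_cut.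
have [K [K0 hK]] := bump_bounded bc N.
exists (1 + K); split=> [|J l x lN]; first by rewrite addr_ge0.
have t0 : 0 < (2 : R) ^+ J by rewrite exprn_gt0.
have sc : smooth (cut (2 ^+ J)) by have [] := bump_cut n hphi t0.
have smc : smooth (fun y => -1 * cut (2 ^+ J) y) by apply: smoothM => //; exact: smooth_cst.
have -> : (fun x => 1 - cut (2 ^+ J) x) = (fun x => 1 + -1 * cut (2 ^+ J) x) by apply/funext => y; rewrite mulN1r.
rewrite cpartialsD//; last exact: smooth_cst.
rewrite cpartialsZ// mulN1r; apply: (le_trans (ler_cabsD _ _)); rewrite cabsN lerD//.
  case/lastP: l lN => [|l i] lN; first by rewrite cpartials_nil cabs1.
  by rewrite cpartials_rcons cderive_cst cpartials_cst0 cabs0.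
have -> : cut (2 ^+ J) = fun y => cut 1 ((2 ^- J) *: y).
  by apply/funext => y; rewrite -[RHS]/(dil (2 ^+ J) (cut 1) y) dil_cut// mulr1.
have [_ ->] := cpartials_scale (2 ^- J) bc.1.
rewrite cabsM cabs_real ger0_norm ?exprn_ge0 ?invr_ge0//.
apply: (le_trans _ (hK l (2 ^- J *: x) lN)); rewrite ler_piMl ?cabs_ge0//.
by rewrite exprn_ile1 ?invr_ge0 ?exprn_ge0// invf_le1// exprn_ege1//; lra.
Qed.

Lemma schwartz_1B b th : bump b -> schwartz th -> schwartz (fun x => (1 - b x) * th x).
Proof.
move=> bb sth; have -> : (fun x => (1 - b x) * th x) = (fun x => th x - b x * th x).
  by apply/funext => x; rewrite mulrBl mul1r.
by apply: schwartzB => //; exact: schwartz_bumpM.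
Qed.

(** The factor 1 - cut is supported in |x| >= 2^J, where one spare decay power of [th] is worth
    2^-J; its derivatives are bounded uniformly in J. *)
Lemma snull_high th : schwartz th -> snull (fun J x => (1 - cut (2 ^+ J) x) * th x).
Proof.
move=> sth; split=> [J|N e e0].
  by apply: schwartz_1B => //; apply: bump_cut => //; rewrite exprn_gt0.
have [K [K0 hK]] := one_sub_cut_bound N; have [smt /(_ N.+1)[M hM]] := sth.
have M0 := schwartz_bound_ge0 hM.
have D0 : 0 <= 2 ^+ N * (K * M) by rewrite !mulr_ge0 ?exprn_ge0.
have [i0 hi] := exprV_small D0 e0; exists i0 => J iJ l x lN.
have t0 : 0 < (2 : R) ^+ J by rewrite exprn_gt0.
have bc := bump_cut n hphi t0.
have [xJ|Jx] := ltP (enorm x) (2 ^+ J).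
  rewrite (cpartials_support (@open_enorm_lt R n (2 ^+ J))) ?cabs0 ?mulr0 ?(ltW e0)// => y /= yJ.
  by rewrite (cut_eq1 hphi) ?subrr ?mul0r// ltW.
have jx := jap_pow_gt0 x N.
have := @leibniz_bound R n N (fun x => 1 - cut (2 ^+ J) x) th x K (M / (1 + enorm x) ^+ N.+1).
have sm1 : smooth (fun x => 1 - cut (2 ^+ J) x).
  have -> : (fun x => 1 - cut (2 ^+ J) x) = (fun x => 1 + -1 * cut (2 ^+ J) x) by apply/funext => y; rewrite mulN1r.
  apply: smoothD; first exact: smooth_cst.
  by apply: smoothM; [exact: smooth_cst|case: bc].
move=> /(_ sm1 smt (fun l lN => hK J l x lN) (fun l lN => schwartz_boundP x hM (leqW lN)) l lN) h.
apply: (le_trans (ler_wpM2l (ltW jx) h)).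
rewrite [leLHS](_ : _ = 2 ^+ N * (K * M) * (1 + enorm x)^-1); last first.
  rewrite exprS; field; rewrite (gt_eqF (jap_gt0 x))/=.
  by rewrite expf_neq0// gt_eqF// jap_gt0.
apply: le_trans (hi J iJ); rewrite ler_wpM2l// lef_pV2 ?posrE ?jap_gt0//.
by apply: (le_trans Jx); rewrite lerDr.
Qed.

Lemma cpartials_FT_le s (r : R) l g xi : 0 <= r -> schwartz g -> (forall x, r < enorm x -> g x = 0) ->
  ((cabs (cpartials l (FT s g) xi))%:E <= ((`|s| * r) ^+ size l)%:E * integ (fun x => cabs (g x)))%E.
Proof.
move=> r0; elim/last_ind: l g => [|l i IH] g sg gr.
  by rewrite cpartials_nil mul1e; apply: cabs_FT_le; exact: schwartz_cintegrable.
rewrite cpartials_rcons FT_cderive_out//.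
have sx : schwartz (fun x => (0 +i* s)%C * ((x ord0 i)%:C%C * g x)) by apply/schwartzZ/schwartz_coord.
apply: (le_trans (IH _ sx _)) => [x xr|]; first by rewrite gr// !mulr0.
rewrite size_rcons exprSr EFinM -muleA; apply: lee_wpmul2l; first by rewrite lee_fin exprn_ge0// mulr_ge0.
have mg := mfun_schwartz sg.
rewrite -integZ ?mulr_ge0//; last by move=> x; exact: cabs_ge0.
apply: le_integ.
- exact: mfun_schwartz.
- exact: mfunZ.
- by move=> x; exact: cabs_ge0.
move=> x; rewrite !cabsM cabs_real (_ : cabs (0 +i* s)%C = `|s|); last by rewrite cabsE /= expr0n add0r sqrtr_sqr.
rewrite -mulrA ler_wpM2l//.
have [xr|rx] := leP (enorm x) r; last by rewrite gr// cabs0 !mulr0.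
by rewrite ler_wpM2r ?cabs_ge0// (le_trans (coord_le_enorm x i)).
Qed.

(** Restricted to a ball of radius 2 2^-J, [th] has an integral of order 2^(-Jn), so its transform
    and all derivatives of it are uniformly small. That transform spreads out over |x| of order 2^J,
    and the bump [b] is what supplies decay uniform in J. *)
Lemma snull_low s b th : s != 0 -> bump b -> schwartz th ->
  snull (fun J x => b x * FT s (fun y => cut (2 ^- J) y * th y) x).
Proof.
move=> s0 bb sth.
have t0 J : 0 < (2 : R) ^- J by rewrite invr_gt0 exprn_gt0.
have sc J : schwartz (fun y => cut (2 ^- J) y * th y) by apply: schwartz_bumpM => //; exact: bump_cut.
have [M hM] := schwartz_bounded sth; have M0 : 0 <= M by apply: le_trans (hM 0); exact: cabs_ge0.
split=> [J|N e e0]; first by apply: schwartz_bumpM => //; exact: schwartz_FT.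
have [K [K0 hK]] := bump_bounded bb N; have [r hr] := bb.2.
pose S := 1 + (`|s| * 2); have S1 : 1 <= S by rewrite lerDl mulr_ge0.
pose D := (1 + `|r|) ^+ N * (2 ^+ N * (K * (S ^+ N * (M * 4 ^+ n)))).
have D0 : 0 <= D by rewrite !mulr_ge0 ?exprn_ge0 ?addr_ge0 ?mulr_ge0.
have [i0 hi] := exprV_small D0 e0; exists i0 => J iJ l x lN.
have I1 : (integ (fun y => cabs (cut (2 ^- J) y * th y)%R) <= (M * 4 ^+ n * 2 ^- J)%:E)%E.
  apply: (@le_trans _ _ (integ (fun y => M * (if enorm y <= 2 * 2 ^- J then 1 else 0))%R)).
    have mb : mfun (fun y : E => if enorm y <= 2 * 2 ^- J then 1 else 0 : R).
      apply: measurable_fun_ifT; [|exact: measurable_cst|exact: measurable_cst].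
      apply: (measurable_fun_bool true); rewrite (_ : _ @^-1` _ = (fun t => enorm (pt t)) @^-1` `]-oo, (2 * 2 ^- J)%R]).
        by apply: measurable_enorm_point => //; exact: measurable_itv.
      by apply/seteqP; split => t /=; rewrite in_itv.
    apply: le_integ; [exact: mfun_schwartz|exact: mfunZ|by move=> y; exact: cabs_ge0|].
    move=> y; case: ifPn => [_|]; last first.
      by rewrite -ltNge mulr0 => h; rewrite (cut_eq0 hphi) ?mul0r ?cabs0// ltW.
    rewrite mulr1 cabsM; apply: le_trans (hM y); rewrite ler_piMl ?cabs_ge0//.
    exact: cabs_cut_le1.
  have mb : mfun (fun y : E => if enorm y <= 2 * 2 ^- J then 1 else 0 : R).
    apply: measurable_fun_ifT; [|exact: measurable_cst|exact: measurable_cst].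
    apply: (measurable_fun_bool true); rewrite (_ : _ @^-1` _ = (fun t => enorm (pt t)) @^-1` `]-oo, (2 * 2 ^- J)%R]).
      by apply: measurable_enorm_point => //; exact: measurable_itv.
    by apply/seteqP; split => t /=; rewrite in_itv.
  rewrite integZ//; last by move=> y; case: ifP.
  have h2 : 0 <= 2 * (2 : R) ^- J by rewrite mulr_ge0// ltW.
  apply: (le_trans (lee_wpmul2l _ (@lebesgue_tuple_ball R n _ h2))); first by rewrite lee_fin.
  rewrite -EFinM lee_fin -mulrA ler_wpM2l// mulrA exprMn (_ : 2 * 2 = 4); last by lra.
  have t1 : (2 : R) ^- J <= 1 by rewrite invf_le1 ?exprn_gt0// exprn_ege1//; lra.
  rewrite ler_wpM2l ?exprn_ge0//; move: t1 (ltW (t0 J)); set t := 2 ^- J => t1 t0'; case: n n3 => // n' _.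
  by rewrite exprS ler_piMr// exprn_ile1.
have [rx|xr] := ltP `|r| (enorm x).
  rewrite (cpartials_support (@open_enorm_gt R n `|r|)) ?cabs0 ?mulr0 ?(ltW e0)// => y /= yr.
  have [->|/hr] := eqVneq (b y) 0; first by rewrite mul0r.
  by move=> h; have := le_lt_trans (ler_norm r) yr; rewrite ltNge h.
have F1 l' : (size l' <= N)%N -> cabs (cpartials l' (FT s (fun y => cut (2 ^- J) y * th y)) x) <= S ^+ N * (M * 4 ^+ n * 2 ^- J).
  move=> l'N; rewrite -lee_fin.
  have hs (y : E) : 2 < enorm y -> cut (2 ^- J) y * th y = 0.
    move=> h; rewrite (cut_eq0 hphi) ?mul0r//; apply: le_trans (ltW h).
    by rewrite ler_piMr// invf_le1 ?exprn_gt0// exprn_ege1//; lra.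
  apply: (le_trans (cpartials_FT_le s l' x _ (sc J) hs)) => //.
  rewrite EFinM; apply: lee_pmul => //; rewrite ?lee_fin ?exprn_ge0 ?mulr_ge0//.
    by apply: integ_ge0 => y; exact: cabs_ge0.
  apply: (@le_trans _ _ (S ^+ size l')); last by rewrite ler_weXn2l.
  by rewrite lerXn2r ?nnegrE ?mulr_ge0 ?addr_ge0 ?mulr_ge0// lerDr.
have smF := (schwartz_FT s0 (sc J)).1.
have := @leibniz_bound R n N b _ x K _ bb.1 smF (fun l lN => hK l x lN) F1 l lN.
move=> h; apply: le_trans (hi J iJ).
apply: (@le_trans _ _ ((1 + `|r|) ^+ N * (2 ^+ N * (K * (S ^+ N * (M * 4 ^+ n * 2 ^- J)))))).
  rewrite ler_pM ?exprn_ge0 ?cabs_ge0 ?addr_ge0 ?enorm_ge0//.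
  by rewrite lerXn2r ?nnegrE ?addr_ge0 ?enorm_ge0// lerD2l.
by rewrite /D le_eqVlt; apply/orP; left; apply/eqP; ring.
Qed.

End null_sequences.

(** * Pairing with functionals of finite homogeneous norm *)

Section pairing.
Context (R : realType) (n : nat) (n3 : (3 <= n)%N).
Context (kap : R) (hkap : @inversion_constant R n kap).
Context (phi : R -> R) (hphi : dyadic_profile phi).
Local Notation E := 'rV[R]_n.
Local Notation C := R[i].
Local Notation mu := (lebesgue_tuple R n).
Local Notation pt := (@Defs.point R n).
Local Notation cut := (@cutoff R n phi).
Local Notation Re := (@complex.Re R).
Local Notation Im := (@complex.Im R).
Implicit Types (b th g h w psi : E -> C) (u v f : functional R n).

Lemma L2norm_le w (y : R) : 0 <= y ->
  (L2norm w <= y%:E)%E = (integ (fun x => cabs (w x) ^+ 2)%R <= (y ^+ 2)%:E)%E.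
Proof.
move=> y0; have -> : integ (fun x => cabs (w x) ^+ 2) = (L2norm w ^+ 2)%E.
  rewrite -expe2_poweR ?Lnorm_ge0// powR_Lnorm//; apply: eq_integral => t _ /=.
  by rewrite ger0_norm ?cabs_ge0// powR_mulrn ?cabs_ge0.
have : (0 <= L2norm w)%E by exact: Lnorm_ge0.
case: (L2norm w) => [r| |//]; last by move=> _; rewrite expe2 mulyy.
rewrite lee_fin => r0; by rewrite -EFin_expe !lee_fin ler_pXn2r.
Qed.

Lemma L2norm_ge0 w : (0 <= L2norm w)%E. Proof. exact: Lnorm_ge0. Qed.

Lemma cut_near_cst x : \forall J \near \oo, cut (2 ^+ J) x = 1.
Proof.
have [i xi] := pow2_ge (enorm x); exists i => // J /= iJ.
rewrite (cut_eq1 hphi) ?exprn_gt0//; apply: (le_trans xi).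
by rewrite ler_weXn2l//; lra.
Qed.

(** Testing against ever larger cutoffs makes each truncation of [w] integrable, hence measurable;
    [w] is their pointwise limit. *)
Lemma represents_cmeasurable u w : represents u w -> cmeasurable w.
Proof.
move=> uw.
have m1 J : cmeasurable (fun x => w x * cut (2 ^+ J) x).
  have sc : schwartz (cut (2 ^+ J)) by apply: bump_schwartz; apply: bump_cut => //; rewrite exprn_gt0.
  by have [/cintegrableP[]] := uw _ sc.
split.
  apply: (@measurable_fun_cvg _ _ _ _ (fun J t => Re (w (pt t) * cut (2 ^+ J) (pt t)))) => [J|t _]; first by case: (m1 J).
  by apply: cvg_near_cst; near=> J; rewrite (near (cut_near_cst (pt t)) J)// mulr1.
apply: (@measurable_fun_cvg _ _ _ _ (fun J t => Im (w (pt t) * cut (2 ^+ J) (pt t)))) => [J|t _]; first by case: (m1 J).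
by apply: cvg_near_cst; near=> J; rewrite (near (cut_near_cst (pt t)) J)// mulr1.
Unshelve. all: by end_near.
Qed.

Lemma cabs_cintegral_cs w psi (a b : R) : cmeasurable w -> cmeasurable psi ->
  cintegrable (fun x => w x * psi x) -> 0 <= a -> 0 <= b ->
  (integ (fun x => cabs (w x) ^+ 2)%R <= (a ^+ 2)%:E)%E ->
  (integ (fun x => cabs (psi x) ^+ 2)%R <= (b ^+ 2)%:E)%E ->
  cabs (cintegral (fun x => w x * psi x)) <= a * b.
Proof.
move=> mw mp i0 a0 b0 wa pb.
have : cabs (cintegral (fun x => w x * psi x)) ^+ 2 <= a ^+ 2 * b ^+ 2.
  apply: (@sqr_le_cauchy_schwarz _ _ _ _ _ (fun x => cabs (w x)) (fun x => cabs (psi x))) => //.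
  - exact: mfun_cabs.
  - exact: mfun_cabs.
  - by move=> x; exact: cabs_ge0.
  - by move=> x; exact: cabs_ge0.
  - exact: cabs_ge0.
  - apply: (le_trans (cabs_cintegral_le i0)); rewrite le_eqVlt; apply/orP; left; apply/eqP.
    by apply: eq_integral => t _; rewrite cabsM.
by rewrite -exprMn ler_pXn2r ?nnegrE ?cabs_ge0// mulr_ge0.
Qed.

Lemma cintegral_punctured g h : cintegrable g -> cintegrable h ->
  (forall x, x != 0 -> g x = h x) -> cintegral g = cintegral h.
Proof.
move=> ig ih gh; apply/eqP; rewrite -subr_eq0; apply/eqP/cabs0_eq0.
have id : cintegrable (fun x => g x + (-1) * h x) by apply: cintegrableD => //; exact: cintegrableZ.
have -> : cintegral g - cintegral h = cintegral (fun x => g x + (-1) * h x).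
  by rewrite cintegralD// ?cintegralZ ?mulN1r//; exact: cintegrableZ.
apply/eqP; rewrite eq_le cabs_ge0 andbT -lee_fin.
apply: (le_trans (cabs_cintegral_le id)).
apply: (@le_trans _ _ (integ (fun _ : E => 0 : R))); last by rewrite /integ integral0.
apply: (integ_punctured_le n3 (u := fun x => cabs (g x + (-1) * h x))) => //.
- by apply: mfun_cabs; case/cintegrableP: id.
- exact: measurable_cst.
- by move=> x; exact: cabs_ge0.
by move=> x x0; rewrite gh// mulN1r subrr cabs0.
Qed.

Definition c0 : R := (2 * pi) ^- n.

Lemma c0_gt0 : 0 < c0.
Proof. by rewrite invr_gt0 exprn_gt0// mulr_gt0// pi_gt0. Qed.

Lemma inv_fourier_FT th : schwartz th -> inv_fourier (FT (-1) th) = fun x => (c0 * kap)%:C%C * th x.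
Proof.
move=> sth; have [_ hk] := hkap; have [E1 _ _ _] := hk _ sth.
by rewrite inv_fourierE E1; apply/funext => x; rewrite mulrA -rmorphM.
Qed.

Definition annulus (J : nat) : E -> C := fun x => cut (2 ^+ J) x - cut (2 ^- J.+1) x.

Lemma bump_annulus J : bump (annulus J).
Proof. by apply: bumpB; apply: bump_cut; rewrite ?invr_gt0 ?exprn_gt0. Qed.

Lemma annulus0 J x : enorm x < 2 ^- J.+1 -> annulus J x = 0.
Proof.
move=> xJ; rewrite /annulus !(cut_eq1 hphi) ?subrr ?invr_gt0 ?exprn_gt0 ?(ltW xJ)//.
apply: (le_trans (ltW xJ)); rewrite (@le_trans _ _ 1)//.
  by rewrite invf_le1 ?exprn_gt0// exprn_ege1//; lra.
by rewrite exprn_ege1//; lra.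
Qed.

Lemma annulus_at0 J : annulus J 0 = 0.
Proof. by apply: annulus0; rewrite enorm0; rewrite invr_gt0; exact: exprn_gt0. Qed.

Lemma cabs_annulus_le1 J x : cabs (annulus J x) <= 1.
Proof.
rewrite /annulus /cutoff -rmorphB/= cabs_real ler_norml.
have a := Psi_ge0 hphi (enorm x / 2 ^+ J); have b := Psi_ge0 hphi (enorm x / 2 ^- J.+1).
have c := Psi_le1 hphi (enorm x / 2 ^+ J); have d := Psi_le1 hphi (enorm x / 2 ^- J.+1).
by apply/andP; split; lra.
Qed.

Lemma annulus_near_cst x : x != 0 -> \forall J \near \oo, annulus J x = 1.
Proof.
rewrite -enorm_gt0 => x0; have [i xi] := pow2_ge (2 / enorm x).
near=> J; rewrite /annulus (near (cut_near_cst x) J)// (cut_eq0 hphi) ?subr0 ?invr_gt0 ?exprn_gt0//.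
rewrite ler_pdivrMr ?exprn_gt0// mulrC -ler_pdivrMr//; apply: (le_trans xi).
rewrite ler_weXn2l//; first lra.
by apply: leqW; near: J; exists i.
Unshelve. all: by end_near.
Qed.

(* |x|^a is not smooth at the origin, hence the truncation to an annulus. *)
Definition weighted (a : R) (J : nat) th : E -> C := fun x => (enorm x `^ a)%:C%C * annulus J x * th x.

Lemma bump_weight a J : bump (fun x => (enorm x `^ a)%:C%C * annulus J x).
Proof.
have r0 : 0 < (2 : R) ^- J.+1 by rewrite invr_gt0 exprn_gt0.
exact: (bump_powR a (bump_annulus J) r0 (@annulus0 J)).
Qed.

Lemma schwartz_weighted a J th : schwartz th -> schwartz (weighted a J th).
Proof. by move=> sth; apply: schwartz_bumpM => //; exact: bump_weight. Qed.

Lemma integ_weighted_le a J th M : schwartz th -> (snorm a th <= M%:E)%E ->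
  (integ (fun x => cabs (weighted a J th x) ^+ 2)%R <= M%:E)%E.
Proof.
move=> sth; apply: le_trans; apply: le_integ.
- by apply: measurable_funX; apply: mfun_schwartz; exact: schwartz_weighted.
- by apply: mfun_wnorm; exact: mfun_schwartz.
- by move=> x; exact: sqr_ge0.
move=> x; rewrite /weighted !cabsM cabs_real ger0_norm ?powR_ge0// !exprMn.
have -> : (enorm x `^ a) ^+ 2 = enorm x `^ (2 * a).
  by rewrite -powR_mulrn ?powR_ge0// -powRrM mulrC.
rewrite -mulrA ler_wpM2l ?powR_ge0//.
by rewrite ler_piMl ?sqr_ge0// exprn_ile1 ?cabs_ge0// cabs_annulus_le1.
Qed.

(** The square is (c0 kap)^-2 kap: the normalisation of the test function whose inverse transform is
    prescribed, times the Plancherel factor. *)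
Definition pairing_const : R := Num.sqrt (c0 ^- 2 * kap^-1).

(** On an annulus |xi|^(-s) th is Schwartz, hence the inverse transform of some Schwartz psi.
    Pairing |xi|^s h with it cancels the weights and equals the pairing of w with psi, where
    Cauchy-Schwarz and Plancherel apply. *)
Lemma absD_pairing_annulus s w h (y M : R) J th : 0 <= y -> schwartz th ->
  (forall psi, schwartz psi -> cintegrable (fun xi => (enorm xi `^ s)%:C%C * h xi * psi xi)) ->
  represents (dist_inv_fourier (dist_of (fun xi => (enorm xi `^ s)%:C%C * h xi))) w ->
  (L2norm w <= y%:E)%E -> (snorm (- s) th <= M%:E)%E ->
  cabs (cintegral (fun x => h x * (annulus J x * th x))) <= pairing_const * y * Num.sqrt M.
Proof.
move=> y0 sth ih rw wy thM; have [k0 hk] := hkap; have p0 := c0_gt0.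
have M0 : 0 <= M by rewrite -lee_fin; apply: le_trans thM; exact: wnorm_ge0.
pose eta := weighted (- s) J th; have se : schwartz eta by exact: schwartz_weighted.
pose psi x := ((c0 * kap)^-1)%:C%C * FT (-1) eta x.
have sF := schwartz_FT (neg1_neq0 R) se; have sp : schwartz psi by exact: schwartzZ.
have Ep : inv_fourier psi = eta.
  rewrite inv_fourierE /psi FT_Z; last exact: schwartz_cintegrable.
  have [-> _ _ _] := hk _ se; apply/funext => x; rewrite !mulrA -!rmorphM/= -/c0.
  by rewrite (_ : c0 * _ * kap = 1) ?mul1r//; field; rewrite !gt_eqF.
have -> : cintegral (fun x => h x * (annulus J x * th x)) = cintegral (fun x => w x * psi x).
  have [_ E1] := rw _ sp; rewrite -[RHS]E1 /dist_inv_fourier Ep; apply: eq_cintegral => x.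
  rewrite /eta /weighted; have [->|x0] := eqVneq x 0.
    by rewrite annulus_at0 !(mul0r, mulr0).
  rewrite mulrACA; have e1 : (enorm x `^ s)%:C%C * (enorm x `^ (- s))%:C%C = 1 :> C.
    have e2 : enorm x `^ s * enorm x `^ (- s) = 1 by rewrite -(powR_enormD s (- s) x0) subrr powRr0.
    by rewrite -rmorphM/= e2.
  rewrite [LHS](_ : _ = ((enorm x `^ s)%:C%C * (enorm x `^ (- s))%:C%C) * (h x * (annulus J x * th x))); last by rewrite e1 mul1r.
  by ring.
have [iw _] := rw _ sp.
have nb : (integ (fun x => cabs (psi x) ^+ 2)%R <= ((pairing_const * Num.sqrt M) ^+ 2)%:E)%E.
  have [_ _ _ E2] := hk _ se.
  have -> : (integ (fun x => cabs (psi x) ^+ 2)%R = ((c0 * kap)^-1 ^+ 2)%:E * integ (fun x => cabs (FT (-1) eta x) ^+ 2)%R)%E.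
    rewrite -integZ ?sqr_ge0//; last 2 first.
    - by apply: measurable_funX; exact: mfun_schwartz.
    - by move=> x; exact: sqr_ge0.
    by apply: eq_integral => t _; rewrite /psi cabsM cabs_real exprMn gtr0_norm ?invr_gt0 ?mulr_gt0.
  rewrite /integ E2 muleA -EFinM.
  apply: (le_trans (lee_wpmul2l _ (integ_weighted_le J sth thM))); first by rewrite lee_fin mulr_ge0 ?sqr_ge0 ?ltW.
  rewrite -EFinM lee_fin exprMn !sqr_sqrtr//; last by rewrite mulr_ge0 ?invr_ge0 ?sqr_ge0// ltW.
  by rewrite ler_wpM2r// le_eqVlt; apply/orP; left; apply/eqP; field; rewrite !gt_eqF.
have := @cabs_cintegral_cs w psi y (pairing_const * Num.sqrt M) (represents_cmeasurable rw) (smooth_cmeasurable sp.1) iw y0.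
rewrite mulr_ge0 ?sqrtr_ge0// => /(_ isT).
by rewrite -L2norm_le// => /(_ wy nb) /le_trans; apply; rewrite mulrCA mulrA.
Qed.

(** The annuli exhaust all points but the origin, so dominated convergence recovers the full pairing
    up to the value on a null set. *)
Lemma absD_pairing s v w (y M : R) th : 0 <= y -> absD s v w -> schwartz th ->
  (L2norm w <= y%:E)%E -> (snorm (- s) th <= M%:E)%E ->
  cabs (v (FT (-1) th)) <= pairing_const * y * Num.sqrt M.
Proof.
move=> y0 [h [rh ih rw]] sth wy thM.
have [i1 E1] := rh _ sth; rewrite /dist_fourier fourierE in E1; rewrite E1.
have [m1 f1] := (cintegrableP _).1 i1.
pose g (x : E) := if x == 0 then 0 else h x * th x.
have [_ ig lim] : [/\ forall J, cintegrable (fun x => h x * (annulus J x * th x)), cintegrable g &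
    cabs (cintegral (fun x => h x * (annulus J x * th x)) - cintegral g) @[J --> \oo] --> 0].
  apply: (@dominated_cintegral _ _ _ _ (fun x => cabs (h x * th x))) => //.
  - move=> J; have sa : schwartz (fun x => annulus J x * th x) by apply: schwartz_bumpM => //; exact: bump_annulus.
    by have [/cintegrableP[]] := rh _ sa.
  - exact: (measurable_cabs m1).
  - by move=> J x; rewrite mulrCA [leLHS]cabsM ler_piMl ?cabs_ge0// cabs_annulus_le1.
  move=> x; apply: cvg_near_cst; rewrite /g; case: eqVneq => [->|x0].
    by near=> J; rewrite annulus_at0 mul0r mulr0 subrr cabs0.
  by near=> J; rewrite (near (annulus_near_cst x0) J)// mul1r subrr cabs0.
have -> : dist_of h th = cintegral g.
  by apply: cintegral_punctured => // x /negbTE x0; rewrite /g x0.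
apply/ler_addgt0Pr => e e0.
have /cvgr0Pnorm_le/(_ _ e0)[J0 _ hJ] := lim.
have := hJ J0 (leqnn _); rewrite ger0_norm ?cabs_ge0// => h1.
have h2 := absD_pairing_annulus J0 y0 sth ih rw wy thM.
set a := cintegral _ in h1 h2.
have -> : cintegral g = a + - (a - cintegral g) by ring.
by apply: (le_trans (ler_cabsD _ _)); rewrite cabsN lerD.
Unshelve. all: by end_near.
Qed.

Lemma Hdot_ge0 s v : (0 <= Hdot_norm s v)%E.
Proof. by apply: le_ereal_inf_tmp => _ [w _ <-]; exact: L2norm_ge0. Qed.

Lemma Hdot_near s v (y e : R) : (Hdot_norm s v <= y%:E)%E -> 0 < e ->
  exists2 w, absD s v w & (L2norm w <= (y + e)%:E)%E.
Proof.
move=> vy e0; have : (Hdot_norm s v < (y + e)%:E)%E.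
  by apply: (le_lt_trans vy); rewrite lte_fin ltrDl.
by move=> /ereal_inf_lt[_ [w hw <-]] /ltW wy; exists w.
Qed.

Lemma Hdot_pairing s v (y M : R) th : schwartz th ->
  (Hdot_norm s v <= y%:E)%E -> (snorm (- s) th <= M%:E)%E ->
  cabs (v (FT (-1) th)) <= pairing_const * y * Num.sqrt M.
Proof.
move=> sth vy thM; have y0 : 0 <= y by rewrite -lee_fin; apply: le_trans vy; exact: Hdot_ge0.
apply/ler_addgt0Pr => e e0.
have P0 : 0 <= pairing_const * Num.sqrt M by rewrite mulr_ge0 ?sqrtr_ge0.
have e1 : 0 < e / (pairing_const * Num.sqrt M + 1) by rewrite divr_gt0// ltr_wpDl.
have [w hw wy] := Hdot_near vy e1.
have := absD_pairing (addr_ge0 y0 (ltW e1)) hw sth wy thM; move=> /le_trans; apply.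
rewrite mulrDr mulrDl lerD2l mulrAC mulrCA ler_piMr ?(ltW e0)//.
by rewrite ler_pdivrMr ?mul1r ?lerDl// ltr_wpDl.
Qed.

End pairing.

(** * Splitting a pairing into dyadic pieces *)

Section decomposition.
Context (R : realType) (n : nat) (n3 : (3 <= n)%N).
Context (kap : R) (hkap : @inversion_constant R n kap).
Context (phi : R -> R) (hphi : dyadic_profile phi).
Local Notation E := 'rV[R]_n.
Local Notation C := R[i].
Local Notation cut := (@cutoff R n phi).
Local Notation Q_ k := (@dyadic_cutoff R n phi k).
Local Notation Qfat := (@Qfat R n phi).
Implicit Types (b th g h w psi u v : E -> C) (f : functional R n).

Definition linear_on_schwartz f := forall (c : C) psi1 psi2, schwartz psi1 -> schwartz psi2 ->
  f (fun x => c * psi1 x + psi2 x) = c * f psi1 + f psi2.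

Lemma schwartz0 : schwartz (fun _ : E => 0 : C).
Proof.
split=> [|N]; first exact: smooth_cst.
by exists 0 => l x _; rewrite cpartials_cst0 cabs0 mulr0.
Qed.

Lemma lin0 f : linear_on_schwartz f -> f (fun=> 0) = 0.
Proof.
move=> lf; have := lf (-1) _ _ schwartz0 schwartz0.
by rewrite mulr0 addr0 mulN1r addNr.
Qed.

Lemma linD f psi1 psi2 : linear_on_schwartz f -> schwartz psi1 -> schwartz psi2 ->
  f (fun x => psi1 x + psi2 x) = f psi1 + f psi2.
Proof.
by move=> lf s1 s2; have := lf 1 _ _ s1 s2; rewrite mul1r => <-; congr f; apply/funext => x; rewrite mul1r.
Qed.

Lemma linZ f c psi : linear_on_schwartz f -> schwartz psi -> f (fun x => c * psi x) = c * f psi.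
Proof.
move=> lf sp; have := lf c _ _ sp schwartz0; rewrite lin0// addr0 => <-.
by congr f; apply/funext => x; rewrite addr0.
Qed.

Lemma schwartz_sum N (F : 'I_N -> E -> C) : (forall i, schwartz (F i)) ->
  schwartz (fun x => \sum_(i < N) F i x).
Proof.
elim: N F => [F _|N IH F sF].
  by rewrite (_ : (fun x => _) = fun=> 0); [exact: schwartz0|apply/funext => x; rewrite big_ord0].
under eq_fun do rewrite big_ord_recr/=.
by apply: schwartzD => //; apply: IH.
Qed.

Lemma lin_sum f N (F : 'I_N -> E -> C) : linear_on_schwartz f -> (forall i, schwartz (F i)) ->
  f (fun x => \sum_(i < N) F i x) = \sum_(i < N) f (F i).
Proof.
move=> lf; elim: N F => [F _|N IH F sF].
  by rewrite big_ord0 -[RHS](lin0 lf); congr f; apply/funext => x; rewrite big_ord0.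
rewrite big_ord_recr/= -IH// -linD//; last exact: schwartz_sum.
by congr f; apply/funext => x; rewrite big_ord_recr.
Qed.

Lemma snorm_scale sig (c : R) th : schwartz th ->
  snorm sig (fun x => c%:C%C * th x) = ((c ^+ 2)%:E * snorm sig th)%E.
Proof.
move=> sth; rewrite /snorm -[c ^+ 2]real_normK ?num_real// -snormZ; last exact: mfun_schwartz.
by apply: eq_integral => t _; rewrite cabsM cabs_real.
Qed.

Lemma FT_convop A th : bump A -> schwartz th -> FT (-1) (convop A th) = fun x => kap%:C%C * (A x * FT (-1) th x).
Proof.
move=> bA sth; have [_ hk] := hkap.
have sp : schwartz (fun x => A x * FT (-1) th x) by apply: schwartz_bumpM => //; exact: (schwartz_FT (neg1_neq0 R)).
by have [_ E1 _ _] := hk _ sp.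
Qed.

Lemma bump_Qfat m : bump (Qfat m).
Proof. by apply: bump_dil (pow2_gt0 _ _) (bump_fat n hphi). Qed.

(** Since the fattened cutoff is 1 on the support of Q_m, it can be inserted and moved onto [v],
    where it becomes a convolution. The norm of Q_m f is thus paired with a quantity that is small
    off the diagonal. *)
Lemma Qk_pairing s f m v (y M : R) : schwartz v -> (Hdot_norm s (Qk phi m f) <= y%:E)%E ->
  (snorm (- s) (convop (Qfat m) v) <= M%:E)%E ->
  cabs (f (fun x => Q_ m x * FT (-1) v x)) <= @pairing_const R n kap / kap * y * Num.sqrt M.
Proof.
move=> sv hy hM; have [k0 _] := hkap.
have sC : schwartz (convop (Qfat m) v) by apply: schwartz_convop => //; exact: bump_Qfat.
have -> : f (fun x => Q_ m x * FT (-1) v x) = Qk phi m f (FT (-1) (fun x => (kap^-1)%:C%C * convop (Qfat m) v x)).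
  rewrite /Qk /dist_mul FT_Z; last exact: schwartz_cintegrable.
  rewrite FT_convop//; last exact: bump_Qfat.
  congr f; apply/funext => x; rewrite [(kap^-1)%:C%C * (_ * _)]mulrA -rmorphM/= mulVf ?gt_eqF// mul1r.
  by rewrite [RHS]mulrA [Q_ m x * Qfat m x]mulrC (fat_thin hphi).
have := @Hdot_pairing R n n3 kap hkap phi hphi s (Qk phi m f) y (kap^-1 ^+ 2 * M) _ (schwartzZ _ sC) hy.
move=> /(_ kap^-1%:C%C); rewrite snorm_scale// EFinM.
move=> /(_ (lee_wpmul2l _ hM)) h; apply: (le_trans (h _)); first by rewrite lee_fin sqr_ge0.
rewrite sqrtrM ?sqr_ge0// sqrtr_sqr gtr0_norm ?invr_gt0//.
by rewrite le_eqVlt; apply/orP; left; apply/eqP; ring.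
Qed.

Lemma Pk_linear j f : linear_on_schwartz f -> linear_on_schwartz (Pk phi j f).
Proof.
move=> lf c psi1 psi2 s1 s2; have bQ := bump_dyadic n hphi j.
have sI psi : schwartz psi -> schwartz (fun x => Q_ j x * inv_fourier psi x).
  move=> sp; apply: schwartz_bumpM => //; rewrite inv_fourierE; apply: schwartzZ.
  exact: (schwartz_FT (one_neq0 R)).
have sT psi : schwartz psi -> schwartz (fourier (fun x => Q_ j x * inv_fourier psi x)).
  by move=> sp; rewrite fourierE; apply: (schwartz_FT (neg1_neq0 R)); exact: sI.
rewrite /Pk /multiplier /dist_inv_fourier /dist_mul /dist_fourier.
rewrite -lf; [|exact: sT|exact: sT]; congr f.
rewrite !fourierE; have i1 := schwartz_cintegrable (sI _ s1); have i2 := schwartz_cintegrable (sI _ s2).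
rewrite -[RHS]/(fun x => (fun x => c * FT (-1) (fun x => Q_ j x * inv_fourier psi1 x) x) x + FT (-1) (fun x => Q_ j x * inv_fourier psi2 x) x).
rewrite -FT_Z// -FT_D//; last exact: cintegrableZ.
congr FT; apply/funext => x; rewrite !inv_fourierE.
have iz := cintegrableZ c (schwartz_cintegrable s1).
rewrite (FT_D 1 iz (schwartz_cintegrable s2)) (FT_Z 1 c (schwartz_cintegrable s1)).
ring.
Qed.

Lemma Pk_snull j f (z : nat -> E -> C) : tempered f -> (forall M, schwartz (z M)) ->
  snull (fun M x => Q_ j x * FT 1 (z M) x) ->
  forall e : R, 0 < e -> exists M0, forall M, (M0 <= M)%N -> cabs (Pk phi j f (z M)) <= e.
Proof.
move=> tf sz nz e e0.
have nz2 := snull_FT (neg1_neq0 R) (snullZ (c0 R n)%:C%C nz).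
have [M0 h] := snull_tempered tf nz2 e0; exists M0 => M hM.
have -> : Pk phi j f (z M) = f (FT (-1) (fun x => (c0 R n)%:C%C * (Q_ j x * FT 1 (z M) x))).
  rewrite /Pk /multiplier /dist_inv_fourier /dist_mul /dist_fourier fourierE inv_fourierE.
  have -> : (fun x => Q_ j x * (((2 * pi) ^- n)%:C%C * FT 1 (z M) x)) =
    (fun x => (c0 R n)%:C%C * (Q_ j x * FT 1 (z M) x)) by apply/funext => x; rewrite mulrCA.
  by [].
exact: h.
Qed.

Lemma dyadic_split (J : nat) x :
  1 = (1 - cut (2 ^+ J) x) + (cut (2 ^- J.+1) x + \sum_(i < (2 * J).+1) Q_ (i%:Z - J%:Z) x).
Proof. by rewrite (dyadic_sum hphi); ring. Qed.

Lemma lin_dyadic_split (P : functional R n) w J : linear_on_schwartz P -> schwartz w ->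
  P w = P (fun x => (1 - cut (2 ^+ J) x) * w x) +
   (P (fun x => cut (2 ^- J.+1) x * w x) + \sum_(l < (2 * J).+1) P (fun x => Q_ (l%:Z - J%:Z) x * w x)).
Proof.
move=> lP sw.
have s1 : schwartz (fun x => (1 - cut (2 ^+ J) x) * w x).
  by apply: schwartz_1B => //; apply: bump_cut => //; exact: exprn_gt0.
have s2 : schwartz (fun x => cut (2 ^- J.+1) x * w x).
  by apply: schwartz_bumpM => //; apply: bump_cut => //; rewrite invr_gt0 exprn_gt0.
have s3 (l : 'I_(2 * J).+1) : schwartz (fun x => Q_ (l%:Z - J%:Z) x * w x).
  by apply: schwartz_bumpM => //; exact: bump_dyadic.
have s4 := schwartz_sum s3.
rewrite -(lin_sum lP s3) -(linD lP s2 s4) -(linD lP s1 (schwartzD s2 s4)).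
congr P; apply/funext => x.
by rewrite -mulr_suml -mulrDl -mulrDl -dyadic_split mul1r.
Qed.

(** The two remainders of the spatial expansion vanish by continuity of [f]. For the part near the
    origin the frequency cutoff of P_j is the bump that [snull_low] asks for. *)
Lemma Pk_decomposition j f v (e : R) : tempered f -> schwartz v -> 0 < e -> exists M0, forall M, (M0 <= M)%N ->
  cabs (Pk phi j f (FT (-1) v) - \sum_(l < (2 * M).+1) Pk phi j f (fun x => Q_ (l%:Z - M%:Z) x * FT (-1) v x)) <= e.
Proof.
move=> tf sv e0; have lP := @Pk_linear j f tf.1.
have sF := schwartz_FT (neg1_neq0 R) sv; have e2 : 0 < e / 2 by rewrite divr_gt0.
have bQ := bump_dyadic n hphi j.
have nh := snull_high hphi sF.
have t0 M : 0 < (2 : R) ^- M by rewrite invr_gt0 exprn_gt0.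
have sl M : schwartz (fun x => cut (2 ^- M) x * FT (-1) v x).
  by apply: schwartz_bumpM => //; exact: bump_cut.
have [M1 h1] := Pk_snull tf nh.1 (snull_bumpM bQ (snull_FT (one_neq0 R) nh)) e2.
have [M2 h2] := Pk_snull tf sl (snull_low n3 hphi (one_neq0 R) bQ sF) e2.
exists (maxn M1 M2) => M; rewrite geq_max => /andP[M1M M2M].
rewrite (lin_dyadic_split M lP sF).
rewrite addrA addrK; apply: (le_trans (ler_cabsD _ _)).
rewrite [e]splitr lerD//; first exact: h1.
by apply: h2; exact: leqW.
Qed.

Lemma sum_cs N (a b : 'I_N -> R) :
  \sum_(i < N) a i * b i <= Num.sqrt (\sum_(i < N) a i ^+ 2) * Num.sqrt (\sum_(i < N) b i ^+ 2).
Proof.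
have := @dotp_le R N (\row_i a i) (\row_i b i).
have -> : dotp (\row_i a i) (\row_i b i) = \sum_(i < N) a i * b i by apply: eq_bigr => i _; rewrite !mxE.
have en (c : 'I_N -> R) : enorm (\row_i c i) = Num.sqrt (\sum_(i < N) c i ^+ 2).
  by congr Num.sqrt; apply: eq_bigr => i _; rewrite mxE.
by rewrite !en.
Qed.

Lemma sum2_cs N L (a b : 'I_N -> 'I_L -> R) :
  \sum_(i < N) \sum_(l < L) a i l * b i l <=
  Num.sqrt (\sum_(i < N) \sum_(l < L) a i l ^+ 2) * Num.sqrt (\sum_(i < N) \sum_(l < L) b i l ^+ 2).
Proof.
apply: (@le_trans _ _ (\sum_(i < N) Num.sqrt (\sum_(l < L) a i l ^+ 2) * Num.sqrt (\sum_(l < L) b i l ^+ 2))).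
  by apply: ler_sum => i _; exact: sum_cs.
apply: (le_trans (sum_cs _ _)); rewrite le_eqVlt; apply/orP; left; apply/eqP.
congr (Num.sqrt _ * Num.sqrt _); apply: eq_bigr => i _; rewrite sqr_sqrtr// sumr_ge0// => l _; exact: sqr_ge0.
Qed.

(** For |sig| <= 1 the weight is integrable at the origin, and n + 2 powers of decay of [th] handle
    infinity. *)
Lemma snorm_finite sig th : `|sig| <= 1 -> schwartz th -> exists2 M : R, 0 <= M & snorm sig th = M%:E.
Proof.
move=> s1 sth; have [K K0 hK] := integ_jap_powR n3 s1.
have [_ /(_ n.+2)[M hM]] := sth; have M0 := schwartz_bound_ge0 hM.
have h : (snorm sig th <= (M ^+ 2 * K)%:E)%E.
  apply: (@le_trans _ _ (integ (fun x => M ^+ 2 * ((1 + 1 * enorm x) ^- (2 * n.+2) * enorm x `^ (2 * sig)))%R)).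
    apply: le_integ.
    - by apply: mfun_wnorm; exact: mfun_schwartz.
    - by apply: mfunZ; apply: mfunM; [exact: mfun_jap_lam|exact: mfun_powR].
    - by move=> x; rewrite mulr_ge0 ?powR_ge0 ?sqr_ge0.
    move=> x; rewrite [leRHS]mulrA [leLHS]mulrC ler_wpM2r ?powR_ge0// mul1r mulnC exprM -exprVn -exprMn.
    rewrite lerXn2r ?nnegrE ?cabs_ge0 ?mulr_ge0 ?invr_ge0 ?(ltW (jap_pow_gt0 _ _))//.
    by have := schwartz_boundP x hM (isT : (size [::] <= n.+2)%N); rewrite cpartials_nil.
  rewrite integZ ?sqr_ge0//; last 2 first.
  - by apply: mfunM; [exact: mfun_jap_lam|exact: mfun_powR].
  - by move=> x; rewrite mulr_ge0 ?powR_ge0// invr_ge0 ltW// jap_lam_gt0.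
  rewrite [(_ * K)%:E]EFinM; apply: lee_wpmul2l; first by rewrite lee_fin sqr_ge0.
  by have := hK 1 ltr01; rewrite powR1 mulr1.
have := wnorm_ge0 sig (fun x => cabs (th x)); rewrite -/(snorm sig th).
move: h; case: (snorm sig th) => [r _ r0|//|//]; by exists r.
Qed.

End decomposition.

Lemma far_index (k : int) (M i : nat) : (`|(k + 4)%R|%N <= M)%N ->
  (4 <= `|((M + i).+1%:Z - k)%R|%N)%N /\ `|((M + i).+1%:Z - k)%R|%N%:Z = (M + i).+1%:Z - k.
Proof. by lia. Qed.

Lemma absz_succ (i : nat) : `|(i%:Z + 1)%R|%N = i.+1.
Proof. by lia. Qed.

(** * Vanishing of the low-frequency contribution *)

Section low_frequency.
Context (R : realType) (n : nat) (n3 : (3 <= n)%N).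
Context (kap : R) (hkap : @inversion_constant R n kap).
Context (phi : R -> R) (hphi : dyadic_profile phi).
Local Notation E := 'rV[R]_n.
Local Notation C := R[i].
Local Notation cut := (@cutoff R n phi).
Local Notation Q_ k := (@dyadic_cutoff R n phi k).
Local Notation Qfat := (@Qfat R n phi).
Implicit Types (b th g h w psi v : E -> C) (f : functional R n).

Lemma ell_ge (q : \bar R) (u : int -> \bar R) k : (2%:E <= q)%E -> (forall k, 0 <= u k)%E ->
  (u k <= ell q u)%E.
Proof.
case: q => [r| |]; rewrite ?lee_fin => h u0 //=; last by apply: ereal_sup_ubound; exists k.
have r0 : 0 < r by lra.
apply: (@le_trans _ _ ((u k `^ r) `^ r^-1)%E); first by rewrite -poweRrM mulfV ?gt_eqF// poweRe1.
have le1 : (u k `^ r <= \esum_(k in [set: int]) u k `^ r)%E.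
  rewrite (esumID [set k])//; last by move=> i _; exact: poweR_ge0.
  rewrite setTI esum_set1; last exact: poweR_ge0.
  by rewrite leeDl// esum_ge0// => i _; exact: poweR_ge0.
apply: gt0_ler_poweR => //; first by rewrite invr_ge0 ltW.
- by rewrite in_itv/= poweR_ge0 leey.
- by rewrite in_itv/= leey andbT esum_ge0// => i _; exact: poweR_ge0.
Qed.

Lemma cintegral0 : cintegral (fun _ : E => 0 : C) = 0.
Proof. by apply: eqReIm; rewrite /cintegral/= /Rintegral integral0. Qed.

Lemma norm_x_Hdot q a s f (y : R) k : (2%:E <= q)%E -> (norm_x phi q a s f <= y%:E)%E ->
  (Hdot_norm s (Qk phi k f) <= (2 `^ (- (k%:~R * a)) * y)%:E)%E.
Proof.
move=> hq hy; have p0 : 0 < 2 `^ (k%:~R * a) :> R by rewrite powR_gt0.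
have h := @ell_ge q (fun k => ((2 `^ (k%:~R * a))%:E * Hdot_norm s (Qk phi k f))%E) k hq.
rewrite powRN EFinM lee_pdivlMl//.
apply: le_trans hy; apply: h => i; apply: mule_ge0; [by rewrite lee_fin powR_ge0|exact: Hdot_ge0].
Qed.

Lemma half_powR N (x : R) : (2^-1 ^+ N) `^ x = 2 `^ (- (N%:R * x)).
Proof.
by rewrite -mulNr powRrM powRN powR_mulrn// exprVn.
Qed.

Lemma pow2D (x y : R) : (2 : R) `^ x * 2 `^ y = 2 `^ (x + y).
Proof. by rewrite powRD// (_ : (2 : R) == 0 = false) ?implybT// gt_eqF. Qed.

Lemma expr_small (x e : R) : 0 < x < 1 -> 0 < e -> exists N0, forall N, (N0 <= N)%N -> x ^+ N <= e.
Proof.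
move=> /andP[x0 x1] e0; have : x ^+ N @[N --> \oo] --> 0 by apply: cvg_expr; rewrite ger0_norm// ltW.
move=> /cvgr0Pnorm_le/(_ _ e0)[N0 _ h]; exists N0 => N hN.
by have := h N hN; rewrite ger0_norm// exprn_ge0// ltW.
Qed.

Lemma lin_tail (P : functional R n) w M0 L : linear_on_schwartz P -> schwartz w ->
  P (fun x => (1 - cut (2 ^+ M0) x) * w x) =
  \sum_(i < L) P (fun x => Q_ (M0 + i).+1%:Z x * w x) + P (fun x => (1 - cut (2 ^+ (M0 + L)) x) * w x).
Proof.
move=> lP sw; elim: L => [|L IH]; first by rewrite big_ord0 add0r addn0.
rewrite big_ord_recr/= IH -addrA; congr (_ + _).
rewrite -linD//; last 2 first.
- by apply: schwartz_bumpM => //; exact: bump_dyadic.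
- by apply: schwartz_1B => //; apply: bump_cut => //; exact: exprn_gt0.
congr P; apply/funext => x; rewrite -mulrDl; congr (_ * _).
rewrite (cutE hphi) (_ : (M0 + L).+1%:Z - 1 = (M0 + L)%:Z); last by lia.
by rewrite -!exprnP addnS; ring.
Qed.

(** A test function g at distance 1 from f has bounded support, so for large m the piece Q_m f
    coincides with Q_m (f - g), whose norm is controlled. *)
Lemma space_x_Hdot q a s f : (2%:E <= q)%E -> space_x phi q a s f ->
  exists m1 : nat, forall m : nat, (m1 <= m)%N ->
  (Hdot_norm s (Qk phi m%:Z f) <= (2 `^ (- (m%:R * a)))%:E)%E.
Proof.
move=> hq [_ /(_ 1 ltr01)[g [[_ [r1 [r2 [_ gr]]]] ng]]].
have [m1 hm] := pow2_ge (2 * r2); exists m1 => m mm.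
have := norm_x_Hdot m%:Z hq ng; rewrite mulr1; congr (Hdot_norm s _ <= _)%E.
apply/funext => psi; rewrite /Qk /dist_mul -[RHS]subr0; congr (_ - _).
rewrite /dist_of -[RHS]cintegral0; apply: eq_cintegral => x.
have [->|/gr/andP[_ xr]] := eqVneq (g x) 0; first by rewrite mul0r.
rewrite /dyadic_cutoff (profile_small hphi) ?mul0r ?mulr0// -exprnP.
rewrite ler_pdivrMr ?exprn_gt0// ler_pdivlMl// (le_trans _ (_ : 2 * r2 <= _))//.
  by rewrite ler_wpM2l.
by apply: (le_trans hm); rewrite ler_weXn2l//; lra.
Qed.

Lemma pow2N_lt1 (x : R) : 0 < x -> 0 < (2 : R) `^ (- x) < 1.
Proof.
move=> x0; rewrite powR_gt0//= powRN invf_lt1 ?powR_gt0//.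
apply: (@le_lt_trans _ _ (1 `^ x)); first by rewrite powR1.
by apply: gt0_ltr_powR; rewrite ?nnegrE//; lra.
Qed.

Lemma sqrt_half_powR N (d K M : R) : 0 <= K -> 0 <= M ->
  Num.sqrt (K * (2^-1 ^+ N) `^ (2 * d) * M) = Num.sqrt (K * M) * 2 `^ (- (N%:R * d)).
Proof.
move=> K0 M0; rewrite mulrAC sqrtrM ?mulr_ge0//; congr (_ * _).
rewrite half_powR (_ : - (N%:R * (2 * d)) = - (N%:R * d) + - (N%:R * d)); last by ring.
by rewrite -pow2D -expr2 sqrtr_sqr ger0_norm// powR_ge0.
Qed.

Lemma pow2_decay (m N : nat) (k : int) (a d : R) : N%:R = m%:R - k%:~R :> R ->
  2 `^ (- (m%:R * a)) * 2 `^ (- (N%:R * d)) = 2 `^ (k%:~R * d) * (2 `^ (- (d + a))) ^+ m.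
Proof.
move=> ->; rewrite -(powR_mulrn m (powR_ge0 _ _)) -powRrM !pow2D.
by congr (_ `^ _); ring.
Qed.

Lemma drop_half_pow (K X M : R) N : 0 <= K -> 0 <= X -> 0 <= M ->
  K * 2^-1 ^+ N * X * M <= K * X * M.
Proof.
move=> K0 X0 M0; rewrite ler_wpM2r// ler_wpM2r// ler_piMr//.
by rewrite exprn_ile1 ?invr_ge0//; lra.
Qed.

(** Space is split at 2^M1, with M1 chosen before J. Inside, continuity of f gives smallness as J
    grows. Outside, the m-th piece is bounded uniformly in J by a constant times 2^(-(d + a) m),
    where d = n/2 - |s|, and d + a > 0 makes the tail small. *)
Lemma low_frequency_null q a s f k th (e : R) : (2%:E <= q)%E -> `|s| <= 1 -> `|a| + `|s| < n%:R / 2 ->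
  space_x phi q a s f -> schwartz th -> 0 < e ->
  exists J0, forall J, (J0 <= J)%N ->
  cabs (f (FT (-1) (fun x => cut (2 ^- J) x * convop (Q_ k) th x))) <= e.
Proof.
move=> hq s1 has sf sth e0; have [tf _] := sf; have lf := tf.1.
have [k0 _] := hkap.
have sN : `|(- s)| <= 1 by rewrite normrN.
(* All low-pass cutoffs are dilates of the one bump [cut 1], which does not vanish at frequency 0;
   the off-diagonal estimate for it has a constant independent of J. *)
have [K K0 hK] := snorm_blockop_far n3 hkap hphi sN (bump_cut n hphi (ltr01 : (0 : R) < 1)).
have [M M0 hM] := snorm_finite n3 sN sth.
have [m1 hm1] := space_x_Hdot hq sf.
pose d : R := n%:R / 2 - `|s|.
have da : 0 < d + a by rewrite /d; have := ler_norm (- a); rewrite normrN; lra.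
pose rho : R := 2 `^ (- (d + a)).
have rho01 : 0 < rho < 1 by exact: pow2N_lt1.
have r1 : 0 < 1 - rho by have /andP[] := rho01; lra.
pose B : R := @pairing_const R n kap / kap * Num.sqrt (K * M) * 2 `^ (k%:~R * d).
have B0 : 0 <= B by rewrite !mulr_ge0 ?powR_ge0 ?sqrtr_ge0// invr_ge0 ltW.
pose D : R := B * (2 / (1 - rho)) + 1.
have D0 : 0 < D by rewrite ltr_wpDl// mulr_ge0// divr_ge0// ltW.
have e4 : 0 < e / 4 by rewrite divr_gt0.
have [N0 hN0] := expr_small rho01 (divr_gt0 e4 D0).
pose M1 := maxn N0 (maxn m1 `|(k + 4)%R|%N).
have m1M : (m1 <= M1)%N by rewrite /M1 leq_max leq_max leqnn orbT.
have kM : (`|(k + 4)%R|%N <= M1)%N by rewrite /M1 leq_max [X in _ || X]leq_max leqnn !orbT.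
have sC : schwartz (convop (Q_ k) th) by apply: schwartz_convop => //; exact: bump_dyadic.
have e2 : 0 < e / 2 by rewrite divr_gt0.
have bM1 : bump (cut (2 ^+ M1)) by apply: bump_cut => //; exact: exprn_gt0.
have [J0 hJ0] := snull_tempered tf (snull_low n3 hphi (neg1_neq0 R) bM1 sC) e2.
exists J0 => J hJ.
set v := fun x => cut (2 ^- J) x * convop (Q_ k) th x.
have sv : schwartz v by apply: schwartz_bumpM => //; apply: bump_cut => //; rewrite invr_gt0 exprn_gt0.
have sw := schwartz_FT (neg1_neq0 R) sv.
have -> : f (FT (-1) v) = f (fun x => cut (2 ^+ M1) x * FT (-1) v x) + f (fun x => (1 - cut (2 ^+ M1) x) * FT (-1) v x).
  rewrite -(linD lf (schwartz_bumpM bM1 sw) (schwartz_1B bM1 sw)).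
  by congr f; apply/funext => x; ring.
apply: (le_trans (ler_cabsD _ _)); rewrite [e]splitr lerD//; first exact: hJ0.
(* The number L0 of pieces depends on J, which is harmless because the geometric bound on their sum
   does not depend on L0. *)
have [L0 hL0] := snull_tempered tf (snull_high hphi sw) e4.
rewrite (lin_tail M1 L0 lf sw); apply: (le_trans (ler_cabsD _ _)).
have -> : e / 2 = e / 4 + e / 4 by lra.
rewrite lerD//; last by apply: hL0; rewrite leq_addl.
apply: (le_trans (cabs_sum _ _ _)).
have term (i : 'I_L0) : cabs (f (fun x => Q_ (M1 + i).+1%:Z x * FT (-1) v x)) <= B * rho ^+ M1 * rho ^+ `|(i%:Z + 1)%R|%N.
  set m : nat := (M1 + i).+1.
  have mN : (m1 <= m)%N by apply: (leq_trans m1M); rewrite /m leqW// leq_addr.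
  have [mk4 mkE] := far_index i kM.
  have hT := hK m%:Z k (- J%:Z) th M mk4 sth; rewrite hM lexx in hT; have {}hT := hT isT.
  have eT : blockop phi (dil (2 ^ (- J%:Z)) (cut 1)) m%:Z k th = convop (Qfat m%:Z) v.
    congr convop; apply/funext => x; rewrite /v dil_cut ?mulr1 ?pow2_gt0//.
    by rewrite -exprnN.
  rewrite eT in hT.
  have hT2 : (snorm (- s) (convop (Qfat m%:Z) v) <= (K * (2^-1 ^+ `|(m%:Z - k)%R|%N) `^ (2 * d) * M)%:E)%E.
    apply: (le_trans hT); rewrite lee_fin normrN (_ : n%:R - 2 * `|s| = 2 * d); last by rewrite /d; lra.
    exact: drop_half_pow (ltW K0) (powR_ge0 _ _) M0.
  apply: (le_trans (Qk_pairing n3 hkap hphi sv (hm1 m mN) hT2)).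
  rewrite (sqrt_half_powR _ _ (ltW K0) M0) /B.
  rewrite absz_succ.
  rewrite [leRHS](_ : _ = @pairing_const R n kap / kap * Num.sqrt (K * M) * (2 `^ (k%:~R * d) * rho ^+ m)); last first.
    rewrite -mulrA -exprD (_ : (M1 + i.+1)%N = m); last by rewrite addnS.
    by ring.
  rewrite [leLHS](_ : _ = @pairing_const R n kap / kap * Num.sqrt (K * M) * (2 `^ (- (m%:R * a)) * 2 `^ (- (`|(m%:Z - k)%R|%N%:R * d)))); last by ring.
  rewrite le_eqVlt; apply/orP; left; apply/eqP; congr (_ * _).
  apply: pow2_decay.
  by rewrite -[LHS]/(`|(m%:Z - k)%R|%N%:Z%:~R) mkE intrB.
apply: (le_trans (ler_sum _ (fun i _ => term i))); rewrite -mulr_sumr.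
apply: (le_trans (ler_wpM2l _ (geometric_int_le 1 L0 rho01))).
  by rewrite mulr_ge0// exprn_ge0//; have /andP[/ltW] := rho01.
have hr : rho ^+ M1 <= e / 4 / D by apply: hN0; rewrite /M1 leq_max leqnn.
have rM : 0 <= rho ^+ M1 by rewrite exprn_ge0//; have /andP[/ltW] := rho01.
apply: (@le_trans _ _ (D * rho ^+ M1)).
  rewrite mulrAC; apply: ler_wpM2r => //.
  by rewrite lerDl.
by rewrite -ler_pdivlMl// mulrC.
Qed.

End low_frequency.

(** * The pairing bound and duality *)

Section main_pairing.
Context (R : realType) (n : nat) (n3 : (3 <= n)%N).
Context (kap : R) (hkap : @inversion_constant R n kap).
Context (phi : R -> R) (hphi : dyadic_profile phi).
Local Notation E := 'rV[R]_n.
Local Notation C := R[i].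
Local Notation cut := (@cutoff R n phi).
Local Notation Q_ k := (@dyadic_cutoff R n phi k).
Local Notation Qfat := (@Qfat R n phi).
Implicit Types (b th g h w psi v u : E -> C) (f : functional R n).

Lemma uniform_threshold N (P : 'I_N -> nat -> Prop) :
  (forall i, exists m, forall M, (m <= M)%N -> P i M) -> exists M, forall i, P i M.
Proof.
move=> /choice[g hg]; exists (\max_(i < N) g i) => i; apply: hg.
exact: (leq_bigmax (F := g) i).
Qed.

Lemma FT_linear_on_schwartz f : linear_on_schwartz f -> linear_on_schwartz (fun u => f (FT (-1) u)).
Proof.
move=> lf c u1 u2 s1 s2; have [i1 i2] := (schwartz_cintegrable s1, schwartz_cintegrable s2).
rewrite (FT_D (-1) (cintegrableZ c i1) i2) (FT_Z (-1) c i1).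
exact: (lf c _ _ (schwartz_FT (neg1_neq0 R) s1) (schwartz_FT (neg1_neq0 R) s2)).
Qed.

(** Converts a frequency piece of f into a value of P_j f. The fattened cutoff goes into the test
    function, since P_j itself supplies Q_j. *)
Lemma Pk_FT j f u : linear_on_schwartz f -> schwartz u ->
  Pk phi j f (FT (-1) (fun x => Qfat j x * u x)) = (c0 R n * kap)%:C%C * f (FT (-1) (fun x => Q_ j x * u x)).
Proof.
move=> lf su.
have s1 : schwartz (fun x => Qfat j x * u x) by apply: schwartz_bumpM => //; exact: bump_Qfat.
have s2 : schwartz (fun x => Q_ j x * u x) by apply: schwartz_bumpM => //; exact: bump_dyadic.
rewrite -(linZ _ lf (schwartz_FT (neg1_neq0 R) s2)).
rewrite -[X in _ = f X](FT_Z (-1) ((c0 R n * kap)%:C%C) (schwartz_cintegrable s2)).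
rewrite /Pk /multiplier /dist_inv_fourier /dist_mul /dist_fourier fourierE (inv_fourier_FT hkap s1).
congr (f (FT (-1) _)); apply/funext => x.
rewrite mulrCA; congr (_ * _).
by rewrite mulrA [Q_ j x * Qfat j x]mulrC (fat_thin hphi).
Qed.

Lemma blockop_convop m k j th : convop (Qfat m) (fun x => Qfat j x * convop (Q_ k) th x) = blockop phi (Qfat j) m k th.
Proof. by []. Qed.

Lemma pow2_exprn (x : R) N : 2 `^ (- (N%:R * x)) = (2 `^ (- x)) ^+ N :> R.
Proof. by rewrite -(powR_mulrn N (powR_ge0 _ _)) -powRrM; congr (_ `^ _); ring. Qed.

Definition weight (d : R) (N : nat) : R := 2 `^ (- (N%:R * d)).

Lemma weightD (d d' : R) N : weight d N * weight d' N = weight (d + d') N.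
Proof. by rewrite /weight pow2D; congr (_ `^ _); ring. Qed.

Lemma weight0 N : weight 0 N = 1. Proof. by rewrite /weight mulr0 oppr0 powRr0. Qed.

Lemma weight_gt0 d N : 0 < weight d N. Proof. by rewrite powR_gt0. Qed.

Lemma sum_weight_le (d : R) (c : int) N : 0 < d ->
  \sum_(l < N) weight d `|(l%:Z + c)%R|%N <= 2 / (1 - 2 `^ (- d)).
Proof.
move=> d0; under eq_bigr do rewrite /weight pow2_exprn.
by apply: geometric_int_le; exact: pow2N_lt1.
Qed.

(** Cauchy-Schwarz over (i, l), with N = |m - k| and d = n/2 - |s|, after inserting 2^(-N (d +
    d')/2) and its inverse. The frequency sum of the block norms gives 2^(-2dN); against the weight
    2^(N (d + d')) this leaves 2^(-N (d - d')), summable in m. *)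
Lemma double_sum_pairing s : `|s| <= 1 -> exists2 K : R, 0 < K &
  forall (d' : R) J M (k : int) (y : int -> int -> R) B th t, 0 < n%:R / 2 - `|s| - d' ->
  schwartz th -> 0 <= B -> 0 <= t -> (snorm (- s) th <= t%:E)%E ->
  \sum_(i < (2 * J).+1) \sum_(l < (2 * M).+1)
    weight (n%:R / 2 - `|s| + d') `|(l%:Z - M%:Z - k)%R|%N * y (i%:Z - J%:Z) (l%:Z - M%:Z) ^+ 2 <= B ^+ 2 ->
  \sum_(i < (2 * J).+1) \sum_(l < (2 * M).+1)
    y (i%:Z - J%:Z) (l%:Z - M%:Z) * Num.sqrt (fine (snorm (- s) (blockop phi (Qfat (i%:Z - J%:Z)) (l%:Z - M%:Z) k th)))
  <= B * Num.sqrt (K / (1 - 2 `^ (- (n%:R / 2 - `|s| - d'))) * t).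
Proof.
move=> s1; have sN : `|(- s)| <= 1 by rewrite normrN.
have [K K0 hK] := snorm_blockop_sum n3 hkap hphi sN; exists (K * 2); first by rewrite mulr_gt0.
move=> d' J M k y B th t dd sth B0 t0 hth hB.
pose d := n%:R / 2 - `|s|; rewrite -/d in dd hB *.
pose N (l : 'I_(2 * M).+1) := `|(l%:Z - M%:Z - k)%R|%N.
pose T (i : 'I_(2 * J).+1) (l : 'I_(2 * M).+1) := fine (snorm (- s) (blockop phi (Qfat (i%:Z - J%:Z)) (l%:Z - M%:Z) k th)).
have T0 i l : 0 <= T i l by rewrite fine_ge0// wnorm_ge0.
have bQ j : bump (Qfat j) by exact: bump_Qfat.
have sT l : \sum_(i < (2 * J).+1) T i l <= K * weight (2 * d) (N l) * t.
  have := hK (l%:Z - M%:Z) k J th t sth hth; rewrite -lee_fin -sumEFin => h.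
  apply: le_trans (le_trans h _).
    rewrite le_eqVlt; apply/orP; left; apply/eqP; apply: eq_bigr => i _; rewrite /T.
    have [r r0 hr] := snorm_finite n3 sN (schwartz_blockop hphi (l%:Z - M%:Z) k (bQ (i%:Z - J%:Z)) sth).
    by rewrite hr.
  rewrite lee_fin normrN half_powR /weight (_ : n%:R - 2 * `|s| = 2 * d)//.
  by rewrite /d; field.
have eq1 (i : 'I_(2 * J).+1) (l : 'I_(2 * M).+1) : y (i%:Z - J%:Z) (l%:Z - M%:Z) * Num.sqrt (T i l) =
   (weight ((d + d') / 2) (N l) * y (i%:Z - J%:Z) (l%:Z - M%:Z)) * (weight (- ((d + d') / 2)) (N l) * Num.sqrt (T i l)).
  rewrite mulrACA weightD (_ : (d + d') / 2 + - ((d + d') / 2) = 0); last by ring.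
  by rewrite weight0 mul1r.
under eq_bigr => i _ do under eq_bigr => l _ do rewrite -/(T i l) eq1.
apply: (le_trans (sum2_cs _ _)); apply: ler_pM; rewrite ?sqrtr_ge0//.
  rewrite -[leRHS](ger0_norm B0) -sqrtr_sqr ler_wsqrtr//; apply: le_trans hB.
  apply: ler_sum => i _; apply: ler_sum => l _.
  rewrite exprMn [weight _ _ ^+ 2]expr2 weightD -/(N l).
  by rewrite (_ : (d + d') / 2 + (d + d') / 2 = d + d')//; field.
rewrite ler_wsqrtr// exchange_big/=.
apply: (@le_trans _ _ (\sum_(l < (2 * M).+1) K * t * weight (d - d') (N l))).
  apply: ler_sum => l _.
  have -> : \sum_(i < (2 * J).+1) (weight (- ((d + d') / 2)) (N l) * Num.sqrt (T i l)) ^+ 2 =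
     weight (- (d + d')) (N l) * \sum_(i < (2 * J).+1) T i l.
    rewrite mulr_sumr; apply: eq_bigr => i _; rewrite exprMn sqr_sqrtr// [weight _ _ ^+ 2]expr2 weightD.
    by rewrite (_ : - ((d + d') / 2) + - ((d + d') / 2) = - (d + d'))//; field.
  apply: (le_trans (ler_wpM2l (ltW (weight_gt0 _ _)) (sT l))).
  rewrite (_ : d - d' = - (d + d') + 2 * d); last by ring.
  by rewrite -weightD le_eqVlt; apply/orP; left; apply/eqP; ring.
rewrite -mulr_sumr.
have -> : K * 2 / (1 - 2 `^ (- (d - d'))) * t = K * t * (2 / (1 - 2 `^ (- (d - d')))) by ring.
apply: ler_wpM2l; first by rewrite mulr_ge0// ltW.
have := @sum_weight_le (d - d') (- M%:Z - k) (2 * M).+1 dd.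
by under eq_bigr do rewrite addrA.
Qed.

(** The order of the choices matters: J fixes finitely many frequency pieces up to e/3 at each end,
    and only then is a common spatial range M chosen for all of them. *)
Lemma main_pairing q a s : (2%:E <= q)%E -> `|s| <= 1 -> `|a| + `|s| < n%:R / 2 ->
  exists2 K : R, 0 < K & forall f, space_x phi q a s f ->
  forall (k : int) (y : int -> int -> R) B,
  (forall j m, (Hdot_norm s (Qk phi m (Pk phi j f)) <= (y j m)%:E)%E) -> 0 <= B ->
  (forall J M, \sum_(i < (2 * J).+1) \sum_(l < (2 * M).+1)
    weight (n%:R / 2 - `|s| + `|a|) `|(l%:Z - M%:Z - k)%R|%N * y (i%:Z - J%:Z) (l%:Z - M%:Z) ^+ 2 <= B ^+ 2) ->
  forall th t, schwartz th -> 0 <= t -> (snorm (- s) th <= t%:E)%E ->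
  cabs (f (fun x => Q_ k x * FT (-1) th x)) <= K * B * Num.sqrt t.
Proof.
move=> hq s1 has; have sN : `|(- s)| <= 1 by rewrite normrN.
have [K K0 hK] := double_sum_pairing s1; have [k0 _] := hkap; have p0 := c0_gt0 R n.
pose K2 := K / (1 - 2 `^ (- (n%:R / 2 - `|s| - `|a|))).
have dd : 0 < n%:R / 2 - `|s| - `|a| by lra.
have K20 : 0 <= K2.
  by rewrite divr_ge0 ?(ltW K0)//; have /andP[_] := pow2N_lt1 dd; lra.
pose Kq := @pairing_const R n kap / kap; have Kq0 : 0 <= Kq by rewrite divr_ge0 ?sqrtr_ge0 ?ltW.
pose c := c0 R n * kap; have c00 : 0 < c by rewrite mulr_gt0.
exists (kap^-1 * (c^-1 * (Kq * Num.sqrt K2)) + 1).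
  by rewrite ltr_wpDl// !mulr_ge0 ?invr_ge0 ?sqrtr_ge0 ?ltW.
move=> f sf k y B hy B0 hB th t sth t0 hth; have [tf _] := sf; have lf := tf.1.
have bQ j : bump (Qfat j) by exact: bump_Qfat.
set u := convop (Q_ k) th.
have su : schwartz u by apply: schwartz_convop => //; exact: bump_dyadic.
have sQ : schwartz (fun x => Q_ k x * FT (-1) th x).
  by apply: schwartz_bumpM; [exact: bump_dyadic|exact: (schwartz_FT (neg1_neq0 R))].
suff H : cabs (f (FT (-1) u)) <= c^-1 * (Kq * Num.sqrt K2) * B * Num.sqrt t.
  have := H; rewrite (FT_convop hkap (bump_dyadic n hphi k) sth) (linZ _ lf sQ) cabsM cabs_real gtr0_norm//.
  rewrite -ler_pdivlMl// => /le_trans; apply.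
  rewrite !mulrA ler_wpM2r ?sqrtr_ge0// ler_wpM2r// -!mulrA lerDl//.
have lP := FT_linear_on_schwartz lf.
apply/ler_addgt0Pr => e e0; have e3 : 0 < e / 3 by rewrite divr_gt0.
have [J1 hJ1] := snull_tempered tf (snull_FT (neg1_neq0 R) (snull_high hphi su)) e3.
have [J2 hJ2] := low_frequency_null n3 hkap hphi k hq s1 has sf sth e3.
pose J := maxn J1 J2.
pose v (j : int) x := Qfat j x * u x.
have sv j : schwartz (v j) by exact: schwartz_bumpM.
(* The remaining e/3 is shared among the 2J + 1 frequency pieces; c is the factor by which P_j f
   differs from the piece of f. *)
pose e' : R := c * (e / 3) / (2 * J).+1%:R.
have e'0 : 0 < e' by rewrite divr_gt0// mulr_gt0.
have [M hM] := uniform_threshold (fun i : 'I_(2 * J).+1 => Pk_decomposition n3 hphi (i%:Z - J%:Z) tf (sv (i%:Z - J%:Z)) e'0).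
have b1 (i : 'I_(2 * J).+1) (l : 'I_(2 * M).+1) :
   cabs (Pk phi (i%:Z - J%:Z) f (fun x => Q_ (l%:Z - M%:Z) x * FT (-1) (v (i%:Z - J%:Z)) x)) <=
   Kq * (y (i%:Z - J%:Z) (l%:Z - M%:Z) * Num.sqrt (fine (snorm (- s) (blockop phi (Qfat (i%:Z - J%:Z)) (l%:Z - M%:Z) k th)))).
  rewrite mulrA; apply: (Qk_pairing n3 hkap hphi (sv _) (hy _ _)).
  rewrite /v blockop_convop.
  have [r r0 hr] := snorm_finite n3 sN (schwartz_blockop hphi (l%:Z - M%:Z) k (bQ (i%:Z - J%:Z)) sth).
  by rewrite hr.
have b2 (i : 'I_(2 * J).+1) : cabs (f (FT (-1) (fun x => Q_ (i%:Z - J%:Z) x * u x))) <=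
   c^-1 * (e' + \sum_(l < (2 * M).+1) Kq * (y (i%:Z - J%:Z) (l%:Z - M%:Z) * Num.sqrt (fine (snorm (- s) (blockop phi (Qfat (i%:Z - J%:Z)) (l%:Z - M%:Z) k th))))).
  rewrite ler_pdivlMl//.
  have := Pk_FT (i%:Z - J%:Z) lf su; move=> /(congr1 (@cabs R)); rewrite cabsM cabs_real gtr0_norm// => <-.
  have := hM i; set A := \sum_(l < _) _; set P := Pk phi _ _ _ => h.
  rewrite -[P](subrK A); apply: (le_trans (ler_cabsD _ _)); apply: lerD => //.
  by apply: (le_trans (cabs_sum _ _ _)); apply: ler_sum => l _; exact: b1.
rewrite (lin_dyadic_split hphi J lP su).
apply: (le_trans (ler_cabsD _ _)); apply: (le_trans (lerD (lexx _) (ler_cabsD _ _))).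
have g1 : cabs (f (FT (-1) (fun x => (1 - cut (2 ^+ J) x) * u x))) <= e / 3 by apply: hJ1; exact: leq_maxl.
have g2 : cabs (f (FT (-1) (fun x => cut (2 ^- J.+1) x * u x))) <= e / 3.
  by apply: hJ2; apply: leqW; exact: leq_maxr.
have g3 : cabs (\sum_(i < (2 * J).+1) f (FT (-1) (fun x => Q_ (i%:Z - J%:Z) x * u x))) <=
   e / 3 + c^-1 * (Kq * Num.sqrt K2) * B * Num.sqrt t.
  apply: (le_trans (cabs_sum _ _ _)); apply: (le_trans (ler_sum _ (fun i _ => b2 i))).
  rewrite -mulr_sumr big_split/= sumr_const card_ord mulrDr; apply: lerD.
    rewrite -mulr_natr /e' le_eqVlt; apply/orP; left; apply/eqP; field.
    by rewrite !gt_eqF.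
  under eq_bigr do rewrite -mulr_sumr.
  rewrite -mulr_sumr [leRHS](_ : _ = c^-1 * (Kq * (B * (Num.sqrt K2 * Num.sqrt t)))); last by ring.
  apply: ler_wpM2l; first by rewrite invr_ge0 ltW.
  apply: ler_wpM2l => //; rewrite -sqrtrM//.
  exact: (hK `|a| J M k y B th t dd sth B0 t0 hth (hB J M)).
by move: g1 g2 g3; lra.
Qed.

End main_pairing.

(** * From bounds on pairings to bounds on norms *)

Section duality.
Context (R : realType) (n : nat) (n3 : (3 <= n)%N).
Context (kap : R) (hkap : @inversion_constant R n kap).
Context (phi : R -> R) (hphi : dyadic_profile phi).
Local Notation E := 'rV[R]_n.
Local Notation C := R[i].
Local Notation mu := (lebesgue_tuple R n).
Local Notation pt := (@Defs.point R n).
Local Notation Q_ k := (@dyadic_cutoff R n phi k).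
Local Notation Re := (@complex.Re R).
Implicit Types (b th g h w psi : E -> C) (f v : functional R n).

(** The value 0 at the origin is that of every annular truncation, so the truncations converge to it
    at every point. *)
Definition punct h : E -> C := fun x => if x == 0 then 0 else h x.

Lemma integ_Re (u : E -> R) : cintegrable (fun x => (u x)%:C%C) ->
  integ u = (Re (cintegral (fun x => (u x)%:C%C)))%:E.
Proof. exact: integral_Re_cintegral. Qed.

Lemma cmeasurable_punct h : cmeasurable h -> cmeasurable (punct h).
Proof.
move=> [m1 m2]; have mo := @measurable_origin R n.
have key (u : E -> R) : mfun u -> mfun (fun x => if x == 0 then 0 else u x).
  move=> mv; apply: measurable_fun_if => //.
    by apply: (measurable_fun_bool true); rewrite setTI; exact: mo.
  by apply: measurable_funTS.
split; [have := key (fun x => Re (h x)) m1|have := key (fun x => complex.Im (h x)) m2];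
  rewrite /mfun; congr measurable_fun; by apply/funext => t; rewrite /punct/=; case: ifP.
Qed.

Lemma integ_fatou (v_ : nat -> E -> R) (v : E -> R) (K : R) : (forall k, mfun (v_ k)) ->
  (forall k x, 0 <= v_ k x) -> (forall x, v_ k x @[k --> \oo] --> v x) ->
  (forall k, (integ (v_ k) <= K%:E)%E) -> mfun v /\ (integ v <= K%:E)%E.
Proof.
move=> mv v0 vv vK; have mv' : mfun v.
  by apply: (@measurable_fun_cvg _ _ _ _ (fun k t => v_ k (pt t))) => [k|t _]; [exact: mv|exact: vv].
split=> //.
have -> : integ v = (\int[mu]_t limn_einf (fun k => (v_ k (pt t))%:E))%E.
  apply: eq_integral => t _; apply/esym; apply: (cvg_limn_einf_sup _).1.
  by apply: cvg_EFin; [exact: nearW|exact: vv].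
apply: (le_trans (@fatou _ _ _ mu setT measurableT (fun k t => (v_ k (pt t))%:E) _ _)).
- by move=> k; apply/measurable_EFinP; exact: mv.
- by move=> k t _; rewrite lee_fin.
rewrite limn_einf_lim; apply: lime_le; first exact: is_cvg_einfs.
by apply: nearW => k; apply: le_trans (vK k); apply: ereal_inf_lbound; exists k => //=.
Qed.

Lemma cvg_cabs (z_ : nat -> C) z : cabs (z_ k - z) @[k --> \oo] --> 0 ->
  cabs (z_ k) @[k --> \oo] --> cabs z.
Proof.
move=> h; apply/cvgrPdist_le => e e0; have /cvgr0Pnorm_le/(_ _ e0) := h; apply: filterS => k.
rewrite ger0_norm ?cabs_ge0// => hk; apply: le_trans hk.
have h1 := ler_cabsD (z_ k - z) z; rewrite subrK in h1.
have h2 := ler_cabsD (z - z_ k) (z_ k); rewrite subrK in h2.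
have h3 : cabs (z - z_ k) = cabs (z_ k - z) by rewrite -cabsN opprB.
by rewrite ler_norml; apply/andP; split; lra.
Qed.

Lemma absD_add s v1 v2 w1 w2 : absD s v1 w1 -> absD s v2 w2 ->
  absD s (fun psi => v1 psi + v2 psi) (fun x => w1 x + w2 x).
Proof.
move=> [h1 [r1 i1 q1]] [h2 [r2 i2 q2]]; exists (fun x => h1 x + h2 x).
have rep u1 u2 a b psi : schwartz psi -> represents u1 a -> represents u2 b ->
    cintegrable (fun x => (a x + b x) * psi x) /\ u1 psi + u2 psi = dist_of (fun x => a x + b x) psi.
  move=> sp /(_ _ sp)[ia ea] /(_ _ sp)[ib eb].
  split; first by apply: eq_cintegrable (cintegrableD ia ib) => x; rewrite mulrDl.
  by rewrite ea eb /dist_of -cintegralD//; apply: eq_cintegral => x; rewrite mulrDl.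
split.
- by move=> psi sp; exact: (rep _ _ _ _ _ sp r1 r2).
- move=> psi sp; apply: eq_cintegrable (cintegrableD (i1 _ sp) (i2 _ sp)) => x; ring.
move=> psi sp; have [ia ea] := rep _ _ _ _ _ sp q1 q2; split=> //.
rewrite -ea /dist_inv_fourier /dist_of -cintegralD.
- by apply: eq_cintegral => x; ring.
- apply: i1; rewrite inv_fourierE; apply: schwartzZ; exact: (schwartz_FT (one_neq0 R)).
- apply: i2; rewrite inv_fourierE; apply: schwartzZ; exact: (schwartz_FT (one_neq0 R)).
Qed.

(** From (a + b)^2 <= 2 a^2 + 2 b^2 and 2 y1^2 + 2 y2^2 <= (2 y1 + 2 y2)^2; sharp constants are of
    no interest here. *)
Lemma L2norm_add w1 w2 (y1 y2 : R) : cmeasurable w1 -> cmeasurable w2 -> 0 <= y1 -> 0 <= y2 ->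
  (L2norm w1 <= y1%:E)%E -> (L2norm w2 <= y2%:E)%E -> (L2norm (fun x => (w1 x + w2 x)%R) <= (2 * y1 + 2 * y2)%:E)%E.
Proof.
move=> m1 m2 y10 y20; rewrite !L2norm_le ?addr_ge0 ?mulr_ge0// => h1 h2.
have sq (w : E -> C) : cmeasurable w -> mfun (fun x => 2 * cabs (w x) ^+ 2).
  by move=> mw; apply: mfunZ; apply: measurable_funX; exact: mfun_cabs.
apply: (@le_trans _ _ (integ (fun x => 2 * cabs (w1 x) ^+ 2 + 2 * cabs (w2 x) ^+ 2)%R)).
  apply: le_integ.
  - by have md := cmeasurableD m1 m2; exact: (measurable_funX 2 (mfun_cabs md)).
  - by apply: measurable_funD; exact: sq.
  - by move=> x; exact: sqr_ge0.
  move=> x; apply: (@le_trans _ _ ((cabs (w1 x) + cabs (w2 x)) ^+ 2)).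
    by rewrite lerXn2r ?nnegrE ?addr_ge0 ?cabs_ge0// ler_cabsD.
  by have := sqr_ge0 (cabs (w1 x) - cabs (w2 x)); rewrite !expr2; lra.
have p0 (w : E -> C) x : 0 <= 2 * cabs (w x) ^+ 2 by rewrite mulr_ge0 ?sqr_ge0.
rewrite integD//; try exact: sq.
have z (w : E -> C) y : cmeasurable w -> (integ (fun x => cabs (w x) ^+ 2)%R <= (y ^+ 2)%:E)%E ->
   (integ (fun x => 2 * cabs (w x) ^+ 2)%R <= (2 * y ^+ 2)%:E)%E.
  move=> mw hw; rewrite integZ//; last 2 first.
  - by apply: measurable_funX; exact: mfun_cabs.
  - by move=> x; exact: sqr_ge0.
  by rewrite [(2 * y ^+ 2)%:E]EFinM; apply: lee_wpmul2l.
apply: (le_trans (leeD (z _ _ m1 h1) (z _ _ m2 h2))).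
rewrite -EFinD lee_fin; have := mulr_ge0 y10 y20; have := sqr_ge0 y1; have := sqr_ge0 y2; rewrite !expr2; lra.
Qed.

(* The candidate for |D|^s of G is the transform of |xi|^s times that of G; its norm is read
   off by testing against |xi|^(2s) times the conjugate transform, truncated to annuli. *)
Lemma test_absD s (G : E -> C) (L : R) : `|s| <= 1 -> schwartz G -> 0 <= L ->
  (forall th t, schwartz th -> 0 <= t -> (snorm (- s) th <= t%:E)%E ->
     cabs (cintegral (fun x => FT (-1) G x * th x)) <= L * Num.sqrt t) ->
  exists w, absD s (dist_of G) w /\ (L2norm w <= (c0 R n * Num.sqrt kap * L)%:E)%E.
Proof.
move=> s1 sG L0 hL; have sN : `|(- s)| <= 1 by rewrite normrN.
have [k0 hk] := hkap; have p0 := c0_gt0 R n.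
pose H := FT (-1) G; have sH : schwartz H by exact: (schwartz_FT (neg1_neq0 R)).
have iH := schwartz_cintegrable sH.
pose bb J (x : E) : C := (enorm x `^ s)%:C%C * annulus phi J x.
have bbb J : bump (bb J) by exact: bump_weight.
pose HJ J := weighted phi s J H.
have sHJ J : schwartz (HJ J) by exact: schwartz_weighted.
have IJ J : (integ (fun x => cabs (HJ J x) ^+ 2)%R <= (L ^+ 2)%:E)%E.
  (* For this [th] the pairing equals I0, the squared norm of the truncation, and its squared dual
     norm is at most I0 as well. Hence I0 <= L sqrt I0. *)
  pose th x := bb J x * (bb J x * (H x)^*%C).
  have sth : schwartz th by do 2 apply: schwartz_bumpM => //; exact: schwartz_conj.
  have i2 : cintegrable (fun x => (cabs (HJ J x) ^+ 2)%:C%C) by exact: schwartz_sqr_integrable.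
  have eI := integ_Re (u := fun x => cabs (HJ J x) ^+ 2) i2.
  rewrite eI; set I0 := Re _ in eI *.
  have I00 : 0 <= I0 by rewrite -lee_fin -eI; apply: integ_ge0 => x; exact: sqr_ge0.
  have E1 : cintegral (fun x => H x * th x) = I0%:C%C.
    have -> : I0%:C%C = cintegral (fun x => (cabs (HJ J x) ^+ 2)%:C%C).
      by rewrite (cintegral_real i2).
    apply: eq_cintegral => x; rewrite -mul_conj /HJ /weighted -/(bb J x) /th.
    have -> : (bb J x * H x)^*%C = bb J x * (H x)^*%C.
      rewrite rmorphM/=; congr (_ * _); rewrite /bb /annulus /cut -rmorphB/= -rmorphM/=.
      by apply: eqReIm => /=; ring.
    by ring.
  have hth : (snorm (- s) th <= I0%:E)%E.
    rewrite -eI; apply: le_integ.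
    - by apply: mfun_wnorm; exact: mfun_schwartz.
    - by apply: measurable_funX; exact: mfun_schwartz.
    - by move=> x; rewrite mulr_ge0 ?powR_ge0 ?sqr_ge0.
    move=> x; rewrite /HJ /weighted -/(bb J x) /th (cabsM (bb J x) (H x)) (cabsM (bb J x) (_ * _)) (cabsM (bb J x) (H x)^*%C) cabs_conj.
    have hb : enorm x `^ (2 * - s) * cabs (bb J x) ^+ 2 <= 1.
      have [->|x0] := eqVneq x 0; first by rewrite /bb annulus_at0 ?mulr0 ?cabs0 ?expr0n ?mulr0.
      rewrite /bb cabsM cabs_real ger0_norm ?powR_ge0// exprMn mulrA.
      have -> : enorm x `^ (2 * - s) * (enorm x `^ s) ^+ 2 = 1.
        rewrite expr2 -!(powR_enormD _ _ x0) (_ : 2 * - s + (s + s) = 0); last by ring.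
        by rewrite powRr0.
      by rewrite mul1r exprn_ile1 ?cabs_ge0// cabs_annulus_le1.
    rewrite [leLHS](_ : _ = (enorm x `^ (2 * - s) * cabs (bb J x) ^+ 2) * (cabs (bb J x) * cabs (H x)) ^+ 2); last by ring.
    by rewrite ler_piMl// sqr_ge0.
  have := hL th I0 sth I00 hth; rewrite E1 cabs_real ger0_norm// => h.
  rewrite lee_fin; have [->|I0n] := eqVneq I0 0; first exact: sqr_ge0.
  have sq0 : 0 < Num.sqrt I0 by rewrite sqrtr_gt0 lt_neqAle eq_sym I0n.
  have : Num.sqrt I0 <= L.
    by rewrite -(ler_pM2r sq0) -expr2 sqr_sqrtr.
  by move=> h2; rewrite -(sqr_sqrtr I00) lerXn2r ?nnegrE ?sqrtr_ge0.
pose h := punct H; pose hs x := (enorm x `^ s)%:C%C * h x.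
have HJhs J x : cabs (HJ J x) <= cabs (hs x).
  rewrite /HJ /weighted /hs /h /punct; case: eqVneq => [->|x0].
    have z (A B : C) : cabs (A * 0 * B) <= cabs (A * 0) by rewrite mulr0 mul0r.
    by rewrite annulus_at0//; exact: z.
  rewrite !cabsM mulrAC ler_piMr ?mulr_ge0 ?cabs_ge0//.
  exact: cabs_annulus_le1.
have HJcvg x : cabs (HJ J x - hs x) @[J --> \oo] --> 0.
  apply: cvg_near_cst; rewrite /HJ /weighted /hs /h /punct; case: eqVneq => [->|x0].
    near=> J; apply/eqP; rewrite -[_ == _]/(cabs _ == 0) annulus_at0//.
    have z (A B : C) : cabs (A * 0 * B - A * 0) = 0 by rewrite mulr0 mul0r subrr cabs0.
    by apply/eqP; exact: z.
  by near=> J; rewrite (near (annulus_near_cst hphi x0) J)// mulr1 subrr cabs0.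
have mpow (p : R) : mfun (fun x => enorm x `^ p) := @measurable_powR_enorm R n p.
have mh : cmeasurable h /\ cmeasurable hs.
  have mh : cmeasurable h by apply: cmeasurable_punct; exact: smooth_cmeasurable sH.1.
  by split=> //; apply: cmeasurableM => //; split=> //=; exact: mpow.
have ihs : cintegrable hs.
  have [M hM] := sH.2 (2 * n.+2)%N; have M0 := schwartz_bound_ge0 hM.
  (* [integ_jap_powR] has exponent 2 tau, so tau = s/2 yields the weight |x|^s. *)
  have s2 : `|s / 2| <= 1 by rewrite normrM [`|2^-1|]ger0_norm ?invr_ge0//; lra.
  have [D D0 hD] := integ_jap_powR n3 s2; have := hD 1 ltr01; rewrite mulrCA mulfV ?mulr1// => hD1.
  have mu0 : mfun (fun x : E => (1 + 1 * enorm x) ^- (2 * n.+2) * enorm x `^ s).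
    exact: (mfunM (mfun_jap_lam (2 * n.+2) ltr01) (mpow s)).
  apply: (le_cintegrable mh.2 (u := fun x : E => M * ((1 + 1 * enorm x) ^- (2 * n.+2) * enorm x `^ s))).
  - exact: (mfunZ M mu0).
  - move=> x; rewrite /hs /h /punct cabsM cabs_real ger0_norm ?powR_ge0//.
    rewrite mulrA mulrC ler_wpM2r ?powR_ge0// mul1r; case: ifP => _.
      by rewrite cabs0 mulr_ge0// invr_ge0 ltW// jap_pow_gt0.
    exact: (@schwartz_boundP _ _ _ _ _ [::] x hM).
  have u0 (x : E) : 0 <= (1 + 1 * enorm x) ^- (2 * n.+2) * enorm x `^ s.
    by rewrite mulr_ge0 ?powR_ge0// invr_ge0 ltW// jap_lam_gt0.
  have := integZ mu0 u0 M0; rewrite /integ => ->.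
  by apply: lte_mul_pinfty; rewrite ?lee_fin//; apply: (le_lt_trans hD1); rewrite ltry.
have [_ Ihs] : mfun (fun x => cabs (hs x) ^+ 2) /\ (integ (fun x => cabs (hs x) ^+ 2)%R <= (L ^+ 2)%:E)%E.
  apply: (integ_fatou (v_ := fun J x => cabs (HJ J x) ^+ 2)) => //.
  - by move=> J; apply: measurable_funX; exact: mfun_schwartz.
  - by move=> J x; exact: sqr_ge0.
  by move=> x; rewrite !expr2; apply: cvgM; exact: cvg_cabs.
pose w := inv_fourier hs.
have rw : represents (dist_inv_fourier (dist_of hs)) w.
  move=> psi sp; have ip := schwartz_cintegrable sp.
  have [j1 e1] := parseval 1 ihs ip; have [j2 _] := parseval 1 ip ihs.
  have j3 : cintegrable (fun x => w x * psi x).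
    by apply: eq_cintegrable (cintegrableZ (c0 R n)%:C%C j2) => x; rewrite /w inv_fourierE -/(c0 R n); ring.
  split=> //; rewrite /dist_inv_fourier /dist_of inv_fourierE.
  transitivity ((c0 R n)%:C%C * cintegral (fun x => hs x * FT 1 psi x)).
    by rewrite -cintegralZ//; apply: eq_cintegral => x; rewrite -/(c0 R n); ring.
  rewrite e1 -cintegralZ; last by apply: eq_cintegrable j2 => x; rewrite mulrC.
  by apply: eq_cintegral => x; rewrite /w inv_fourierE -/(c0 R n); ring.
have FTJ x : cabs (FT 1 (HJ J) x - FT 1 hs x) @[J --> \oo] --> 0.
  have [mhs fhs] := (cintegrableP _).1 ihs.
  have [_ _] : [/\ forall J, cintegrable (fun y => cis (1 * dotp y x) * HJ J y),
     cintegrable (fun y => cis (1 * dotp y x) * hs y) &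
     cabs (cintegral (fun y => cis (1 * dotp y x) * HJ J y) - cintegral (fun y => cis (1 * dotp y x) * hs y)) @[J --> \oo] --> 0].
    apply: (@dominated_cintegral _ _ _ _ (fun y => cabs (hs y))) => //.
    - by move=> J; have /cintegrableP[] := cintegrable_cis 1 x (schwartz_cintegrable (sHJ J)).
    - exact: (measurable_cabs mhs).
    - by move=> J y; rewrite cabsM cabs_cis mul1r.
    move=> y; apply: eq_cvgn (HJcvg y) => J.
    by rewrite -mulrBr cabsM cabs_cis mul1r.
  by [].
(* [hs] need not be a Schwartz function: Plancherel is applied to the truncations, and Fatou passes
   to the limit. *)
have [mF IF] : mfun (fun x => cabs (FT 1 hs x) ^+ 2) /\ (integ (fun x => cabs (FT 1 hs x) ^+ 2)%R <= (kap * L ^+ 2)%:E)%E.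
  apply: (integ_fatou (v_ := fun J x => cabs (FT 1 (HJ J) x) ^+ 2)) => //.
  - by move=> J; apply: measurable_funX; apply: mfun_schwartz; exact: (schwartz_FT (one_neq0 R)).
  - by move=> J x; exact: sqr_ge0.
  - by move=> x; rewrite !expr2; apply: cvgM; exact: cvg_cabs.
  move=> J; have [_ _ e1 _] := hk _ (sHJ J); rewrite /integ e1 EFinM.
  by apply: lee_wpmul2l; [rewrite lee_fin ltW|exact: IJ].
exists w; split; last first.
  have y0 : 0 <= c0 R n * Num.sqrt kap * L by rewrite !mulr_ge0 ?sqrtr_ge0// ltW.
  rewrite L2norm_le// !exprMn sqr_sqrtr ?(ltW k0)//.
  have -> : (integ (fun x => cabs (w x) ^+ 2)%R = ((c0 R n) ^+ 2)%:E * integ (fun x => cabs (FT 1 hs x) ^+ 2)%R)%E.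
    rewrite -(integZ mF (fun x => sqr_ge0 _) (sqr_ge0 _)).
    by apply: eq_integral => t _; rewrite /w inv_fourierE -/(c0 R n) cabsM exprMn cabs_real gtr0_norm.
  rewrite -mulrA [(_ * (_ * _))%:E]EFinM; apply: lee_wpmul2l => //.
  by rewrite lee_fin sqr_ge0.
exists h; split=> //.
- move=> psi sp.
  have i1 : cintegrable (fun x => h x * psi x).
    have i0 := cintegrable_schwartzM sp iH.
    have [m0 f0] := (cintegrableP _).1 i0.
    apply: (@le_cintegrable _ _ _ (fun x => cabs (psi x * H x))) => //.
    - by apply: cmeasurableM; [exact: mh.1|exact: smooth_cmeasurable sp.1].
    - exact: (measurable_cabs m0).
    by move=> x; rewrite /h /punct; case: ifP => _; [rewrite mul0r cabs0 cabs_ge0|rewrite mulrC].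
  split=> //; have [_ e1] := parseval (-1) (schwartz_cintegrable sG) (schwartz_cintegrable sp).
  rewrite /dist_fourier fourierE /dist_of e1; apply: (cintegral_punctured n3) => //.
    by apply: eq_cintegrable (cintegrable_schwartzM sp iH) => x; rewrite mulrC.
  by move=> x /negbTE x0; rewrite /h /punct x0.
- move=> psi sp; apply: eq_cintegrable (cintegrable_schwartzM sp ihs) => x; by rewrite mulrC.
Unshelve. all: by end_near.
Qed.

(* f is the sum of a part small in the norm and a test function g: the first contributes
   little by duality, and for the second |D|^s is explicit. *)
Lemma Hdot_le_of_pairing q a s : (2%:E <= q)%E -> `|s| <= 1 ->
  exists2 K : R, 0 < K & forall f, space_x phi q a s f -> forall k B, 0 <= B ->
  (forall th t, schwartz th -> 0 <= t -> (snorm (- s) th <= t%:E)%E ->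
    cabs (f (fun x => Q_ k x * FT (-1) th x)) <= B * Num.sqrt t) ->
  (Hdot_norm s (Qk phi k f) <= (K * B)%:E)%E.
Proof.
move=> hq s1; have [k0 _] := hkap; have c00 := c0_gt0 R n.
have sk0 : 0 < Num.sqrt kap by rewrite sqrtr_gt0.
have ck0 : 0 < c0 R n * Num.sqrt kap by rewrite mulr_gt0.
have Kp0 : 0 <= pairing_const n kap by exact: sqrtr_ge0.
exists (2 * (c0 R n * Num.sqrt kap)); first by rewrite mulr_gt0.
move=> f [tf fs] k B B0 hB.
(* The coefficient of e in the final bound: 2 (e + e) from the near-optimal w1, and the rest from
   the pairing of f - g that enters the estimate for the test function. *)
set K1 := 4 + 2 * (c0 R n * Num.sqrt kap) * pairing_const n kap.
have K10 : 0 < K1 by rewrite ltr_pwDl// !mulr_ge0// ltW.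
have main e : 0 < e -> (Hdot_norm s (Qk phi k f) <= (2 * (c0 R n * Num.sqrt kap) * B + e * K1)%:E)%E.
  move=> e0; have p0 : 0 < 2 `^ (k%:~R * a) :> R by rewrite powR_gt0.
  have [g [tg hg]] := fs _ (mulr_gt0 p0 e0).
  set v : functional R n := fun psi => f psi - dist_of g psi in hg.
  have hv : (Hdot_norm s (Qk phi k v) <= e%:E)%E.
    by have := norm_x_Hdot k hq hg; rewrite mulrA pow2D addNr powRr0 mul1r.
  have [w1 hw1 Lw1] := Hdot_near hv e0.
  have bQ : bump (Q_ k) by exact: (bump_dyadic n hphi k).
  pose G x := Q_ k x * g x.
  have sG : schwartz G by apply: schwartz_bumpM => //; apply: bump_schwartz; exact: test_bump.
  have BK0 : 0 <= B + pairing_const n kap * e by rewrite addr_ge0// mulr_ge0// ltW.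
  have pair th t : schwartz th -> 0 <= t -> (snorm (- s) th <= t%:E)%E ->
     cabs (cintegral (fun x => FT (-1) G x * th x)) <= (B + pairing_const n kap * e) * Num.sqrt t.
    move=> sth t0 tht.
    have [_ e1] := parseval (-1) (schwartz_cintegrable sG) (schwartz_cintegrable sth).
    have -> : cintegral (fun x => FT (-1) G x * th x) =
        f (fun x => Q_ k x * FT (-1) th x) - Qk phi k v (FT (-1) th).
      rewrite /Qk /dist_mul /v opprB addrCA subrr addr0 -e1.
      by apply: eq_cintegral => x; rewrite /G; ring.
    have h2 := Hdot_pairing n3 hkap hphi sth hv tht.
    apply: (le_trans (ler_cabsD _ _)); rewrite cabsN mulrDl; apply: lerD; [exact: hB|exact: h2].
  have [w2 [hw2 Lw2]] := test_absD s1 sG BK0 pair.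
  have hw := absD_add hw1 hw2.
  have -> : Qk phi k f = (fun psi => Qk phi k v psi + dist_of G psi).
    apply/funext => psi; rewrite /Qk /dist_mul /v.
    have -> : dist_of g (fun x => Q_ k x * psi x) = dist_of G psi.
      by apply: eq_cintegral => x; rewrite /G; ring.
    by rewrite subrK.
  have m1 : cmeasurable w1 by have [? [_ _ r]] := hw1; exact: (represents_cmeasurable hphi r).
  have m2 : cmeasurable w2 by have [? [_ _ r]] := hw2; exact: (represents_cmeasurable hphi r).
  apply: (@le_trans _ _ (L2norm (fun x => (w1 x + w2 x)%R))).
    by apply: ereal_inf_lbound; exists (fun x => w1 x + w2 x).
  have ee0 : 0 <= e + e by rewrite addr_ge0// ltW.
  apply: (le_trans (L2norm_add m1 m2 ee0 (mulr_ge0 (ltW ck0) BK0) Lw1 Lw2)).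
  by rewrite lee_fin /K1 le_eqVlt; apply/orP; left; apply/eqP; ring.
apply/lee_addgt0Pr => e e0.
have := main (e / K1) (divr_gt0 e0 K10); rewrite -EFinD; congr (_ <= _%:E)%E.
by rewrite divfK// gt_eqF.
Qed.

End duality.

(** * Summation over dyadic scales *)

Section discrete_sums.
Context (R : realType).

Lemma esum_le_seq (a : int -> \bar R) y : (forall l : seq int, uniq l -> (\sum_(k <- l) a k <= y)%E) ->
  (\esum_(k in [set: int]) a k <= y)%E.
Proof.
move=> h; apply: ge_ereal_sup => _ [X [fX _] <-].
by rewrite fsbig_finite//; apply: h; exact: finmap.fset_uniq.
Qed.

Lemma seq_le_esum (a : int -> \bar R) (l : seq int) : uniq l ->
  (\sum_(k <- l) a k <= \esum_(k in [set: int]) a k)%E.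
Proof.
move=> ul; apply: esum_ge; exists [set` l]; first by split=> //; exact: finite_seq.
by rewrite -fsbig_seq.
Qed.

Lemma big_window (V : nmodType) (a : int -> V) N (c : int) :
  \sum_(i < N) a (i%:Z - c) = \sum_(k <- [seq (i : nat)%:Z - c | i <- iota 0 N]) a k.
Proof. by rewrite big_map -[in RHS](subn0 N) big_mkord. Qed.

Lemma uniq_window N (c : int) : uniq [seq (i : nat)%:Z - c | i <- iota 0 N].
Proof. by rewrite map_inj_uniq ?iota_uniq// => i j /addIr[]. Qed.

Lemma window_le_esum (a : int -> \bar R) N (c : int) :
  (\sum_(i < N) a (i%:Z - c)%R <= \esum_(k in [set: int]) a k)%E.
Proof. by rewrite big_window; apply: seq_le_esum; exact: uniq_window. Qed.

Lemma seq_sub_window (l : seq int) : exists M : nat,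
  {subset l <= [seq (i : nat)%:Z - M%:Z | i <- iota 0 (2 * M).+1]}.
Proof.
exists (\max_(k <- l) `|k|%N) => k kl; set M := \max_(k <- l) _.
have kM : (`|k| <= M)%N by rewrite /M (big_rem k)//= leq_maxl.
apply/mapP; exists `|(k + M%:Z)%R|%N; first by rewrite mem_iota; lia.
by lia.
Qed.

Lemma seq_le_window (a : int -> R) (l : seq int) : uniq l -> (forall k, 0 <= a k) ->
  exists M, \sum_(k <- l) a k <= \sum_(i < (2 * M).+1) a (i%:Z - M%:Z).
Proof.
move=> ul a0; have [M sM] := seq_sub_window l; exists M; rewrite big_window.
set W := map _ _ in sM *.
have -> : \sum_(k <- l) a k = \sum_(k <- [seq k <- W | k \in l]) a k.
  apply: perm_big; apply: uniq_perm => //.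
    by rewrite filter_uniq// uniq_window.
  move=> k; rewrite mem_filter; apply/idP/idP => [kl|/andP[]//].
  by rewrite kl/=; exact: sM.
by rewrite big_filter big_mkcond/=; apply: ler_sum => k _; case: ifP.
Qed.

Lemma seq_weight_le (d : R) (m : int) (l : seq int) : 0 < d -> uniq l ->
  \sum_(k <- l) weight d `|(m - k)%R|%N <= 2 / (1 - 2 `^ (- d)).
Proof.
move=> d0 ul; have [M] := seq_le_window ul (fun k => ltW (weight_gt0 d `|(m - k)%R|%N)).
move=> /le_trans; apply; apply: le_trans (sum_weight_le (- M%:Z - m) (2 * M).+1 d0).
by apply: ler_sum => i _; rewrite le_eqVlt; apply/orP; left; apply/eqP; congr weight; lia.
Qed.

(* The tangent line of a power, standing in for the convexity inequality of Jensen. *)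
Lemma sqr_le_power_split (r t N X : R) : 2 <= r -> 0 < t -> 0 <= X -> X <= N ->
  X ^+ 2 <= t `^ (1 - r / 2) * (N `^ (2 - r) * X `^ r) + t * N ^+ 2.
Proof.
move=> r2 t0 X0 XN; have N0 := le_trans X0 XN.
have [h|h] := leP (X ^+ 2) (t * N ^+ 2); first by rewrite ler_wpDl// !mulr_ge0 ?powR_ge0.
have X0' : 0 < X.
  rewrite lt_neqAle X0 andbT; apply: contraTN h => /eqP <-.
  by rewrite expr0n/= -leNgt mulr_ge0 ?sqr_ge0// ltW.
have N0' := lt_le_trans X0' XN.
rewrite ler_wpDr ?mulr_ge0 ?sqr_ge0 ?(ltW t0)//.
have pow2 (z : R) (x : R) : 0 < z -> (z ^+ 2) `^ x = z `^ (2 * x).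
  by move=> z0; rewrite -(powR_mulrn 2 (ltW z0)) -powRrM.
have -> : X ^+ 2 = (X ^+ 2) `^ (1 - r / 2) * X `^ r.
  rewrite pow2// -powRD ?(gt_eqF X0') ?implybT//.
  by rewrite (_ : 2 * (1 - r / 2) + r = 2%:R) ?powR_mulrn//; field.
rewrite mulrA ler_wpM2r ?powR_ge0//.
have -> : N `^ (2 - r) = (N ^+ 2) `^ (1 - r / 2) by rewrite pow2//; congr (_ `^ _); field.
rewrite -powRM ?sqr_ge0 ?(ltW t0)// (_ : 1 - r / 2 = - (r / 2 - 1)); last by ring.
rewrite 2!powRN lef_pV2 ?posrE ?powR_gt0 ?mulr_gt0 ?exprn_gt0//.
by apply: ge0_ler_powR; rewrite ?nnegrE ?mulr_ge0 ?sqr_ge0 ?(ltW t0) ?(ltW h)//; lra.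
Qed.

(** * A discrete convolution inequality in l^r *)

Section convolution.
Context (d : R) (d0 : 0 < d).
Local Notation G := (2 / (1 - 2 `^ (- d))).
Context (X : int -> int -> R) (N : int -> R) (S : R).
Hypotheses (S0 : 0 < S) (X0 : forall j m, 0 <= X j m) (XN : forall j m, X j m <= N j).
Hypothesis NS : forall l : seq int, uniq l -> \sum_(j <- l) N j ^+ 2 <= S.

Lemma geometric_gt0 : 0 < G.
Proof. by have /andP[_ h] := pow2N_lt1 d0; rewrite divr_gt0// subr_gt0. Qed.

Lemma weighted_window_le (k : int) J M :
  \sum_(i < (2 * J).+1) \sum_(l < (2 * M).+1)
    weight d `|(l%:Z - M%:Z - k)%R|%N * N (i%:Z - J%:Z) ^+ 2 <= G * S.
Proof.
have G0 := geometric_gt0.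
apply: (@le_trans _ _ (\sum_(i < (2 * J).+1) G * N (i%:Z - J%:Z) ^+ 2)).
  apply: ler_sum => i _; rewrite -mulr_suml ler_wpM2r ?sqr_ge0//.
  apply: le_trans (sum_weight_le (- M%:Z - k) (2 * M).+1 d0).
  by apply: ler_sum => l _; rewrite addrA.
rewrite -mulr_sumr ler_wpM2l ?(ltW G0)//.
by rewrite (big_window (fun j => N j ^+ 2)); apply: NS; exact: uniq_window.
Qed.

Context (r : R) (r2 : 2 <= r).
Let r0 : 0 < r. Proof. by apply: lt_le_trans r2; rewrite ltr0n. Qed.

Hypothesis XNr : forall j (l : seq int), uniq l -> \sum_(m <- l) X j m `^ r <= N j `^ r.

(** N^(2-r) X^r is N_j^2 times the r-th power of X/N. Its sum over m is at most N_j^2, which is why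
    its total mass is controlled by S. *)
Let term (k j m : int) : R := weight d `|(m - k)%R|%N * (N j `^ (2 - r) * X j m `^ r).

Let term_ge0 k j m : 0 <= term k j m.
Proof. by rewrite mulr_ge0 ?mulr_ge0 ?powR_ge0// ltW// weight_gt0. Qed.

Let U (k : int) : \bar R := \esum_(j in [set: int]) \esum_(m in [set: int]) (term k j m)%:E.

Let sumU (F : seq int) : uniq F -> (\sum_(k <- F) U k <= (G * S)%:E)%E.
Proof.
move=> uF; have G0 := geometric_gt0; have t0 k j m : (0 <= (term k j m)%:E)%E by rewrite lee_fin.
rewrite -esum_sum; last by move=> j k _ _; exact: esum_ge0.
apply: esum_le_seq => l ul.
apply: (@le_trans _ _ (\sum_(j <- l) (G * N j ^+ 2)%:E)%E); last first.
  by rewrite sumEFin lee_fin -mulr_sumr ler_wpM2l ?(ltW G0)// NS.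
apply: lee_sum => j _; rewrite -esum_sum//; apply: esum_le_seq => l' ul'.
under eq_bigr do rewrite sumEFin.
rewrite sumEFin lee_fin.
apply: (@le_trans _ _ (\sum_(m <- l') G * (N j `^ (2 - r) * X j m `^ r))).
  apply: ler_sum => m _; rewrite -mulr_suml ler_wpM2r ?mulr_ge0 ?powR_ge0//.
  exact: seq_weight_le.
rewrite -mulr_sumr ler_wpM2l ?(ltW G0)// -mulr_sumr.
(* If N_j = 0 then X vanishes as well, so the default value of the power N_j^(2-r) does no harm. *)
have [Nj0|Nj0] := eqVneq (N j) 0.
  rewrite big1 ?mulr0 ?sqr_ge0// => m _.
  have -> : X j m = 0 by apply/le_anti; rewrite X0 andbT -Nj0 XN.
  by rewrite powR0// gt_eqF.
have Nj : 0 < N j by rewrite lt_neqAle eq_sym Nj0 (le_trans (X0 j 0)).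
apply: (@le_trans _ _ (N j `^ (2 - r) * N j `^ r)); first by rewrite ler_wpM2l ?powR_ge0// XNr.
by rewrite -powRD ?(gt_eqF Nj) ?implybT// subrK powR_mulrn// ltW.
Qed.

(** For each k the tangent-line inequality bounds the weighted sum of X^2 by t^(1 - r/2) U_k + t G
    S. With the best order of t this gives the r-th root of V_k = u_k S^(r/2 - 1) for A_k, and
    summing V_k over k costs only 2 G S^(r/2). *)
Lemma lr_convolution_le (A : int -> \bar R) (K : R) : 0 <= K -> (forall k, 0 <= A k)%E ->
  (forall k B, 0 <= B ->
    (forall J M, \sum_(i < (2 * J).+1) \sum_(l < (2 * M).+1)
       weight d `|(l%:Z - M%:Z - k)%R|%N * X (i%:Z - J%:Z) (l%:Z - M%:Z) ^+ 2 <= B ^+ 2) ->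
    (A k <= (K * B)%:E)%E) ->
  (ell r%:E A <= (Num.sqrt (1 + G) * (2 * G) `^ r^-1 * K * Num.sqrt S)%:E)%E.
Proof.
move=> K0 A0 hA; have G0 := geometric_gt0.
have rn0 : r != 0 by rewrite gt_eqF.
have U0 k : (0 <= U k)%E by apply: esum_ge0 => j _; apply: esum_ge0 => m _; rewrite lee_fin.
have Ufin k : U k = (fine (U k))%:E.
  rewrite fineK// ge0_fin_numE//; have := sumU (F := [:: k]) erefl.
  by rewrite big_seq1 => /le_lt_trans; apply; rewrite ltry.
(* The summable second term keeps [u k] positive. *)
pose u k : R := fine (U k) + S * weight d `|k|%N.
have u0 k : 0 < u k by rewrite ltr_wpDl ?fine_ge0// mulr_gt0// weight_gt0.
pose V k : R := u k * S `^ (r / 2 - 1).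
have V0 k : 0 < V k by rewrite mulr_gt0// powR_gt0.
have AV k : (A k <= (K * (Num.sqrt (1 + G) * V k `^ r^-1))%:E)%E.
  apply: hA => [|J M]; first by rewrite mulr_ge0 ?sqrtr_ge0 ?powR_ge0.
  (* t = W/S balances the two terms: the first becomes at most W, because t^(1 - r/2) u_k = W, and
     the second at most G W. *)
  pose W : R := V k `^ (2 / r); have W0 : 0 < W by rewrite powR_gt0.
  pose t : R := W / S; have t0 : 0 < t by rewrite divr_gt0.
  have tS : t * S = W by rewrite divfK// gt_eqF.
  have tu : t `^ (1 - r / 2) * u k = W.
    have Sx : S != 0 by rewrite gt_eqF.
    rewrite /t powRM ?invr_ge0 ?(ltW W0) ?(ltW S0)// /W -powRrM.
    rewrite -(powR_inv1 (ltW S0)) -[in X in _ * X * _]powRrM.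
    have -> : u k = V k * S `^ (1 - r / 2).
      by rewrite /V -mulrA -powRD ?Sx ?implybT// (_ : _ + _ = 0) ?powRr0 ?mulr1//; ring.
    rewrite mulrACA -powRD ?Sx ?implybT// (_ : - 1 * (1 - r / 2) + (1 - r / 2) = 0); last by ring.
    rewrite powRr0 mulr1 -[X in _ * X](powRr1 (ltW (V0 k))) -powRD ?(gt_eqF (V0 k)) ?implybT//.
    by congr (_ `^ _); field.
  have -> : (Num.sqrt (1 + G) * V k `^ r^-1) ^+ 2 = (1 + G) * W.
    rewrite exprMn sqr_sqrtr; last by rewrite addr_ge0// ltW.
    by rewrite expr2 -powRD ?(gt_eqF (V0 k)) ?implybT// /W; congr (_ * _ `^ _); field.
  apply: (@le_trans _ _ (\sum_(i < (2 * J).+1) \sum_(l < (2 * M).+1)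
      (t `^ (1 - r / 2) * term k (i%:Z - J%:Z) (l%:Z - M%:Z) +
       t * (weight d `|(l%:Z - M%:Z - k)%R|%N * N (i%:Z - J%:Z) ^+ 2)))).
    apply: ler_sum => i _; apply: ler_sum => l _; rewrite /term.
    have w0 := ltW (weight_gt0 d `|(l%:Z - M%:Z - k)%R|%N).
    apply: (le_trans (ler_wpM2l w0 (sqr_le_power_split r2 t0 (X0 _ _) (XN _ _)))).
    by rewrite le_eqVlt; apply/orP; left; apply/eqP; ring.
  under eq_bigr do rewrite big_split/= -!mulr_sumr.
  rewrite big_split/= -!mulr_sumr mulrDl mul1r; apply: lerD.
    rewrite -[leRHS]tu ler_wpM2l ?powR_ge0//.
    apply: (@le_trans _ _ (fine (U k))); last by rewrite lerDl mulr_ge0 ?(ltW S0)// ltW// weight_gt0.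
    rewrite -lee_fin -Ufin -sumEFin.
    apply: (@le_trans _ _ (\sum_(i < (2 * J).+1) \esum_(m in [set: int]) (term k (i%:Z - J%:Z) m)%:E)%E).
      by apply: lee_sum => i _; rewrite -sumEFin; exact: (window_le_esum (fun m => (term k (i%:Z - J%:Z) m)%:E)).
    exact: (window_le_esum (fun j => \esum_(m in [set: int]) (term k j m)%:E)%E).
  apply: (@le_trans _ _ (t * (G * S))); first by rewrite ler_wpM2l ?(ltW t0)// weighted_window_le.
  by rewrite mulrCA tS.
have D0 : 0 <= K * Num.sqrt (1 + G) by rewrite mulr_ge0 ?sqrtr_ge0.
have G20 : 0 <= 2 * G by rewrite mulr_ge0// ltW.
set T := Num.sqrt (1 + G) * _ * _ * _.
have T0 : 0 <= T by rewrite !mulr_ge0 ?sqrtr_ge0 ?powR_ge0.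
have Tr : T `^ r = (K * Num.sqrt (1 + G)) `^ r * (S `^ (r / 2 - 1) * (G * S + S * G)).
  have -> : T = (K * Num.sqrt (1 + G)) * ((2 * G) `^ r^-1 * Num.sqrt S) by rewrite /T; ring.
  rewrite powRM ?mulr_ge0 ?powR_ge0 ?sqrtr_ge0//; congr (_ * _).
  rewrite powRM ?powR_ge0 ?sqrtr_ge0// -powRrM mulVf// powRr1//.
  rewrite -powR12_sqrt ?(ltW S0)// -powRrM.
  have -> : 2^-1 * r = (r / 2 - 1) + 1 by field.
  by rewrite powRD ?(gt_eqF S0) ?implybT// powRr1 ?(ltW S0)//; ring.
suff hs : (\esum_(k in [set: int]) A k `^ r <= (T `^ r)%:E)%E.
  have := gt0_ler_poweR (r := r^-1) _ _ _ hs.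
  rewrite poweR_EFin -powRrM mulfV// powRr1// => h /=; apply: h.
  - by rewrite invr_ge0 ltW.
  - by rewrite in_itv/= leey andbT; apply: esum_ge0 => k _; exact: poweR_ge0.
  - by rewrite in_itv/= leey andbT lee_fin powR_ge0.
apply: esum_le_seq => F uF.
apply: (@le_trans _ _ (\sum_(k <- F) ((K * Num.sqrt (1 + G)) `^ r * (S `^ (r / 2 - 1) * u k))%:E)%E).
  apply: lee_sum => k _.
  have -> : (K * Num.sqrt (1 + G)) `^ r * (S `^ (r / 2 - 1) * u k) = (K * (Num.sqrt (1 + G) * V k `^ r^-1)) `^ r.
    rewrite [X in _ = X `^ r]mulrA (powRM _ D0 (powR_ge0 _ _)) -[X in _ = _ * X]powRrM mulVf//.
    by rewrite (powRr1 (ltW (V0 k))) /V; congr (_ * _); rewrite mulrC.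
  rewrite -poweR_EFin; apply: gt0_ler_poweR => //.
  - by rewrite ltW.
  - by rewrite in_itv/= leey andbT.
  - by rewrite in_itv/= leey andbT lee_fin !mulr_ge0 ?sqrtr_ge0 ?powR_ge0.
rewrite sumEFin lee_fin Tr -mulr_sumr ler_wpM2l ?powR_ge0// -mulr_sumr ler_wpM2l ?powR_ge0//.
rewrite big_split/=; apply: lerD.
  rewrite -lee_fin -sumEFin; apply: le_trans (sumU uF).
  by apply: lee_sum => k _; rewrite -Ufin.
rewrite -mulr_sumr ler_wpM2l ?(ltW S0)//.
apply: le_trans (seq_weight_le 0 d0 uF).
by apply: ler_sum => k _; rewrite sub0r abszN.
Qed.

End convolution.
End discrete_sums.

(** * Comparison of the two norms *)

Section comparison.
Context (R : realType) (n : nat) (n3 : (3 <= n)%N).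
Context (kap : R) (hkap : @inversion_constant R n kap).
Context (phi : R -> R) (hphi : dyadic_profile phi).
Implicit Types (f : functional R n).

Lemma ell_sum_le (r : R) (u : int -> R) (y : R) (l : seq int) : 2 <= r -> 0 <= y -> (forall k, 0 <= u k) ->
  (ell r%:E (fun k => (u k)%:E) <= y%:E)%E -> uniq l -> \sum_(k <- l) u k `^ r <= y `^ r.
Proof.
move=> r2 y0 u0 h ul; have r0 : 0 < r by lra.
rewrite -lee_fin -sumEFin.
apply: (le_trans (seq_le_esum (fun k => (u k `^ r)%:E) ul)).
rewrite -poweR_EFin.
have -> : (\esum_(k in [set: int]) (u k `^ r)%:E =
    (ell r%:E (fun k => (u k)%:E)) `^ r)%E.
  rewrite /ell -poweRrM mulVf ?gt_eqF// poweRe1 ?esum_ge0// => k _; exact: poweR_ge0.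
apply: gt0_ler_poweR => //.
- by rewrite ltW.
- by rewrite in_itv/= leey andbT poweR_ge0.
- by rewrite in_itv/= leey andbT.
Qed.

Lemma norm_x_ge0 q a s f : (2%:E <= q)%E -> (0 <= norm_x phi q a s f)%E.
Proof.
move=> hq; have u0 k : (0 <= (2 `^ (k%:~R * a))%:E * Hdot_norm s (Qk phi k f))%E.
  by apply: mule_ge0; [rewrite lee_fin powR_ge0|exact: Hdot_ge0].
by apply: le_trans (u0 0) _; exact: ell_ge.
Qed.

(** Passing from the spatial weight at k to the one at m costs at most 2^(|a| |m - k|), squared
    here; the surplus 2 |a| in the exponent on the left pays for it. *)
Lemma weight_shift (d a y : R) (m k : int) :
  weight (d + 2 * `|a|) `|(m - k)%R|%N * y ^+ 2 <=
  (2 `^ (- (k%:~R * a))) ^+ 2 * (weight d `|(m - k)%R|%N * (2 `^ (m%:~R * a) * y) ^+ 2).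
Proof.
have -> : weight (d + 2 * `|a|) `|(m - k)%R|%N = weight d `|(m - k)%R|%N * weight (2 * `|a|) `|(m - k)%R|%N.
  by rewrite /weight pow2D; congr (_ `^ _); ring.
have w0 := ltW (weight_gt0 d `|(m - k)%R|%N); set w := weight d _ in w0 *.
set p := 2 `^ (- (k%:~R * a)); set q := 2 `^ (m%:~R * a).
rewrite [leRHS](_ : _ = w * ((p * p) * (q * q)) * y ^+ 2); last by ring.
rewrite ler_wpM2r ?sqr_ge0// ler_wpM2l// /p /q !pow2D /weight.
apply: ler_powR; first by rewrite ler1n.
have -> : (`|(m - k)%R|%N)%:R = `|(m%:~R - k%:~R : R)|.
  by rewrite natr_absz intr_norm rmorphB.
have := ler_norm (- ((m%:~R - k%:~R) * a) : R); rewrite normrN normrM; lra.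
Qed.

Lemma norm_x_le q a s : (2%:E <= q)%E -> `|s| <= 1 -> `|a| + `|s| < n%:R / 2 ->
  exists2 K : R, 0 < K & forall f, space_x phi q a s f -> forall d, 0 < d ->
  (norm_Dx phi q a s f <= d%:E)%E -> (norm_x phi q a s f <= (K * d)%:E)%E.
Proof.
move=> hq s1 has; have [K1 K10 h1] := main_pairing n3 hkap hphi hq s1 has.
have [K2 K20 h2] := Hdot_le_of_pairing n3 hkap hphi a hq s1.
pose del : R := n%:R / 2 - `|s| - `|a|; have del0 : 0 < del by rewrite /del; lra.
pose G : R := 2 / (1 - 2 `^ (- del)); have G0 : 0 < G := geometric_gt0 del0.
(* One constant for finite and infinite q: [fine] of +oo is 0, and the added 1 makes the middle
   factor at least 1, as the supremum case requires. *)
pose K3 : R := Num.sqrt (1 + G) * ((2 * G) `^ (fine q)^-1 + 1) * (K2 * K1).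
have K0 : 0 <= K2 * K1 by rewrite mulr_ge0 ?ltW.
have K30 : 0 < K3.
  have h3 : 0 < (2 * G) `^ (fine q)^-1 + 1 by rewrite ltr_wpDl ?powR_ge0.
  have h4 : 0 < Num.sqrt (1 + G) by rewrite sqrtr_gt0 addr_gt0.
  by rewrite !mulr_gt0.
exists K3 => // f sf d d0 hd.
pose Nx j := norm_x phi q a s (Pk phi j f).
have Nx0 j : (0 <= Nx j)%E := norm_x_ge0 a s _ hq.
have Nxd j : (Nx j <= d%:E)%E by apply: le_trans hd; exact: ell_ge.
have Nfin j : Nx j = (fine (Nx j))%:E.
  by rewrite fineK// ge0_fin_numE// (le_lt_trans (Nxd j))// ltry.
pose N j := fine (Nx j); have N0 j : 0 <= N j by rewrite fine_ge0.
have HN j m : (Hdot_norm s (Qk phi m (Pk phi j f)) <= (2 `^ (- (m%:~R * a)) * N j)%:E)%E.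
  by apply: (norm_x_Hdot m hq (y := N j)); rewrite -Nfin.
have Hfin j m : Hdot_norm s (Qk phi m (Pk phi j f)) = (fine (Hdot_norm s (Qk phi m (Pk phi j f))))%:E.
  by rewrite fineK// ge0_fin_numE ?Hdot_ge0// (le_lt_trans (HN j m))// ltry.
pose y j m := fine (Hdot_norm s (Qk phi m (Pk phi j f))).
pose X j m : R := 2 `^ (m%:~R * a) * y j m.
have X0 j m : 0 <= X j m by rewrite mulr_ge0 ?powR_ge0// fine_ge0// Hdot_ge0.
have XN j m : X j m <= N j.
  rewrite /X -ler_pdivlMl ?powR_gt0// -powRN -lee_fin -Hfin; exact: HN.
have S0 : 0 < d ^+ 2 by rewrite exprn_gt0.
have NS (l : seq int) : uniq l -> \sum_(j <- l) N j ^+ 2 <= d ^+ 2.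
  move=> ul; have e : norm_Dx phi q a s f = ell 2%:E (fun j => (N j)%:E).
    by congr (ell _ _); apply/funext => j; exact: Nfin.
  have := ell_sum_le (lexx 2) (ltW d0) N0 _ ul; rewrite -e => /(_ hd).
  rewrite powR_mulrn ?(ltW d0)//; congr (_ <= _).
  by apply: eq_bigr => j _; rewrite powR_mulrn.
pose A k : \bar R := ((2 `^ (k%:~R * a))%:E * Hdot_norm s (Qk phi k f))%E.
have hA k B : 0 <= B ->
    (forall J M, \sum_(i < (2 * J).+1) \sum_(l < (2 * M).+1)
       weight del `|(l%:Z - M%:Z - k)%R|%N * X (i%:Z - J%:Z) (l%:Z - M%:Z) ^+ 2 <= B ^+ 2) ->
    (A k <= (K2 * K1 * B)%:E)%E.
  move=> B0 hB; pose B' : R := 2 `^ (- (k%:~R * a)) * B.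
  have B'0 : 0 <= B' by rewrite mulr_ge0 ?powR_ge0.
  have hB' J M : \sum_(i < (2 * J).+1) \sum_(l < (2 * M).+1)
      weight (n%:R / 2 - `|s| + `|a|) `|(l%:Z - M%:Z - k)%R|%N * y (i%:Z - J%:Z) (l%:Z - M%:Z) ^+ 2 <= B' ^+ 2.
    rewrite exprMn; apply: le_trans (ler_wpM2l (sqr_ge0 _) (hB J M)).
    rewrite mulr_sumr; apply: ler_sum => i _; rewrite mulr_sumr; apply: ler_sum => l _.
    have -> : n%:R / 2 - `|s| + `|a| = del + 2 * `|a| by rewrite /del; ring.
    exact: weight_shift.
  have Hy j m : (Hdot_norm s (Qk phi m (Pk phi j f)) <= (y j m)%:E)%E by rewrite -Hfin.
  have hp := h1 f sf k y B' Hy B'0 hB'.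
  have := h2 f sf k (K1 * B') (mulr_ge0 (ltW K10) B'0) hp.
  rewrite /A -lee_pdivlMl ?powR_gt0// => /le_trans; apply.
  by rewrite -EFinM lee_fin -powRN /B' le_eqVlt; apply/orP; left; apply/eqP; ring.
have A0 k : (0 <= A k)%E by apply: mule_ge0; [rewrite lee_fin powR_ge0|exact: Hdot_ge0].
have sd : Num.sqrt (d ^+ 2) = d by rewrite sqrtr_sqr gtr0_norm.
have : q = (fine q)%:E \/ q = +oo%E by case: (q) hq => [r| |]//; [left|right].
case=> eq.
  have r2 : 2 <= fine q by rewrite -lee_fin -eq.
  have XNr j (l : seq int) : uniq l -> \sum_(m <- l) X j m `^ (fine q) <= N j `^ (fine q).
    move=> ul; apply: ell_sum_le => //; rewrite -eq -Nfin le_eqVlt; apply/orP; left; apply/eqP.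
    by congr (ell _ _); apply/funext => m; rewrite EFinM -Hfin.
  rewrite /norm_x [X in ell X _]eq.
  apply: (le_trans (lr_convolution_le del0 S0 X0 XN NS r2 XNr K0 A0 hA)).
  rewrite lee_fin sd /K3 -/G ler_wpM2r ?(ltW d0)// ler_wpM2r// ler_wpM2l ?sqrtr_ge0//.
  by rewrite lerDl.
rewrite /norm_x [X in ell X _]eq; apply: ge_ereal_sup => _ [k _ <-].
have GS0 : 0 <= G * d ^+ 2 by rewrite mulr_ge0 ?ltW.
apply: (@le_trans _ _ (K2 * K1 * Num.sqrt (G * d ^+ 2))%:E).
  apply: hA => [|J M]; first exact: sqrtr_ge0.
  rewrite sqr_sqrtr//; apply: le_trans (weighted_window_le del0 NS k J M).
  apply: ler_sum => i _; apply: ler_sum => l _; rewrite ler_wpM2l ?(ltW (weight_gt0 _ _))//.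
  by rewrite lerXn2r ?nnegrE.
rewrite lee_fin sqrtrM ?(ltW G0)// sd mulrA ler_wpM2r ?(ltW d0)// /K3 mulrC ler_wpM2r//.
apply: (@le_trans _ _ (Num.sqrt (1 + G) * 1)); first by rewrite mulr1 ler_wsqrtr// lerDr.
by rewrite ler_wpM2l ?sqrtr_ge0// lerDr powR_ge0.
Qed.

End comparison.

Theorem theorem1p6 (R : realType) (n : nat) (hn : (3 <= n)%N)
  (phi : R -> R) (hphi : dyadic_profile phi)
  (q : \bar R) (hq : (2%:E <= q)%E)
  (a s : R) (hs : `|s| <= 1) (has : `|a| + `|s| < n%:R / 2) :
  exists K : R, forall f : functional R n, space_x phi q a s f ->
    (norm_x phi q a s f <= K%:E * norm_Dx phi q a s f)%E.
Proof.
have c0 : cutoff phi 1 (0 : 'rV[R]_n) = 1 by rewrite (cut_eq1 hphi) ?enorm0.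
have [kap hkap] := exists_inversion_constant (bump_cut n hphi ltr01) c0.
have [K K0 hK] := norm_x_le hn hkap hphi hq hs has.
exists K => f sf; have D0 : (0 <= norm_Dx phi q a s f)%E.
  by apply: le_trans (norm_x_ge0 phi a s (Pk phi 0 f) hq) _; apply: ell_ge => // k; exact: norm_x_ge0.
case E : (norm_Dx phi q a s f) D0 => [d| |//] D0; last by rewrite gt0_muley ?leey// lte_fin.
(* [norm_x_le] asks for a strictly positive bound, since the balancing divides by its square. A norm
   equal to 0 is reached by adding e/K and letting e tend to 0. *)
rewrite -EFinM; apply/lee_addgt0Pr => e e0; have e1 : 0 < e / K by rewrite divr_gt0.
have := hK f sf (d + e / K) (ltr_wpDl D0 e1); rewrite E lee_fin lerDl (ltW e1) => /(_ isT).
by rewrite mulrDr mulrCA mulfV ?mulr1 ?gt_eqF.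
Qed.
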